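(* Let $(R,\mathfrak m,k)$ be a $d$-dimensional unramified regular local ring of mixed characteristic, and let $I\subset R$ be a proper ideal with $\operatorname{depth}(R/I)\ge 2$. Then $H^{d-1}_I(R)=0$. Suppose in addition that $R/I$ is $2$-dimensional. Then $H^{d-2}_I(R)\ne 0$.
   Context: All rings are commutative, noetherian, with unity. $H^i_I(-)$ denotes local cohomology with support in $I$. A regular local ring $(R,\mathfrak m,k)$ of mixed characteristic with $\operatorname{char}(k)=p>0$ is unramified if $p\notin\mathfrak m^2$. *)

(* Defs.v *)
From HB Require Import structures.
From mathcomp Require Import all_boot all_algebra.
From mathcomp Require Import ring_quotient boolp.

Set Implicit Arguments.
Unset Strict Implicit.
Unset Printing Implicit Defensive.

Import GRing.Theory.

Local Open Scope ring_scope.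
Local Open Scope quotient_scope.

(** * Ideals, dimension, regularity and depth *)

(* [{pred A}] is boolean-valued, but with the classical axioms of [boolp] every
   subset is of this form.  Recall that [idealr A] consists of PROPER ideals.  *)

Section Ideals.
Variable A : comNzRingType.

Definition in_span (s : seq A) (x : A) : Prop :=
  exists c : 'I_(size s) -> A, x = \sum_i c i * s`_i.

Definition ideal_pow (I : {pred A}) (t : nat) (x : A) : Prop :=
  exists (n : nat) (c : 'I_n -> A) (u : 'I_n -> 'I_t -> A),
    (forall i j, u i j \in I) /\ x = \sum_i c i * \prod_j u i j.

Definition generates (s : seq A) (I : {pred A}) : Prop :=
  forall x, x \in I <-> in_span s x.

Definition noetherian : Prop :=
  forall I : {pred A}, submod_closed (I : {pred A^o}) ->
    exists s : seq A, generates s I.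

Definition maximal_ideal (m : idealr A) : Prop :=
  forall J : idealr A, {subset m <= J} -> {subset J <= m}.

Definition local_ring (m : idealr A) : Prop :=
  maximal_ideal m /\ forall n : idealr A, maximal_ideal n -> n =i m.

Definition prime_chain (n : nat) : Prop :=
  exists P : nat -> prime_idealr A, forall i, (i < n)%N ->
    {subset P i <= P i.+1} /\ ~ {subset P i.+1 <= P i}.

Definition krull_dim (n : nat) : Prop := prime_chain n /\ ~ prime_chain n.+1.

Definition min_number_of_generators (I : {pred A}) (n : nat) : Prop :=
  (exists s : seq A, size s = n /\ generates s I) /\
  (forall s : seq A, generates s I -> (n <= size s)%N).

Definition regular_local_ring (m : idealr A) (d : nat) : Prop :=
  [/\ noetherian, local_ring m, krull_dim d & min_number_of_generators m d].

Definition mixed_characteristic (m : idealr A) (p : nat) : Prop :=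
  (forall n : nat, (n.+1)%:R != 0 :> A) /\ p \in [pchar {ideal_quot m}].

Definition unramified (m : idealr A) (p : nat) : Prop :=
  ~ ideal_pow m 2 p%:R.

Definition regular_sequence (s : seq A) : Prop :=
  (forall i, (i < size s)%N ->
     forall a, in_span (take i s) (s`_i * a) -> in_span (take i s) a) /\
  ~ in_span s 1.

End Ideals.

(* Depth of the [A]-module [A/I] with respect to [m], as the supremum of the
   lengths of [A/I]-regular sequences in [m]; an element of [A] acts on [A/I]
   through its residue class.                                                 *)
Definition depth_quot_ge (A : comNzRingType) (m I : idealr A) (n : nat) : Prop :=
  exists s : seq A, [/\ (n <= size s)%N, {subset s <= m} &
    regular_sequence [seq \pi_{ideal_quot I} x | x <- s]].

(** * Submodules and quotient modules *)

Section SubModule.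
Variables (R : comNzRingType) (V : lmodType R) (S : submodClosed V).

Definition submodule : Type := {x : V | x \in S}.

HB.instance Definition _ := [isSub of submodule for @sval V (fun x => x \in S)].
HB.instance Definition _ := [Choice of submodule by <:].
HB.instance Definition _ := [SubChoice_isSubLmodule of submodule by <:].

End SubModule.

Section QuotientModule.
Variables (R : comNzRingType) (V : lmodType R) (S : submodClosed V).

(* [submodClosed] does not inherit from [zmodClosed], which [Quotient.quot]
   expects.                                                                   *)
Definition zmod_pred : {pred V} := S.
HB.instance Definition _ :=
  GRing.isZmodClosed.Build V zmod_pred (GRing.submod_closedB (submodClosedP S)).

Definition quot_module : Type := Quotient.quot (zmod_pred : zmodClosed V).

HB.instance Definition _ := GRing.Zmodule.on quot_module.

Definition quot_proj (x : V) : quot_module :=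
  \pi_(Quotient.quot (zmod_pred : zmodClosed V)) x.

Definition quot_scale (a : R) (x : quot_module) : quot_module :=
  quot_proj (a *: repr x).

Lemma quot_projD x y : quot_proj (x + y) = quot_proj x + quot_proj y.
Proof. exact: raddfD. Qed.

Lemma quot_projP (x : quot_module) : exists v, x = quot_proj v.
Proof. by exists (repr x); rewrite /quot_proj reprK. Qed.

Lemma eq_quot_proj x y : quot_proj x = quot_proj y <-> x - y \in S.
Proof.
have -> : (x - y \in S) = (x - y \in zmod_pred) by [].
by rewrite Quotient.idealrBE; split=> /eqP.
Qed.

Lemma quot_scale_proj a (x : V) :
  quot_scale a (quot_proj x) = quot_proj (a *: x).
Proof.
apply/eq_quot_proj; rewrite -scalerBr rpredZ //.
by apply/eq_quot_proj; rewrite /quot_proj reprK.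
Qed.

Lemma quot_scaleA a b x : quot_scale a (quot_scale b x) = quot_scale (a * b) x.
Proof. by case: (quot_projP x) => v ->; rewrite !quot_scale_proj scalerA. Qed.

Lemma quot_scale1 : left_id 1 quot_scale.
Proof. by move=> x; case: (quot_projP x) => v ->; rewrite quot_scale_proj scale1r. Qed.

Lemma quot_scaleDr : right_distributive quot_scale +%R.
Proof.
move=> a x y; case: (quot_projP x) => v ->; case: (quot_projP y) => w ->.
by rewrite -quot_projD !quot_scale_proj scalerDr quot_projD.
Qed.

Lemma quot_scaleDl x : {morph quot_scale^~ x : a b / a + b}.
Proof.
move=> a b; case: (quot_projP x) => v ->.
by rewrite !quot_scale_proj scalerDl quot_projD.
Qed.

HB.instance Definition _ := GRing.Zmodule_isLmodule.Build R quot_module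
  quot_scaleA quot_scale1 quot_scaleDr quot_scaleDl.

End QuotientModule.

(** * Cochain complexes and their cohomology *)

Record cochain_complex (R : comNzRingType) := CochainComplex {
  cobj :> nat -> lmodType R;
  cdiff : forall n, {linear cobj n -> cobj n.+1};
  cdiffK : forall n x, cdiff n.+1 (cdiff n x) = 0 }.

Section Cohomology.
Variables (R : comNzRingType) (C : cochain_complex R) (n : nat).

Definition cocycle : {pred C n} := fun x => cdiff C n x == 0.

Fact cocycle_closed : submod_closed cocycle.
Proof.
split=> [|a x y /eqP dx /eqP dy]; first by apply/eqP; rewrite raddf0.
by apply/eqP; rewrite linearP dx dy scaler0 addr0.
Qed.
HB.instance Definition _ := GRing.isSubmodClosed.Build R (C n) cocycle
  (GRing.submod_closed_semi cocycle_closed).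

End Cohomology.

Definition coboundary_in (R : comNzRingType) (C : cochain_complex R) (n : nat) :
    C n -> Prop :=
  match n with
  | 0 => fun x => x = 0
  | k.+1 => fun x => exists y : C k, cdiff C k y = x
  end.

Section Cohomology2.
Variables (R : comNzRingType) (C : cochain_complex R) (n : nat).

Lemma coboundary_in0 : coboundary_in (0 : C n).
Proof. by case: n => [|k] //=; exists 0; rewrite raddf0. Qed.

Lemma coboundary_in_lin a (x y : C n) :
  coboundary_in x -> coboundary_in y -> coboundary_in (a *: x + y).
Proof.
case: n x y => [|k] /= x y; first by move=> -> ->; rewrite scaler0 addr0.
by move=> [w <-] [z <-]; exists (a *: w + z); rewrite linearP.
Qed.

Definition coboundary : {pred submodule (@cocycle R C n)} :=
  fun x => `[< coboundary_in (val x) >].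

Fact coboundary_closed : submod_closed coboundary.
Proof.
split=> [|a x y /asboolP bx /asboolP biy]; apply/asboolP.
  by rewrite raddf0; exact: coboundary_in0.
by rewrite linearP; exact: coboundary_in_lin.
Qed.
HB.instance Definition _ :=
  GRing.isSubmodClosed.Build R (submodule (@cocycle R C n)) coboundary
  (GRing.submod_closed_semi coboundary_closed).

Definition cohomology : lmodType R := quot_module coboundary.

End Cohomology2.

(** * Local cohomology, as the right derived functors of the torsion functor *)

Section Torsion.
Variables (R : comNzRingType) (I : {pred R}).

Section Objects.
Variable V : lmodType R.

Definition torsion : {pred V} :=
  fun x => `[< exists t, forall a, ideal_pow I t a -> a *: x = 0 >].

Lemma ideal_pow_addl s t a : ideal_pow I (s + t) a -> ideal_pow I s a.
Proof.
move=> [n [c [u [uI ->]]]].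
exists n, (fun i => c i * \prod_j u i (rshift s j)), (fun i j => u i (lshift t j)).
split=> //; apply: eq_bigr => i _; rewrite big_split_ord /= -mulrA; congr (_ * _).
exact: mulrC.
Qed.

Fact torsion_closed : submod_closed torsion.
Proof.
split=> [|b x y /asboolP[s xs] /asboolP[t yt]]; apply/asboolP.
  by exists 0%N => a _; rewrite scaler0.
exists (s + t)%N => a Ia; rewrite scalerDr scalerA mulrC -scalerA.
rewrite xs ?scaler0 ?add0r; last exact: ideal_pow_addl Ia.
by apply: yt; apply: (@ideal_pow_addl t s); rewrite addnC.
Qed.
HB.instance Definition _ := GRing.isSubmodClosed.Build R V torsion
  (GRing.submod_closed_semi torsion_closed).

Definition Gamma : lmodType R := submodule torsion.

End Objects.

Section Morphisms.
Variables (V W : lmodType R) (f : {linear V -> W}).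

Fact Gamma_map_subproof (x : Gamma V) : f (val x) \in @torsion W.
Proof.
apply/asboolP; have /asboolP[t xt] := valP x.
by exists t => a /xt ax0; rewrite -linearZ ax0 raddf0.
Qed.

Definition Gamma_map (x : Gamma V) : Gamma W :=
  exist _ (f (val x)) (Gamma_map_subproof x).

Fact Gamma_map_linear : linear Gamma_map.
Proof. by move=> a x y; apply: val_inj; rewrite /= !linearP. Qed.
HB.instance Definition _ :=
  GRing.isLinear.Build R (Gamma V) (Gamma W) _ Gamma_map Gamma_map_linear.

End Morphisms.

Section Complexes.
Variable C : cochain_complex R.

Fact Gamma_diffK n (x : Gamma (C n)) :
  Gamma_map (cdiff C n.+1) (Gamma_map (cdiff C n) x) = 0.
Proof. by apply: val_inj; rewrite /= cdiffK. Qed.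

Definition Gamma_complex : cochain_complex R :=
  @CochainComplex R (fun n => Gamma (C n)) (fun n => Gamma_map (cdiff C n))
    Gamma_diffK.

End Complexes.

End Torsion.

Definition injective_module (R : comNzRingType) (E : lmodType R) : Prop :=
  forall (V W : lmodType R) (f : {linear V -> W}) (g : {linear V -> E}),
    injective f -> exists h : {linear W -> E}, forall x, h (f x) = g x.

Record injective_resolution (R : comNzRingType) (M : lmodType R) :=
  InjectiveResolution {
    res_complex :> cochain_complex R;
    res_aug : {linear M -> res_complex 0%N};
    res_injective : forall n, injective_module (res_complex n);
    res_aug_inj : injective res_aug;
    res_exact0 : forall x : res_complex 0%N,
      cdiff res_complex 0 x = 0 <-> exists y, res_aug y = x;
    res_exactS : forall n (x : res_complex n.+1),
      cdiff res_complex n.+1 x = 0 <-> exists y, cdiff res_complex n y = x }.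

(* [H^n_I(M)] computed from the injective resolution [E] of [M]; up to
   isomorphism it does not depend on [E].                                     *)
Definition local_cohomology (R : comNzRingType) (I : {pred R}) (M : lmodType R)
    (E : injective_resolution M) (n : nat) : lmodType R :=
  cohomology (Gamma_complex I E) n.

(* Main.v *)
(** A class of [Ext^j(R/b, R)] is represented by a cocycle of [E^j] killed by [b], and local cohomology by
    cocycles killed by a power of [I].

    Vanishing.  Let [A] be the completion of [R]; it is flat over [R], so [A/IA] has a regular sequence [a, b].
    Lifting along a residual p-basis gives a Taylor map [Theta : A -> (A/IA)[[t]]], [x_i |-> x_i + t_i] for the
    regular parameters [x_i] other than [p], with constant term the projection.  Modulo [(t_i^N)] the target is a
    finite [A]-module on which [a, b] are regular.  Flatness of [Theta] over the primes not containing [p] shows that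
    an element of it which lies in [Theta(A)] up to a power of the maximal ideal comes, up to a fixed [p^c], from
    [A] modulo [I^s].  This replaces local duality: together with [Ext^d(R/J, R) = 0] for saturated [J] it makes
    [p^c e] divisible by every [a^k] modulo coboundaries, hence a coboundary for a higher power of [I].  A class
    killed by a power of [p] is reduced to cocycles killed by [p], and for these the subrings
    [k[[x_1^q, ..., x_n^q]]] of [A/pA = k[[x]]] (Frobenius powers [q]) play the role of [Theta(A)].

    Nonvanishing.  If [dim R/I = 2] then [(I, a, b)] is primary to the maximal ideal, so [Ext^d(R/(I, a, b), R)] is
    nonzero, and climbing down along [b] and [a] gives [Ext^(d-2)(R/I, R) <> 0].  It injects into local cohomology
    because [Ext^(d-3)(R/J, R) = 0] for every ideal [J] containing a power of [I]. *)

From HB Require Import structures.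
Require Import Defs.
From mathcomp Require Import all_boot all_algebra.
From mathcomp Require Import ring_quotient boolp.
From mathcomp Require classical_sets.
From mathcomp Require Import ring.

Set Implicit Arguments.
Unset Strict Implicit.
Unset Printing Implicit Defensive.

Import GRing.Theory.
Local Open Scope ring_scope.

(** * Submodules, ideals and noetherian modules *)

(** The cochain that proves divisibility is explicit. Let [K] be the preimage of [(t_i^N)]. For [v]
    in the saturation of [(a^k) + K], a power of [b] times [v] lies in [(a^k) + K], so regularity of
    [a, b] in the target of [Theta] gives [F = Theta(v)/a^k]. Once [F] comes from the ring,
    [v |-> F e] extends by injectivity of [E^(d-1)], and its value at [1] is a quotient of a
    multiple of [e] by [a^k]. The obstacle: [F] is known to lie in the image of [Theta] only after
    multiplication by a power of the maximal ideal. Ring maps fix [p], so [p] cannot be shifted like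
    the other parameters; this is why primes containing [p] are excluded from the flatness. The
    factor [p^c] pays both for these primes and for the power of the maximal ideal. Modulo [p] no
    such factor exists, whence the Frobenius argument. No coefficient ring is chosen: [Theta] arises
    by lifting through square-zero extensions, where well-definedness is the triviality of the
    relations between the parameters. Statements about a quotient [Z/W] are phrased with the two
    predicates [Z] and [W], so that chains of submodules stay in one type. *)

Definition sub T (W W' : T -> Prop) := forall x, W x -> W' x.
Definition full {T} (x : T) := True.

Section Modules.
Variables (R : comNzRingType) (V : lmodType R).
Implicit Types (W Z U : V -> Prop) (x y : V).

Definition submod W := W 0 /\ forall (a : R) x y, W x -> W y -> W (a *: x + y).

Definition lin (r : nat) (v : nat -> V) x := exists c : nat -> R, x = \sum_(i < r) c i *: v i.

(* [Z/W] is a noetherian module *)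
Definition noeth Z W := forall U, submod U -> sub W U -> sub U Z ->
  exists r v, (forall i, (i < r)%N -> U (v i)) /\
    forall x, U x -> exists c : nat -> R, W (x - \sum_(i < r) c i *: v i).

Definition addm W U x := exists w u, [/\ W w, U u & x = w + u].
Definition capm W U x := W x /\ U x.

Section Submod.
Variables (W : V -> Prop) (hW : submod W).
Lemma submod0 : W 0. Proof. by case: hW. Qed.
Lemma submodD x y : W x -> W y -> W (x + y).
Proof. by case: hW => _ h hx hy; rewrite -[x]scale1r; apply: h. Qed.
Lemma submodZ a x : W x -> W (a *: x).
Proof. by case: hW => h0 h hx; rewrite -[_ *: _]addr0; apply: h. Qed.
Lemma submodN x : W x -> W (- x).
Proof. by move=> hx; rewrite -scaleN1r; apply: submodZ. Qed.
Lemma submodB x y : W x -> W y -> W (x - y).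
Proof. by move=> hx hy; apply: submodD => //; apply: submodN. Qed.
Lemma submodDl x y : W x -> W (x + y) -> W y.
Proof. by move=> hx h; rewrite -(addKr x y); apply: submodD => //; apply: submodN. Qed.
Lemma submod_sum I (r : seq I) (P : pred I) (F : I -> V) :
  (forall i, P i -> W (F i)) -> W (\sum_(i <- r | P i) F i).
Proof.
by move=> h; elim/big_rec: _ => [|i x Pi hx]; [apply: submod0 | apply: submodD => //; apply: h].
Qed.
Lemma submod_lin r v x : (forall i, (i < r)%N -> W (v i)) -> lin r v x -> W x.
Proof. by move=> h [c ->]; apply: submod_sum => i _; apply: submodZ; apply: h. Qed.
End Submod.

Lemma submod_full : submod (@full V). Proof. by []. Qed.
Lemma submod_zero : submod (fun x => x = 0).
Proof. by split=> // a x y -> ->; rewrite scaler0 addr0. Qed.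

Lemma submod_addm W U : submod W -> submod U -> submod (addm W U).
Proof.
move=> hW hU; split; first by exists 0, 0; rewrite addr0; split=> //; apply: submod0.
move=> a _ _ [w [u [hw hu ->]]] [w' [u' [hw' hu' ->]]].
exists (a *: w + w'), (a *: u + u'); split; [exact: (proj2 hW)|exact: (proj2 hU)|].
by rewrite scalerDr addrACA.
Qed.
Lemma addml W U : submod U -> sub W (addm W U).
Proof. by move=> hU x hx; exists x, 0; rewrite addr0; split=> //; apply: submod0. Qed.
Lemma addmr W U : submod W -> sub U (addm W U).
Proof. by move=> hU x hx; exists 0, x; rewrite add0r; split=> //; apply: submod0. Qed.
Lemma addm_sub W U Z : submod Z -> sub W Z -> sub U Z -> sub (addm W U) Z.
Proof. by move=> hZ h1 h2 _ [w [u [hw hu ->]]]; apply: submodD; auto. Qed.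
Lemma submod_capm W U : submod W -> submod U -> submod (capm W U).
Proof.
move=> hW hU; split; first by split; apply: submod0.
by move=> a x y [? ?] [? ?]; split; [apply: (proj2 hW)|apply: (proj2 hU)].
Qed.

Lemma submod_lin_span r v : submod (lin r v).
Proof.
split; first by exists (fun=> 0); rewrite big1 // => i _; rewrite scale0r.
move=> a _ _ [c ->] [c' ->]; exists (fun i => a * c i + c' i).
rewrite scaler_sumr -big_split; apply: eq_bigr => i _ /=.
by rewrite scalerDl scalerA.
Qed.
Lemma lin_mem r v i : (i < r)%N -> lin r v (v i).
Proof.
move=> ir; exists (fun j => (i == j)%:R).
rewrite (bigD1 (Ordinal ir)) //= eqxx scale1r big1 ?addr0 // => j.
by rewrite -val_eqE /= eq_sym => /negbTE ->; rewrite scale0r.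
Qed.
Lemma lin_sub r v r' v' : (forall i, (i < r)%N -> lin r' v' (v i)) -> sub (lin r v) (lin r' v').
Proof. by move=> h x; apply: submod_lin => //; apply: submod_lin_span. Qed.
Lemma lin_cat r v r' v' : exists v'', forall x, lin (r + r') v'' x <-> addm (lin r v) (lin r' v') x.
Proof.
exists (fun i => if (i < r)%N then v i else v' (i - r)%N) => x; split.
  move=> [c ->]; exists (\sum_(i < r) c i *: v i), (\sum_(i < r') c (r + i)%N *: v' i).
  split; [by exists c|by exists (fun i => c (r + i)%N)|].
  rewrite big_split_ord /=; congr (_ + _); apply: eq_bigr => i _ /=; first by rewrite ltn_ord.
  by rewrite ltnNge leq_addr /= addKn.
move=> [_ [_ [[c ->] [c' ->] ->]]].
exists (fun i => if (i < r)%N then c i else c' (i - r)%N).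
rewrite big_split_ord /=; congr (_ + _); apply: eq_bigr => i _ /=; first by rewrite ltn_ord.
by rewrite ltnNge leq_addr /= addKn.
Qed.
Lemma lin1 v x : lin 1 v x <-> exists c, x = c *: v 0%N.
Proof.
split=> [[c ->]|[c ->]]; first by exists (c 0%N); rewrite big_ord1.
by exists (fun=> c); rewrite big_ord1.
Qed.

Lemma noeth_fg Z W U : noeth Z W -> submod W -> submod U -> sub W U -> sub U Z ->
  exists r v, forall x, U x <-> addm W (lin r v) x.
Proof.
move=> nZ hW hU WU UZ; have [r [v [vU gen]]] := nZ U hU WU UZ.
exists r, v => x; split.
  move=> /gen [c hc]; exists (x - \sum_(i < r) c i *: v i), (\sum_(i < r) c i *: v i).
  by split=> //; [exists c|rewrite subrK].
by apply: addm_sub => // y; apply: submod_lin.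
Qed.

(** Without a maximal member, choice yields a strictly increasing sequence in [Q]; its union is
    finitely generated modulo [W], so it already equals one of its terms. *)
Lemma noeth_max Z W (Q : (V -> Prop) -> Prop) U0 :
  noeth Z W -> submod U0 -> sub W U0 -> sub U0 Z -> Q U0 ->
  exists U, [/\ submod U, sub U0 U, sub U Z, Q U &
    forall U', submod U' -> sub U U' -> sub U' Z -> Q U' -> sub U' U].
Proof.
move=> nZ hU0 WU0 U0Z QU0; apply: contrapT => nomax.
pose good U := [/\ submod U, sub U0 U, sub U Z & Q U].
have step (u : {U | good U}) : {u' : {U | good U} | sub (sval u) (sval u') /\ ~ sub (sval u') (sval u)}.
  apply: cid; case: u => U [h1 h2 h3 h4]; apply: contrapT => hn; apply: nomax; exists U; split=> //.
  move=> U' h1' h2' h3' h4'; apply: contrapT => h; apply: hn.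
  have g' : good U' by split=> // x /h2 /h2'.
  by exists (exist _ U' g').
have g0 : good U0 by split.
pose f n := iter n (fun u => sval (step u)) (exist _ U0 g0).
have fS n : sub (sval (f n)) (sval (f n.+1)) by rewrite /f iterS; case: (svalP (step (iter n (fun u => sval (step u)) (exist _ U0 g0)))).
have fnS n : ~ sub (sval (f n.+1)) (sval (f n)) by rewrite /f iterS; case: (svalP (step (iter n (fun u => sval (step u)) (exist _ U0 g0)))).
have fm n k : sub (sval (f n)) (sval (f (n + k)%N)).
  by elim: k => [|k IH] x; rewrite ?addn0 ?addnS // => /IH; apply: fS.
have fle n k : (n <= k)%N -> sub (sval (f n)) (sval (f k)) by move=> nk; rewrite -(subnKC nk); apply: fm.
pose U x := exists n, sval (f n) x.
have hU : submod U.
  split; first by exists 0%N; case: hU0.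
  move=> a x y [k hk] [l hl]; exists (maxn k l).
  have [hf _ _ _] := svalP (f (maxn k l)).
  by apply: (proj2 hf); [apply: (fle k)|apply: (fle l)]; rewrite ?leq_maxl ?leq_maxr.
have [] := nZ U hU.
- by move=> x /WU0 hx; exists 0%N.
- by move=> x [k hk]; have [_ _ h _] := svalP (f k); apply: h.
move=> r [v [vU gen]].
have [N hN] : exists N, forall i, (i < r)%N -> sval (f N) (v i).
  elim: r vU {gen} => [|r IH] vU; first by exists 0%N.
  have [N hN] := IH (fun i ir => vU i (ltnW ir)); have [M hM] := vU r (ltnSn r).
  exists (maxn N M) => i; rewrite ltnS leq_eqVlt => /orP[/eqP->|ir].
    by apply: fle hM; rewrite leq_maxr.
  by apply: fle (hN _ ir); rewrite leq_maxl.
apply: (fnS N) => x hx.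
have /gen [c hc] : U x by exists N.+1.
have [hf f0 _ _] := svalP (f N).
rewrite -(subrK (\sum_(i < r) c i *: v i) x); apply: submodD => //.
  by apply: f0; apply: WU0.
by apply: submod_sum => // i _; apply: submodZ => //; apply: hN.
Qed.

Lemma noeth_ind Z W (Q : (V -> Prop) -> Prop) : noeth Z W ->
  (forall U, submod U -> sub W U -> sub U Z ->
     (forall U', submod U' -> sub U U' -> sub U' Z -> ~ sub U' U -> Q U') -> Q U) ->
  forall U, submod U -> sub W U -> sub U Z -> Q U.
Proof.
move=> nZ step U hU WU UZ; apply: contrapT => nQ.
have [U1 [h1 h2 h3 h4 hm]] := @noeth_max Z W (fun U => ~ Q U) U nZ hU WU UZ nQ.
apply: h4; apply: step => //; first by move=> x /WU /h2.
by move=> U' h1' h2' h3' hn; apply: contrapT => nq; apply: hn; apply: hm.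
Qed.

Lemma noeth_sub Z W Z' W' : noeth Z W -> submod W' -> sub W W' -> sub Z' Z -> noeth Z' W'.
Proof.
move=> nZ hW' WW' Z'Z U hU WU UZ.
have [r [v [vU gen]]] := nZ U hU (fun x h => WU x (WW' x h)) (fun x h => Z'Z x (UZ x h)).
by exists r, v; split=> // x /gen [c /WW' hc]; exists c.
Qed.

Lemma lin_choose (W U : V -> Prop) r v : submod W -> submod U ->
  (forall i, (i < r)%N -> addm W U (v i)) ->
  exists v', (forall i, (i < r)%N -> U (v' i)) /\ forall i, (i < r)%N -> W (v i - v' i).
Proof.
move=> hW hU h.
have /choice [v' hv] : forall i, exists u, (i < r)%N -> U u /\ W (v i - u).
  move=> i; case: (ltnP i r) => [ir|_]; last by exists 0.
  by have [w [u [hw hu e]]] := h i ir; exists u; rewrite e addrK.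
by exists v'; split=> i /hv [].
Qed.

(** Generators of the image of [U] in [Z/W] are lifted into [U] by [lin_choose]; generators of the
    intersection of [W] and [U] modulo [Y] are added to them. *)
Lemma noeth_trans Z W Y : submod Z -> submod W -> submod Y -> sub Y W -> sub W Z ->
  noeth Z W -> noeth W Y -> noeth Z Y.
Proof.
move=> hZ hW hY YW WZ n1 n2 U hU YU UZ.
have [|r [v [vU gen]]] := n1 (addm W U) (submod_addm hW hU) (addml hU).
  by apply: addm_sub.
have [v' [v'U hv']] := lin_choose hW hU vU.
have gen' x : U x -> exists c : nat -> R, W (x - \sum_(i < r) c i *: v' i).
  move=> /(addmr hW) /gen [c hc]; exists c.
  rewrite -(subrK (\sum_(i < r) c i *: v i) x) -addrA -sumrB.
  apply: submodD => //; apply: submod_sum => // i _; rewrite -scalerBr; apply: submodZ => //.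
  exact: hv'.
have [||r2 [v2 [v2U gen2]]] := n2 (capm W U) (submod_capm hW hU).
- by move=> x hx; split; [apply: YW|apply: YU].
- by move=> x [].
have [v'' hv''] := lin_cat r v' r2 v2.
exists (r + r2)%N, (fun i => if (i < r)%N then v' i else v2 (i - r)%N); split.
  move=> i ir; case: ltnP => h; first exact: v'U.
  by have [] := v2U (i - r)%N; rewrite // ltn_subLR.
move=> x Ux; have [c hc] := gen' x Ux.
have [|c2 hc2] := gen2 (x - \sum_(i < r) c i *: v' i).
  split=> //; apply: submodB => //; apply: submod_sum => // i _; apply: submodZ => //; exact: v'U.
exists (fun i => if (i < r)%N then c i else c2 (i - r)%N).
rewrite big_split_ord /= opprD addrA.
rewrite (eq_bigr (fun i : 'I_r => c i *: v' i)); last by move=> i _; rewrite ltn_ord.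
rewrite [X in _ - X](eq_bigr (fun i : 'I_r2 => c2 i *: v2 i)) // => i _.
by rewrite ltnNge leq_addr /= addKn.
Qed.
End Modules.

Section Rings.
Variable R : comNzRingType.
Implicit Types (I J P : R -> Prop) (x y a : R).

Definition ideal I := submod (V := R^o) I.
Definition span (r : nat) (v : nat -> R) : R -> Prop := lin (V := R^o) r v.
Definition noethR := noeth (V := R^o) (fun=> True) (fun x => x = 0).

Lemma idealP I : ideal I <-> [/\ I 0, forall x y, I x -> I y -> I (x + y) & forall a x, I x -> I (a * x)].
Proof.
split=> [h|[h0 hD hM]].
  by split; [exact: submod0 h|exact: submodD h|move=> a x; exact: submodZ h a x].
by split=> // a x y hx hy; apply: hD => //; apply: hM.
Qed.
Lemma ideal0 I : ideal I -> I 0. Proof. by case/idealP. Qed.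
Lemma idealD I x y : ideal I -> I x -> I y -> I (x + y). Proof. by case/idealP => _ h _; apply: h. Qed.
Lemma idealN I x : ideal I -> I x -> I (- x). Proof. by move=> h; apply: (submodN h). Qed.
Lemma idealB I x y : ideal I -> I x -> I y -> I (x - y).
Proof. by move=> h hx hy; apply: idealD => //; apply: idealN. Qed.
Lemma ideal_sum I (T : Type) (s : seq T) (P : pred T) (F : T -> R) : ideal I ->
  (forall i, P i -> I (F i)) -> I (\sum_(i <- s | P i) F i).
Proof. by move=> h hF; elim/big_rec: _ => [|i x Pi hx]; [apply: ideal0|apply: idealD => //; apply: hF]. Qed.
Lemma idealM I a x : ideal I -> I x -> I (a * x).
Proof. by move=> /idealP[_ _ h]; apply: h. Qed.
Lemma idealMr I a x : ideal I -> I x -> I (x * a).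
Proof. by rewrite mulrC; apply: idealM. Qed.
Lemma ideal1 I x : ideal I -> I 1 -> I x.
Proof. by move=> h h1; rewrite -[x]mulr1; apply: idealM. Qed.

Lemma spanP r v x : span r v x <-> exists c : nat -> R, x = \sum_(i < r) c i * v i.
Proof. by []. Qed.
Lemma ideal_span r v : ideal (span r v). Proof. exact: submod_lin_span. Qed.
Lemma span_mem r v i : (i < r)%N -> span r v (v i). Proof. exact: lin_mem. Qed.
Lemma span_sub r v I : ideal I -> (forall i, (i < r)%N -> I (v i)) -> sub (span r v) I.
Proof. by move=> hI h x; apply: submod_lin. Qed.

Lemma noethR_fg I : noethR -> ideal I -> exists r v, forall x, I x <-> span r v x.
Proof.
move=> nR hI; have [] := nR I hI; first by move=> x ->; apply: submod0 hI.
  by [].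
move=> r [v [vI gen]]; exists r, v => x; split; last by apply: span_sub.
by move=> /gen [c /eqP]; rewrite subr_eq0 => /eqP e; exists c.
Qed.
Lemma noethR_ideal I : noethR -> ideal I -> noeth (V := R^o) (fun=> True) I.
Proof. by move=> nR hI; apply: (noeth_sub nR) => // x ->; apply: submod0 hI. Qed.

Lemma noethR_ind (Q : (R -> Prop) -> Prop) I : noethR -> ideal I ->
  (forall J, ideal J -> sub I J -> (forall J', ideal J' -> sub J J' -> ~ sub J' J -> Q J') -> Q J) ->
  Q I.
Proof.
move=> nR hI step; apply: (noeth_ind (noethR_ideal nR hI)) => // U hU IU _ IH.
by apply: step => // J' hJ' s n; apply: IH.
Qed.
Lemma noethR_max (Q : (R -> Prop) -> Prop) I : noethR -> ideal I -> Q I ->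
  exists J, [/\ ideal J, sub I J, Q J &
    forall J', ideal J' -> sub J J' -> Q J' -> sub J' J].
Proof.
move=> nR hI QI.
have [//|J [h1 h2 _ h4 h5]] := noeth_max (noethR_ideal nR hI) hI (fun _ h => h) _ QI.
by exists J; split=> // J' a b c; apply: h5.
Qed.

Definition prime P := [/\ ideal P, ~ P 1 & forall x y, P (x * y) -> P x \/ P y].

Lemma primeX P x k : prime P -> P (x ^+ k) -> P x.
Proof.
move=> [hP P1 hM]; elim: k => [|k IH]; first by rewrite expr0.
by rewrite exprS => /hM [].
Qed.

Definition colon I a : R -> Prop := fun x => I (a * x).
Lemma ideal_colon I a : ideal I -> ideal (colon I a).
Proof.
move=> hI; apply/idealP; split; rewrite /colon.
- by rewrite mulr0; apply: submod0 hI.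
- by move=> x y hx hy; rewrite mulrDr; apply: submodD hI _ _ hx hy.
- by move=> b x hx; rewrite mulrCA; apply: idealM.
Qed.
(** The ideal [I + aR]. *)
Definition addg I a : R -> Prop := fun x => exists r, I (x - r * a).
Lemma ideal_addg I a : ideal I -> ideal (addg I a).
Proof.
move=> hI; apply/idealP; split.
- by exists 0; rewrite mul0r subr0; apply: submod0 hI.
- move=> x y [r hr] [s hs]; exists (r + s); rewrite mulrDl opprD addrACA.
  exact: submodD hI _ _ hr hs.
- by move=> b x [r hr]; exists (b * r); rewrite -mulrA -mulrBr; apply: idealM.
Qed.
Lemma addgl I a : ideal I -> sub I (addg I a).
Proof. by move=> hI x hx; exists 0; rewrite mul0r subr0. Qed.
Lemma addgr I a : ideal I -> addg I a a.
Proof. by move=> hI; exists 1; rewrite mul1r subrr; apply: submod0 hI. Qed.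
Lemma colonl I a : ideal I -> sub I (colon I a).
Proof. by move=> hI x; apply: idealM. Qed.

(* An ideal maximal among those avoiding a multiplicative set is prime. *)
Lemma prime_avoid (M : R -> Prop) I : noethR -> ideal I -> M 1 ->
  (forall x y, M x -> M y -> M (x * y)) -> (forall x, M x -> ~ I x) ->
  exists P, [/\ prime P, sub I P & forall x, M x -> ~ P x].
Proof.
move=> nR hI M1 MM dis.
have [P [hP IP QP Pmax]] := noethR_max (Q := fun P => forall x, M x -> ~ P x) nR hI dis.
exists P; split=> //; split=> //; first exact: QP.
move=> x y Pxy; apply: contrapT => /not_orP[nx ny].
have h z : ~ P z -> exists r s, M s /\ P (s - r * z).
  move=> nz; apply: contrapT => hn; apply: nz.
  suff hs : sub (addg P z) P by apply: hs; apply: addgr.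
  refine (Pmax _ (ideal_addg z hP) (addgl z hP) _).
  by move=> s Ms [r hr]; apply: hn; exists r, s.
have [r [s [Ms hs]]] := h x nx; have [r' [s' [Ms' hs']]] := h y ny.
apply: (QP (s * s') (MM _ _ Ms Ms')).
have -> : s * s' = s' * (s - r * x) + r * x * (s' - r' * y) + r * r' * (x * y) by ring.
by apply: (submodD hP); [apply: (submodD hP)|]; apply: idealM.
Qed.

End Rings.

(** * Krull intersections and irreducible submodules *)

Section Krull.
Variables (R : comNzRingType) (V : lmodType R).
Implicit Types (W Z U : V -> Prop).

Lemma noeth_stable Z W (U : nat -> V -> Prop) : noeth Z W ->
  (forall k, submod (U k)) -> (forall k, sub W (U k)) -> (forall k, sub (U k) Z) ->
  (forall k, sub (U k) (U k.+1)) -> exists k, sub (U k.+1) (U k).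
Proof.
move=> nZ h1 h2 h3 h4.
have [|U' [_ _ _ [k ->] h5]] := noeth_max (Q := fun X => exists k, X = U k) nZ (h1 0%N) (h2 0%N) (h3 0%N).
  by exists 0%N.
by exists k; apply: h5 => //; exists k.+1.
Qed.

(** The submodules [(U : y^k)] of [Z] increase with [k], so two consecutive ones agree. *)
Lemma colon_stable Z W U y : noeth Z W -> submod Z -> submod U -> sub W U -> sub U Z ->
  exists k, forall z, Z z -> U (y ^+ k.+1 *: z) -> U (y ^+ k *: z).
Proof.
move=> nZ hZ hU WU UZ.
have [|||k|k hk] := @noeth_stable Z W (fun k z => Z z /\ U (y ^+ k *: z)) nZ.
- move=> k; split; first by rewrite scaler0; split; apply: submod0.
  move=> a x z [hx hx'] [hz hz']; split; first exact: (proj2 hZ).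
  by rewrite scalerDr scalerA mulrC -scalerA; apply: (proj2 hU).
- by move=> k x hx; split; [apply: UZ; apply: WU|apply: submodZ => //; apply: WU].
- by move=> k x [].
- by move=> x [? ?]; split=> //; rewrite exprS -scalerA; apply: submodZ.
by exists k => z Zz h; have [] := hk z (conj Zz h).
Qed.

(* Krull's intersection theorem, in a form that does not presuppose a local ring. *)
Lemma krull Z W r (y : nat -> R) v : noeth Z W -> submod Z -> submod W -> sub W Z -> Z v ->
  exists N, forall w (u : nat -> V), (forall i, (i < r)%N -> Z (u i)) ->
    W (w *: v - \sum_(i < r) y i ^+ N *: u i) ->
    exists c : nat -> R, W ((w - \sum_(i < r) c i * y i) *: v).
Proof.
move=> nZ hZ hW WZ Zv.
(* [Q U] says that [U] meets [Rv] inside [W + (y)v], which is [U0]. A maximal such [U] will absorb a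
   power of each [y i] times [Z]. *)
pose Q U := forall a, U (a *: v) -> exists c : nat -> R, W ((a - \sum_(i < r) c i * y i) *: v).
pose U0 x := exists c : nat -> R, W (x - (\sum_(i < r) c i * y i) *: v).
have hU0 : submod U0.
  split.
    exists (fun=> 0); rewrite big1 => [|i _]; last by rewrite mul0r.
    by rewrite scale0r subr0; apply: submod0.
  move=> a x z [c hc] [c' hc']; exists (fun i => a * c i + c' i).
  rewrite (_ : _ - _ = a *: (x - (\sum_(i < r) c i * y i) *: v) + (z - (\sum_(i < r) c' i * y i) *: v)).
    exact: (proj2 hW).
  rewrite scalerBr addrACA -opprD scalerA -scalerDl mulr_sumr -big_split /=.
  by congr (_ - _ *: _); apply: eq_bigr => i _; rewrite mulrDl mulrA.
have U0v i : (i < r)%N -> forall a, U0 (a *: (y i *: v)).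
  move=> ir a; exists (fun j => if j == i then a else 0).
  rewrite (bigD1 (Ordinal ir)) //= eqxx big1 => [|j].
    by rewrite addr0 scalerA subrr; apply: submod0.
  by rewrite -val_eqE /= => /negbTE ->; rewrite mul0r.
have WU0 : sub W U0.
  by move=> x hx; exists (fun=> 0); rewrite big1 ?scale0r ?subr0 // => i _; rewrite mul0r.
have U0Z : sub U0 Z.
  by move=> x [c hc]; rewrite -(subrK ((\sum_(i < r) c i * y i) *: v) x); apply: submodD => //;
    [apply: WZ|apply: submodZ].
have QU0 : Q U0 by move=> a [c]; rewrite -scalerBl; exists c.
have [U [hU U0U UZ QU Umax]] := noeth_max nZ hU0 WU0 U0Z QU0.
(* Adding [y_i^k Z] to [U] preserves [Q]: if [a v = u + y_i^k z], then [y_i a v] lies in [U0], so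
   [y_i^(k+1) z] and by stability [y_i^k z] lie in [U]. *)
have key i : (i < r)%N -> exists k, forall z, Z z -> U (y i ^+ k *: z).
  move=> ir; have [k hk] := colon_stable (y i) nZ hZ hU (fun x h => U0U x (WU0 x h)) UZ.
  exists k; pose Y x := exists2 z, Z z & x = y i ^+ k *: z.
  have hY : submod Y.
    split; first by exists 0; rewrite ?scaler0 //; apply: submod0.
    move=> a _ _ [z1 h1 ->] [z2 h2 ->]; exists (a *: z1 + z2); first exact: (proj2 hZ).
    by rewrite scalerDr !scalerA mulrC.
  suff h : sub (addm U Y) U.
    by move=> z Zz; apply: h; apply: addmr => //; exists z.
  refine (Umax _ (submod_addm hU hY) (addml hY) _ _).
    by apply: addm_sub => // _ [z Zz ->]; apply: submodZ.
  move=> a [u [_ [hu [z Zz ->] e]]]; apply: QU; rewrite e; apply: submodD => //.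
  apply: hk => //; rewrite exprS -scalerA.
  have := U0U _ (U0v i ir a); rewrite scalerA mulrC -scalerA e scalerDr => h.
  by apply: submodDl h; rewrite ?submodZ //; apply: submodZ.
have [N hN] : exists N, forall i, (i < r)%N -> forall z, Z z -> U (y i ^+ N *: z).
  elim: (r) key => [|r' IH] key; first by exists 0%N.
  have [N hN] := IH (fun i ir => key i (ltnW ir)); have [M hM] := key r' (ltnSn r').
  exists (maxn N M) => i; rewrite ltnS leq_eqVlt => /orP[/eqP->|ir] z Zz.
    by rewrite -(subnK (leq_maxr N M)) exprD -scalerA; apply: submodZ => //; apply: hM.
  by rewrite -(subnK (leq_maxl N M)) exprD -scalerA; apply: submodZ => //; apply: hN.
exists N => w u hu hw; apply: QU.
rewrite -(subrK (\sum_(i < r) y i ^+ N *: u i) (w *: v)); apply: submodD => //.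
  by apply: U0U; apply: WU0.
by apply: submod_sum => // i _; apply: hN => //; apply: hu.
Qed.

(** The submodule [I^L Z] for [I] generated by the first [r] values of [y]. Peeling off one
    generator at a time avoids indexing products of length [L]. *)
Fixpoint ipowm (r : nat) (y : nat -> R) (L : nat) (Z : V -> Prop) : V -> Prop :=
  if L is L'.+1 then fun x => exists u : nat -> V,
    (forall i, (i < r)%N -> ipowm r y L' Z (u i)) /\ x = \sum_(i < r) y i *: u i
  else Z.

Lemma submod_ipowm r y L Z : submod Z -> submod (ipowm r y L Z).
Proof.
move=> hZ; elim: L => [//|L IH] /=; split.
  exists (fun=> 0); split; first by move=> i _; apply: submod0.
  by rewrite big1 // => i _; rewrite scaler0.
move=> a _ _ [u [hu ->]] [u' [hu' ->]]; exists (fun i => a *: u i + u' i); split.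
  by move=> i ir; apply: (proj2 IH); auto.
rewrite scaler_sumr -big_split; apply: eq_bigr => i _ /=.
by rewrite scalerDr !scalerA mulrC.
Qed.
Lemma ipowm_mul r y L Z i x : submod Z -> (i < r)%N -> ipowm r y L Z x -> ipowm r y L.+1 Z (y i *: x).
Proof.
move=> hZ ir hx; exists (fun j => if j == i then x else 0); split.
  by move=> j jr; case: ifP => // _; apply: submod0; apply: submod_ipowm.
rewrite (bigD1 (Ordinal ir)) //= eqxx big1 ?addr0 // => j.
by rewrite -val_eqE /= => /negbTE ->; rewrite scaler0.
Qed.
Lemma ipowm_sub r y L Z (H : V -> Prop) : submod H ->
  (forall i x, (i < r)%N -> ipowm r y L Z x -> H (y i *: x)) -> sub (ipowm r y L.+1 Z) H.
Proof. by move=> hH h _ [u [hu ->]]; apply: submod_sum => // i _; apply: h => //; apply: hu. Qed.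
Lemma ipowmS r y L Z : submod Z -> sub (ipowm r y L.+1 Z) (ipowm r y L Z).
Proof.
move=> hZ; elim: L => [|L IH].
  by apply: ipowm_sub => // i x _; apply: submodZ.
apply: ipowm_sub; first exact: submod_ipowm.
by move=> i x ir hx; apply: ipowm_mul => //; apply: IH.
Qed.
Lemma ipowm_le r y K L Z : submod Z -> (K <= L)%N -> sub (ipowm r y L Z) (ipowm r y K Z).
Proof.
move=> hZ; elim: L => [|L IH]; first by rewrite leqn0 => /eqP ->.
by rewrite leq_eqVlt => /orP[/eqP->//|KL] x hx; apply: IH => //; apply: ipowmS hx.
Qed.
Lemma ipowm_le0 r y L Z : submod Z -> sub (ipowm r y L Z) Z.
Proof. by move=> hZ; apply: (@ipowm_le r y 0). Qed.

(** Monomials are sorted by the exponent of the last generator, which prepares an induction on the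
    number of generators. *)
Lemma ipowm_split r y L Z (H : V -> Prop) : submod Z -> submod H ->
  (forall a x, (a <= L)%N -> ipowm r y (L - a) Z x -> H (y r ^+ a *: x)) ->
  sub (ipowm r.+1 y L Z) H.
Proof.
move=> hZ; elim: L H => [|L IH] H hH h.
  by move=> x hx; have := h 0%N x (leqnn _); rewrite expr0 scale1r; apply.
move=> _ [u [hu ->]]; apply: submod_sum => // i _.
apply: (IH (fun x => H (y i *: x))) (hu i (ltn_ord i)).
  split; first by rewrite scaler0; apply: submod0.
  move=> a x z hx hz; rewrite scalerDr; apply: submodD => //.
  by rewrite scalerA mulrC -scalerA; apply: submodZ.
move=> a x aL hx; have := ltn_ord i; rewrite ltnS leq_eqVlt => /orP[/eqP ->|ir].
  by rewrite scalerA -exprS; apply: h => //.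
rewrite scalerA mulrC -scalerA; apply: h; first by rewrite ltnW.
rewrite subSn //; exact: ipowm_mul.
Qed.

(** Pigeonhole on monomials: in degree [L + N] either the last generator has exponent at least [N],
    or the others have total degree at least [L]. *)
Lemma ipowm_pigeon r y Z (G : V -> Prop) : submod Z -> submod G ->
  (forall i, (i < r)%N -> exists N, forall z, Z z -> G (y i ^+ N *: z)) ->
  exists L, sub (ipowm r y L Z) G.
Proof.
move=> hZ hG; elim: r => [|r IH] h.
  exists 1%N => _ [u [_ ->]]; rewrite big_ord0; exact: submod0.
have [L hL] := IH (fun i ir => h i (ltnW ir)).
have [N hN] := h r (ltnSn r).
exists (L + N)%N; apply: ipowm_split => // a x aL hx.
case: (leqP N a) => Na.
  rewrite -(subnK Na) exprD -scalerA; apply: submodZ => //; apply: hN.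
  exact: ipowm_le0 hx.
apply: submodZ => //; apply: hL; apply: ipowm_le hx => //.
by rewrite -(subnKC (ltnW Na)) addnC -addnA addnC addnK leq_addl.
Qed.

(** The ideal generated by [y] lies in the Jacobson radical. *)
Definition jac (r : nat) (y : nat -> R) :=
  forall c : nat -> R, exists s, s * (1 - \sum_(i < r) c i * y i) = 1.

(** Submodules are closed in the [y]-adic topology: Krull's theorem gives [(1 - j) v] in [W] with
    [j] in [(y)], and [1 - j] is a unit. *)
Lemma krull_closed Z W r y v : jac r y -> noeth Z W -> submod Z -> submod W -> sub W Z -> Z v ->
  (forall L, addm W (ipowm r y L Z) v) -> W v.
Proof.
move=> hj nZ hZ hW WZ Zv h.
have [N hN] := krull r y nZ hZ hW WZ Zv.
pose G x := exists2 u : nat -> V, (forall i, (i < r)%N -> Z (u i)) & x = \sum_(i < r) y i ^+ N *: u i.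
have hG : submod G.
  split; first by exists (fun=> 0) => [i _|]; [exact: submod0|rewrite big1 // => i _; rewrite scaler0].
  move=> a _ _ [u hu ->] [u' hu' ->]; exists (fun i => a *: u i + u' i).
    by move=> i ir; apply: (proj2 hZ); auto.
  rewrite scaler_sumr -big_split; apply: eq_bigr => i _ /=.
  by rewrite scalerDr !scalerA mulrC.
have [|L hL] := @ipowm_pigeon r y Z G hZ hG.
  move=> i ir; exists N => z hz; exists (fun j => if j == i then z else 0).
    by move=> j _; case: ifP => // _; apply: submod0.
  rewrite (bigD1 (Ordinal ir)) //= eqxx big1 ?addr0 // => j.
  by rewrite -val_eqE /= => /negbTE ->; rewrite scaler0.
have [w [_ [hw /hL [u hu ->] e]]] := h L.
have [|c hc] := hN 1 u hu; first by rewrite scale1r e addrK.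
have [s hs] := hj c.
by rewrite -[v]scale1r -hs -scalerA; apply: submodZ.
Qed.

(** Iterating [Z = W + (y)Z] gives [Z = W + (y)^L Z] for all [L], and [W] is closed. *)
Lemma nakayama Z W r y : jac r y -> noeth Z W -> submod Z -> submod W -> sub W Z ->
  (forall x, Z x -> addm W (ipowm r y 1 Z) x) -> sub Z W.
Proof.
move=> hj nZ hZ hW WZ h.
have hL L : sub Z (addm W (ipowm r y L Z)).
  elim: L => [|L IH] x hx; first by apply: addmr.
  have [w [_ [hw [u [hu ->]] e]]] := h _ hx; rewrite e.
  have hA := submod_addm hW (submod_ipowm r y L.+1 hZ).
  apply: submodD => //; first by apply: addml hw; apply: submod_ipowm.
  apply: submod_sum => // i _.
  have [w' [z [hw' hz ->]]] := IH _ (hu i (ltn_ord i)).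
  exists (y i *: w'), (y i *: z); split; [exact: submodZ|exact: ipowm_mul|exact: scalerDr].
by move=> x hx; apply: (krull_closed hj nZ hZ hW WZ hx) => L; apply: hL.
Qed.

(* Noetherian reduction of a property of submodules to irreducible ones; [q] is the associated
   prime and [a0] generates the socle at [q]. *)
Lemma irreducible_ind Z W (Q : (V -> Prop) -> Prop) : noethR R -> noeth Z W -> submod Z ->
  submod W -> sub W Z -> Q Z ->
  (forall U1 U2, Q U1 -> Q U2 -> Q (capm U1 U2)) ->
  (forall U a0 (q : R -> Prop), submod U -> sub W U -> sub U Z -> Z a0 -> ~ U a0 -> prime q ->
     (forall r, q r <-> U (r *: a0)) ->
     (forall a, Z a -> ~ U a -> exists y r, ~ q y /\ U (y *: a0 - r *: a)) ->
     (forall y, q y -> exists k, forall z, Z z -> U (y ^+ k *: z)) -> Q U) ->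
  Q W.
Proof.
move=> nR nZ hZ hW WZ QZ Qcap Qirr.
apply: (noeth_ind nZ) => // U hU WU UZ IH.
have ext (A B : V -> Prop) : sub A B -> sub B A -> A = B.
  by move=> h1 h2; apply/predeqP => x; split; [apply: h1|apply: h2].
(* An intersection of two strictly larger submodules is covered by the induction hypothesis and
   [Qcap]; after this case [U] is irreducible. *)
case: (EM (exists U1 U2, [/\ submod U1, submod U2, sub U1 Z, sub U2 Z &
   [/\ sub U U1, sub U U2, ~ sub U1 U, ~ sub U2 U & sub (capm U1 U2) U]])).
  move=> [U1 [U2 [h1 h2 h3 h4 [h5 h6 h7 h8 h9]]]].
  rewrite (ext U (capm U1 U2)) //; last by move=> x hx; split; [apply: h5|apply: h6].
  by apply: Qcap; apply: IH.
move=> nred.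
have irr U1 U2 : submod U1 -> submod U2 -> sub U1 Z -> sub U2 Z -> sub U U1 -> sub U U2 ->
    ~ sub U1 U -> ~ sub U2 U -> exists x, [/\ U1 x, U2 x & ~ U x].
  move=> *; apply: contrapT => hn; apply: nred; exists U1, U2; split=> //; split=> // x [hx hx'].
  by apply: contrapT => hu; apply: hn; exists x.
case: (EM (sub Z U)) => [ZU|nZU]; first by rewrite (ext U Z).
have [a [Za nUa]] : exists a, Z a /\ ~ U a.
  apply: contrapT => hn; apply: nZU => x hx; apply: contrapT => hu; apply: hn; by exists x.
pose ann a (r : R) := U (r *: a).
have hann b : ideal (ann b).
  apply/idealP; split; rewrite /ann.
  - by rewrite scale0r; apply: submod0.
  - by move=> x z hx hz; rewrite scalerDl; apply: submodD.
  - by move=> c x hx; rewrite -scalerA; apply: submodZ.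
have [|_ [_ _ [a0 [Za0 nUa0 ->]] qmax]] :=
    noethR_max (Q := fun J => exists a, [/\ Z a, ~ U a & J = ann a]) nR (hann a).
  by exists a.
pose M b x := exists r u, U u /\ x = u + r *: b.
have hM b : submod (M b).
  split; first by exists 0, 0; rewrite scale0r addr0; split=> //; apply: submod0.
  move=> c _ _ [r [u [hu ->]]] [r' [u' [hu' ->]]]; exists (c * r + r'), (c *: u + u').
  by split; [apply: (proj2 hU)|rewrite scalerDr scalerDl scalerA addrACA].
have UM b : sub U (M b) by move=> u hu; exists 0, u; rewrite scale0r addr0.
have MZ b : Z b -> sub (M b) Z.
  by move=> hb _ [r [u [hu ->]]]; apply: submodD => //; [apply: UZ|apply: submodZ].
have Mb b : M b b by exists 1, 0; rewrite scale1r add0r; split=> //; apply: submod0.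
have pq : prime (ann a0).
  split; [exact: hann|by rewrite /ann scale1r|].
  move=> x z hxz; case: (EM (ann a0 z)) => [|nz]; first by right.
  left; have h : sub (ann (z *: a0)) (ann a0).
    apply: qmax; [exact: hann| |].
      by move=> r hr; rewrite /ann scalerA mulrC -scalerA; apply: submodZ.
    by exists (z *: a0); split=> //; apply: submodZ.
  by apply: h; rewrite /ann scalerA.
apply: (Qirr U a0 (ann a0)) => //.
(* By irreducibility [U + Rb] and [U + R a0] meet outside [U]; comparing the two expressions of a
   common element gives [y] and [r]. *)
- move=> b Zb nUb.
  have [||x [[r [u [hu ex]]] [y [u' [hu' ey]]] nUx]] :=
      irr (M b) (M a0) (hM b) (hM a0) (MZ b Zb) (MZ a0 Za0) (UM b) (UM a0).
  + by move=> h; apply: nUb; apply: h.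
  + by move=> h; apply: nUa0; apply: h.
  exists y, r; split; first by move=> hy; apply: nUx; rewrite ey; apply: submodD.
  have -> : y *: a0 - r *: b = u - u'.
    have -> : y *: a0 = x - u' by rewrite ey addrC addKr.
    have -> : r *: b = x - u by rewrite ex addrC addKr.
    by rewrite opprB addrC addrA subrK.
  exact: submodB.
(* If [y^k Z] were not inside [U], then [(U : y^(k+1))], which contains [a0], and [U + y^k Z] would
   both be strictly larger than [U]; but they meet in [U], since [(U : y^(2k+1)) = (U : y^k)]. *)
move=> y hy; have [k hk] := colon_stable y nZ hZ hU WU UZ.
exists k => z0 Zz0; apply: contrapT => hn.
have hkj j z : Z z -> U (y ^+ (k + j) *: z) -> U (y ^+ k *: z).
  elim: j => [|j IHj] Zz; first by rewrite addn0.
  rewrite -addSnnS exprD -scalerA => h; apply: IHj => //.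
  by rewrite exprD -scalerA; apply: hk => //; apply: submodZ.
pose Y x := Z x /\ U (y ^+ k.+1 *: x).
pose Y' x := exists2 z, Z z & U (x - y ^+ k *: z).
have hY : submod Y.
  split; first by split; rewrite ?scaler0; apply: submod0.
  move=> c x z [hx hx'] [hz hz']; split; first exact: (proj2 hZ).
  by rewrite scalerDr scalerA mulrC -scalerA; apply: (proj2 hU).
have hY' : submod Y'.
  split; first by exists 0; rewrite ?scaler0 ?subr0; apply: submod0.
  move=> c x z [x' hx hx'] [z' hz hz']; exists (c *: x' + z'); first exact: (proj2 hZ).
  by rewrite scalerDr scalerA mulrC -scalerA opprD addrACA -scalerBr; apply: (proj2 hU).
have [||||||x [[Zx hx] [z Zz hz] nUx]] := irr Y Y' hY hY'.
- by move=> x [].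
- move=> x [z Zz h]; rewrite -(subrK (y ^+ k *: z) x); apply: submodD => //; first exact: UZ.
  exact: submodZ.
- by move=> x hx; split; [apply: UZ|apply: submodZ].
- by move=> x hx; exists 0; rewrite ?scaler0 ?subr0 //; apply: submod0.
- move=> h; apply: nUa0; apply: h; split=> //.
  by rewrite exprSr -scalerA; apply: submodZ.
- move=> h; apply: hn; apply: h; exists z0 => //; rewrite subrr; exact: submod0.
apply: nUx; rewrite -(subrK (y ^+ k *: z) x); apply: submodD => //.
apply: (hkj k.+1) => //; rewrite addnC exprD -scalerA.
have := submodZ hU (y ^+ k.+1) hz; rewrite scalerBr => h.
by rewrite -(subKr (y ^+ k.+1 *: x) (_ *: _)); apply: submodB.
Qed.

(* Such an extension of [U] is a finite-dimensional space over the residue field at [P]. *)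
Lemma saturated_dcc (P : R -> Prop) (E : nat -> V -> Prop) (U : V -> Prop) v r :
  prime P -> (forall l, submod (E l)) -> (forall l, sub (E l.+1) (E l)) ->
  (forall l w x, ~ P w -> E l (w *: x) -> E l x) -> submod U ->
  (forall i a, (i < r)%N -> P a -> U (a *: v i)) ->
  (exists l0, forall l x, (l0 <= l)%N -> U x -> E l0 x -> E l x) ->
  exists l0, forall l x, (l0 <= l)%N -> addm U (lin r v) x -> E l0 x -> E l x.
Proof.
move=> pP hE Edec Esat hU.
have Ele k l : (k <= l)%N -> sub (E l) (E k).
  elim: l => [|l IH]; first by rewrite leqn0 => /eqP ->.
  by rewrite leq_eqVlt => /orP[/eqP->//|kl] x hx; apply: IH => //; apply: Edec.
elim: r => [|r IH] kill [l0 hl0].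
  exists l0 => l x hl [u [_ [hu [c ->] ->]]]; rewrite big_ord0 addr0; exact: hl0.
have [l1 hl1] := IH (fun i a ir => kill i a (ltnW ir)) (ex_intro _ l0 hl0).
pose U' := addm U (lin r v).
have hU' : submod U' by apply: submod_addm => //; apply: submod_lin_span.
have dec x : addm U (lin r.+1 v) x -> exists a u, U' u /\ x = u + a *: v r.
  move=> [u [_ [hu [c ->] ->]]]; exists (c r), (u + \sum_(i < r) c i *: v i).
  by split; [exists u, (\sum_(i < r) c i *: v i); split=> //; exists c|rewrite big_ord_recr /= addrA].
have Uv a : P a -> U' (a *: v r) by move=> ha; apply: addml; [apply: submod_lin_span|apply: kill].
(* Either every [E l] contains an element whose coefficient at [v r] is outside [P], and subtracting
   a multiple of it moves any element into [U']; or from some [l2] on all these coefficients lie in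
   [P], and then [v r] contributes nothing beyond [U']. *)
pose hit l := exists w u, [/\ ~ P w, U' u & E l (u + w *: v r)].
case: (EM (forall l, hit l)) => [hall|/existsNP[l2 hl2]].
  exists l1 => l x hl /dec [a [u [hu ->]]] hx.
  have [w [u' [nPw hu' he]]] := hall l.
  apply: (Esat _ w) => //.
  rewrite -(subrK (a *: (u' + w *: v r)) (w *: _)); apply: submodD => //; last exact: submodZ.
  have e : w *: (u + a *: v r) - a *: (u' + w *: v r) = w *: u - a *: u'.
    by rewrite !scalerDr !scalerA mulrC opprD addrACA subrr addr0.
  apply: (hl1 l _ hl); first by rewrite e; apply: (submodB hU'); apply: submodZ.
  apply: submodB; [exact: hE|exact: submodZ|apply: submodZ => //; exact: Ele he].
exists (maxn l1 l2) => l x hl /dec [a [u [hu ex]]] hx.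
apply: hl1 => //; first by rewrite (leq_trans _ hl) // leq_maxl.
  rewrite ex; apply: (submodD hU') => //; apply: Uv.
  apply: contrapT => na; apply: hl2; exists a, u; split=> //; rewrite -ex.
  by apply: Ele hx; rewrite leq_maxr.
by apply: Ele hx; rewrite leq_maxl.
Qed.
End Krull.

Section RingKrull.
Variable R : comNzRingType.
Implicit Types (I J : R -> Prop).

Definition ipow (r : nat) (y : nat -> R) (L : nat) : R -> Prop := ipowm (V := R^o) r y L full.

Lemma ideal_full : ideal (@full R). Proof. exact: submod_full. Qed.
Lemma ideal_ipow r y L : ideal (ipow r y L).
Proof. by apply: submod_ipowm; apply: submod_full. Qed.
Lemma ipow1 r y x : ipow r y 1 x <-> span r y x.
Proof.
split=> [[u [_ ->]]|[u ->]]; exists u; first by apply: eq_bigr => i _; exact: mulrC.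
by split=> //; apply: eq_bigr => i _; exact: mulrC.
Qed.
Lemma ipowS_E r (y : nat -> R) L (x : R) : ipow r y L.+1 x <->
  exists u : nat -> R, (forall i, (i < r)%N -> ipow r y L (u i)) /\ x = \sum_(i < r) y i * u i.
Proof. by []. Qed.
Lemma ipow_le r y K L : (K <= L)%N -> sub (ipow r y L) (ipow r y K).
Proof. by move=> h; apply: (ipowm_le (V := R^o)) => //; exact: submod_full. Qed.
Lemma ipow_sub r y L (H : R -> Prop) : ideal H ->
  (forall i x, (i < r)%N -> ipow r y L x -> H (y i * x)) -> sub (ipow r y L.+1) H.
Proof. exact: ipowm_sub. Qed.
Lemma ipow_mulvar r y L i x : (i < r)%N -> ipow r y L x -> ipow r y L.+1 (y i * x).
Proof. by apply: (ipowm_mul (V := R^o)); exact: submod_full. Qed.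
Lemma ipowM r y K L a b : ipow r y K a -> ipow r y L b -> ipow r y (K + L) (a * b).
Proof.
elim: K a => [|K IH] a; first by move=> _ hb; apply: idealM => //; apply: ideal_ipow.
move=> [u [hu ->]] hb; rewrite mulr_suml; apply: (submod_sum (ideal_ipow _ _ _)) => i _.
by rewrite -mulrA addSn; apply: ipow_mulvar => //; apply: IH => //; apply: hu.
Qed.
Lemma ipowD r y K L (H : R -> Prop) : ideal H ->
  (forall a b, ipow r y K a -> ipow r y L b -> H (a * b)) -> sub (ipow r y (K + L)) H.
Proof.
elim: K H => [|K IH] H hH h.
  by move=> x hx; rewrite -[x]mul1r; apply: h.
rewrite addSn; apply: ipow_sub => // i x ir.
apply: (IH (colon H (y i)) (ideal_colon _ hH)) => a b ha hb; rewrite /colon mulrA.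
by apply: h => //; apply: ipow_mulvar.
Qed.
Lemma ipow_mono r y r' y' L : (forall i, (i < r)%N -> span r' y' (y i)) ->
  sub (ipow r y L) (ipow r' y' L).
Proof.
move=> h; elim: L => [//|L IH]; apply: ipow_sub; first exact: ideal_ipow.
move=> i x ir /IH hx; rewrite -add1n; apply: ipowM hx.
by apply/ipow1; apply: h.
Qed.

Lemma ring_krull r (y : nat -> R) I v : noethR R -> ideal I ->
  exists N, forall w (u : nat -> R), I (w * v - \sum_(i < r) y i ^+ N * u i) ->
    exists2 j, span r y j & I ((w - j) * v).
Proof.
move=> nR hI.
have [N hN] := @krull R R^o full I r y v (noethR_ideal nR hI) (@submod_full R R^o) hI (fun _ _ => Logic.I) Logic.I.
by exists N => w u /(hN w u (fun _ _ => Logic.I)) [c hc]; exists (\sum_(i < r) c i * y i); [exists c|].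
Qed.

Lemma ring_closed r (y : nat -> R) I v : jac r y -> noethR R -> ideal I ->
  (forall L, exists2 a, I a & ipow r y L (v - a)) -> I v.
Proof.
move=> hj nR hI h.
apply: (@krull_closed R R^o full I r y v hj (noethR_ideal nR hI) (@submod_full R R^o) hI) => // L.
by have [a ha hv] := h L; exists a, (v - a); split=> //; rewrite addrC subrK.
Qed.
End RingKrull.

(** * Krull's principal ideal theorem and systems of parameters *)

Section Dimension.
Variable R : comNzRingType.
Hypothesis nR : noethR R.
Implicit Types (I J K M P Q : R -> Prop).

(** The contraction of the extension of [K] to the localisation at [P]; it stands in for the
    localised ring. *)
Definition sat P K : R -> Prop := fun a => exists2 w, ~ P w & K (w * a).
Lemma ideal_sat P K : prime P -> ideal K -> ideal (sat P K).
Proof.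
move=> [_ P1 PM] hK; apply/idealP; split.
- by exists 1; rewrite ?mulr0 //; apply: submod0 hK.
- move=> x y [w nw hw] [w' nw' hw']; exists (w * w'); first by case/PM.
  have -> : w * w' * (x + y) = w' * (w * x) + w * (w' * y) by ring.
  by apply: (submodD hK); apply: idealM.
- by move=> a x [w nw hw]; exists w => //; rewrite mulrCA; apply: idealM.
Qed.
Lemma sat_sat P K w a : prime P -> ~ P w -> sat P K (w * a) -> sat P K a.
Proof. by move=> [_ _ PM] nw [w' nw' h]; exists (w' * w); [case/PM|rewrite -mulrA]. Qed.
Lemma sat_sub P K : prime P -> sub K (sat P K).
Proof. by move=> [_ P1 _] x hx; exists 1; rewrite ?mul1r. Qed.
Lemma sat_mono P K K' : sub K K' -> sub (sat P K) (sat P K').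
Proof. by move=> h x [w nw hw]; exists w => //; apply: h. Qed.

(* Krull's principal ideal theorem, localised at [P'']. *)
Lemma principal_ideal P P' P'' x : prime P -> prime P' -> prime P'' ->
  sub P P' -> ~ sub P' P -> sub P' P'' -> P'' x -> ~ P' x ->
  exists Q, [/\ prime Q, sub P Q, sub Q P'', Q x & ~ sub P'' Q].
Proof.
move=> pP pP' pP'' PP' nP'P P'P'' hx nx; apply: contrapT => hn.
have min Q : prime Q -> sub P Q -> sub Q P'' -> Q x -> sub P'' Q.
  by move=> *; apply: contrapT => ?; apply: hn; exists Q.
have [hP P1 PM] := pP; have [hP' P'1 P'M] := pP'; have [hP'' P''1 P''M] := pP''.
have [b [b' nb]] : exists b, P' b /\ ~ P b.
  by apply: contrapT => h; apply: nP'P => b hb; apply: contrapT => nb; apply: h; exists b.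
(* By contradiction [P''] is minimal over [P + (x)]. Hence [G] contains a power of [P''], which
   makes the quotient by [G] artinian at [P'']. *)
pose G := sat P'' (addg P x).
have hG : ideal G by apply: ideal_sat => //; apply: ideal_addg.
have nilG z : P'' z -> exists k, G (z ^+ k).
  move=> hz; apply: contrapT => nk.
  have [||y|Q [pQ IQ dis]] := @prime_avoid R (fun y => exists w k, ~ P'' w /\ y = w * z ^+ k)
      (addg P x) nR (ideal_addg _ hP).
  - by exists 1, 0%N; rewrite expr0 mulr1.
  - move=> _ _ [w [k [hw ->]]] [w' [k' [hw' ->]]]; exists (w * w'), (k + k')%N.
    by rewrite exprD mulrACA; split=> //; case/P''M.
  - by move=> [w [k [hw ->]]] hy; apply: nk; exists k, w.
  apply: (dis z); first by exists 1, 1%N; rewrite mul1r.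
  apply: min hz => //.
  - by move=> y hy; apply: IQ; apply: addgl.
  - move=> y hy; apply: contrapT => ny; apply: (dis y) => //.
    by exists y, 0%N; rewrite mulr1.
  - by apply: IQ; apply: addgr.
have [r [v hv]] := noethR_fg nR hP''.
have [L hL] : exists L, sub (ipow r v L) G.
  apply: (@ipowm_pigeon R R^o r v full G (@submod_full R R^o) hG) => i ir.
  have [k hk] := nilG (v i) ((hv _).2 (span_mem v ir)); exists k => z _.
  exact: idealMr.
(* In place of the symbolic powers of [P']: powers of a single element [b] of [P'] outside [P],
   together with [P], localised at [P']. *)
pose c l := sat P' (addg P (b ^+ l)).
have hc l : ideal (c l) by apply: ideal_sat => //; apply: ideal_addg.
have cS l : sub (c l.+1) (c l).
  apply: sat_mono => z [s hs]; exists (s * b); by rewrite -mulrA -exprS.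
pose E l := sat P'' (addg (c l) x).
have hE l : ideal (E l) by apply: ideal_sat => //; apply: ideal_addg.
have ES l : sub (E l.+1) (E l).
  by apply: sat_mono => z [s hs]; exists s; apply: cS.
have Esat l w a : ~ P'' w -> E l (w * a) -> E l a by apply: sat_sat.
have GE l : sub G (E l).
  apply: sat_mono => z [s hs]; exists s.
  by apply: sat_sub => //; exists 0; rewrite mul0r subr0.
(* The layers between [G] and [R] are given by powers of [P''], each killed by [P''] modulo the one
   below; [saturated_dcc] treats one layer at a time. *)
have stab i : (i <= L)%N -> exists l0, forall l a, (l0 <= l)%N -> addm (V := R^o) G (ipow r v (L - i)) a -> E l0 a -> E l a.
  elim: i => [|i IH] iL.
    exists 0%N => l a _ ha _; apply: GE; move: ha; rewrite subn0 => -[u [w [hu /hL hw ->]]].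
    exact: (submodD hG).
  have [l0 hl0] := IH (ltnW iL).
  have [g [h hgh]] := noethR_fg nR (ideal_ipow r v (L - i.+1)).
  have hU : submod (V := R^o) (addm (V := R^o) G (ipow r v (L - i))).
    by apply: submod_addm => //; apply: ideal_ipow.
  have [||l1 hl1] := @saturated_dcc R R^o P'' E (addm (V := R^o) G (ipow r v (L - i))) h g pP'' hE ES Esat hU.
  - move=> j a jg /hv ha; apply: (addmr (V := R^o) hG).
    have -> : (L - i = 1 + (L - i.+1))%N by rewrite add1n subnSK.
    by apply: ipowM; [apply/ipow1|apply/hgh; apply: span_mem].
  - by exists l0.
  exists l1 => l a hl [u [w [hu /hgh hw ->]]] he; apply: hl1 => //.
  by exists u, w; split=> //; apply: addml hu; apply: ideal_ipow.
have [l hl] := stab L (leqnn _).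
have cE : sub (c l) (E l.+1).
  move=> z hz; apply: (hl l.+1 z (leqnSn l)).
    rewrite subnn; apply: (addmr (V := R^o) hG); exact: Logic.I.
  by apply: sat_sub => //; apply: addgl.
(* Stability puts [c l] inside [c l.+1 + (x)] locally at [P'']; the coefficient of [x] is again in
   [c l], because [x] is outside [P'] and [c l] is saturated at [P']. *)
have step z : c l z -> exists w u, [/\ ~ P'' w, c l u & c l.+1 (w * z - x * u)].
  move=> hz; have [w nw [s hs]] := cE z hz; exists w, s; split=> //; last by rewrite [x * s]mulrC.
  apply: (@sat_sat P' (addg P (b ^+ l)) x s pP' nx).
  have : c l (w * z - (w * z - s * x)) by apply: (submodB (hc l)); [apply: idealM|apply: cS].
  by rewrite subKr mulrC.
have bl : c l (b ^+ l) by apply: sat_sub => //; apply: addgr.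
have stepN N : exists w u, [/\ ~ P'' w, c l u & c l.+1 (w * b ^+ l - x ^+ N * u)].
  elim: N => [|N [w [u [nw hu h]]]].
    by exists 1, (b ^+ l); rewrite expr0 mul1r subrr; split=> //; apply: submod0 (hc _).
  have [w' [u' [nw' hu' h']]] := step u hu; exists (w' * w), u'; split=> //; first by case/P''M.
  have -> : w' * w * b ^+ l - x ^+ N.+1 * u' =
     w' * (w * b ^+ l - x ^+ N * u) + x ^+ N * (w' * u - x * u') by rewrite exprS; ring.
  by apply: (submodD (hc _)); apply: idealM.
have nc : noeth (V := R^o) (c l) (c l.+1) by apply: (noeth_sub nR (hc _)) => // z ->; exact: submod0 (hc _).
(* Up to factors outside [P''], [b^l] lies in [c l.+1 + x^N c l] for every [N]. Krull's theorem then
   puts [(w - e x) b^l] in [c l.+1], and cancelling [b^l] modulo [P] forces [w] into [P'']. *)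
have [N hN] := @krull R R^o (c l) (c l.+1) 1 (fun=> x) (b ^+ l) nc (hc l) (hc _) (@cS l) bl.
have [w [u [nw hu hwu]]] := stepN N.
have [|e] := hN w (fun=> u) (fun _ _ => hu); first by rewrite big_ord1.
rewrite big_ord1 => -[w2 nw2 [r' hr']].
have : P (b ^+ l * (w2 * (w - e 0%N * x) - r' * b)).
  by rewrite (_ : _ * _ = w2 * ((w - e 0%N * x) *: (b ^+ l : R^o)) - r' * b ^+ l.+1) // exprS /GRing.scale /=; ring.
case/PM => [h|h]; first by apply: nb; apply: primeX h.
have h2 : P' (w2 * (w - e 0%N * x)).
  by rewrite -(subrK (r' * b) (w2 * _)); apply: (submodD hP'); [apply: PP'|apply: idealM].
case/P'M: h2 => // h2; apply: nw.
rewrite -(subrK (e 0%N * x) w); apply: (submodD hP''); [exact: P'P''|exact: idealM].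
Qed.

Definition chain n (P : nat -> R -> Prop) :=
  (forall i, (i <= n)%N -> prime (P i)) /\
  (forall i, (i < n)%N -> sub (P i) (P i.+1) /\ ~ sub (P i.+1) (P i)).

Lemma chain_le n (P : nat -> R -> Prop) i j : chain n P -> (i <= j <= n)%N -> sub (P i) (P j).
Proof.
move=> [_ h] /andP[]; elim: j => [|j IH]; first by rewrite leqn0 => /eqP -> _ x.
rewrite leq_eqVlt => /orP[/eqP-> _ x //|ij] jn x /(IH ij (ltnW jn)) hx.
by have [h1 _] := h j jn; apply: h1.
Qed.

Lemma chain_cut n (P : nat -> R -> Prop) x : chain n.+1 P -> P n.+1 x ->
  exists Q : nat -> R -> Prop, [/\ chain n.+1 Q, Q 0%N = P 0%N, Q n.+1 = P n.+1 & Q 1%N x].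
Proof.
elim: n P => [|n IH] P cP hx; first by exists P.
have [prP inP] := cP.
suff [Q0 [prQ h1 h2 h3 hQx]] : exists Q0, [/\ prime Q0, sub (P n) Q0 /\ ~ sub Q0 (P n),
    sub Q0 (P n.+2), ~ sub (P n.+2) Q0 & Q0 x].
  have [|//|Q [[prQ' inQ] e0 e1 hQ1]] := IH (fun i => if i == n.+1 then Q0 else P i); last 1 first.
  - exists (fun i => if i == n.+2 then P n.+2 else Q i); split=> //; last by rewrite eqxx.
    split.
      move=> i; rewrite leq_eqVlt; case: (i =P n.+2) => [-> _|_ /= hi]; first exact: prP.
      exact: prQ'.
    move=> i; rewrite ltnS leq_eqVlt => /orP[/eqP ->|hi].
      by rewrite (ltn_eqF (ltnSn _)) eqxx e1 eqxx.
    by rewrite !ltn_eqF ?(ltn_trans hi) //; apply: inQ.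
  - split; first by move=> i hi; case: eqP => // _; apply: prP; apply: leq_trans hi _.
    move=> i; rewrite ltnS eqSS leq_eqVlt => /orP[/eqP ->|hi].
      by rewrite eqxx (ltn_eqF (ltnSn _)).
    by rewrite !ltn_eqF // ?ltnS ?(ltnW hi) //; apply: inP; rewrite !ltnS ltnW // ltnW.
  - by rewrite eqxx.
have [h1 h2] := inP n.+1 (ltnSn _); have [h3 h4] := inP n (leqnSn _).
case: (EM (P n.+1 x)) => [hx'|nx].
  by exists (P n.+1); split=> //; apply: prP.
have [Q [pQ PQ QP Qx nPQ]] := principal_ideal (prP n (leqW (leqnSn _))) (prP n.+1 (leqnSn _))
   (prP n.+2 (leqnn _)) h3 h4 h1 hx nx.
exists Q; split=> //; split=> // h; apply: nx; apply: h3; exact: h.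
Qed.

Definition regmod K (r : nat) (y : nat -> R) := forall i a, (i < r)%N ->
  addm (V := R^o) K (span i y) (y i * a) -> addm (V := R^o) K (span i y) a.

Lemma span_recl r (y : nat -> R) (x : R) : span r.+1 y x <-> exists a b, span r (fun i => y i.+1) b /\ x = a * y 0%N + b.
Proof.
split.
  move=> [c ->]; exists (c 0%N), (\sum_(i < r) c i.+1 * y i.+1); split; last by rewrite big_ord_recl.
  by exists (fun i => c i.+1).
move=> [a [b [[c ->] ->]]]; exists (fun i => if i is j.+1 then c j else a).
by rewrite big_ord_recl.
Qed.

Lemma addm_recl K r (y : nat -> R) (x : R) : ideal K ->
  addm (V := R^o) K (span r.+1 y) x <-> addm (V := R^o) (addg K (y 0%N)) (span r (fun i => y i.+1)) x.
Proof.
move=> hK; split.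
  move=> [k [_ [hk /span_recl [a [b [hb ->]]] ->]]]; exists (k + a * y 0%N), b; rewrite addrA.
  by split=> //; exists a; rewrite addrK.
move=> [k [b [[a ha] hb ->]]]; exists (k - a * y 0%N), (a * y 0%N + b); split=> //.
  by apply/span_recl; exists a, b.
by rewrite addrA subrK.
Qed.

(** The chain is cut so that its second prime contains [y 0], and induction applies over
    [K + (y 0)]. If [n = r], that prime equals [K + (y 0)]; then [P 0 = K + y_0 P 0], so Nakayama
    gives [P 0 = K], and [y 0] is regular modulo this prime. *)
Lemma dimension_bound r (y : nat -> R) K n (P : nat -> R -> Prop) : ideal K -> chain n P -> sub K (P 0%N) ->
  (forall z, P n z -> exists s, s * (1 - z) = 1) ->
  (forall x, P n x <-> addm (V := R^o) K (span r y) x) ->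
  (n <= r)%N /\ (n = r -> sub (P 0%N) K /\ regmod K r y).
Proof.
elim: r y K n P => [|r IH] y K n P hK cP KP loc hM.
  case: n cP hM loc => [|n] cP hM loc.
    split=> // _; split=> // x /hM [k [_ [hk [c ->] ->]]]; rewrite big_ord0 addr0; exact: hk.
  have [_ /(_ n (leqnn _)) [_ []]] := cP => x /hM [k [_ [hk [c ->] ->]]].
  by rewrite big_ord0 addr0; apply: (chain_le cP (_ : 0 <= n <= n.+1)%N); [rewrite leqnSn|apply: KP].
case: n cP hM loc => [|n] cP hM loc; first by split.
have y0 : P n.+1 (y 0%N) by apply/hM; apply: (addmr (V := R^o) hK); exact: (span_mem y (ltn0Sn r)).
have [Q [cQ e0 e1 hQ]] := chain_cut cP y0.
have [prQ inQ] := cQ.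
have cQ' : chain n (fun i => Q i.+1) by split=> i hi; [apply: prQ|apply: inQ].
have [Q01 nQ01] := inQ 0%N (ltn0Sn n); rewrite e0 in Q01 nQ01.
have [hQ1 Q1n1 Q1M] := prQ 1%N (ltn0Sn n).
have hK' := ideal_addg (y 0%N) hK.
have K'Q : sub (addg K (y 0%N)) (Q 1%N).
  move=> x [a ha]; rewrite -(subrK (a * y 0%N) x); apply: (submodD hQ1); last exact: idealM.
  by apply: Q01; apply: KP.
have [||le eq] := IH (fun i => y i.+1) (addg K (y 0%N)) n (fun i => Q i.+1) hK' cQ' K'Q.
- by rewrite /= e1.
- by move=> x; rewrite /= e1 -addm_recl //; apply: hM.
split=> // -[en]; have [Q1K reg] := eq en.
have [hP P1 PM] := cP.1 0%N (leq0n _).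
have ny0 : ~ P 0%N (y 0%N).
  move=> h; apply: nQ01 => x /Q1K [a ha]; rewrite -(subrK (a * y 0%N) x).
  by apply: (submodD hP); [apply: KP|apply: idealM].
have PK : sub (P 0%N) K.
  apply: (@nakayama R R^o (P 0%N) K 1 (fun=> y 0%N)) => //.
  - move=> c; rewrite big_ord1; apply: loc; have [hPn _ _] := cP.1 n.+1 (leqnn _).
    exact: idealM.
  - by apply: (noeth_sub (noethR_ideal nR hK)).
  move=> x hx; have [a ha] := Q1K x (Q01 x hx).
  exists (x - a * y 0%N), (a * y 0%N); rewrite subrK; split=> //.
  exists (fun=> a); split; last by rewrite big_ord1; exact: mulrC.
  move=> i _ /=; suff : P 0%N (a * y 0%N) by case/PM.
  rewrite -[_ * _](subKr x); apply: (submodB hP) => //; exact: KP.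
split=> // -[|i] a ir.
  move=> [k [_ [hk [c ->] e]]]; rewrite big_ord0 addr0 in e.
  suff : P 0%N (y 0%N * a).
    by case/PM=> // /PK ha; exists a, 0; rewrite addr0; split=> //; exists (fun=> 0); rewrite big_ord0.
  by apply: KP; rewrite e.
by move=> /(addm_recl _ _ _ hK) h; apply/(addm_recl _ _ _ hK); apply: reg.
Qed.
End Dimension.

(** * Regular sequences, Koszul relations and quotient rings *)

Definition regseq (R : comNzRingType) (r : nat) (y : nat -> R) := forall i a, (i < r)%N ->
  span i y (y i * a) -> span i y a.

(** Vanishing of the first Koszul homology. The alternating matrix [s] is indexed by all naturals,
    so its symmetry needs no bounds. *)
Definition koszul (R : comNzRingType) (r : nat) (y : nat -> R) := forall c : nat -> R,
  \sum_(i < r) y i * c i = 0 -> exists s : nat -> nat -> R,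
    [/\ forall i, s i i = 0, forall i j, s j i = - s i j &
        forall i, (i < r)%N -> c i = \sum_(j < r) s i j * y j].

(** Regularity writes the last coefficient of a relation in terms of the earlier [y i]; subtracting
    the corresponding trivial relations leaves a shorter relation. *)
Lemma regseq_koszul (R : comNzRingType) (r : nat) (y : nat -> R) : regseq r y -> koszul r y.
Proof.
elim: r => [|r IH] reg c e.
  by exists (fun _ _ => 0); split=> // *; rewrite oppr0.
have [|f hf] := reg r (c r) (ltnSn r).
  exists (fun i => - c i); apply/eqP; rewrite -subr_eq0; apply/eqP.
  rewrite -[RHS]e big_ord_recr /= addrC -sumrN; congr (_ + _); apply: eq_bigr => i _.
  by rewrite scaleNr opprK; exact: mulrC.
have [|s [h1 h2 h3]] := IH (fun i a ir => reg i a (ltnW ir)) (fun i => c i + f i * y r).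
  rewrite -[RHS]e big_ord_recr /= hf mulr_sumr -big_split; apply: eq_bigr => i _ /=.
  by rewrite mulrDr; congr (_ + _); rewrite /GRing.scale /=; ring.
exists (fun i j => if i == r then (if j == r then 0 else if (j < r)%N then f j else 0)
        else if j == r then (if (i < r)%N then - f i else 0) else s i j).
split.
- by move=> i; case: eqP.
- move=> i j; case: (i =P r) => [_|ni]; case: (j =P r) => [_|nj] //; rewrite ?oppr0 //.
    by case: ifP; rewrite ?oppr0.
  by case: ifP; rewrite ?oppr0 ?opprK.
move=> i; rewrite ltnS leq_eqVlt => /orP[/eqP ->|ir].
  rewrite big_ord_recr /= eqxx mul0r addr0 hf; apply: eq_bigr => j _.
  by rewrite ltn_ord (ltn_eqF (ltn_ord j)).
rewrite big_ord_recr /= eqxx (ltn_eqF ir) ir mulNr; apply/eqP; rewrite eq_sym subr_eq; apply/eqP.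
rewrite h3 //; apply: eq_bigr => j _; by rewrite (ltn_eqF (ltn_ord j)).
Qed.

Lemma rmorphism_of (A B : comNzRingType) (f : A -> B) : f 1 = 1 ->
  (forall x y, f (x + y) = f x + f y) -> (forall x y, f (x * y) = f x * f y) ->
  exists g : {rmorphism A -> B}, g =1 f.
Proof.
move=> f1 fD fM.
have f0 : f 0 = 0 by apply: (addrI (f 0)); rewrite -fD !addr0.
pose m1 := GRing.isNmodMorphism.Build A B f (f0, fD).
pose m2 := GRing.isMonoidMorphism.Build A B f (f1, fM).
by exists (HB.pack_for (GRing.RMorphism.type A B) f m1 m2).
Qed.

Section Quotients.
Variables (A : comNzRingType) (I : A -> Prop).
Hypotheses (hI : ideal I) (I1 : ~ I 1).

Lemma quotient_idealr : exists J : idealr A, forall x, x \in J <-> I x.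
Proof.
pose P : {pred A} := fun x => `[< I x >].
have PE x : x \in P <-> I x by rewrite /P unfold_in; split=> [/asboolP|h] //; apply/asboolP.
have cl : idealr_closed P.
  split; first by apply/PE; apply: submod0 hI.
    by apply/negP => /PE.
  move=> a x y /PE hx /PE hy; apply/PE; exact: (proj2 hI).
by exists (HB.pack_for (idealr A) P (isIdealr.Build A P cl)).
Qed.

Lemma quotient_ring : exists (B : comNzRingType) (f : {rmorphism A -> B}),
  (forall b, exists a, f a = b) /\ (forall a, f a = 0 <-> I a).
Proof.
have [J hJ] := quotient_idealr.
exists {ideal_quot J}, (\pi_{ideal_quot J})%qT; split; first by move=> b; exists (repr b); exact: reprK.
move=> a; rewrite -hJ -[a in a \in J]subr0 Quotient.idealrBE; split=> [e|/eqP e].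
  by apply/eqP; apply: (etrans e); symmetry; exact: (rmorph0 (\pi_{ideal_quot J})%qT).
by apply: (etrans e); exact: (rmorph0 (\pi_{ideal_quot J})%qT).
Qed.
End Quotients.

Lemma residue_field (A : comNzRingType) (I : A -> Prop) : ideal I -> ~ I 1 ->
  (forall x, ~ I x -> exists y, I (1 - y * x)) ->
  exists (k : fieldType) (f : {rmorphism A -> k}),
  (forall b, exists a, f a = b) /\ (forall a, f a = 0 <-> I a).
Proof.
move=> hI I1 inv; have [B [f [sf kf]]] := quotient_ring hI I1.
have invB (b : B) : exists c, (b != 0 -> c * b = 1) /\ (b = 0 -> c = 0).
  case: (sf b) => a <-; case: (EM (I a)) => [/kf ->|na].
    by exists 0; split=> //; rewrite eqxx.
  have [y hy] := inv a na; exists (f y); split=> [_|/kf //].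
  by move/kf: hy; rewrite rmorphB rmorph1 rmorphM => /eqP; rewrite subr_eq0 => /eqP.
have [g hg] := choice invB.
pose m := GRing.ComNzRing_isField.Build B (fun x hx => (hg x).1 hx) ((hg 0).2 erefl).
pose k := HB.pack_for fieldType B m.
by exists k, f.
Qed.

(** * Power series and complete rings *)

Record ps (K : Type) := PS { pcoef : nat -> K }.
Lemma psP K (f g : ps K) : (forall i, pcoef f i = pcoef g i) -> f = g.
Proof. by case: f => f; case: g => g /= /funext ->. Qed.

HB.instance Definition _ (K : Type) := gen_eqMixin (ps K).
HB.instance Definition _ (K : Type) := gen_choiceMixin (ps K).

Section PowerSeries.
Variable K : comNzRingType.
Implicit Types f g h : ps K.

Definition ps_add f g := PS (fun i => pcoef f i + pcoef g i).
Definition ps_opp f := PS (fun i => - pcoef f i).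
Definition ps_zero : ps K := PS (fun=> 0).
Definition ps_mul f g := PS (fun i => \sum_(j < i.+1) pcoef f j * pcoef g (i - j)).
Definition psC (a : K) : ps K := PS (fun i => if i == 0%N then a else 0).
Definition trunc N f : {poly K} := \poly_(i < N) pcoef f i.

Lemma ps_addA : associative ps_add. Proof. by move=> f g h; apply: psP => i /=; rewrite addrA. Qed.
Lemma ps_addC : commutative ps_add. Proof. by move=> f g; apply: psP => i /=; rewrite addrC. Qed.
Lemma ps_add0 : left_id ps_zero ps_add. Proof. by move=> f; apply: psP => i /=; rewrite add0r. Qed.
Lemma ps_addN : left_inverse ps_zero ps_opp ps_add. Proof. by move=> f; apply: psP => i /=; rewrite addNr. Qed.
HB.instance Definition _ := GRing.isZmodule.Build (ps K) ps_addA ps_addC ps_add0 ps_addN.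

Lemma trunc_coef N f i : (i < N)%N -> (trunc N f)`_i = pcoef f i.
Proof. by move=> h; rewrite coef_poly h. Qed.
(** A coefficient of a product depends only on truncations, so the ring axioms are inherited from
    polynomials. *)
Lemma ps_mulE N f g i : (i < N)%N -> pcoef (ps_mul f g) i = (trunc N f * trunc N g)`_i.
Proof.
move=> h; rewrite coefM /=; apply: eq_bigr => j _.
by rewrite !trunc_coef // (leq_ltn_trans _ h) ?leq_subr // -ltnS.
Qed.
Lemma coefM_eq (p q p' q' : {poly K}) i : (forall j, (j <= i)%N -> p`_j = p'`_j) ->
  (forall j, (j <= i)%N -> q`_j = q'`_j) -> (p * q)`_i = (p' * q')`_i.
Proof.
move=> h1 h2; rewrite !coefM; apply: eq_bigr => j _.
by rewrite h1 1?h2 ?leq_subr // -ltnS.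
Qed.
Lemma ps_mulA : associative ps_mul.
Proof.
move=> f g h; apply: psP => i; rewrite !(ps_mulE (N := i.+1)) //.
rewrite (@coefM_eq _ _ (trunc i.+1 f) (trunc i.+1 g * trunc i.+1 h)) //; last first.
  by move=> j ji; rewrite trunc_coef // (ps_mulE (N := i.+1)).
rewrite mulrA; apply: coefM_eq => // j ji.
by rewrite trunc_coef // (ps_mulE (N := i.+1)).
Qed.
Lemma ps_mulC : commutative ps_mul.
Proof. by move=> f g; apply: psP => i; rewrite !(ps_mulE (N := i.+1)) // mulrC. Qed.
Lemma pcoefCM a f i : pcoef (ps_mul (psC a) f) i = a * pcoef f i.
Proof. by rewrite /= big_ord_recl /= subn0 big1 ?addr0 // => j _; rewrite mul0r. Qed.
Lemma ps_mul1 : left_id (psC 1) ps_mul.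
Proof. by move=> f; apply: psP => i; rewrite pcoefCM mul1r. Qed.
Lemma ps_mulDl : left_distributive ps_mul ps_add.
Proof.
move=> f g h; apply: psP => i /=; rewrite -big_split; apply: eq_bigr => j _ /=; exact: mulrDl.
Qed.
Lemma ps_one_neq0 : psC 1 != ps_zero.
Proof. by apply/eqP => /(congr1 (fun f => pcoef f 0)) /=; apply/eqP; apply: oner_neq0. Qed.
HB.instance Definition _ := GRing.Zmodule_isComNzRing.Build (ps K)
  ps_mulA ps_mulC ps_mul1 ps_mulDl ps_one_neq0.

#[local] Arguments ps_mul : simpl never.
Lemma pcoefD f g i : pcoef (f + g) i = pcoef f i + pcoef g i. Proof. by []. Qed.
Lemma pcoefN f i : pcoef (- f) i = - pcoef f i. Proof. by []. Qed.
Lemma pcoefB f g i : pcoef (f - g) i = pcoef f i - pcoef g i. Proof. by []. Qed.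
Lemma pcoef0 i : pcoef (0 : ps K) i = 0. Proof. by []. Qed.
Lemma pcoef1 i : pcoef (1 : ps K) i = (i == 0%N)%:R. Proof. by rewrite /=; case: eqP. Qed.
Lemma pcoefM f g i : pcoef (f * g) i = \sum_(j < i.+1) pcoef f j * pcoef g (i - j).
Proof. by []. Qed.
Lemma pcoefM0 f g : pcoef (f * g) 0 = pcoef f 0 * pcoef g 0.
Proof. by rewrite pcoefM big_ord_recl big_ord0 addr0. Qed.
Lemma pcoef_sum (J : Type) (r : seq J) (P : pred J) (F : J -> ps K) i :
  pcoef (\sum_(j <- r | P j) F j) i = \sum_(j <- r | P j) pcoef (F j) i.
Proof. by apply: (big_morph (fun f => pcoef f i)) => // f g; rewrite pcoefD. Qed.
Lemma pcoefC a f i : pcoef (psC a * f) i = a * pcoef f i. Proof. exact: pcoefCM. Qed.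

Lemma pcoefMC a f i : pcoef (f * psC a) i = pcoef f i * a. Proof. by rewrite mulrC pcoefC mulrC. Qed.

Fact psC_nmod : nmod_morphism psC.
Proof. by split=> [|a b]; apply: psP => -[|i] //=; rewrite addr0. Qed.
Fact psC_monoid : monoid_morphism psC.
Proof. by split=> // a b; apply: psP => -[|i]; rewrite pcoefC //= mulr0. Qed.
HB.instance Definition _ := GRing.isNmodMorphism.Build K (ps K) psC psC_nmod.
HB.instance Definition _ := GRing.isMonoidMorphism.Build K (ps K) psC psC_monoid.

Definition psX : ps K := PS (fun i => (i == 1%N)%:R).
Lemma pcoefX f i : pcoef (psX * f) i = if i is j.+1 then pcoef f j else 0.
Proof.
case: i => [|i]; first by rewrite pcoefM0 mul0r.
rewrite pcoefM (bigD1 (inord 1)) //= inordK // subn1 /= mul1r big1 ?addr0 // => j.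
by rewrite -val_eqE /= inordK // => /negbTE ->; rewrite mul0r.
Qed.
Lemma pcoefXn n f i : pcoef (psX ^+ n * f) i = if (i < n)%N then 0 else pcoef f (i - n).
Proof.
elim: n i => [|n IH] i; first by rewrite mul1r subn0.
by rewrite exprS -mulrA pcoefX; case: i => [|i] //; rewrite ltnS IH subSS.
Qed.
Definition pshift n f := PS (fun i => pcoef f (n + i)).
Lemma pcoefCXn n a i : pcoef (psC a * psX ^+ n) i = if i == n then a else 0.
Proof.
rewrite mulrC pcoefXn; case: ltngtP => [//|h|->] /=; last by rewrite subnn.
by rewrite subn_eq0 leqNgt h.
Qed.
Lemma ps_decomp n f : f = \sum_(i < n) psC (pcoef f i) * psX ^+ i + psX ^+ n * pshift n f.
Proof.
apply: psP => i; rewrite pcoefD pcoef_sum pcoefXn.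
under eq_bigr => j _ do rewrite pcoefCXn.
case: ltnP => h.
  rewrite addr0 (bigD1 (Ordinal h)) //= eqxx big1 ?addr0 // => j.
  by rewrite -val_eqE /= eq_sym => /negbTE ->.
rewrite big1 ?add0r /= ?subnKC // => j _.
by rewrite gtn_eqF // (leq_trans (ltn_ord j) h).
Qed.
Lemma ps_decomp1 f : f = psC (pcoef f 0) + psX * pshift 1 f.
Proof. by rewrite {1}(ps_decomp 1 f) big_ord1 expr0 mulr1 expr1. Qed.
End PowerSeries.
Arguments pcoef : simpl never.
Lemma pcoefE K (F : nat -> K) i : pcoef (PS F) i = F i. Proof. by []. Qed.

Section Images.
Variables (A B : comNzRingType) (f : {rmorphism A -> B}).

Lemma span_image r (y : nat -> A) (x : A) : span r y x -> span r (f \o y) (f x).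
Proof.
move=> [c ->]; exists (f \o c); rewrite rmorph_sum; apply: eq_bigr => i _; exact: rmorphM.
Qed.
Lemma ipow_image r (y : nat -> A) L (x : A) : ipow r y L x -> ipow r (f \o y) L (f x).
Proof.
elim: L x => [|L IH] x //; move=> /ipowS_E [u [hu ->]].
exists (f \o u); split; first by move=> i ir; apply: IH; apply: hu.
rewrite rmorph_sum; apply: eq_bigr => i _; exact: rmorphM.
Qed.
Lemma ipow_lift r (y : nat -> A) L (x : B) : (forall b, exists a, f a = b) -> ipow r (f \o y) L x ->
  exists2 a, ipow r y L a & f a = x.
Proof.
move=> sf; elim: L x => [|L IH] x; first by move=> _; case: (sf x) => a <-; exists a.
move=> /ipowS_E [u [hu ->]].
have /choice [v hv] : forall i, exists a, (i < r)%N -> ipow r y L a /\ f a = u i.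
  move=> i; case: (ltnP i r) => [ir|_]; last by exists 0.
  by have [a h1 h2] := IH _ (hu i ir); exists a.
exists (\sum_(i < r) y i * v i).
  by apply: ideal_sum => [|i _]; [exact: ideal_ipow|apply: ipow_mulvar => //; apply: (hv i _).1].
by rewrite rmorph_sum; apply: eq_bigr => i _; rewrite rmorphM (hv i _).2.
Qed.
Lemma ideal_preim (J : B -> Prop) : ideal J -> ideal (fun x => J (f x)).
Proof.
move=> hJ; apply/idealP; split.
- by rewrite rmorph0; exact: ideal0.
- by move=> x y hx hy; rewrite rmorphD; apply: (idealD hJ).
- by move=> a x hx; rewrite rmorphM; apply: idealM.
Qed.
Lemma noeth_image : (forall b, exists a, f a = b) -> noethR A -> noethR B.
Proof.
move=> sf nA U hU U0 _; have [r [v hv]] := noethR_fg nA (ideal_preim hU).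
exists r, (f \o v); split; first by move=> i ir; apply/hv; apply: span_mem.
move=> b; case: (sf b) => a <- /hv /span_image [c e]; exists c; by rewrite e subrr.
Qed.
Lemma jac_image r (y : nat -> A) : (forall b, exists a, f a = b) -> jac r y -> jac r (f \o y).
Proof.
move=> sf hj c; have /choice [d hd] := fun i => sf (c i).
have [s hs] := hj d; exists (f s); rewrite -[RHS](rmorph1 f) -hs rmorphM rmorphB rmorph1 rmorph_sum.
by congr (_ * (_ - _)); apply: eq_bigr => i _; rewrite rmorphM hd.
Qed.
End Images.

Section Completeness.
Variables (T : comNzRingType).
Implicit Types (r L : nat) (y : nat -> T).

(** Completeness as summability: a series whose [i]-th term lies in [(y)^i] has a sum. Uniqueness of
    the sum is left to [separated]. *)
Definition complete r y := forall a : nat -> T, (forall i, ipow r y i (a i)) ->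
  exists s, forall L, ipow r y L (s - \sum_(i < L) a i).
Definition separated r y := forall x : T, (forall L, ipow r y L x) -> x = 0.

(** The geometric series inverts [1 - x]. *)
Lemma complete_jac r y : complete r y -> separated r y -> jac r y.
Proof.
move=> hc hs c; set x := \sum_(i < r) _.
have hx i : ipow r y i (x ^+ i).
  by elim: i => // i IH; rewrite exprS -add1n; apply: ipowM IH; apply/ipow1; exists c.
have [s h] := hc _ hx; exists s; apply/eqP; rewrite -subr_eq0; apply/eqP; apply: hs => L.
have -> : s * (1 - x) - 1 = (s - \sum_(i < L) x ^+ i) * (1 - x) - x ^+ L.
  have e' : \sum_(i < L) x ^+ i * (1 - x) = 1 - x ^+ L.
    by rewrite -mulr_suml mulrC -[1 - x]opprB mulNr -subrX1 opprB.
  by rewrite mulrBl mulr_suml e' opprB addrA -addrA; ring.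
by apply: (idealB (ideal_ipow _ _ _)) => //; apply: idealMr => //; apply: ideal_ipow.
Qed.

Lemma noeth_separated r y : noethR T -> jac r y -> separated r y.
Proof.
move=> nT hj x h; apply: (ring_closed (I := fun x => x = 0) hj nT); first exact: submod_zero.
by move=> L; exists 0; rewrite ?subr0.
Qed.
Lemma noeth_closed r y (J : T -> Prop) x : noethR T -> jac r y -> ideal J ->
  (forall L, exists2 a, J a & ipow r y L (x - a)) -> J x.
Proof. by move=> nT hj hJ h; apply: (ring_closed hj nT hJ). Qed.

Lemma complete0 y : complete 0 y.
Proof.
move=> a ha; exists (a 0%N) => -[|L]; first exact: Logic.I.
rewrite big_ord_recl opprD addrA subrr add0r; apply: (idealN (ideal_ipow _ _ _)).
apply: ideal_sum => [|i _]; first exact: (ideal_ipow _ _ _).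
   case: (ha (lift ord0 i)) => u [_ ->].
by rewrite big_ord0; exact: ideal0 (ideal_ipow _ _ _).
Qed.
Lemma separated0 y : separated 0 y.
Proof. by move=> x /(_ 1%N) /ipow1 [c ->]; rewrite big_ord0. Qed.
End Completeness.

Lemma complete_image (A B : comNzRingType) (f : {rmorphism A -> B}) r (y : nat -> A) :
  (forall b, exists a, f a = b) -> complete r y -> complete r (f \o y).
Proof.
move=> sf hc a ha.
have /choice [b hb] : forall i, exists b, ipow r y i b /\ f b = a i.
  by move=> i; have [b ? ?] := ipow_lift sf (ha i); exists b.
have [s hs] := hc b (fun i => (hb i).1); exists (f s) => L.
have := ipow_image f (hs L); rewrite rmorphB rmorph_sum.
by rewrite (eq_bigr (fun i : 'I_L => a i)) // => i _; apply: (hb i).2.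
Qed.

Section PSComplete.
Variable K : comNzRingType.
Implicit Types (r L : nat) (y : nat -> K) (f : ps K).

Definition scons y : nat -> ps K := fun i => if i is j.+1 then psC (y j) else psX K.

(** This coefficientwise description of the powers of [(X, y)] reduces completeness and
    separatedness of power series to those of [K]. *)
Lemma ps_ipow r y L f : ipow r.+1 (scons y) L f <-> forall j, (j < L)%N -> ipow r y (L - j) (pcoef f j).
Proof.
split; last first.
  move=> h; rewrite (ps_decomp L f).
  have hX n : ipow r.+1 (scons y) n (psX K ^+ n).
    elim: n => [//|n IH]; rewrite exprS; exact: (ipow_mulvar (i := 0) (y := scons y)).
  apply: (idealD (ideal_ipow _ _ _)); last by apply: idealMr => //; apply: ideal_ipow.
  apply: ideal_sum => [|i _]; first exact: (ideal_ipow _ _ _). 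
  rewrite -[X in ipow _ _ X](subnK (ltnW (ltn_ord i))); apply: ipowM => //.
  apply: (ipow_mono (y := psC (K:=K) \o y)); last by apply: ipow_image; apply: h.
  by move=> j jr; apply: (span_mem (scons y) (i := j.+1)).
elim: L f => [//|L IH].
pose H f := forall j, (j < L.+1)%N -> ipow r y (L.+1 - j) (pcoef f j).
have hH : ideal H.
  apply/idealP; split.
  - by move=> j _; exact: ideal0 (ideal_ipow _ _ _).
  - by move=> f g hf hg j jL; apply: (idealD (ideal_ipow _ _ _)); [apply: hf|apply: hg].
  move=> g f hf j jL; rewrite pcoefM; apply: ideal_sum => [|i _]; first exact: (ideal_ipow _ _ _). 
  apply: idealM; first exact: ideal_ipow.
  apply: ipow_le (hf _ _); first by rewrite leq_sub2l // leq_subr.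
  by rewrite (leq_ltn_trans _ jL) // leq_subr.
apply: (ipow_sub hH) => i f ir /IH hf j jL.
case: i ir => [|i] ir; rewrite /scons.
  rewrite pcoefX; case: j jL => [|j] jL; first exact: ideal0 (ideal_ipow _ _ _).
  by rewrite subSS; apply: hf.
rewrite pcoefC; case: (ltnP j L) => h; first by rewrite subSn 1?ltnW //; apply: ipow_mulvar => //; apply: hf.
have -> : (L.+1 - j = 1)%N by apply/eqP; rewrite subSn // eqSS subn_eq0.
by apply/ipow1; rewrite mulrC; apply: (idealM _ (ideal_span _ _)); apply: span_mem.
Qed.

Lemma ps_complete r y : complete r y -> complete r.+1 (scons y).
Proof.
move=> hc a ha.
have /choice [s hs] : forall j, exists s, forall L, ipow r y L (s - \sum_(i < j + L) pcoef (a i) j).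
  move=> j; have [|s hs] := hc (fun i => pcoef (a (j + i)%N) j).
    move=> [//|i]; have /ps_ipow /(_ j) := ha (j + i.+1)%N; rewrite addKn; apply.
    by rewrite -addSnnS leq_addr.
  exists (\sum_(i < j) pcoef (a i) j + s) => L.
  by rewrite big_split_ord /= opprD addrACA subrr add0r.
exists (PS s) => L; apply/ps_ipow => j jL.
rewrite pcoefB pcoef_sum pcoefE; have := hs j (L - j)%N; by rewrite subnKC 1?ltnW.
Qed.

Lemma ps_separated r y : separated r y -> separated r.+1 (scons y).
Proof.
move=> hs f h; apply: psP => j; rewrite pcoef0; apply: hs => L.
case: L => [//|L].
by have /ps_ipow /(_ j) := h (L.+1 + j)%N; rewrite addnK; apply; rewrite addSn ltnS leq_addl.
Qed.

(** Hilbert's basis theorem with lowest instead of leading coefficients: [W l] is [(U : X^l)], and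
    [lc l], its ideal of constant terms, is stationary from some [N] on. *)
Lemma ps_noeth : noethR K -> noethR (ps K).
Proof.
move=> nK U hU _ _.
have hU' : ideal U by [].
pose W l f := U (psX K ^+ l * f).
have hW l : ideal (W l) by apply: ideal_colon.
have WS l f : W l (psX K * f) <-> W l.+1 f by rewrite /W mulrA -exprSr.
have Wle k l f : (k <= l)%N -> W k f -> W l f.
  by move=> kl h; rewrite /W -(subnK kl) exprD -mulrA; apply: idealM.
pose lc l a := exists2 f, W l f & pcoef f 0 = a.
have hlc l : ideal (lc l).
  apply/idealP; split.
  - by exists 0 => //; exact: ideal0 (hW l).
  - by move=> _ _ [f hf <-] [g hg <-]; exists (f + g) => //; apply: (idealD (hW l)).
  - by move=> a _ [f hf <-]; exists (psC a * f); rewrite ?pcoefC //; apply: idealM.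
have lcle k l : (k <= l)%N -> sub (lc k) (lc l).
  by move=> kl _ [f hf <-]; exists f => //; apply: Wle hf.
have fglc l : exists r (g : nat -> ps K), (forall i, (i < r)%N -> W l (g i)) /\
    (forall f, W l f -> exists c : nat -> K, W l.+1 (pshift 1 (f - \sum_(i < r) psC (c i) * g i)) /\
       pcoef (f - \sum_(i < r) psC (c i) * g i) 0 = 0).
  have [r [v hv]] := noethR_fg nK (hlc l).
  have /choice [g hg] : forall i, exists g, (i < r)%N -> W l g /\ pcoef g 0 = v i.
    move=> i; case: (ltnP i r) => [ir|_]; last by exists 0.
    by have [g h1 h2] := (hv (v i)).2 (span_mem v ir); exists g.
  exists r, g; split; first by move=> i ir; apply: (hg i ir).1.
  move=> f hf; have /hv [c hc] : lc l (pcoef f 0) by exists f.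
  exists c; set h := f - _.
  have h0 : pcoef h 0 = 0.
    rewrite pcoefB pcoef_sum hc; apply/eqP; rewrite subr_eq0; apply/eqP; apply: eq_bigr => i _.
    by rewrite pcoefC (hg i _).2.
  split=> //; apply/WS; rewrite (_ : psX K * _ = h).
    apply: (idealB (hW l)) => //; apply: ideal_sum => [|i _]; first exact: (hW l). 
    by apply: (idealM _ (hW l)); apply: (hg i _).1.
  by rewrite [RHS](ps_decomp1 h) h0 rmorph0 add0r.
have [N hN] : exists N, forall l, (N <= l)%N -> sub (lc l) (lc N).
  pose Z a := exists l, lc l a.
  have hZ : ideal Z.
    apply/idealP; split.
    - by exists 0%N; exact: ideal0 (hlc _).
    - move=> x y [k hk] [l hl]; exists (maxn k l); apply: (idealD (hlc _)).
        by apply: lcle hk; rewrite leq_maxl.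
      by apply: lcle hl; rewrite leq_maxr.
    - by move=> a x [l hl]; exists l; apply: idealM.
  have [r [v hv]] := noethR_fg nK hZ.
  have [N hN] : exists N, forall i, (i < r)%N -> lc N (v i).
    have : forall i, (i < r)%N -> Z (v i) by move=> i ir; apply/hv; apply: span_mem.
    elim: r {hv} => [|r IH] h; first by exists 0%N.
    have [N hN] := IH (fun i ir => h i (ltnW ir)); have [M hM] := h r (ltnSn r).
    exists (maxn N M) => i; rewrite ltnS leq_eqVlt => /orP[/eqP->|ir].
      by apply: lcle hM; rewrite leq_maxr.
    by apply: lcle (hN _ ir); rewrite leq_maxl.
  by exists N => l _ a ha; apply: (span_sub (hlc N) hN); apply/hv; exists l.
have [r [g [gW gen]]] := fglc N.
have genN l : (N <= l)%N -> forall f, W l f -> exists c : nat -> K,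
    W l.+1 (pshift 1 (f - \sum_(i < r) psC (c i) * g i)) /\ pcoef (f - \sum_(i < r) psC (c i) * g i) 0 = 0.
  move=> Nl f hf; have [f' hf' e] := hN l Nl _ (ex_intro2 _ _ f hf erefl).
  have [c [_ h0]] := gen f' hf'; exists c.
  have h0' : pcoef (f - \sum_(i < r) psC (c i) * g i) 0 = 0 by rewrite pcoefB -e -pcoefB.
  split=> //; apply/WS; rewrite (_ : psX K * _ = f - \sum_(i < r) psC (c i) * g i).
    apply: (idealB (hW l)) => //; apply: ideal_sum => [|i _]; first exact: (hW l). 
    by apply: (idealM _ (hW l)); apply: Wle (gW i _).
  by rewrite [RHS](ps_decomp1 (f - _)) h0' rmorph0 add0r.
(* The generators [g] of level [N] realise the constant terms of every later level as well. Repeated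
   division by [X] thus never needs new generators, and the successive coefficients assemble into
   power series. *)
have fgN : exists r g, (forall i, (i < r)%N -> W N (g i)) /\ forall f, W N f -> span r g f.
  exists r, g; split=> // f hf.
  have /choice [st hst] : forall q : ps K * (nat -> K), exists q' : ps K * (nat -> K), forall l, (N <= l)%N -> W l q.1 ->
      W l.+1 q'.1 /\ q.1 = \sum_(i < r) psC (q'.2 i) * g i + psX K * q'.1.
    move=> [h c]; case: (EM (exists2 l, (N <= l)%N & W l h)); last first.
      by move=> hn; exists (h, c) => l Nl hl; case: hn; exists l.
    move=> [l Nl hl]; have [d [_ d0]] := genN l Nl h hl.
    have e : h - \sum_(i < r) psC (d i) * g i = psX K * pshift 1 (h - \sum_(i < r) psC (d i) * g i).
      by rewrite [LHS]ps_decomp1 d0 rmorph0 add0r.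
    exists (pshift 1 (h - \sum_(i < r) psC (d i) * g i), d) => l' Nl' hl' /=; split; last by rewrite -e addrC subrK.
    apply/WS; rewrite -e; apply: (idealB (hW _)) => //; apply: ideal_sum => [|i _]; first exact: (hW _). 
    by apply: (idealM _ (hW _)); apply: Wle (gW i _).
  pose q n := iter n st (f, fun=> 0).
  have hq n : W (N + n)%N (q n).1.
    elim: n => [|n IH]; first by rewrite addn0.
    rewrite addnS; exact: (hst (q n) (N + n)%N (leq_addr _ _) IH).1.
  have eq n : (q n).1 = \sum_(i < r) psC ((q n.+1).2 i) * g i + psX K * (q n.+1).1.
    exact: (hst (q n) (N + n)%N (leq_addr _ _) (hq n)).2.
  apply/spanP; exists (fun i => PS (fun j => (q j.+1).2 i)).
  have h n : f = \sum_(j < n) psX K ^+ j * (\sum_(i < r) psC ((q j.+1).2 i) * g i) + psX K ^+ n * (q n).1.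
    elim: n => [|n IH]; first by rewrite big_ord0 add0r expr0 mul1r.
    by rewrite {1}IH big_ord_recr /= -addrA exprSr -mulrA -mulrDr -eq.
  apply: psP => n; rewrite (h n.+1) pcoefD pcoefXn ltnSn addr0.
  under eq_bigr => j _ do rewrite mulr_sumr.
  rewrite exchange_big !pcoef_sum; apply: eq_bigr => i _.
  rewrite pcoef_sum pcoefM; apply: eq_bigr => j _.
  by rewrite pcoefXn ltnNge -ltnS ltn_ord /= pcoefC.
(* Descending from level [N] to level [0], each level adds generators that realise its own constant
   terms. *)
have fgW l : (l <= N)%N -> exists r g, (forall i, (i < r)%N -> W (N - l)%N (g i)) /\ forall f, W (N - l)%N f -> span r g f.
  elim: l => [|l IH] lN; first by rewrite subn0.
  have [r1 [g1 [h1 h2]]] := IH (ltnW lN).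
  have [r2 [g2 [h3 h4]]] := fglc (N - l.+1)%N.
  rewrite (_ : (N - l)%N = (N - l.+1).+1) in h1 h2; last by rewrite subnSK.
  exists (r2 + r1)%N, (fun i => if (i < r2)%N then g2 i else psX K * g1 (i - r2)%N); split.
    move=> i ir; case: ltnP => h; first exact: h3.
    by apply/WS; apply: h1; rewrite ltn_subLR.
  move=> f /h4 [c [/h2 /spanP[d hd] hc]]; apply/spanP.
  exists (fun i => if (i < r2)%N then psC (c i) else d (i - r2)%N).
  rewrite big_split_ord /= -(subrK (\sum_(i < r2) psC (c i) * g2 i) f) [LHS]addrC; congr (_ + _).
    by apply: eq_bigr => i _; rewrite ltn_ord.
  rewrite [LHS]ps_decomp1 hc rmorph0 add0r hd mulr_sumr; apply: eq_bigr => i _.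
  by rewrite ltnNge leq_addr /= addKn mulrCA.
have [r0 [g0 [h1 h2]]] := fgW N (leqnn _); rewrite subnn in h1 h2.
exists r0, g0; split; first by move=> i ir; have := h1 i ir; rewrite /W mul1r.
move=> f hf; have [|c ->] := h2 f; first by rewrite /W mul1r.
by exists c; rewrite subrr.
Qed.
End PSComplete.

(** Modulo [(y)^L] the value is that of a truncated polynomial at [z], whence multiplicativity; the
    terms beyond degree [L] are negligible because [z] lies in [(y)]. *)
Lemma ps_eval (K T : comNzRingType) (f : {rmorphism K -> T}) r (y : nat -> T) (z : T) :
  complete r y -> separated r y -> span r y z ->
  exists g : {rmorphism ps K -> T}, (forall a, g (psC a) = f a) /\ g (psX K) = z.
Proof.
move=> hc hs hz.
have hzn n : ipow r y n (z ^+ n).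
  by elim: n => // n IH; rewrite exprS -add1n; apply: ipowM IH; apply/ipow1.
pose S F L := \sum_(i < L) f (pcoef F i) * z ^+ i.
have /choice [g hg] : forall F, exists s, forall L, ipow r y L (s - S F L).
  move=> F; apply: (hc (fun i => f (pcoef F i) * z ^+ i)) => i.
  by apply: idealM; [apply: ideal_ipow|].
have uniq F s : (forall L, ipow r y L (s - S F L)) -> g F = s.
  move=> h; apply/eqP; rewrite -subr_eq0; apply/eqP; apply: hs => L.
  have -> : g F - s = (g F - S F L) - (s - S F L) by ring.
  exact: (idealB (ideal_ipow _ _ _)).
have gC a : g (psC a) = f a.
  apply: uniq => -[//|L]; rewrite /S big_ord_recl /= mulr1 opprD addrA subrr add0r.
  rewrite big1 ?oppr0 => [|i _]; first exact: ideal0 (ideal_ipow _ _ _).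
  by rewrite pcoefE /= rmorph0 mul0r.
have SE F L : S F L = (map_poly f (trunc L F)).[z].
  rewrite (@horner_coef_wide _ L); last first.
    by apply: (leq_trans (size_poly _ _)); apply: size_poly.
  by apply: eq_bigr => i _; rewrite coef_map trunc_coef.
have gD F G : g (F + G) = g F + g G.
  apply: uniq => L; have -> : S (F + G) L = S F L + S G L.
    by rewrite -big_split; apply: eq_bigr => i _; rewrite pcoefD rmorphD mulrDl.
  by rewrite opprD addrACA; apply: (idealD (ideal_ipow _ _ _)).
have gM F G : g (F * G) = g F * g G.
  apply: uniq => L.
  have hSM : ipow r y L (S F L * S G L - S (F * G) L).
    rewrite !SE -hornerM -rmorphM -hornerN -hornerD -rmorphN -rmorphD /=.
    rewrite horner_coef; apply: ideal_sum => [|i _]; first exact: ideal_ipow.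
    rewrite coef_map /=; case: (ltnP i L) => h.
      rewrite coefB -(ps_mulE (N := L)) // trunc_coef // subrr rmorph0 mul0r.
      exact: ideal0 (ideal_ipow _ _ _).
    by apply: idealM; [apply: ideal_ipow|apply: ipow_le (hzn _)].
  have -> : g F * g G - S (F * G) L = (g F - S F L) * g G + S F L * (g G - S G L) +
     (S F L * S G L - S (F * G) L) by ring.
  have hi := ideal_ipow r y L.
  apply: (idealD hi) => //; apply: (idealD hi); first exact: idealMr.
  exact: idealM.
have g1 : g 1 = 1 by rewrite -[1]/(psC 1) gC rmorph1.
have [g' hg'] := rmorphism_of g1 gD gM.
exists g'; split=> [a|]; rewrite hg' //.
apply: uniq => -[//|[|L]].
  rewrite /S big_ord1 /psX pcoefE rmorph0 mul0r subr0; exact/ipow1.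
rewrite /S !big_ord_recl /psX !pcoefE rmorph0 mul0r add0r /bump /= rmorph1 mul1r expr1 opprD addrA subrr add0r.
rewrite big1 ?oppr0 => [|i _]; first exact: ideal0 (ideal_ipow _ _ _).
by rewrite mul0r.
Qed.

Section Approx.
Variables (A : comNzRingType) (r : nat) (y : nat -> A).

(** A set that meets every class modulo [(y)] is dense as soon as it is closed under sums and under
    multiplication by each [y i]: the coefficients of the error are approximated in turn. *)
Lemma ipow_approx (D : A -> Prop) : D 0 -> (forall a b, D a -> D b -> D (a + b)) ->
  (forall i a, (i < r)%N -> D a -> D (y i * a)) ->
  (forall a, exists2 b, D b & span r y (a - b)) ->
  forall L a, exists2 b, D b & ipow r y L (a - b).
Proof.
move=> D0 DD DM h; elim=> [|L IH] a; first by exists 0.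
have [b hb /spanP [c hc]] := h a.
have /choice [d hd] : forall i, exists d, D d /\ ipow r y L (c i - d).
  by move=> i; have [d ? ?] := IH (c i); exists d.
exists (b + \sum_(i < r) y i * d i).
  apply: (DD) => //; elim/big_rec: _ => // i x _ hx; apply: DD => //; apply: DM => //.
  exact: (hd i).1.
rewrite opprD addrA hc -sumrB; apply: ideal_sum => [|i _]; first exact: ideal_ipow.
by rewrite [c i * _]mulrC -mulrBr; apply: ipow_mulvar => //; apply: (hd i).2.
Qed.
End Approx.

(** The elements on which [g] and [h] agree modulo [J] are dense, and [J] is closed. *)
Lemma rmorphism_eq_mod (A T : comNzRingType) (g h : {rmorphism A -> T}) r (y : nat -> A)
    l (z : nat -> T) (J : T -> Prop) : ideal J ->
  (forall x, (forall L, exists2 j, J j & ipow l z L (x - j)) -> J x) ->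
  (forall i, (i < r)%N -> [/\ span l z (g (y i)), span l z (h (y i)) & J (g (y i) - h (y i))]) ->
  (forall a, exists2 b, J (g b - h b) & span r y (a - b)) ->
  forall a, J (g a - h a).
Proof.
move=> hJ cl hy hD a; apply: cl => L.
have [|||b hb hab] := @ipow_approx A r y (fun b => J (g b - h b)) _ _ _ hD L a.
- by rewrite !rmorph0 subr0; apply: ideal0.
- by move=> x x' hx hx'; rewrite !rmorphD opprD addrACA; apply: idealD.
- move=> i x ir hx; have [_ _ hi] := hy i ir; rewrite !rmorphM.
  have -> : g (y i) * g x - h (y i) * h x = (g (y i) - h (y i)) * g x + h (y i) * (g x - h x) by ring.
  by apply: idealD => //; [apply: idealMr|apply: idealM].
exists (g b - h b) => //.
have -> : g a - h a - (g b - h b) = g (a - b) - h (a - b) by rewrite !rmorphB; ring.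
apply: (idealB (ideal_ipow _ _ _)).
  by apply: ipow_mono (ipow_image g hab) => i ir; have [] := hy i ir.
by apply: ipow_mono (ipow_image h hab) => i ir; have [] := hy i ir.
Qed.

(** Successive approximation: the correction at stage [L] has coefficients in [(y)^L] of [S], so
    they are summable in [S]. The target has only to be separated. *)
Lemma complete_generation (S T : comNzRingType) (f : {rmorphism S -> T}) r (y : nat -> S) m (v : nat -> T) :
  complete r y -> separated r (f \o y) ->
  (forall t, exists s : nat -> S, span r (f \o y) (t - \sum_(j < m) f (s j) * v j)) ->
  forall t, exists s : nat -> S, t = \sum_(j < m) f (s j) * v j.
Proof.
move=> hc hs h t.
have step L x : ipow r (f \o y) L x -> exists s : nat -> S, (forall j, ipow r y L (s j)) /\
    ipow r (f \o y) L.+1 (x - \sum_(j < m) f (s j) * v j).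
  elim: L x => [|L IH] x; first by move=> _; have [s hs'] := h x; exists s; split=> //; apply/ipow1.
  move=> /ipowS_E [u [hu ->]].
  have /choice [s hs'] : forall i, exists s : nat -> S, (i < r)%N -> (forall j, ipow r y L (s j)) /\
      ipow r (f \o y) L.+1 (u i - \sum_(j < m) f (s j) * v j).
    move=> i; case: (ltnP i r) => [ir|_]; last by exists (fun=> 0).
    by have [s hs'] := IH _ (hu i ir); exists s.
  exists (fun j => \sum_(i < r) y i * s i j); split=> [j|].
    apply: ideal_sum => [|i _]; first exact: ideal_ipow.
    by apply: ipow_mulvar => //; apply: (hs' i _).1.
  have -> : \sum_(j < m) f (\sum_(i < r) y i * s i j) * v j =
     \sum_(i < r) f (y i) * \sum_(j < m) f (s i j) * v j.
    under eq_bigr => j _ do rewrite rmorph_sum mulr_suml.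
    rewrite exchange_big; apply: eq_bigr => i _; rewrite mulr_sumr; apply: eq_bigr => j _.
    by rewrite rmorphM mulrA.
  rewrite -sumrB; apply: ideal_sum => [|i _]; first exact: ideal_ipow.
  by rewrite -mulrBr; apply: (ipow_mulvar (y := f \o y)) => //; apply: (hs' i _).2.
have /choice [st hst] : forall q : T * nat, exists s : nat -> S, ipow r (f \o y) q.2 q.1 ->
    (forall j, ipow r y q.2 (s j)) /\ ipow r (f \o y) q.2.+1 (q.1 - \sum_(j < m) f (s j) * v j).
  move=> [x L] /=; case: (EM (ipow r (f \o y) L x)) => [/step [s hs']|]; last by exists (fun=> 0).
  by exists s.
pose q := fix q n := if n is n.+1 then q n - \sum_(j < m) f (st (q n, n) j) * v j else t.
have hq n : ipow r (f \o y) n (q n).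
  by elim: n => [|n IH] //; have [_] := hst (q n, n) IH.
have hsn n j : ipow r y n (st (q n, n) j) by have [h1 _] := hst (q n, n) (hq n); apply: h1.
have /choice [s hs'] := fun j => hc (fun n => st (q n, n) j) (fun n => hsn n j).
exists s; apply/eqP; rewrite -subr_eq0; apply/eqP; apply: hs => L.
have e : t = q L + \sum_(j < m) f (\sum_(i < L) st (q i, nat_of_ord i) j) * v j.
  elim: L => [|L IH].
    by rewrite big1 ?addr0 // => j _; rewrite big_ord0 rmorph0 mul0r.
  rewrite {1}IH /= -addrA; congr (_ + _); rewrite addrC; apply/eqP.
  rewrite eq_sym subr_eq -big_split; apply/eqP; apply: eq_bigr => j _ /=.
  by rewrite big_ord_recr rmorphD mulrDl.
rewrite {1}e -addrA -sumrB; apply: (idealD (ideal_ipow _ _ _)) => //.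
apply: ideal_sum => [|j _]; first exact: ideal_ipow.
rewrite -mulrBl -rmorphB; apply: idealMr; first exact: ideal_ipow.
by rewrite -opprB rmorphN; apply: (idealN (ideal_ipow _ _ _)); apply: ipow_image.
Qed.

Lemma complete_surjective (S T : comNzRingType) (f : {rmorphism S -> T}) r (y : nat -> S) :
  complete r y -> separated r (f \o y) ->
  (forall t, exists s, span r (f \o y) (t - f s)) -> forall t, exists s, f s = t.
Proof.
move=> hc hs h t; have [|s ->] := @complete_generation S T f r y 1 (fun=> 1) hc hs _ t.
  by move=> x; have [s hx] := h x; exists (fun=> s); rewrite big_ord1 mulr1.
by exists (s 0%N); rewrite big_ord1 mulr1.
Qed.

(** * Lifting of maps along complete rings *)

Section PthRoot.
Variables (k : fieldType) (p : nat) (k0 : k -> Prop).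
Hypotheses (pk : p \in [pchar k]) (k0B : forall a b, k0 a -> k0 b -> k0 (a - b))
  (k0M : forall a b, k0 a -> k0 b -> k0 (a * b)) (k0X : forall a, k0 (a ^+ p)).

Let k00 : k0 0. Proof. by have := k0B (k0X 0) (k0X 0); rewrite subrr. Qed.
Let k0D a b : k0 a -> k0 b -> k0 (a + b).
Proof. by move=> ha hb; rewrite -[b]opprK; apply: k0B => //; rewrite -sub0r; apply: k0B. Qed.
Let k01 : k0 1. Proof. by have := k0X 1; rewrite expr1n. Qed.
Let k0n n : k0 n%:R.
Proof. by elim: n => [|n IH]; rewrite ?mulr0n // -natr1; apply: k0D. Qed.
Let k0V a : k0 a -> k0 a^-1.
Proof.
move=> ha; case: (eqVneq a 0) => [->|a0]; first by rewrite invr0.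
have p0 : (0 < p)%N by apply: prime_gt0; apply: (pcharf_prime pk).
have -> : a^-1 = a^-1 ^+ p * a ^+ p.-1.
  by rewrite -{1}(prednK p0) exprSr mulrAC -exprMn mulVf // expr1n mul1r.
apply: k0M => //; elim: {p0} p.-1 => [|n IH]; rewrite ?expr0 //.
by rewrite exprS; apply: k0M.
Qed.

Let P0 (f : {poly k}) := forall i, k0 f`_i.

Lemma subfield_division (f g : {poly k}) : f \is monic -> P0 f -> P0 g ->
  exists q s, [/\ g = q * f + s, P0 s & (size s < size f)%N].
Proof.
move=> fm hf; have f0 := monic_neq0 fm.
have [n] := ubnP (size g); elim: n g => // n IH g hn hg.
case: (ltnP (size g) (size f)) => h; first by exists 0, g; rewrite mul0r add0r.
pose g' := g - lead_coef g *: (f * 'X^(size g - size f)).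
have hg' : P0 g'.
  move=> i; rewrite coefB coefZ coefMXn; apply: k0B => //; apply: k0M; first exact: hg.
  by case: ifP.
have sg0 : (0 < size g)%N by apply: leq_trans h; rewrite size_poly_gt0.
have sm : (size g' < size g)%N.
  rewrite -(prednK sg0) ltnS; apply/leq_sizeP => j; rewrite leq_eqVlt => /orP[/eqP <-|jg].
    rewrite coefB coefZ coefMXn ltn_subRL.
    have -> : ((size f + (size g).-1 < size g) = false)%N.
      apply/negbTE; rewrite -leqNgt -{1}(prednK sg0) -add1n leq_add2r size_poly_gt0 //.
    have -> : ((size g).-1 - (size g - size f) = (size f).-1)%N.
      rewrite -subn1 -subnDA addnC subnDA subKn // subn1 //.
    by rewrite -/(lead_coef f) -/(lead_coef g) (monicP fm) mulr1 subrr.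
  apply/leq_sizeP: j jg; rewrite prednK //.
  rewrite (leq_trans (size_polyD _ _)) // geq_max leqnn size_polyN.
  by rewrite (leq_trans (size_scale_leq _ _)) // size_mulXn // subnK.
have [|q [s [e hs hss]]] := IH g' _ hg'; first by apply: (leq_trans sm); rewrite -ltnS.
exists (q + lead_coef g *: 'X^(size g - size f)), s; split=> //.
by rewrite mulrDl addrAC -e /g' -scalerAl ['X^_ * f]mulrC subrK.
Qed.

(** A monic polynomial over [k0] of least degree at [r] divides [X^p - r^p = (X - r)^p], hence is a
    power of [X - r]. Exponent one would put [r] in [k0]; a larger exponent below [p] is excluded by
    the derivative. *)
Lemma pth_root_independent r (c : nat -> k) : ~ k0 r -> (forall i, (i < p)%N -> k0 (c i)) ->
  \sum_(i < p) c i * r ^+ i = 0 -> forall i, (i < p)%N -> c i = 0.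
Proof.
move=> nr hc e.
suff main (f : {poly k}) : P0 f -> (size f <= p)%N -> root f r -> f = 0.
  move=> i ip; have -> : c i = (\poly_(i < p) c i)`_i by rewrite coef_poly ip.
  suff -> : \poly_(j < p) c j = 0 by rewrite coef0.
  apply: main; [|exact: size_poly|by rewrite /root horner_poly e].
  by move=> j; rewrite coef_poly; case: ifP => // /hc.
have [n] := ubnP (size f); elim: n f => // n IH f hn hf sf rf.
apply/eqP; apply: contraT => f0.
have minf g : P0 g -> (size g < size f)%N -> root g r -> g = 0.
  move=> hg sg rg; apply: IH => //; first by apply: (leq_trans sg); rewrite -ltnS.
  by rewrite (leq_trans (ltnW sg) sf).
pose f1 := (lead_coef f)^-1 *: f.
have l0 : lead_coef f != 0 by rewrite lead_coef_eq0.
have hf1 : P0 f1 by move=> i; rewrite coefZ; apply: k0M => //; apply: k0V; apply: hf.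
have f1m : f1 \is monic by rewrite monicE lead_coefZ mulVf.
have sf1 : size f1 = size f by rewrite size_scale // invr_eq0.
have rf1 : root f1 r by rewrite rootZ // invr_eq0.
have pp := pcharf_prime pk; have p0 := prime_gt0 pp.
have [|q [s [e' hs ss]]] := @subfield_division f1 ('X^p - (r ^+ p)%:P) f1m hf1.
  move=> i; rewrite coefB coefXn coefC; apply: k0B; [exact: k0n|by case: ifP].
have s0 : s = 0.
  apply: minf => //; first by rewrite -sf1.
  move/(congr1 (horner^~ r)): e'; rewrite !(hornerD, hornerM) hornerN hornerXn hornerC (rootP rf1) mulr0 add0r subrr => h.
  by rewrite /root -h.
have dv : f1 %| ('X - r%:P) ^+ p.
  have pP : p \in [pchar {poly k}] by rewrite pchar_poly.
  have -> : ('X - r%:P) ^+ p = 'X^p - (r ^+ p)%:P.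
    by rewrite -(pFrobenius_autE pP) rmorphB /= !pFrobenius_autE polyC_exp.
  by rewrite e' s0 addr0 dvdp_mull.
have /dvdp_exp_XsubCP [m _] := dv.
rewrite eqp_monic ?monic_exp ?monicXsubC // => /eqP ef.
have sfm : size f = m.+1 by rewrite -sf1 ef size_exp_XsubC.
case: m => [|[|m]] in ef sfm.
- by move: rf1; rewrite ef expr0 /root hornerC oner_eq0.
- case: nr; rewrite -[r]opprK -sub0r; apply: k0B => //.
  by have := hf1 0%N; rewrite ef expr1 coefB coefX coefC sub0r.
(* The exponent [m.+2] is below [p], so the derivative is nonzero; it has smaller degree and still
   vanishes at [r], against minimality. *)
have der : f1^`() = ('X - r%:P) ^+ m.+1 *+ m.+2.
  by rewrite ef deriv_exp derivXsubC mul1r.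
have /minf h : P0 f1^`().
  by move=> i; rewrite coef_deriv -mulr_natl; apply: k0M.
have : f1^`()`_m.+1 = 0.
  rewrite h ?coef0 //; first by rewrite -sf1 lt_size_deriv // monic_neq0.
  by rewrite der /root hornerMn horner_exp !hornerE subrr exprS mul0r mul0rn.
have -> : f1^`()`_m.+1 = m.+2%:R.
  by rewrite coef_deriv; have := monicP f1m; rewrite /lead_coef sf1 sfm => ->.
move/eqP; rewrite -(dvdn_pcharf pk) => /dvdn_leq => /(_ isT); rewrite leqNgt -ltnS.
by move: sf; rewrite sfm ltnS => ->.
Qed.
End PthRoot.

(** The integral polynomial [((a + b)^p - a^p - b^p)/p]. As the defect of additivity is [p] times a
    polynomial expression, it can be lifted along with [a] and [b]. *)
Definition frob_rest (A : comNzRingType) (p : nat) (a b : A) : A :=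
  \sum_(i < p.-1) ('C(p, i.+1) %/ p)%:R * (a ^+ (p - i.+1) * b ^+ i.+1).

Lemma frob_restE (A : comNzRingType) (p : nat) (a b : A) : prime.prime p ->
  (a + b) ^+ p = a ^+ p + b ^+ p + p%:R * frob_rest p a b.
Proof.
case: p => // q pp; rewrite /frob_rest /=.
rewrite exprDn big_ord_recl subn0 expr0 mulr1 bin0 mulr1n -addrA; congr (_ + _).
rewrite big_ord_recr /= /bump /= add1n subnn expr0 mul1r binn mulr1n addrC.
congr (_ + _); rewrite mulr_sumr; apply: eq_bigr => i _; rewrite add1n mulrA -natrM mulnC divnK.
  by rewrite mulr_natl.
by apply: prime_dvd_bin => //=; rewrite ltnS.
Qed.

Lemma antisym_sum (A : comNzRingType) (f : nat -> nat -> A) r :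
  (forall i, f i i = 0) -> (forall i j, f j i = - f i j) ->
  \sum_(i < r) \sum_(j < r) f i j = 0.
Proof.
move=> h0 h; elim: r => [|r IH]; first by rewrite big_ord0.
rewrite big_ord_recr /= big_ord_recr /= h0 addr0.
under eq_bigr => i _ do rewrite big_ord_recr.
rewrite big_split /= IH add0r -big_split big1 // => i _ /=.
by rewrite (h i r) subrr.
Qed.

Section Lifting.
Variables (A T E : comNzRingType) (pi : {rmorphism T -> E}) (phi : {rmorphism A -> E}).
Variables (p n : nat) (x : nat -> A) (e : nat -> T).
Hypotheses (pp : prime.prime p) (xn : x n = p%:R) (en : e n = p%:R).
Hypotheses (loc : forall a, ~ span n.+1 x a -> exists b, b * a = 1) (M1 : ~ span n.+1 x 1).
Hypotheses (KR : koszul n.+1 x) (spi : forall b, exists a, pi a = b).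
Definition kills t := forall d, pi d = 0 -> t * d = 0.
Hypotheses (sq0 : forall d, pi d = 0 -> kills d) (ek : forall i, (i < n.+1)%N -> kills (e i)).
Hypothesis eE : forall i, (i < n.+1)%N -> pi (e i) = phi (x i).

Lemma kills_eq z u v : kills z -> pi u = pi v -> u * z = v * z.
Proof.
move=> kz e'; apply/eqP; rewrite -subr_eq0 -mulrBl mulrC kz //.
by rewrite rmorphB e' subrr.
Qed.
Lemma killsM a z : kills z -> kills (a * z).
Proof. by move=> kz d hd; rewrite -mulrA kz // mulr0. Qed.
Lemma killsP d : pi d = 0 -> p%:R * d = 0.
Proof. by rewrite -en; apply: ek. Qed.
(** The kernel of [pi] has square zero and is killed by [p], so the [p]-th power of a lift does not
    depend on the lift. *)
Lemma frob_pi u v : pi u = pi v -> u ^+ p = v ^+ p.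
Proof.
move=> e'; rewrite -(subrK v u); set d := u - v; have hd : pi d = 0 by rewrite rmorphB e' subrr.
rewrite addrC frob_restE // -addrA.
have dd : d * d = 0 by apply: sq0.
have -> : d ^+ p = 0 by case: p (prime_gt1 pp) => [|[|q]] // _; rewrite !exprS mulrA dd mul0r.
rewrite add0r mulr_sumr big1 ?addr0 // => i _; rewrite exprS.
rewrite (_ : _ * _ = ('C(p, i.+1) %/ p)%:R * v ^+ (p - i.+1) * d ^+ i * (p%:R * d)); last by ring.
by rewrite killsP ?mulr0.
Qed.

(** The lift is forced on the maximal ideal, where [c_i x_i] must go to [u_i e_i] with [u_i] over
    [phi (c_i)]; the choice of [u_i] is immaterial because [e_i] kills the kernel of [pi]. *)
Definition basic r t := exists (c : nat -> A) (u : nat -> T), [/\ forall i, pi (u i) = phi (c i),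
  r = \sum_(i < n.+1) c i * x i & t = \sum_(i < n.+1) u i * e i].

Lemma basicD r t r' t' : basic r t -> basic r' t' -> basic (r + r') (t + t').
Proof.
move=> [c [u [h -> ->]]] [c' [u' [h' -> ->]]]; exists (fun i => c i + c' i), (fun i => u i + u' i).
split; first by move=> i; rewrite !rmorphD h h'.
  by rewrite -big_split; apply: eq_bigr => i _; rewrite mulrDl.
by rewrite -big_split; apply: eq_bigr => i _; rewrite mulrDl.
Qed.
Lemma basicM a v r t : pi v = phi a -> basic r t -> basic (a * r) (v * t).
Proof.
move=> hv [c [u [h -> ->]]]; exists (fun i => a * c i), (fun i => v * u i); split.
- by move=> i; rewrite !rmorphM hv h.
- by rewrite mulr_sumr; apply: eq_bigr => i _; rewrite mulrA.
- by rewrite mulr_sumr; apply: eq_bigr => i _; rewrite mulrA.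
Qed.
Lemma basic_gen i : (i < n.+1)%N -> basic (x i) (e i).
Proof.
move=> ir; exists (fun j => (j == i)%:R), (fun j => (j == i)%:R); split=> [j||].
- by rewrite !rmorph_nat.
- rewrite (bigD1 (Ordinal ir)) //= eqxx mul1r big1 ?addr0 // => j.
  by rewrite -val_eqE /= => /negbTE ->; rewrite mul0r.
- rewrite (bigD1 (Ordinal ir)) //= eqxx mul1r big1 ?addr0 // => j.
  by rewrite -val_eqE /= => /negbTE ->; rewrite mul0r.
Qed.
Lemma basicN r t : basic r t -> basic (- r) (- t).
Proof. by rewrite -mulN1r -[- t]mulN1r; apply: basicM; rewrite !rmorphN1. Qed.
Lemma basicp : basic p%:R p%:R. Proof. by rewrite -{1}xn -en; apply: basic_gen. Qed.
Lemma basic_span r t : basic r t -> span n.+1 x r.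
Proof. by move=> [c [u [_ -> _]]]; exists c. Qed.
Lemma span_basic r : span n.+1 x r -> exists t, basic r t.
Proof.
move=> [c ->]; have /choice [u hu] := fun i => spi (phi (c i)).
by exists (\sum_(i < n.+1) u i * e i), c, u.
Qed.
Lemma basic_pi r t : basic r t -> pi t = phi r.
Proof.
move=> [c [u [h -> ->]]]; rewrite !rmorph_sum; apply: eq_bigr => i _.
by rewrite !rmorphM h eE.
Qed.
(** Well-definedness of the forced values: a relation between the [x i] is alternating by [KR], and
    the terms [v_ij e_i e_j] that it produces cancel in pairs. *)
Lemma basic0 t : basic 0 t -> t = 0.
Proof.
move=> [c [u [h hc ->]]]; have [|s [s0 sN sE]] := KR (c := c).
  by rewrite [RHS]hc; apply: eq_bigr => i _; rewrite mulrC.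
have /choice [v hv] := fun ij : nat * nat => spi (phi (s ij.1 ij.2)).
rewrite -[RHS](@antisym_sum _ (fun i j => if (i < n.+1)%N && (j < n.+1)%N then v (i, j) * e i * e j else 0) n.+1).
- apply: eq_bigr => i _.
  under [RHS]eq_bigr => j _ do rewrite !ltn_ord /= mulrAC.
  rewrite -mulr_suml; apply: kills_eq; first exact: ek.
  rewrite h sE // !rmorph_sum; apply: eq_bigr => j _.
  by rewrite !rmorphM hv eE.
- move=> i; case: ifP => // /andP[ir _]; rewrite -mulrA -[RHS](mul0r (e i * e i)).
  by apply: kills_eq; [apply/killsM/ek|rewrite hv s0 !rmorph0].
move=> i j; rewrite andbC; case: ifP => [/andP[ir jr]|_]; last by rewrite oppr0.
rewrite -mulrA -mulrA [e j * e i]mulrC -mulNr; apply: kills_eq; first exact/killsM/ek.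
by rewrite rmorphN !hv sN rmorphN.
Qed.

(** By [frob_pi] the lift is also forced on [p]-th powers, hence on the subring of elements
    [a^p + r'] with [r'] in the maximal ideal. *)
Definition frob_basic r t := exists a u r' t',
  [/\ pi u = phi a, basic r' t', r = a ^+ p + r' & t = u ^+ p + t'].

Lemma frob_basicD r t r' t' : frob_basic r t -> frob_basic r' t' -> frob_basic (r + r') (t + t').
Proof.
move=> [a [u [q [w [h1 h2 -> ->]]]]] [a' [u' [q' [w' [h1' h2' -> ->]]]]].
exists (a + a'), (u + u'), (q + q' - frob_rest p a a' * p%:R), (w + w' - frob_rest p u u' * p%:R).
split; [by rewrite !rmorphD h1 h1'| |by rewrite frob_restE //; ring|by rewrite frob_restE //; ring].
apply: basicD; first exact: basicD.
apply/basicN/basicM; last exact: basicp.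
rewrite !rmorph_sum; apply: eq_bigr => i _.
by rewrite !rmorphM !rmorphXn !rmorph_nat h1 h1'.
Qed.
Lemma frob_basicN r t : frob_basic r t -> frob_basic (- r) (- t).
Proof.
move=> [a [u [q [w [h1 h2 -> ->]]]]].
have eN (B : comNzRingType) (b : B) : - b ^+ p = (- b) ^+ p + frob_rest p b (- b) * p%:R.
  have := frob_restE b (- b) pp; rewrite subrr expr0n gtn_eqF ?prime_gt0 //= => /eqP.
  by rewrite eq_sym -addrA addr_eq0 mulrC => /eqP ->; rewrite opprK.
exists (- a), (- u), (- q + frob_rest p a (- a) * p%:R), (- w + frob_rest p u (- u) * p%:R).
split; [by rewrite !rmorphN h1| |by rewrite opprD eN; ring|by rewrite opprD eN; ring].
apply: basicD; first exact: basicN.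
apply: basicM; last exact: basicp.
rewrite !rmorph_sum; apply: eq_bigr => i _.
by rewrite !rmorphM !rmorphXn !rmorph_nat !rmorphN h1.
Qed.
Lemma frob_basicM r t r' t' : frob_basic r t -> frob_basic r' t' -> frob_basic (r * r') (t * t').
Proof.
move=> [a [u [q [w [h1 h2 -> ->]]]]] [a' [u' [q' [w' [h1' h2' -> ->]]]]].
exists (a * a'), (u * u'), (a ^+ p * q' + a' ^+ p * q + q * q'), (u ^+ p * w' + u' ^+ p * w + w * w').
split; [by rewrite !rmorphM h1 h1'| |by rewrite exprMn; ring|by rewrite exprMn; ring].
apply: basicD; last by apply: basicM => //; apply: basic_pi.
by apply: basicD; apply: basicM => //; rewrite !rmorphXn ?h1 ?h1'.
Qed.
Lemma frob_basic_pi r t : frob_basic r t -> pi t = phi r.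
Proof.
by move=> [a [u [q [w [h1 h2 -> ->]]]]]; rewrite !rmorphD !rmorphXn h1 (basic_pi h2).
Qed.
(** If [a^p] lies in the maximal ideal, so does [a]; its lift may then be taken basic, and the claim
    reduces to [basic0]. *)
Lemma frob_basic0 t : frob_basic 0 t -> t = 0.
Proof.
move=> [a [u [q [w [h1 h2 er ->]]]]].
have aM : span n.+1 x a.
  apply: contrapT => /loc [b hb]; apply: M1.
  have -> : 1 = b ^+ p * (- q).
    have -> : - q = a ^+ p by apply/eqP; rewrite eq_sym -addr_eq0 -er.
    by rewrite -exprMn hb expr1n.
  by apply: (idealM _ (ideal_span _ _)); apply: (idealN (ideal_span _ _)); apply: basic_span h2.
have [v hv] := span_basic aM.
have ev : u ^+ p = v ^+ p by apply: frob_pi; rewrite h1 (basic_pi hv).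
rewrite ev; apply: basic0; rewrite er; apply: basicD => //.
rewrite -(prednK (prime_gt0 pp)) !exprSr; apply: basicM => //.
by rewrite !rmorphXn (basic_pi hv).
Qed.

(** Graphs of ring maps that lift [phi] on a subring containing the domain of [frob_basic]. *)
Definition partial_lift (G : A -> T -> Prop) :=
  [/\ forall a t, frob_basic a t -> G a t, forall a t, G a t -> pi t = phi a, forall t, G 0 t -> t = 0 &
      (forall a t b u, G a t -> G b u -> G (a - b) (t - u)) /\
      (forall a t b u, G a t -> G b u -> G (a * b) (t * u))].

Lemma partial_lift_max : exists2 G, partial_lift G &
  forall G', partial_lift G' -> (forall a t, G a t -> G' a t) -> forall a t, G' a t -> G a t.
Proof.
(* Adjoining [frob_basic] makes the union of the empty chain admissible in Zorn's lemma. *)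
pose un (X : A * T -> Prop) a t := X (a, t) \/ frob_basic a t.
have [F FP tot|X [hX Xmax]] := @classical_sets.Zorn_bigcup (A * T)%type (fun X => partial_lift (un X)).
  set U := classical_sets.bigcup _ _.
  have base : partial_lift frob_basic.
    split=> //; [exact: frob_basic_pi|exact: frob_basic0|split].
      by move=> a t b u ha hb; apply: frob_basicD => //; apply: frob_basicN.
    exact: frob_basicM.
  have pick1 a t : un U a t -> frob_basic a t \/ exists2 X, F X & X (a, t).
    by move=> [[X FX hX]|]; [right; exists X|left].
  have pick2 a t b u : un U a t -> un U b u -> exists G, [/\ partial_lift G, G a t, G b u & forall a t, G a t -> un U a t].
    have sub X : F X -> forall a t, un X a t -> un U a t.
      by move=> FX a' t' [h|h]; [left; exists X|right].
    move=> /pick1 [h|[X FX hX]] /pick1 [h'|[Y FY hY]].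
    - by exists frob_basic; split=> // *; right.
    - by exists (un Y); split; [apply: FP|right|left|apply: sub].
    - by exists (un X); split; [apply: FP|left|right|apply: sub].
    case: (tot _ _ FX FY) => h.
      by exists (un Y); split; [apply: FP|left; apply: h|left|apply: sub].
    by exists (un X); split; [apply: FP|left|left; apply: h|apply: sub].
  split.
  - by move=> a t h; right.
  - by move=> a t h; have [G [[_ hp _ _] h1 _ _]] := pick2 _ _ _ _ h h; apply: hp.
  - by move=> t h; have [G [[_ _ h0 _] h1 _ _]] := pick2 _ _ _ _ h h; apply: h0.
  by split=> a t b u h h'; have [G [[_ _ _ [hB hM]] h1 h2 h3]] := pick2 _ _ _ _ h h';
    apply: h3; [apply: hB|apply: hM].
exists (un X) => // G' hG' sub a t hG; apply: contrapT => nX.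
apply: (Xmax (fun z => G' z.1 z.2)).
  split; first by move=> [b u] h; apply: sub; left.
  by move=> h; apply: nX; left; apply: (h (a, t)).
suff -> : un (fun z => G' z.1 z.2) = G' by [].
apply/funext => b; apply/funext => u; apply/propext; split=> [[//|h]|h]; last by left.
by case: hG' => h0 _ _ _; apply: h0.
Qed.

(** The [p]-basis argument without a [p]-basis: a maximal partial lift is total, because the residue
    class of a missing [r0] lies outside the residue field of the domain, so that its powers below
    the [p]-th are independent over it and [r0] may be sent to any lift of [phi r0]. *)
Lemma lifting : exists psi : {rmorphism A -> T}, (forall a, pi (psi a) = phi a) /\
  forall i, (i < n.+1)%N -> psi (x i) = e i.
Proof.
have [G hG Gmax] := partial_lift_max; have [G0 Gpi Gf [GB GM]] := hG.
have Gb r t : basic r t -> G r t.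
  move=> h; apply: G0; exists 0, 0, r, t; split=> //; first by rewrite !rmorph0.
    by rewrite expr0n gtn_eqF ?prime_gt0 // add0r.
  by rewrite expr0n gtn_eqF ?prime_gt0 // add0r.
have G00 : G 0 0 by have := GB _ _ _ _ (Gb _ _ basicp) (Gb _ _ basicp); rewrite !subrr.
have GN a t : G a t -> G (- a) (- t) by move=> /(GB _ _ _ _ G00); rewrite !sub0r.
have GD a t b u : G a t -> G b u -> G (a + b) (t + u).
  by move=> ha /GN hb; rewrite -[b]opprK -[u]opprK; apply: GB.
have Guniq a t u : G a t -> G a u -> t = u.
  by move=> h1 h2; apply/eqP; rewrite -subr_eq0; apply/eqP; apply: Gf; have := GB _ _ _ _ h1 h2; rewrite subrr.
have GX a t : pi t = phi a -> G (a ^+ p) (t ^+ p).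
  move=> h; apply: G0; exists a, t, 0, 0; rewrite !addr0; split=> //.
  by have := basicD basicp (basicN basicp); rewrite !subrr.
have G1 : G 1 1 by rewrite -[1](expr1n A p) -[X in G _ X](expr1n T p); apply: GX; rewrite !rmorph1.
have Gsum m (f : nat -> A) (g : nat -> T) : (forall i, (i < m)%N -> G (f i) (g i)) ->
    G (\sum_(i < m) f i) (\sum_(i < m) g i).
  elim: m => [|m IH] h; first by rewrite !big_ord0.
  by rewrite !big_ord_recr /=; apply: GD; [apply: IH => i im; apply/h/ltnW|apply: h].
have GXn a t m : G a t -> G (a ^+ m) (t ^+ m).
  by move=> h; elim: m => [|m IH]; rewrite ?expr0 // !exprS; apply: GM.
suff all r0 : exists t, G r0 t.
  have [psi hpsi] := choice all.
  have [g hg] : exists g : {rmorphism A -> T}, g =1 psi.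
    apply: rmorphism_of => [|a b|a b]; first exact: Guniq (hpsi _) G1.
      exact: Guniq (hpsi _) (GD _ _ _ _ (hpsi _) (hpsi _)).
    exact: Guniq (hpsi _) (GM _ _ _ _ (hpsi _) (hpsi _)).
  exists g; split=> [a|i ir]; rewrite hg; first exact: Gpi (hpsi _).
  exact: Guniq (hpsi _) (Gb _ _ (basic_gen ir)).
apply: contrapT => nr0.
have hM : ideal (span n.+1 x) := ideal_span _ _.
have [k [f [sf kf]]] := residue_field hM M1 (fun a h => let: ex_intro b hb := loc h in
  ex_intro _ b (eq_ind_r (fun z => span n.+1 x (1 - z)) (eq_ind_r (fun z => span n.+1 x z) (ideal0 hM) (subrr 1)) hb)).
(* The residue field of the domain of [G], which contains all [p]-th powers. It avoids the class of
   [r0], since [G] is already defined on the maximal ideal. *)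
pose k0 (c : k) := exists a t, G a t /\ f a = c.
have pk : p \in [pchar k].
  apply/andP; split=> //; rewrite -(rmorph_nat f); apply/eqP/kf; rewrite -xn; exact: span_mem.
have indep (c : nat -> A) (g : nat -> T) : (forall i, (i < p)%N -> G (c i) (g i)) ->
    span n.+1 x (\sum_(i < p) c i * r0 ^+ i) -> forall i, (i < p)%N -> span n.+1 x (c i).
  move=> hc hs i ip; apply/kf.
  apply: (@pth_root_independent k p k0 pk _ _ _ (f r0) (f \o c)) => //.
  - by move=> _ _ [a [t [ha <-]]] [b [u [hb <-]]]; exists (a - b), (t - u); rewrite rmorphB; split=> //; apply: GB.
  - by move=> _ _ [a [t [ha <-]]] [b [u [hb <-]]]; exists (a * b), (t * u); rewrite rmorphM; split=> //; apply: GM.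
  - move=> c0; have [a <-] := sf c0; have [t ht] := spi (phi a).
    by exists (a ^+ p), (t ^+ p); rewrite rmorphXn; split=> //; apply: GX.
  - move=> [a [t [ha]]] /eqP; rewrite -subr_eq0 -rmorphB => /eqP /kf /span_basic [u hu].
    by apply: nr0; exists (t - u); have := GB _ _ _ _ ha (Gb _ _ hu); rewrite subKr.
  - by move=> j jp; exists (c j), (g j); split=> //; apply: hc.
  have := (kf _).2 hs; rewrite rmorph_sum => hs'; rewrite -[RHS]hs'; apply: eq_bigr => j _.
  by rewrite rmorphM rmorphXn.
have [u0 hu0] := spi (phi r0).
pose G' a t := exists (c : nat -> A) (g : nat -> T), [/\ forall i, (i < p)%N -> G (c i) (g i),
  a = \sum_(i < p) c i * r0 ^+ i & t = \sum_(i < p) g i * u0 ^+ i].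
(* Exponents are reduced modulo [p]; by [GX] the pair of [r0^p] and [u0^p] is already in [G]. *)
have G'mono a t m : G a t -> G' (a * r0 ^+ m) (t * u0 ^+ m).
  move=> h; have mp : (m %% p < p)%N by rewrite ltn_mod prime_gt0.
  exists (fun i => if i == (m %% p)%N then a * (r0 ^+ p) ^+ (m %/ p) else 0),
         (fun i => if i == (m %% p)%N then t * (u0 ^+ p) ^+ (m %/ p) else 0); split.
  - by move=> i ip; case: eqP => // _; apply: GM => //; apply: GXn; apply: GX.
  - rewrite (bigD1 (Ordinal mp)) //= eqxx -mulrA -exprM -exprD mulnC -divn_eq big1 ?addr0 // => i.
    by rewrite -val_eqE /= => /negbTE ->; rewrite mul0r.
  - rewrite (bigD1 (Ordinal mp)) //= eqxx -mulrA -exprM -exprD mulnC -divn_eq big1 ?addr0 // => i.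
    by rewrite -val_eqE /= => /negbTE ->; rewrite mul0r.
have G'G a t : G a t -> G' a t by move=> /(G'mono _ _ 0%N); rewrite !mulr1.
have G'B a t b u : G' a t -> G' b u -> G' (a - b) (t - u).
  move=> [c [g [h -> ->]]] [c' [g' [h' -> ->]]]; exists (fun i => c i - c' i), (fun i => g i - g' i).
  split; first by move=> i ip; apply: GB; auto.
    by rewrite -sumrB; apply: eq_bigr => i _; rewrite mulrBl.
  by rewrite -sumrB; apply: eq_bigr => i _; rewrite mulrBl.
have G'D a t b u : G' a t -> G' b u -> G' (a + b) (t + u).
  move=> ha hb; rewrite -[b]opprK -[u]opprK; apply: (G'B) => //; rewrite -sub0r -[- u]sub0r.
  by apply: G'B => //; apply: G'G.
have G'sum m (c : nat -> A) (g : nat -> T) : (forall i, (i < m)%N -> G' (c i) (g i)) ->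
    G' (\sum_(i < m) c i) (\sum_(i < m) g i).
  elim: m => [|m IH] h; first by rewrite !big_ord0; apply: G'G.
  by rewrite !big_ord_recr /=; apply: G'D; [apply: IH => i im; apply/h/ltnW|apply: h].
apply: nr0; exists u0; apply: (Gmax G' _ G'G).
  split.
  - by move=> a t /G0; apply: G'G.
  - move=> _ _ [c [g [h -> ->]]]; rewrite !rmorph_sum; apply: eq_bigr => i _.
    by rewrite !rmorphM !rmorphXn hu0 (Gpi _ _ (h i (ltn_ord i))).
  - move=> t [c [g [h h0 ->]]].
    (* By independence all coefficients lie in the maximal ideal, where [G] is basic; so the whole
       pair is basic and [basic0] applies. *)
    have hM' := indep c g h; rewrite -h0 in hM'; have {}hM' := hM' (ideal0 hM).
    apply: basic0; rewrite h0.
    have hb m : (m <= p)%N -> basic (\sum_(i < m) c i * r0 ^+ i) (\sum_(i < m) g i * u0 ^+ i).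
      elim: m => [|m IH] mp.
        by rewrite !big_ord0; have := basicD basicp (basicN basicp); rewrite !subrr.
      rewrite !big_ord_recr /=; apply: basicD; first by apply: IH; apply: ltnW.
      have [u hu] := span_basic (hM' m mp).
      rewrite (Guniq _ _ _ (h m mp) (Gb _ _ hu)) mulrC [u * _]mulrC.
      by apply: basicM => //; rewrite !rmorphXn hu0.
    exact: hb (leqnn _).
  split=> // _ _ _ _ [c [g [h -> ->]]] [c' [g' [h' -> ->]]].
  rewrite !mulr_suml; apply: (G'sum p (fun i => c i * r0 ^+ i * _) (fun i => g i * u0 ^+ i * _)) => i ip.
  rewrite !mulr_sumr; apply: (G'sum p (fun j => c i * r0 ^+ i * (c' j * r0 ^+ j)) (fun j => g i * u0 ^+ i * (g' j * u0 ^+ j))) => j jp.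
  rewrite mulrACA -exprD [X in G' _ X]mulrACA -exprD.
  by apply/G'mono/GM; auto.
by have := G'mono _ _ 1%N G1; rewrite !mul1r !expr1.
Qed.
End Lifting.

Lemma factor (A B T : comNzRingType) (f : {rmorphism A -> B}) (g : {rmorphism A -> T}) :
  (forall b, exists a, f a = b) -> (forall a, f a = 0 -> g a = 0) ->
  exists h : {rmorphism B -> T}, forall a, h (f a) = g a.
Proof.
move=> sf k; have [s hs] := choice sf.
have hE a : g (s (f a)) = g a.
  by apply/eqP; rewrite -subr_eq0 -rmorphB k // rmorphB hs subrr.
have [h hh] : exists h : {rmorphism B -> T}, h =1 g \o s.
  apply: rmorphism_of => [|a b|a b] /=; first by rewrite -(rmorph1 f) hE rmorph1.
    by rewrite -{1}(hs a) -{1}(hs b) -rmorphD hE rmorphD.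
  by rewrite -{1}(hs a) -{1}(hs b) -rmorphM hE rmorphM.
by exists h => a; rewrite hh /= hE.
Qed.

(** A ring map to [C/J], kept as a map into [C] so that the successive lifts have one type and admit
    a limit. *)
Definition hom_mod (A C : comNzRingType) (J : C -> Prop) (th : A -> C) :=
  [/\ J (th 1 - 1), forall a b, J (th (a + b) - (th a + th b)) & forall a b, J (th (a * b) - th a * th b)].

Section LiftLimit.
Variables (A C : comNzRingType) (p n : nat) (x : nat -> A) (e : nat -> C).
Hypotheses (pp : prime.prime p) (xn : x n = p%:R) (en : e n = p%:R).
Hypotheses (loc : forall a, ~ span n.+1 x a -> exists b, b * a = 1) (M1 : ~ span n.+1 x 1).
Hypothesis KR : koszul n.+1 x.

Lemma lift_step (J J' : C -> Prop) (th : A -> C) : ideal J -> ideal J' -> sub J' J -> ~ J 1 ->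
  (forall a b, J a -> J b -> J' (a * b)) -> (forall i a, (i < n.+1)%N -> J a -> J' (e i * a)) ->
  hom_mod J th -> (forall i, (i < n.+1)%N -> J (th (x i) - e i)) ->
  exists th', [/\ hom_mod J' th', forall a, J (th' a - th a) & forall i, (i < n.+1)%N -> J' (th' (x i) - e i)].
Proof.
move=> hJ hJ' J'J J1 sq kill [h1 hD hM] hx.
have [E [f [sf kf]]] := quotient_ring hJ J1.
have [E' [f' [sf' kf']]] := quotient_ring hJ' (fun h => J1 (J'J _ h)).
have eqf a b : J (a - b) -> f a = f b by move=> /kf; rewrite rmorphB => /eqP; rewrite subr_eq0 => /eqP.
have eqf' a b : f' a = f' b -> J' (a - b) by move=> h; apply/kf'; rewrite rmorphB h subrr.
have [g gf] : exists g : {rmorphism E' -> E}, forall a, g (f' a) = f a.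
  by apply: factor => // a /kf' /J'J /kf.
have [phi hphi] : exists phi : {rmorphism A -> E}, phi =1 f \o th.
  apply: rmorphism_of => [|a b|a b] /=; first by rewrite (eqf _ 1) // rmorph1.
    by rewrite (eqf _ _ (hD a b)) rmorphD.
  by rewrite (eqf _ _ (hM a b)) rmorphM.
have [psi [hpsi psix]] : exists psi : {rmorphism A -> E'}, (forall a, g (psi a) = phi a) /\
    forall i, (i < n.+1)%N -> psi (x i) = f' (e i).
  apply: (@lifting A E' E g phi p n x (f' \o e)) => //.
  - by rewrite /= en rmorph_nat.
  - by move=> b; have [a <-] := sf b; exists (f' a).
  - move=> d hd d' hd'; have [a ea] := sf' d; have [a' ea'] := sf' d'.
    rewrite -ea -ea' -rmorphM; apply/kf'; apply: sq; apply/kf; rewrite -gf; [by rewrite ea|by rewrite ea'].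
  - move=> i ir d hd; have [a ea] := sf' d.
    rewrite -ea -rmorphM; apply/kf'; apply: kill => //; apply/kf; by rewrite -gf ea.
  - by move=> i ir; rewrite /= gf hphi /= (eqf _ _ (hx i ir)).
have [th' hth'] := choice (fun a => sf' (psi a)).
exists th'; split.
- split=> [|a b|a b]; apply: eqf'; rewrite ?rmorphD ?rmorphM !hth' ?rmorph1 ?rmorphD ?rmorphM //.
- by move=> a; apply/kf; rewrite rmorphB -gf hth' hpsi hphi /= subrr.
- by move=> i ir; apply: eqf'; rewrite hth' psix.
Qed.

Lemma lifting_limit (r : nat) (y : nat -> C) (J : C -> Prop) (th : A -> C) :
  complete r y -> separated r y -> ideal J -> ~ J 1 -> sub J (span r y) ->
  (forall a, (forall L, exists2 j, J j & ipow r y L (a - j)) -> J a) ->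
  (forall i, (i < n.+1)%N -> span r y (e i)) ->
  hom_mod J th -> (forall i, (i < n.+1)%N -> J (th (x i) - e i)) ->
  exists psi : {rmorphism A -> C}, (forall a, J (psi a - th a)) /\ forall i, (i < n.+1)%N -> psi (x i) = e i.
Proof.
move=> hc hs hJ J1 JM cl eM hth hx.
(* The intersection of [J] and [(y)^L]. As [J] and all [e i] lie in [(y)], its square and its
   products with the [e i] fall into the next term, so each step is a square-zero lifting. *)
pose JL L a := J a /\ ipow r y L a.
have hJL L : ideal (JL L) by apply: (submod_capm hJ); apply: ideal_ipow.
have J0 : sub J (JL 0%N) by move=> a ha; split.
pose good L th := hom_mod (JL L) th /\ forall i, (i < n.+1)%N -> JL L (th (x i) - e i).
have [step hstep] : exists step : nat -> (A -> C) -> A -> C, forall L th, good L th ->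
    good L.+1 (step L th) /\ forall a, JL L (step L th a - th a).
  have /choice [st hst] : forall q : nat * (A -> C), exists th', good q.1 q.2 ->
      good q.1.+1 th' /\ forall a, JL q.1 (th' a - q.2 a).
    move=> [L t] /=; case: (EM (good L t)) => [[h1 h2]|]; last by exists t.
    have [||a b [ha _] [hb hb']|i a ir [ha ha']|th' [h3 h4 h5]] := @lift_step (JL L) (JL L.+1) t (hJL _) (hJL _) _ _ _ _ h1 h2.
    - by move=> a [h h']; split=> //; apply: ipow_le h'.
    - by move=> [].
    - split; first exact: idealM.
      by rewrite -add1n; apply: ipowM => //; apply/ipow1; apply: JM.
    - split; first exact: idealM.
      by rewrite -add1n; apply: ipowM => //; apply/ipow1; apply: eM.
    by exists th'.
  by exists (fun L t => st (L, t)) => L t; apply: (hst (L, t)).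
pose t := fix t L := if L is L.+1 then step L (t L) else th.
have ht L : good L (t L).
  elim: L => [|L IH]; last by have [] := hstep L _ IH.
  case: hth => h1 h2 h3; split; [split=> *; apply: J0; auto|by move=> i ir; apply: J0; apply: hx].
have tS L a : JL L (t L.+1 a - t L a) by have [_] := hstep L _ (ht L); apply.
have /choice [lim hlim] : forall a, exists s, forall L, ipow r y L (s - t L a).
  move=> a; have [|s h] := hc (fun L => t L.+1 a - t L a); first by move=> L; case: (tS L a).
  exists (s + th a) => L; have -> : s + th a - t L a = s - \sum_(i < L) (t i.+1 a - t i a).
    by rewrite -(big_mkord xpredT (fun i => t i.+1 a - t i a)) telescope_sumr //= opprB addrA.
  exact: h.
have hI L := ideal_ipow r y L.
have lim_eq a b : (forall L, ipow r y L (t L a - b)) -> lim a = b.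
  move=> h; apply/eqP; rewrite -subr_eq0; apply/eqP; apply: hs => L.
  by rewrite -(subrK (t L a) (lim a)) -addrA; apply: idealD.
have [psi hpsi] : exists psi : {rmorphism A -> C}, psi =1 lim.
  apply: rmorphism_of => [|a b|a b]; apply: lim_eq => L; have [[[_ h1] hD hM] _] := ht L => //.
    have [_ h] := hD a b; have -> : t L (a + b) - (lim a + lim b) =
      t L (a + b) - (t L a + t L b) - ((lim a - t L a) + (lim b - t L b)) by ring.
    by apply: (idealB (hI L)) => //; apply: (idealD (hI L)).
  have [_ h] := hM a b; have -> : t L (a * b) - lim a * lim b =
      t L (a * b) - t L a * t L b - ((lim a - t L a) * lim b + t L a * (lim b - t L b)) by ring.
  by apply: (idealB (hI L)) => //; apply: (idealD (hI L)); [apply: (idealMr _ (hI L))|apply: (idealM _ (hI L))].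
exists psi; split=> [a|i ir]; rewrite hpsi; last first.
  by apply: lim_eq => L; have [_ /(_ i ir) []] := ht L.
apply: cl => L; exists (t L a - th a).
  elim: L => [|L IH]; first by rewrite subrr; apply: ideal0.
  rewrite -(subrK (t L a) (t L.+1 a)) -addrA; apply: idealD => //; by case: (tS L a).
by have -> : lim a - th a - (t L a - th a) = lim a - t L a by ring.
Qed.
End LiftLimit.

(** * Power series in several variables *)

Section PSMaps.
Variables (K K' : comNzRingType).
Definition ps_aug (f : ps K) : K := pcoef f 0.
Fact ps_aug_nmod : nmod_morphism ps_aug. Proof. by []. Qed.
Fact ps_aug_monoid : monoid_morphism ps_aug. Proof. by split=> // f g; apply: pcoefM0. Qed.
HB.instance Definition _ := GRing.isNmodMorphism.Build (ps K) K ps_aug ps_aug_nmod.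
HB.instance Definition _ := GRing.isMonoidMorphism.Build (ps K) K ps_aug ps_aug_monoid.

Variable h : {rmorphism K -> K'}.
Definition ps_map (f : ps K) : ps K' := PS (fun i => h (pcoef f i)).
Fact ps_map_nmod : nmod_morphism ps_map.
Proof. by split=> [|f g]; apply: psP => i; rewrite ?pcoefD !pcoefE ?rmorph0 // rmorphD. Qed.
Fact ps_map_monoid : monoid_morphism ps_map.
Proof.
split=> [|f g]; apply: psP => i; first by rewrite pcoefE !pcoef1 rmorph_nat.
rewrite pcoefE !pcoefM rmorph_sum; apply: eq_bigr => j _; exact: rmorphM.
Qed.
HB.instance Definition _ := GRing.isNmodMorphism.Build (ps K) (ps K') ps_map ps_map_nmod.
HB.instance Definition _ := GRing.isMonoidMorphism.Build (ps K) (ps K') ps_map ps_map_monoid.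
Lemma ps_mapC a : ps_map (psC a) = psC (h a).
Proof. by apply: psP => i; rewrite !pcoefE; case: eqP => // _; apply: rmorph0. Qed.
Lemma ps_mapX : ps_map (psX K) = psX K'.
Proof. by apply: psP => i; rewrite !pcoefE rmorph_nat. Qed.
End PSMaps.

Fixpoint PSn (n : nat) (K : comNzRingType) : comNzRingType :=
  if n is m.+1 then ps (PSn m K) : comNzRingType else K.

(** Indices below [n] are the variables, and index [n + j] is the constant [y j]; the list thus
    generates the ideal [(t, y)]. *)
Fixpoint psv (n : nat) (K : comNzRingType) (y : nat -> K) : nat -> PSn n K :=
  if n is m.+1 then scons (@psv m K y) else y.

Fixpoint psnC (n : nat) (K : comNzRingType) : {rmorphism K -> PSn n K} :=
  match n with
  | 0 => (idfun : {rmorphism K -> K})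
  | m.+1 => (@psC (PSn m K) \o @psnC m K : {rmorphism K -> ps (PSn m K)})
  end.

Fixpoint psn_aug (n : nat) (K : comNzRingType) : {rmorphism PSn n K -> K} :=
  match n with
  | 0 => (idfun : {rmorphism K -> K})
  | m.+1 => (@psn_aug m K \o @ps_aug (PSn m K) : {rmorphism ps (PSn m K) -> K})
  end.

Fixpoint psn_map (n : nat) (K K' : comNzRingType) (h : {rmorphism K -> K'}) : {rmorphism PSn n K -> PSn n K'} :=
  match n with
  | 0 => h
  | m.+1 => (ps_map (@psn_map m K K' h) : {rmorphism ps (PSn m K) -> ps (PSn m K')})
  end.

Section IteratedPS.
Variable K : comNzRingType.
Implicit Types (n r : nat) (y : nat -> K).

Lemma psn_complete n r y : complete r y -> complete (n + r) (psv n y).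
Proof. by move=> h; elim: n => [//|n IH]; apply: ps_complete. Qed.
Lemma psn_separated n r y : separated r y -> separated (n + r) (psv n y).
Proof. by move=> h; elim: n => [//|n IH]; apply: ps_separated. Qed.
Lemma psn_noeth n : noethR K -> noethR (PSn n K).
Proof. by move=> h; elim: n => [//|n IH]; apply: ps_noeth. Qed.
Lemma psv_base n y i : psv n y (n + i) = psnC n K (y i).
Proof. by elim: n => [//|n IH]; rewrite addSn /= IH. Qed.
Lemma psv_eq n y y' i : (i < n)%N -> psv n y i = psv n y' i.
Proof. by elim: n i => [|n IH] [|i] //= h; rewrite (IH i). Qed.
Lemma psn_augC n a : psn_aug n K (psnC n K a) = a.
Proof. by elim: n => [//|n IH] /=; rewrite /ps_aug pcoefE. Qed.
Lemma psn_augv n y i : (i < n)%N -> psn_aug n K (psv n y i) = 0.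
Proof.
elim: n i => [//|n IH] [|i] h /=; first by rewrite /ps_aug pcoefE rmorph0.
by rewrite /ps_aug pcoefE; apply: IH.
Qed.
Lemma psn_aug_span n y f : span n (psv n y) (f - psnC n K (psn_aug n K f)).
Proof.
elim: n f => [|n IH] f; first by rewrite subrr; apply: ideal0; apply: ideal_span.
have hI := ideal_span n.+1 (psv n.+1 y).
have /= -> : f - psnC n.+1 K (psn_aug n.+1 K f) =
   psC (pcoef f 0 - psnC n K (psn_aug n K (pcoef f 0))) + pshift 1 f * psX _.
  by rewrite {1}(ps_decomp1 f) rmorphB /= /ps_aug; ring.
apply: (idealD hI).
  apply: (span_sub hI _ (span_image _ (IH (pcoef f 0)))) => i ir; exact: (@span_mem _ n.+1 (psv n.+1 y) i.+1).
apply: (idealM _ hI); exact: (@span_mem _ n.+1 (psv n.+1 y) 0).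
Qed.

Lemma psn_eval n (T : comNzRingType) (f : {rmorphism K -> T}) r (w : nat -> T) (z : nat -> T) y :
  complete r w -> separated r w -> (forall i, (i < n)%N -> span r w (z i)) ->
  exists g : {rmorphism PSn n K -> T}, (forall a, g (psnC n K a) = f a) /\
    forall i, (i < n)%N -> g (psv n y i) = z i.
Proof.
move=> hc hs; elim: n z => [|n IH] z hz; first by exists f.
have [g [gC gv]] := IH (fun i => z i.+1) (fun i ir => hz i.+1 ir).
have [h [hC hX]] := ps_eval g hc hs (hz 0%N (ltn0Sn n)).
exists h; split=> [a|]; first by rewrite /= hC.
by move=> [|i] ir; rewrite /= ?hX // hC gv.
Qed.
End IteratedPS.

Lemma psn_mapC n (K K' : comNzRingType) (h : {rmorphism K -> K'}) a : psn_map n h (psnC n K a) = psnC n K' (h a).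
Proof. by elim: n => [//|n IH] /=; rewrite ps_mapC IH. Qed.
Lemma psn_mapv n (K K' : comNzRingType) (h : {rmorphism K -> K'}) y i : psn_map n h (psv n y i) = psv n (h \o y) i.
Proof.
elim: n i => [//|n IH] [|i] /=; first exact: ps_mapX.
by rewrite ps_mapC IH.
Qed.
Lemma psn_map_aug n (K K' : comNzRingType) (h : {rmorphism K -> K'}) f : psn_aug n K' (psn_map n h f) = h (psn_aug n K f).
Proof. by elim: n f => [//|n IH] f /=; rewrite /ps_aug pcoefE IH. Qed.
Lemma psn_map_surj n (K K' : comNzRingType) (h : {rmorphism K -> K'}) : (forall b, exists a, h a = b) ->
  forall F a, h a = psn_aug n K' F -> exists2 G, psn_map n h G = F & psn_aug n K G = a.
Proof.
move=> sh; elim: n => [|n IH] /= F a ha; first by exists a.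
have surj F' : exists G, psn_map n h G = F'.
  by have [b hb] := sh (psn_aug n K' F'); have [G hG _] := IH F' b hb; exists G.
have [g hg] := choice surj; have [G0 h0 h0'] := IH _ _ ha.
exists (PS (fun i => if i == 0%N then G0 else g (pcoef F i))).
  by apply: psP => -[|i]; rewrite /ps_map !pcoefE /= ?h0 ?hg.
by rewrite /ps_aug pcoefE.
Qed.

Lemma nilpotent_complete (T : comNzRingType) r (y : nat -> T) N :
  (forall a, ipow r y N a -> a = 0) -> complete r y /\ separated r y.
Proof.
move=> h; split; last by move=> x hx; apply: h.
move=> a ha; exists (\sum_(i < N) a i) => L.
case: (leqP L N) => LN.
  rewrite -(subnKC LN) big_split_ord /= addrAC subrr add0r.
  by apply: ideal_sum => [|i _]; [exact: ideal_ipow|apply: ipow_le (ha _); rewrite leq_addr].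
rewrite -(subnKC (ltnW LN)) big_split_ord /= opprD addrA subrr add0r.
rewrite big1 ?oppr0; first exact: ideal0 (ideal_ipow _ _ _).
by move=> i _; apply: h; apply: ipow_le (ha _); rewrite leq_addr.
Qed.

Section Completion.
Variables (R : comNzRingType) (r : nat) (x : nat -> R).
Hypotheses (nR : noethR R) (M1 : ~ span r x 1).
Hypothesis loc : forall a, ~ span r x a -> exists b, b * a = 1.

(** The completion is [R[[T]]/(T_j - x_j)]. It maps to each [R/(x)^(L+1)], and this yields the last
    clause. *)
Lemma completion : exists (A : comNzRingType) (i : {rmorphism R -> A}),
  [/\ noethR A, complete r (i \o x), separated r (i \o x), 
      forall a, exists c, span r (i \o x) (a - i c) &
      forall L c, ipow r (i \o x) L (i c) -> ipow r x L c].
Proof.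
pose v := psv r (fun _ : nat => 0 : R).
pose J := span r (fun j => v j - psnC r R (x j)).
have hJ : ideal J by apply: ideal_span.
have M1L L : ~ ipow r x L.+1 1 by move=> h; apply: M1; apply/ipow1; apply: ipow_le h.
have ev L : exists (Q : comNzRingType) (f : {rmorphism R -> Q}) (g : {rmorphism PSn r R -> Q}),
    [/\ forall b, exists a, f a = b, forall c, f c = 0 <-> ipow r x L.+1 c, forall c, g (psnC r R c) = f c &
        forall j, (j < r)%N -> g (v j) = f (x j)].
  have [Q [f [sf kf]]] := quotient_ring (ideal_ipow r x L.+1) (@M1L L).
  have [|hc hs] := @nilpotent_complete Q r (f \o x) L.+1.
    by move=> a /(ipow_lift sf) [b /kf hb <-].
  have [|g [h1 h2]] := @psn_eval R r Q f r (f \o x) (f \o x) (fun=> 0) hc hs.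
    by move=> i ir; apply: (span_mem (f \o x)).
  by exists Q, f, g.
have gJ (Q : comNzRingType) (f : {rmorphism R -> Q}) (g : {rmorphism PSn r R -> Q}) :
    (forall c, g (psnC r R c) = f c) -> (forall j, (j < r)%N -> g (v j) = f (x j)) -> forall F, J F -> g F = 0.
  move=> h1 h2; apply: span_sub; first exact: (ideal_preim (J := fun z => z = 0) g (@submod_zero Q Q^o)).
  by move=> j jr; rewrite rmorphB h1 h2 // subrr.
have J1 : ~ J 1.
  have [Q [f [g [sf kf h1 h2]]]] := ev 0%N.
  by move=> /(gJ Q f g h1 h2) /eqP; rewrite rmorph1 oner_eq0.
have [A [q [sq kq]]] := quotient_ring hJ J1.
pose i : {rmorphism R -> A} := q \o psnC r R.
have qv j : (j < r)%N -> q (v j) = i (x j).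
  move=> jr; apply/eqP; rewrite -subr_eq0 -rmorphB; apply/eqP/kq.
  exact: (span_mem (fun j => v j - psnC r R (x j))).
have spE L : forall a, ipow r (q \o v) L a <-> ipow r (i \o x) L a.
  move=> a; split; apply: ipow_mono => j jr.
    by rewrite [(_ \o _) j]qv //; apply: (span_mem (i \o x)).
  have -> : (i \o x) j = (q \o v) j by symmetry; apply: qv.
  exact: span_mem.
exists A, i; have cv : complete r v by have := @psn_complete R r 0 (fun=> 0) (@complete0 _ _); rewrite addn0.
have sv : separated r v by have := @psn_separated R r 0 (fun=> 0) (@separated0 _ _); rewrite addn0.
have nA : noethR A by apply: (noeth_image sq); apply: psn_noeth.
have jA : jac r (q \o v) by apply: jac_image => //; apply: complete_jac.
split=> //.
- move=> a ha; have [|s hs] := complete_image sq cv (a := a); first by move=> L; apply/spE.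
  by exists s => L; apply/spE.
- by move=> a ha; apply: (noeth_separated nA jA) => L; apply/spE.
- move=> a; have [F <-] := sq a; exists (psn_aug r R F).
  rewrite -[i _]/(q (psnC r R _)) -rmorphB; apply/ipow1/spE/ipow1; apply: span_image; exact: psn_aug_span.
move=> [//|L] c /spE /(ipow_lift sq) [F hF eF].
have [Q [f [g [sf kf h1 h2]]]] := ev L; apply/kf; rewrite -h1.
have -> : psnC r R c = F - (F - psnC r R c) by rewrite subKr.
rewrite rmorphB (gJ Q f g h1 h2 (F - _)) ?subr0; last by apply/kq; rewrite rmorphB eF subrr.
have : ipow r (f \o x) L.+1 (g F).
  by apply: ipow_mono (ipow_image g hF) => j jr /=; rewrite h2 //; apply: (span_mem (f \o x)).
by move=> /(ipow_lift sf) [b /kf hb <-].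
Qed.
End Completion.

(** * Completion and flatness *)

Section FiniteModules.
Variables (R : comNzRingType) (V : lmodType R).
Hypothesis nR : noethR R.
Implicit Types (W Z : V -> Prop).

Lemma noeth_cyclic W v : submod W -> noeth (addm W (lin 1 v)) W.
Proof.
move=> hW U hU WU UZ.
pose q (a : R) := U (a *: v 0%N).
have hq : ideal q.
  apply/idealP; split; rewrite /q.
  - by rewrite scale0r; apply: submod0.
  - by move=> x y hx hy; rewrite scalerDl; apply: submodD.
  - by move=> a x hx; rewrite -scalerA; apply: submodZ.
have [r [c hc]] := noethR_fg nR hq.
exists r, (fun i => c i *: v 0%N); split; first by move=> i ir; apply/hc; apply: span_mem.
move=> x Ux; have [w [_ [hw /lin1 [a ->] e]]] := UZ x Ux.
have /hc /spanP [d hd] : q a.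
  by apply: (submodDl hU (WU w hw)); rewrite -e.
exists d; rewrite e hd scaler_suml -addrA -sumrB big1 ?addr0 // => i _.
by rewrite scalerA subrr.
Qed.

Lemma noeth_lin W r v : submod W -> noeth (addm W (lin r v)) W.
Proof.
move=> hW; elim: r => [|r IH].
  move=> U hU WU UZ; exists 0%N, v; split=> // x /UZ [w [_ [hw [c ->] ->]]].
  by exists c; rewrite !big_ord0 addr0 subr0.
have h1 : submod (addm W (lin r v)) by apply: submod_addm => //; apply: submod_lin_span.
have h2 : submod (addm W (lin r.+1 v)) by apply: submod_addm => //; apply: submod_lin_span.
apply: (noeth_trans h2 h1 hW) => //.
- by apply: addml; apply: submod_lin_span.
- apply: (addm_sub h2); first by apply: addml; apply: submod_lin_span.
  move=> x hx; apply: (addmr hW); apply: (lin_sub _ hx) => i ir; apply: lin_mem; exact: ltnW.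
apply: (noeth_sub (noeth_cyclic (v := fun=> v r) h1) h1) => //.
move=> _ [w [_ [hw [c ->] ->]]]; rewrite big_ord_recr /=.
exists (w + \sum_(i < r) c i *: v i), (c r *: v r); split; last by rewrite addrA.
  by exists w, (\sum_(i < r) c i *: v i); split=> //; exists c.
by apply/lin1; exists (c r).
Qed.

Lemma ipow_scale r (y : nat -> R) L Z a z : submod Z -> ipow r y L a -> Z z -> ipowm r y L Z (a *: z).
Proof.
move=> hZ; elim: L a => [|L IH] a; first by move=> _ hz; apply: (submodZ hZ).
move=> /ipowS_E [u [hu ->]] hz; rewrite scaler_suml.
apply: submod_sum => [|i _]; first exact: submod_ipowm.
by rewrite -scalerA; apply: (ipowm_mul (V := V)) => //; apply: IH => //; apply: hu.
Qed.
End FiniteModules.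

Section Columns.
Variable R : comNzRingType.

Lemma col_lin g (v : 'cV[R]_g.+1) : lin g.+1 (fun j => delta_mx (inord j) 0) v.
Proof.
exists (fun j => v (inord j) 0); apply/colP => j; rewrite summxE (bigD1 j) //= inord_val !mxE !eqxx mulr1.
rewrite big1 ?addr0 // => l /negbTE nl; rewrite !mxE inord_val eq_sym nl mulr0 //.
Qed.
Lemma noeth_col g : noethR R -> noeth (V := 'cV[R]_g) full (fun x => x = 0).
Proof.
move=> nR; case: g => [|g].
  move=> U hU _ _; exists 0%N, (fun=> 0); split=> // x _; exists (fun=> 0); rewrite big_ord0 subr0.
  by apply/colP => -[].
have h0 := @submod_zero R 'cV[R]_g.+1.
apply: (noeth_sub (noeth_lin nR (r := g.+1) (v := fun j => delta_mx (inord j) 0) h0) h0) => // x _.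
by apply: (addmr h0); apply: col_lin.
Qed.
Lemma ipowm_col g r (y : nat -> R) L (v : 'cV[R]_g) :
  ipowm r y L full v <-> forall j, ipow r y L (v j 0).
Proof.
split.
  elim: L v => [|L IH] v; first by move=> _ j.
  move=> [u [hu ->]] j; rewrite summxE; apply: ideal_sum => [|i _]; first exact: ideal_ipow.
  by rewrite mxE; apply: ipow_mulvar => //; apply: IH; apply: hu.
case: g v => [|g] v h.
  by rewrite (_ : v = 0); [apply: submod0; apply: submod_ipowm|apply/colP => -[]].
have -> : v = \sum_(j < g.+1) v j 0 *: delta_mx j 0.
  by rewrite [LHS]matrix_sum_delta; apply: eq_bigr => i _; rewrite big_ord1.
apply: submod_sum => [|i _]; first exact: submod_ipowm.
exact: ipow_scale.
Qed.
End Columns.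

Lemma ipow_exp (R : comNzRingType) r (y : nat -> R) i N : (i < r)%N -> ipow r y N (y i ^+ N).
Proof. by move=> ir; elim: N => [//|N IH]; rewrite exprS; apply: ipow_mulvar. Qed.

(* Artin-Rees, in the weak form needed for completions *)
Lemma artin_rees (R : comNzRingType) g h (B : 'M[R]_(h, g)) r (y : nat -> R) N :
  noethR R -> jac r y -> (forall a, ~ span r y a -> exists b, b * a = 1) ->
  exists L, forall a : 'cV[R]_g, ipowm r y L full (B *m a) ->
    addm (fun c => B *m c = 0) (ipowm r y N full) a.
Proof.
move=> nR hj loc.
pose K (c : 'cV[R]_g) := B *m c = 0.
have hK : submod K.
  by split; rewrite /K ?mulmx0 // => a u v hu hv; rewrite mulmxDr -scalemxAr hu hv scaler0 addr0.
pose Q (U : 'cV[R]_g -> Prop) := sub K U -> exists L, forall a, ipowm r y L full (B *m a) -> U a.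
have hW : submod (addm K (ipowm r y N full)) by apply: submod_addm => //; apply: submod_ipowm.
suff : Q (addm K (ipowm r y N full)) by apply; apply: addml; apply: submod_ipowm.
apply: (@irreducible_ind R 'cV[R]_g full (addm K (ipowm r y N full)) Q nR) => //.
- by apply: (noeth_sub (@noeth_col R g nR) hW) => // ? ->; apply: submod0.
- by exists 0%N.
- move=> U1 U2 h1 h2 KU; have [|L1 hL1] := h1; first by move=> x /KU [].
  have [|L2 hL2] := h2; first by move=> x /KU [].
  exists (maxn L1 L2) => a ha; split; [apply: hL1|apply: hL2]; apply: ipowm_le ha => //.
    by rewrite leq_maxl.
  by rewrite leq_maxr.
move=> U a0 q hU WU _ _ nUa0 pq qE irr _ KU; apply: contrapT => hn.
have mq i : (i < r)%N -> q (y i).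
  move=> ir; apply: (primeX (k := N) pq); apply/qE; apply: WU; apply: addmr => //.
  by apply: ipow_scale => //; apply: ipow_exp.
have [hq q1 qM] := pq.
have unit z : ~ q z -> exists b, b * z = 1.
  by move=> nz; apply: loc => hz; apply: nz; apply: (span_sub hq mq hz).
pose BU (x : 'cV[R]_h) := exists2 u, U u & x = B *m u.
have hBU : submod BU.
  split; first by exists 0; [apply: submod0|rewrite mulmx0].
  move=> c _ _ [u hu ->] [v hv ->]; exists (c *: u + v); first exact: (proj2 hU).
  by rewrite mulmxDr -scalemxAr.
(* For every [L] a vector [a] outside [U] has [B a] in [(y)^L]. Up to a unit, [a0] is a multiple of
   [a] modulo [U], so [B a0] lies in the closure of the image of [U]. *)
suff [u hu e] : BU (B *m a0).
  apply: nUa0; rewrite -(subrK u a0); apply: submodD => //; apply: KU.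
  by rewrite /K mulmxBr e subrr.
apply: (@krull_closed R 'cV[R]_h full BU r y _ hj _ (@submod_full _ _) hBU) => //.
  by apply: (noeth_sub (@noeth_col _ h nR) hBU) => // ? ->; apply: submod0.
move=> L.
have [a [ha na]] : exists a, ipowm r y L full (B *m a) /\ ~ U a.
  apply: contrapT => hn'; apply: hn; exists L => a ha; apply: contrapT => na.
  by apply: hn'; exists a.
have [z [s [nz hz]]] := irr a Logic.I na; have [b hb] := unit z nz.
exists (B *m (b *: (z *: a0 - s *: a))), (B *m ((b * s) *: a)); split.
- by exists (b *: (z *: a0 - s *: a)) => //; apply: submodZ.
- by rewrite -scalemxAr; apply: submodZ => //; apply: submod_ipowm.
by rewrite -mulmxDr scalerBr !scalerA hb scale1r subrK.
Qed.

Section Flatness.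
Variables (R A : comNzRingType) (i : {rmorphism R -> A}) (r : nat) (x : nat -> R).
Hypotheses (nR : noethR R) (nA : noethR A) (jR : jac r x) (jA : jac r (i \o x)).
Hypothesis loc : forall a, ~ span r x a -> exists b, b * a = 1.
Hypothesis dense : forall a, exists c, span r (i \o x) (a - i c).
Hypothesis sub_ipow : forall L c, ipow r (i \o x) L (i c) -> ipow r x L c.

Lemma dense_ipow L a : exists c, ipow r (i \o x) L (a - i c).
Proof.
have [||||_ [c ->] h] := @ipow_approx A r (i \o x) (fun b => exists c, b = i c) _ _ _ _ L a.
- by exists 0; rewrite rmorph0.
- by move=> _ _ [b ->] [c ->]; exists (b + c); rewrite rmorphD.
- by move=> j _ _ [c ->]; exists (x j * c); rewrite rmorphM.
- by move=> b; have [c hc] := dense b; exists (i c) => //; exists c.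
by exists c.
Qed.

Lemma dense_col g L (a : 'cV[A]_g) : exists c : 'cV[R]_g, ipowm r (i \o x) L full (a - map_mx i c).
Proof.
have [f hf] := choice (fun j => dense_ipow L (a j 0)).
by exists (\col_j f j); apply/ipowm_col => j; rewrite !mxE.
Qed.

Lemma map_ipowm g L (c : 'cV[R]_g) : ipowm r (i \o x) L full (map_mx i c) -> ipowm r x L full c.
Proof. by move=> /ipowm_col h; apply/ipowm_col => j; apply: sub_ipow; have := h j; rewrite mxE. Qed.
Lemma map_ipowm' g L (c : 'cV[R]_g) : ipowm r x L full c -> ipowm r (i \o x) L full (map_mx i c).
Proof. by move=> /ipowm_col h; apply/ipowm_col => j; rewrite mxE; apply: ipow_image. Qed.
Lemma mulmx_ipowm (T : comNzRingType) (y : nat -> T) g h (B : 'M[T]_(h, g)) L (c : 'cV[T]_g) :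
  ipowm r y L full c -> ipowm r y L full (B *m c).
Proof.
move=> /ipowm_col hc; apply/ipowm_col => j; rewrite mxE; apply: ideal_sum => [|l _]; first exact: ideal_ipow.
by apply: idealM => //; apply: ideal_ipow.
Qed.

(** The equational criterion: [c] is approximated by a vector over [R] whose image under [B] is
    small, Artin-Rees turns it into an exact relation, and the span of the relations over [R] is
    closed. *)
Lemma completion_flat g h (B : 'M[R]_(h, g)) (c : 'cV[A]_g) : map_mx i B *m c = 0 ->
  exists l (e : nat -> A) (s : nat -> 'cV[R]_g), (forall k, (k < l)%N -> B *m s k = 0) /\
    c = \sum_(k < l) e k *: map_mx i (s k).
Proof.
move=> hc.
pose K (c : 'cV[R]_g) := B *m c = 0.
have hK : submod K.
  by split; rewrite /K ?mulmx0 // => a u v hu hv; rewrite mulmxDr -scalemxAr hu hv scaler0 addr0.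
have h0 := @submod_zero R 'cV[R]_g.
have [l [s hs]] := noeth_fg (@noeth_col _ g nR) h0 hK (fun x hx => etrans (f_equal (mulmx B) hx) (mulmx0 _ _)) (fun _ _ => Logic.I).
exists l; suff [e he] : lin l (fun k => map_mx i (s k)) c.
  exists e, s; split=> // k kl; apply/hs; apply: (addmr h0); exact: lin_mem.
apply: (@krull_closed A 'cV[A]_g full _ r (i \o x) _ jA _ (@submod_full _ _) (submod_lin_span _ _)) => //.
  by apply: (noeth_sub (@noeth_col _ g nA)); [apply: submod_lin_span|move=> ? ->; apply: submod0; apply: submod_lin_span|].
move=> N; have [L hL] := artin_rees B N nR jR loc.
have [a ha] := dense_col (maxn L N) c.
have [|k [b [hk hb e]]] := hL a.
  apply: map_ipowm; rewrite map_mxM; have -> : map_mx i B *m map_mx i a = - (map_mx i B *m (c - map_mx i a)).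
    by rewrite mulmxBr hc sub0r opprK.
  apply: submodN; first exact: submod_ipowm.
  apply: mulmx_ipowm; apply: ipowm_le ha => //; exact: leq_maxl.
have /hs [_ [_ [-> [d ->] ek]]] := hk; rewrite add0r in ek.
exists (map_mx i k), (map_mx i b + (c - map_mx i a)); split.
- exists (fun j => i (d j)); rewrite ek raddf_sum; apply: eq_bigr => j _; exact: map_mxZ.
- apply: submodD; [exact: submod_ipowm|exact: map_ipowm'|].
  by apply: ipowm_le ha => //; exact: leq_maxr.
by rewrite addrA -map_mxD -e addrC subrK.
Qed.

End Flatness.

Section Extension.
Variables (A T : comNzRingType) (f : {rmorphism A -> T}).
Implicit Types (I J : A -> Prop).

Definition extend I : T -> Prop := fun t =>
  exists g (b : nat -> A), (forall j, (j < g)%N -> I (b j)) /\ span g (f \o b) t.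

Lemma ideal_extend I : ideal (extend I).
Proof.
split; first by exists 0%N, (fun=> 0); split=> //; apply: ideal0; apply: ideal_span.
move=> a _ _ [g [b [hb /spanP [c ->]]]] [g' [b' [hb' /spanP [c' ->]]]].
exists (g + g')%N, (fun i => if (i < g)%N then b i else b' (i - g)%N); split.
  move=> i ir; case: ltnP => h; first exact: hb.
  by apply: hb'; rewrite ltn_subLR.
apply/spanP; exists (fun i => if (i < g)%N then a * c i else c' (i - g)%N).
rewrite /GRing.scale /= mulr_sumr big_split_ord /=; congr (_ + _); apply: eq_bigr => i _.
  by rewrite ltn_ord mulrA.
by rewrite ltnNge leq_addr /= addKn.
Qed.
Lemma extend_mem I a : I a -> extend I (f a).
Proof. by move=> ha; exists 1%N, (fun=> a); split=> //; apply: (span_mem (f \o fun=> a) (i := 0)). Qed.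
Lemma extend_sub I (J : T -> Prop) : ideal J -> (forall a, I a -> J (f a)) -> sub (extend I) J.
Proof. by move=> hJ h t [g [b [hb]]]; apply: span_sub => // i ir; apply: h; apply: hb. Qed.
Lemma extend_mono I J : sub I J -> sub (extend I) (extend J).
Proof. by move=> h; apply: extend_sub => [|a /h]; [exact: ideal_extend|exact: extend_mem]. Qed.
Lemma extend_span g (b : nat -> A) t : extend (span g b) t <-> span g (f \o b) t.
Proof.
split; last by move=> h; exists g, b; split=> // j jg; apply: span_mem.
by apply: extend_sub; [exact: ideal_span|move=> a; exact: span_image].
Qed.
End Extension.

Lemma jac_sub (T : comNzRingType) r (y : nat -> T) r' (y' : nat -> T) :
  (forall i, (i < r')%N -> span r y (y' i)) -> jac r y -> jac r' y'.
Proof.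
move=> h hj c; have /spanP [d ->] : span r y (\sum_(i < r') c i * y' i); last exact: hj.
by apply: (span_sub (ideal_span _ _) h); apply/spanP; exists c.
Qed.
Lemma jac_unit (T : comNzRingType) r (y : nat -> T) z : jac r y -> span r y z -> exists s, s * (1 - z) = 1.
Proof. by move=> hj /spanP [c ->]. Qed.
Lemma jac_proper (T : comNzRingType) r (y : nat -> T) : jac r y -> ~ span r y 1.
Proof.
by move=> hj /(jac_unit hj) [s]; rewrite subrr mulr0 => /eqP; rewrite eq_sym oner_eq0.
Qed.

(** * Relations between Taylor variables *)

Section KoszulRelations.

Lemma koszul_cons (K : comNzRingType) r (y : nat -> K) : koszul r (fun i => y i.+1) ->
  (forall a, span r (fun i => y i.+1) (y 0%N * a) -> span r (fun i => y i.+1) a) -> koszul r.+1 y.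
Proof.
move=> hK reg c; rewrite big_ord_recl /= => e.
have [|f hf] := reg (c 0%N).
  apply/spanP; exists (fun i => - c i.+1); move/eqP: e; rewrite addr_eq0 => /eqP ->.
  by rewrite -sumrN; apply: eq_bigr => i _; rewrite mulNr mulrC.
have [|s [h1 h2 h3]] := hK (fun i => c i.+1 + f i * y 0%N).
  rewrite -[RHS]e hf mulr_sumr -big_split; apply: eq_bigr => i _ /=.
  by rewrite mulrDr addrC; congr (_ + _); rewrite /GRing.scale /=; ring.
exists (fun i j => match i, j with 0, 0 => 0 | 0, j.+1 => if (j < r)%N then f j else 0
   | i.+1, 0 => if (i < r)%N then - f i else 0 | i.+1, j.+1 => s i j end); split.
- by case.
- by move=> [|i] [|j]; rewrite ?oppr0 //; case: ifP; rewrite ?oppr0 ?opprK.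
case=> [_|i ir].
  by rewrite big_ord_recl mul0r add0r hf; apply: eq_bigr => j _; rewrite /= ltn_ord.
rewrite big_ord_recl /= -[(i < r)%N]/(i.+1 < r.+1)%N ir mulNr; apply/eqP; rewrite eq_sym addrC subr_eq; apply/eqP.
by rewrite h3.
Qed.

Lemma koszul_psC (K : comNzRingType) r (y : nat -> K) : koszul r y -> koszul r (fun i => psC (y i)).
Proof.
move=> hK c e.
have /choice [s hs] : forall l, exists s : nat -> nat -> K, [/\ forall i, s i i = 0, forall i j, s j i = - s i j &
        forall i, (i < r)%N -> pcoef (c i) l = \sum_(j < r) s i j * y j].
  move=> l; apply: hK; have := congr1 (fun f => pcoef f l) e; rewrite pcoef_sum pcoef0 => h.
  by rewrite -[RHS]h; apply: eq_bigr => i _; rewrite pcoefC.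
exists (fun i j => PS (fun l => s l i j)); split.
- by move=> i; apply: psP => l; rewrite pcoefE; have [h _ _] := hs l.
- by move=> i j; apply: psP => l; rewrite pcoefN !pcoefE; have [_ h _] := hs l.
move=> i ir; apply: psP => l; rewrite pcoef_sum; have [_ _ ->] := hs l => //.
by apply: eq_bigr => j _; rewrite pcoefMC.
Qed.

Lemma span_psC (K : comNzRingType) r (y : nat -> K) f :
  span r (fun i => psC (y i)) f <-> forall l, span r y (pcoef f l).
Proof.
split; first by move=> /spanP [c ->] l; apply/spanP; exists (fun i => pcoef (c i) l); rewrite pcoef_sum;
  apply: eq_bigr => i _; rewrite pcoefMC.
move=> /(@choice _ _ _) [c hc]; apply/spanP; exists (fun i => PS (fun l => c l i)).
by apply: psP => l; rewrite pcoef_sum hc; apply: eq_bigr => i _; rewrite pcoefMC.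
Qed.

(** Modulo [J] each coefficient of [f] is [-a] times the next one, hence divisible by every power of
    [a], and [J] is closed. *)
Lemma shifted_var_regular (K : comNzRingType) (J : K -> Prop) a : noethR K -> ideal J -> jac 1 (fun=> a) ->
  forall f : ps K, (forall l, J (pcoef ((psX K + psC a) * f) l)) -> forall l, J (pcoef f l).
Proof.
move=> nK hJ ha f h l.
have h1 j : J (pcoef f j + a * pcoef f j.+1).
  by have := h j.+1; rewrite mulrDl pcoefD pcoefX pcoefC.
apply: (@noeth_closed K 1 (fun=> a) J _ nK ha hJ) => L.
exists (pcoef f l - (- a) ^+ L * pcoef f (l + L)).
  elim: L => [|L IH]; first by rewrite addn0 mul1r subrr; apply: ideal0.
  have -> : pcoef f l - (- a) ^+ L.+1 * pcoef f (l + L.+1) =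
     (pcoef f l - (- a) ^+ L * pcoef f (l + L)) + (- a) ^+ L * (pcoef f (l + L) + a * pcoef f (l + L).+1).
    by rewrite addnS exprS; ring.
  by apply: idealD => //; apply: idealM.
rewrite subKr; apply: idealMr; first exact: ideal_ipow.
rewrite exprNn; apply: idealM; first exact: ideal_ipow.
exact: (ipow_exp (fun=> a) L (i := 0)).
Qed.

(** From index [n] on the first summand is zero, so these entries stay constant; this is how [p] is
    kept fixed. *)
Definition taylor_var n (D : comNzRingType) (w : nat -> D) i := psv n (fun=> 0) i + psnC n D (w i).

Lemma psn_unit n (D : comNzRingType) (f : PSn n D) s : s * psn_aug n D f = 1 -> exists g, g * f = 1.
Proof.
move=> hs.
have hj : jac n (psv n (fun=> 0 : D)).
  have hc := @psn_complete D n 0 (fun=> 0) (@complete0 _ _); have hp := @psn_separated D n 0 (fun=> 0) (@separated0 _ _).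
  by rewrite addn0 in hc hp; apply: complete_jac.
have [|g hg] := @jac_unit _ n _ (1 - psnC n D s * f) hj.
  have := psn_aug_span (fun=> 0) (- (psnC n D s * f)); rewrite rmorphN rmorphM psn_augC hs rmorphN rmorph1 opprK addrC.
  by [].
by exists (g * psnC n D s); rewrite -mulrA -[RHS]hg; congr (_ * _); ring.
Qed.

Lemma jac_psnC n (D : comNzRingType) z : jac 1 (fun=> z) -> jac 1 (fun=> psnC n D z).
Proof.
move=> hj c; have [s hs] := hj (fun=> psn_aug n D (c 0%N)).
apply: (@psn_unit n D _ s); rewrite -[RHS]hs !big_ord1.
by rewrite rmorphB rmorph1 rmorphM psn_augC.
Qed.

(** Each shifted variable is regular modulo the ones after it, so the relations reduce to those of
    the unshifted constants. *)
Lemma koszul_taylor n r (D : comNzRingType) (w : nat -> D) : noethR D ->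
  (forall m, (m < n)%N -> jac 1 (fun=> w m)) ->
  koszul r (fun i => w (n + i)%N) -> koszul (n + r) (taylor_var n w).
Proof.
move=> nD; elim: n w => [|n IH] w hj hK.
  by rewrite (_ : taylor_var 0 w = w) //; apply/funext => i; rewrite /taylor_var /= add0r.
have e : (fun i => taylor_var n.+1 w i.+1) = fun i => psC (taylor_var n (fun i => w i.+1) i).
  by apply/funext => i; rewrite /taylor_var /= rmorphD.
have hK' : koszul (n + r) (taylor_var n (fun i => w i.+1)).
  by apply: IH => // m mn; apply: hj.
apply: koszul_cons; rewrite e; first exact: koszul_psC.
move=> f /span_psC hf; apply/span_psC; apply: shifted_var_regular hf.
- exact: psn_noeth.
- exact: ideal_span.
- by apply: jac_psnC; apply: hj.
Qed.
End KoszulRelations.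

(** * A local criterion of flatness *)

Section Flat.
Variables (A T : comNzRingType) (f : {rmorphism A -> T}) (r : nat) (x : nat -> A) (p0 : A -> Prop).
Hypotheses (nA : noethR A) (nT : noethR T) (hp0 : ideal p0) (kp0 : forall a, p0 a -> f a = 0).
Hypotheses (jT : jac r (f \o x)) (loc : forall a, ~ span r x a -> exists b, b * a = 1).

(** Equational form of the vanishing of [Tor_1] between [T] and the quotient by the entries of [b],
    over [A/p0]: relations over [T] come from vectors over [A] that are relations modulo [p0]. *)
Definition row_flat g (b : 'rV[A]_g) := forall c : 'cV[T]_g, map_mx f b *m c = 0 ->
  exists l (M : 'M[A]_(g, l)) (e : 'cV[T]_l), (forall k, p0 ((b *m M) 0 k)) /\ c = map_mx f M *m e.

Definition row_ideal g (b : 'rV[A]_g) : A -> Prop := fun z => exists s : 'cV[A]_g, z%:M = b *m s.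

Lemma row_flat_indep g (b : 'rV[A]_g) g' (b' : 'rV[A]_g') (M : 'M[A]_(g, g')) (N : 'M[A]_(g', g)) :
  b' = b *m M -> b = b' *m N -> row_flat b -> row_flat b'.
Proof.
move=> e1 e2 fb c hc.
have [|l [P [e [hP ec]]]] := fb (map_mx f M *m c); first by rewrite mulmxA -map_mxM -e1.
exists (l + g')%N, (row_mx (N *m P) (1%:M - N *m M)), (col_mx e c); split.
  have -> : b' *m row_mx (N *m P) (1%:M - N *m M) = row_mx (b *m P) 0.
    by rewrite mul_mx_row mulmxA -e2 mulmxBr mulmx1 mulmxA -e2 -e1 subrr.
  by move=> k; rewrite mxE; case: split => j; [exact: hP|rewrite mxE; apply: ideal0].
rewrite map_row_mx mul_row_col map_mxM -mulmxA -ec map_mxB map_mx1 mulmxBl mul1mx map_mxM -mulmxA.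
by rewrite addrC subrK.
Qed.

(* A relation on [b] becomes, after extending by [z], one on generators [d] of [(b : z)]. *)
Lemma row_flat_colon g (b : 'rV[A]_g) h (d : 'rV[A]_h) (t : 'M[A]_(g, h)) z : sub p0 (row_ideal b) ->
  z *: d = b *m t -> (forall y, colon (row_ideal b) z y -> row_ideal d y) ->
  row_flat (row_mx b z%:M) -> forall c : 'cV[T]_g, map_mx f b *m c = 0 ->
  exists l (M : 'M[A]_(g, l)) (e : 'cV[T]_l) (c' : 'cV[T]_h),
    [/\ forall k, p0 ((b *m M) 0 k), map_mx f d *m c' = 0 & c = map_mx f M *m e - map_mx f t *m c'].
Proof.
move=> p0b et hd fb c hc.
have [|l [M [e [hM ec]]]] := fb (col_mx c 0).
  by rewrite map_row_mx mul_row_col hc mulmx0 addr0.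
rewrite -[M]vsubmxK map_col_mx mul_col_mx in ec; have [ec1 ec2] := eq_col_mx ec.
rewrite -[M]vsubmxK mul_row_col mul_scalar_mx in hM.
set rho := usubmx M in ec1 hM; set sig := dsubmx M in ec2 hM.
have /choice [m hm] : forall k, exists s : 'cV[A]_h, (sig 0 k)%:M = d *m s.
  move=> k; apply: hd; have [s hs] := p0b _ (hM k).
  exists (s - rho *m delta_mx k 0); rewrite mulmxBr -hs.
  have -> : b *m (rho *m delta_mx k 0) = ((b *m rho) 0 k)%:M.
    by rewrite mulmxA -colE; apply/matrixP => i j; rewrite !ord1 [LHS]mxE [RHS]mxE mulr1n.
  by rewrite -raddfB /= [in RHS]mxE [(z *: sig) 0 k]mxE addrAC subrr add0r.
pose mu := \matrix_(i, k) m k i 0.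
have emu : sig = d *m mu.
  apply/rowP => k; have := congr1 (fun u : 'M_1 => u 0 0) (hm k); rewrite !mxE eqxx mulr1n => ->.
  by apply: eq_bigr => j _; rewrite !mxE.
exists l, (rho + t *m mu), e, (map_mx f mu *m e); split.
- by move=> k; rewrite mulmxDr mulmxA -et -scalemxAl -emu; apply: hM.
- by rewrite mulmxA -map_mxM -emu.
by rewrite map_mxD map_mxM mulmxDl -mulmxA addrK.
Qed.

Lemma row_of_ideal J : ideal J -> exists g (b : 'rV[A]_g), forall z, row_ideal b z <-> J z.
Proof.
move=> hJ; have [g [v hv]] := noethR_fg nA hJ.
exists g, (\row_i v i) => z; rewrite hv; split.
  move=> [s hs]; have := congr1 (fun u : 'M_1 => u 0 0) hs; rewrite !mxE eqxx mulr1n => ->.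
  apply: ideal_sum => [|i _]; first exact: ideal_span.
  by rewrite !mxE mulrC; apply: (idealM _ (ideal_span _ _)); apply: span_mem.
move=> /spanP [c ->]; exists (\col_i c i); apply/matrixP => i j; rewrite !ord1 !mxE eqxx mulr1n.
by apply: eq_bigr => l _; rewrite !mxE mulrC.
Qed.
Lemma row_idealP g (b : 'rV[A]_g) (s : 'cV[A]_g) : row_ideal b ((b *m s) 0 0).
Proof. by exists s; apply/matrixP => i j; rewrite !ord1 [LHS]mxE eqxx mulr1n. Qed.
Lemma row_ideal_entry g (b : 'rV[A]_g) k : row_ideal b (b 0 k).
Proof. by have := row_idealP b (delta_mx k 0); rewrite -colE mxE. Qed.
Lemma row_factor g (b : 'rV[A]_g) h (d : 'rV[A]_h) : (forall k, row_ideal b (d 0 k)) -> exists t, d = b *m t.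
Proof.
move=> /(@choice _ _ _) [s hs]; exists (\matrix_(i, k) s k i 0); apply/rowP => k.
have := congr1 (fun u : 'M_1 => u 0 0) (hs k); rewrite !mxE eqxx mulr1n => ->.
by apply: eq_bigr => j _; rewrite !mxE.
Qed.
Lemma row_ideal_cat g (b : 'rV[A]_g) z y : row_ideal (row_mx b z%:M) y <-> addg (row_ideal b) z y.
Proof.
split.
  move=> [s hs]; rewrite -[s]vsubmxK mul_row_col mul_scalar_mx in hs.
  exists (dsubmx s 0 0); exists (usubmx s); apply/matrixP => i j; rewrite !ord1.
  have := congr1 (fun u : 'M_1 => u 0 0) hs; rewrite [LHS]mxE eqxx mulr1n [RHS]mxE [X in _ + X]mxE => ->.
  by rewrite mulrC addrK mxE eqxx mulr1n.
move=> [a [s hs]]; exists (col_mx s a%:M); rewrite mul_row_col -hs mul_scalar_mx scale_scalar_mx -raddfD /=.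
by rewrite mulrC subrK.
Qed.

(** Noetherian induction on [J]. If [zy] is in [J] but [z], [y] are not, the cases [J + (z)] and
    [(J : z)] combine through [row_flat_colon]. A nonmaximal prime is treated by Nakayama, and the
    maximal ideal is the hypothesis. *)
Lemma flat_rows : row_flat (\row_(i < r) x i) -> sub p0 (span r x) ->
  forall J, ideal J -> sub p0 J -> forall g (b : 'rV[A]_g), (forall z, row_ideal b z <-> J z) -> row_flat b.
Proof.
move=> base p0M J hJ p0J.
suff : sub p0 J -> forall g (b : 'rV[A]_g), (forall z, row_ideal b z <-> J z) -> row_flat b by apply.
apply: (@noethR_ind A (fun J => sub p0 J -> forall g (b : 'rV[A]_g), (forall z, row_ideal b z <-> J z) -> row_flat b) J nA hJ).
move=> {p0J hJ} I hI _ IH p0I g b hb.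
have same h (d : 'rV[A]_h) : (forall z, row_ideal d z <-> I z) -> row_flat d -> row_flat b.
  move=> hd; have [|M eM] := @row_factor _ d _ b; first by move=> k; apply/hd/hb; apply: row_ideal_entry.
  have [|N eN] := @row_factor _ b _ d; first by move=> k; apply/hb/hd; apply: row_ideal_entry.
  exact: row_flat_indep eM eN.
case: (EM (I 1)) => [I1|nI1].
  apply: (same 1%N 1%:M) => [z|c]; last first.
    rewrite map_mx1 mul1mx => ->; exists 0%N, 0, 0; split; first by case.
    by rewrite mulmx0.
  by split=> [_|_]; [apply: ideal1|exists (z%:M); rewrite mul1mx].
have big z : ~ I z -> row_flat (row_mx b z%:M).
  move=> nz; apply: (IH (addg I z)) => //.
  - exact: ideal_addg.
  - exact: addgl.
  - by move=> h; apply: nz; apply: h; apply: addgr.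
  - by move=> y /p0I; apply: addgl.
  by move=> y; rewrite row_ideal_cat; split=> -[s /hb hs]; exists s.
have p0b : sub p0 (row_ideal b) by move=> y /p0I /hb.
case: (EM (exists z y, [/\ I (z * y), ~ I z & ~ I y])) => [[z [y [hzy nz ny]]]|npr].
  have [h [d hd]] := row_of_ideal (ideal_colon z hI).
  have [|t et] := @row_factor _ b _ (z *: d).
    by move=> k; apply/hb; rewrite mxE; apply/hd; apply: row_ideal_entry.
  have fd : row_flat d.
    apply: (IH (colon I z)) => //.
    - exact: ideal_colon.
    - exact: colonl.
    - by move=> h'; apply: ny; apply: h'.
    - by move=> u /p0I; apply: colonl.
  move=> c hc; have [|l [M [e [c' [hM hc' ec]]]]] := row_flat_colon p0b et _ (big z nz) hc.
    by move=> u hu; apply/hd; apply/hb.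
  have [l' [N [e' [hN ec']]]] := fd c' hc'.
  exists (l + l')%N, (row_mx M (- (t *m N))), (col_mx e e'); split.
    have -> : b *m row_mx M (- (t *m N)) = row_mx (b *m M) (- (z *: (d *m N))).
      by rewrite mul_mx_row mulmxN mulmxA -et -scalemxAl.
    move=> k; rewrite mxE; case: split => j; first exact: hM.
    by rewrite mxE; apply: (idealN hp0); rewrite mxE; apply: (idealM _ hp0).
  by rewrite map_row_mx mul_row_col map_mxN mulNmx map_mxM -mulmxA -ec'.
have pr z y : I (z * y) -> ~ I z -> I y.
  by move=> h nz; apply: contrapT => ny; apply: npr; exists z, y.
case: (EM (forall i, (i < r)%N -> I (x i))) => [xI|/existsNP [i /not_implyP [ir nxi]]].
  apply: same base => z; split.
    by move=> [s hs]; have := congr1 (fun u : 'M_1 => u 0 0) hs; rewrite !mxE eqxx mulr1n => ->;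
      apply: ideal_sum => // i _; rewrite mxE; apply: idealMr => //; apply: xI.
  move=> Iz; have : span r x z.
    by apply: contrapT => /loc [a ha]; apply: nI1; rewrite -ha; apply: idealM.
  move=> /spanP [a ->]; exists (\col_i a i); apply/matrixP => i j; rewrite !ord1 !mxE eqxx mulr1n.
  by apply: eq_bigr => k _; rewrite !mxE mulrC.
pose Z (c : 'cV[T]_g) := map_mx f b *m c = 0.
pose W (c : 'cV[T]_g) := exists l (M : 'M[A]_(g, l)) (e : 'cV[T]_l), (forall k, p0 ((b *m M) 0 k)) /\ c = map_mx f M *m e.
have hZ : submod Z.
  by split; rewrite /Z ?mulmx0 // => a u v hu hv; rewrite mulmxDr -scalemxAr hu hv scaler0 addr0.
have hW : submod W.
  split; first by exists 0%N, 0, 0; split; [case|rewrite mulmx0].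
  move=> a _ _ [l [M [e [hM ->]]]] [l' [M' [e' [hM' ->]]]]; exists (l + l')%N, (row_mx M M'), (col_mx (a *: e) e').
  split; last by rewrite map_row_mx mul_row_col scalemxAr.
  by move=> k; rewrite mul_mx_row mxE; case: split.
have WZ : sub W Z.
  move=> _ [l [M [e [hM ->]]]]; rewrite /Z mulmxA -map_mxM (_ : map_mx f _ = 0) ?mul0mx //.
  by apply/rowP => k; rewrite mxE [RHS]mxE kp0.
suff : sub Z W by [].
have nZ : noeth Z W.
  by apply: (noeth_sub (@noeth_col T g nT) hW) => // ? ->; apply: submod0.
apply: (nakayama jT nZ hZ hW WZ) => c hc.
(* As [I] is prime and [x i] is outside it, [(I : x i)] is [I] itself: a relation on [b] is a good
   one minus [x i] times another relation on [b], which is the shape Nakayama needs. *)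
have et : x i *: b = b *m (x i)%:M by rewrite mul_mx_scalar.
have [|l [M [e [c' [hM hc' ec]]]]] := row_flat_colon p0b et _ (big _ nxi) hc.
  by move=> u /hb hu; apply/hb; apply: pr hu nxi.
exists (map_mx f M *m e), (- (map_mx f (x i)%:M *m c')); split=> //; first by exists l, M, e.
exists (fun j => if j == i then - c' else 0); split.
  by move=> j jr; case: ifP => _; [apply: submodN|apply: submod0].
rewrite (bigD1 (Ordinal ir)) //= eqxx big1 ?addr0; last first.
  by move=> j; rewrite -val_eqE /= => /negbTE ->; rewrite scaler0.
by rewrite map_scalar_mx mul_scalar_mx scalerN.
Qed.

(* [(f(J)T : f(a)) = f(J : a)T], the only consequence of flatness that is needed. *)
Definition colon_flat := forall J a t, ideal J -> sub p0 J -> extend f J (f a * t) -> extend f (colon J a) t.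

(** Up to sign, [t] is the last coordinate of a relation on the generators of [J] followed by [a];
    the vectors over [A] that express it have their last coordinate in [(J : a)]. *)
Lemma flat_colon : row_flat (\row_(i < r) x i) -> sub p0 (span r x) -> colon_flat.
Proof.
move=> base p0M J a t hJ p0J h.
have [g [b hb]] := row_of_ideal hJ.
have ha : ideal (addg J a) by apply: ideal_addg.
have fb : row_flat (row_mx b a%:M).
  apply: (flat_rows base p0M ha); first by move=> y /p0J; apply: addgl.
  by move=> y; rewrite row_ideal_cat; split=> -[s /hb hs]; exists s.
have [s hs] : exists s : 'cV[T]_g, (f a * t)%:M = map_mx f b *m s.
  pose I z := exists s : 'cV[T]_g, z%:M = map_mx f b *m s.
  have hI : ideal I.
    split; first by exists 0; rewrite mulmx0 raddf0.
    move=> c u v [s hs] [s' hs']; exists (c *: s + s'); rewrite mulmxDr -scalemxAr -hs -hs' raddfD /=.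
    by rewrite scale_scalar_mx.
  apply: (extend_sub hI _ h) => z /hb [s hs]; exists (map_mx f s).
  by rewrite -map_mxM -hs map_scalar_mx.
have [|l [M [e [hM ec]]]] := fb (col_mx (- s) t%:M).
  by rewrite map_row_mx mul_row_col map_scalar_mx mulmxN -hs mul_scalar_mx scale_scalar_mx addNr.
rewrite -[M]vsubmxK map_col_mx mul_col_mx in ec; have [_ ec2] := eq_col_mx ec.
rewrite -[M]vsubmxK mul_row_col mul_scalar_mx in hM.
have := congr1 (fun u : 'M_1 => u 0 0) ec2; rewrite mxE eqxx mulr1n => ->.
rewrite mxE; apply: ideal_sum => [|k _]; first exact: ideal_extend.
apply: idealMr; first exact: ideal_extend.
rewrite mxE; apply: extend_mem; rewrite /colon.
have -> : a * dsubmx M 0 k = (b *m usubmx M + a *: dsubmx M) 0 k - (b *m usubmx M) 0 k.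
  by rewrite [X in X - _]mxE [X in _ + X - _]mxE addrAC subrr add0r.
apply: (idealB hJ); first exact: p0J.
apply/hb; have := row_idealP b (usubmx M *m delta_mx k 0).
by rewrite mulmxA -colE mxE.
Qed.
End Flat.

(** * Ideals along the completion *)

Section CompletionIdeals.
Variables (R A : comNzRingType) (i : {rmorphism R -> A}) (r : nat) (x : nat -> R).
Hypotheses (nR : noethR R) (nA : noethR A) (jR : jac r x) (jA : jac r (i \o x)).
Hypothesis loc : forall a, ~ span r x a -> exists b, b * a = 1.
Hypothesis dense : forall a, exists c, span r (i \o x) (a - i c).
Hypothesis sub_ipow : forall L c, ipow r (i \o x) L (i c) -> ipow r x L c.
Implicit Types (J K : R -> Prop).

Let dense_ipow := dense_ipow dense.

Lemma completion_contract J a : ideal J -> extend i J (i a) -> J a.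
Proof.
move=> hJ [g [b [hb /spanP [c hc]]]].
apply: (@noeth_closed R r x J a nR jR hJ) => L.
have /choice [d hd] := fun j => dense_ipow L (c j).
exists (\sum_(j < g) d j * b j).
  by apply: ideal_sum => // j _; apply: idealM => //; apply: hb.
apply: sub_ipow; rewrite rmorphB hc rmorph_sum -sumrB.
apply: ideal_sum => [|j _]; first exact: ideal_ipow.
by rewrite rmorphM -mulrBl; apply: idealMr => //; apply: ideal_ipow.
Qed.

(* One-row form of the flatness of the completion. *)
Lemma completion_relations g (b : nat -> R) (c : nat -> A) : \sum_(j < g) i (b j) * c j = 0 ->
  exists l (e : nat -> A) (s : nat -> nat -> R), (forall k, (k < l)%N -> \sum_(j < g) b j * s k j = 0) /\
    forall j, (j < g)%N -> c j = \sum_(k < l) e k * i (s k j).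
Proof.
move=> h; pose B : 'M[R]_(1, g) := \row_j b j; pose C : 'cV[A]_g := \col_j c j.
have hBC : map_mx i B *m C = 0.
  apply/matrixP => u v; rewrite !ord1 !mxE -[RHS]h; apply: eq_bigr => j _; by rewrite !mxE.
have [l [e [s [hs hC]]]] := completion_flat nR nA jR jA loc dense sub_ipow hBC.
exists l, e, (fun k j => if insub j is Some o then s k (o : 'I_g) 0 else 0); split=> [k kl|j jg].
  have := congr1 (fun u : 'cV_1 => u 0 0) (hs k kl); rewrite !mxE => hk; rewrite -[RHS]hk.
  by apply: eq_bigr => j _; rewrite valK /B mxE.
have := congr1 (fun u : 'cV_g => u (Ordinal jg) 0) hC; rewrite summxE [LHS]mxE /= => ->.
by apply: eq_bigr => k _; rewrite !mxE (insubT (fun j => j < g)%N jg).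
Qed.

Lemma completion_koszul : koszul r x -> koszul r (i \o x).
Proof.
move=> hK c /completion_relations [l [e [s [hs hc]]]].
have /choice [t ht] : forall k, exists t : nat -> nat -> R, (k < l)%N ->
   [/\ forall i, t i i = 0, forall i j, t j i = - t i j &
        forall i, (i < r)%N -> s k i = \sum_(j < r) t i j * x j].
  move=> k; case: (ltnP k l) => [kl|_]; last by exists (fun _ _ => 0).
  by have [t ht] := hK (s k) (hs k kl); exists t.
exists (fun a b => \sum_(k < l) e k * i (t k a b)); split.
- by move=> a; rewrite big1 // => k _; have [-> _ _] := ht k (ltn_ord k); rewrite rmorph0 mulr0.
- by move=> a b; rewrite -sumrN; apply: eq_bigr => k _; have [_ -> _] := ht k (ltn_ord k); rewrite rmorphN mulrN.
move=> a ar; rewrite hc //; under [RHS]eq_bigr => j _ do rewrite mulr_suml.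
rewrite exchange_big; apply: eq_bigr => k _; have [_ _ ->] := ht k (ltn_ord k) => //.
by rewrite rmorph_sum mulr_sumr; apply: eq_bigr => j _; rewrite rmorphM mulrA.
Qed.

Lemma completion_colon J a t : ideal J -> extend i J (i a * t) -> extend i (colon J a) t.
Proof.
move=> hJ [g [b [hb /spanP [c hc]]]].
have [|l [e [s [hs he]]]] := @completion_relations g.+1 (fun j => if (j < g)%N then b j else a)
   (fun j => if (j < g)%N then - c j else t).
  rewrite big_ord_recr /= ltnn hc -big_split big1 // => j _.
  by rewrite /= ltn_ord mulrN mulrC addNr.
have := he g (ltnSn g); rewrite ltnn => ->.
apply: ideal_sum => [|k _]; first exact: ideal_extend.
apply: idealM; [exact: ideal_extend|apply: extend_mem; rewrite /colon].
have := hs k (ltn_ord k); rewrite big_ord_recr /= ltnn => /eqP; rewrite addrC addr_eq0 => /eqP ->.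
apply: (idealN hJ); apply: ideal_sum => // j _; rewrite ltn_ord; apply: idealMr => //; exact: hb.
Qed.

Lemma completion_capm J K t : ideal J -> ideal K -> extend i J t -> extend i K t ->
  extend i (fun z => J z /\ K z) t.
Proof.
move=> hJ hK [g [b [hb /spanP [c hc]]]] [g' [b' [hb' /spanP [c' hc']]]].
have [|l [e [s [hs he]]]] := @completion_relations (g + g')%N (fun j => if (j < g)%N then b j else b' (j - g)%N)
   (fun j => if (j < g)%N then c j else - c' (j - g)%N).
  rewrite big_split_ord /=; apply/eqP; rewrite addr_eq0 -sumrN; apply/eqP.
  transitivity t; [rewrite hc|rewrite hc']; apply: eq_bigr => j _; first by rewrite ltn_ord mulrC.
  by rewrite ltnNge leq_addr /= addKn mulrN opprK mulrC.
pose z k := \sum_(j < g) b j * s k j.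
have -> : t = \sum_(k < l) e k * i (z k).
  rewrite hc; under [RHS]eq_bigr => k _ do rewrite rmorph_sum mulr_sumr.
  rewrite exchange_big; apply: eq_bigr => j _ /=.
  have := he j (ltn_addr _ (ltn_ord j)); rewrite ltn_ord => ->.
  by rewrite mulr_suml; apply: eq_bigr => k _; rewrite rmorphM [i (b j) * _]mulrC mulrA.
have hE : ideal (extend i (fun z => J z /\ K z)) by apply: ideal_extend.
apply: ideal_sum => // k _; apply: (idealM _ hE); apply: extend_mem; split.
  by apply: ideal_sum => // j _; apply: idealMr => //; apply: hb.
have := hs k (ltn_ord k); rewrite big_split_ord /= => /eqP; rewrite addr_eq0 => /eqP h.
rewrite /z (eq_bigr (fun j : 'I_g => (if (j < g)%N then b j else b' (j - g)%N) * s k j)); last by move=> j _; rewrite ltn_ord.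
rewrite h; apply: (idealN hK); apply: ideal_sum => // j _; apply: idealMr => //.
by rewrite ltnNge leq_addr /= addKn; apply: hb'.
Qed.

Let Rb J t := exists c, extend i J (t - i c).

(** The parameters are treated one by one: [t] is corrected by elements of [R] until it lies in
    [K A], where [K] is multiplied into [J] by more and more of the [x j]. Contraction supplies the
    correction, and flatness intersects [K] with the next colon ideal. *)
Lemma completion_saturated1 J t : ideal J -> (forall j, (j < r)%N -> Rb J (i (x j) * t)) -> Rb J t.
Proof.
move=> hJ h.
have step k : (k <= r)%N -> exists c (K : R -> Prop), [/\ ideal K, forall j z, (j < k)%N -> K z -> J (x j * z) &
    extend i K (t - i c)].
  elim: k => [|k IH] kr.
    exists 0, full; split=> //.
    rewrite rmorph0 subr0 -[t]mul1r -(rmorph1 i); apply: idealMr; first exact: ideal_extend.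
    exact: extend_mem.
  have [c [K [hK KJ hc]]] := IH (ltnW kr); have [d hd] := h k kr.
  pose xK z := exists2 w, K w & z = x k * w.
  have hxK : ideal xK.
    apply/idealP; split.
    - by exists 0; [apply: ideal0|rewrite mulr0].
    - by move=> _ _ [u hu ->] [v hv ->]; exists (u + v); [apply: idealD|rewrite mulrDr].
    - by move=> a _ [u hu ->]; exists (a * u); [apply: idealM|rewrite mulrCA].
  pose JK := addm (V := R^o) J xK.
  have hJK : ideal JK by apply: submod_addm.
  have [w [_ [hw [u hu ->] e]]] : JK (d - x k * c).
    apply: completion_contract => //.
    have -> : i (d - x k * c) = i (x k) * (t - i c) - (i (x k) * t - i d).
      by rewrite rmorphB rmorphM; ring.
    apply: (idealB (ideal_extend _ _)).
      have hE : ideal (fun s => extend i JK (i (x k) * s)) by apply: ideal_colon; apply: ideal_extend.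
      apply: (extend_sub hE _ hc) => a ha; rewrite -rmorphM; apply: extend_mem.
      by apply: (addmr (V := R^o) hJ); exists a.
    by apply: extend_mono hd => a; apply: addml.
  exists (c + u), (fun z => K z /\ colon J (x k) z); split.
  - by apply: submod_capm => //; apply: ideal_colon.
  - by move=> j z; rewrite ltnS leq_eqVlt => /orP[/eqP ->|jk] [hz hz'] //; apply: KJ.
  apply: completion_capm => //; first exact: ideal_colon.
    rewrite rmorphD opprD addrA; apply: (idealB (ideal_extend _ _)) => //; exact: extend_mem.
  apply: completion_colon => //.
  have -> : i (x k) * (t - i (c + u)) = (i (x k) * t - i d) + i w.
    have -> : i w = i (d - x k * c) - i (x k * u) by rewrite e rmorphD addrK.
    by rewrite !rmorphB !rmorphD !rmorphM; ring.
  by apply: (idealD (ideal_extend _ _)) => //; apply: extend_mem.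
(* Now every [x j] multiplies [K] into [J], so coefficients over [A] may be replaced by elements of
   [R] congruent to them modulo the maximal ideal. *)
have [c [K [hK KJ [g [b [hb /spanP [a ha]]]]]]] := step r (leqnn _).
have /choice [d hd] := fun j => dense (a j).
exists (c + \sum_(j < g) d j * b j).
have -> : t - i (c + \sum_(j < g) d j * b j) = \sum_(j < g) (a j - i (d j)) * i (b j).
  rewrite rmorphD rmorph_sum opprD addrA ha -sumrB; apply: eq_bigr => j _.
  by rewrite rmorphM mulrBl.
apply: ideal_sum => [|j _]; first exact: ideal_extend.
have hE : ideal (fun s => extend i J (s * i (b j))).
  have := ideal_colon (i (b j)) (ideal_extend i J); by congr ideal; apply/funext => s; rewrite /colon mulrC.
apply: (span_sub hE _ (hd j)) => l lr; rewrite -rmorphM; apply: extend_mem; apply: KJ => //; exact: hb.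
Qed.

Lemma completion_saturated J L t : ideal J -> (forall w, ipow r x L w -> Rb J (i w * t)) -> Rb J t.
Proof.
move=> hJ; elim: L t => [|L IH] t h; first by have := h 1 Logic.I; rewrite rmorph1 mul1r.
apply: IH => w hw; apply: completion_saturated1 => // j jr.
by rewrite mulrA -rmorphM; apply: h; apply: ipow_mulvar.
Qed.
End CompletionIdeals.

Lemma double_sum_submod (R : comNzRingType) (V : lmodType R) (W : V -> Prop) (F : nat -> nat -> V) r :
  submod W -> (forall i, (i < r)%N -> W (F i i)) -> (forall i j, (i < r)%N -> (j < r)%N -> W (F i j + F j i)) ->
  W (\sum_(i < r) \sum_(j < r) F i j).
Proof.
move=> hW; elim: r => [|r IH] h0 h; first by rewrite big_ord0; apply: submod0.
rewrite big_ord_recr /= big_ord_recr /=.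
under eq_bigr => i _ do rewrite big_ord_recr.
rewrite big_split /= -addrA; apply: (submodD hW).
  apply: IH => [i ir|i j ir jr]; first by apply/h0/leqW.
  by apply: h; apply: leqW.
rewrite addrA -big_split /=; apply: (submodD hW); last exact: h0.
by apply: submod_sum => // i _; apply: h => //; exact: leqW (ltn_ord i).
Qed.

Section FlatCriteria.
Variables (A T : comNzRingType) (f : {rmorphism A -> T}) (r : nat) (x : nat -> A) (p0 : A -> Prop).
Hypothesis hp0 : ideal p0.

Lemma row_flat_submod g (b : 'rV[A]_g) : submod (fun c : 'cV[T]_g =>
  exists l (M : 'M[A]_(g, l)) (e : 'cV[T]_l), (forall k, p0 ((b *m M) 0 k)) /\ c = map_mx f M *m e).
Proof.
split; first by exists 0%N, 0, 0; split; [case|rewrite mulmx0].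
move=> a _ _ [l [M [e [hM ->]]]] [l' [M' [e' [hM' ->]]]]; exists (l + l')%N, (row_mx M M'), (col_mx (a *: e) e').
split; last by rewrite map_row_mx mul_row_col scalemxAr.
by move=> k; rewrite mul_mx_row mxE; case: split.
Qed.

(** The base case of [flat_rows]: trivial relations between the first [m] entries lift to [A], and
    an entry in [p0] makes its unit vector a relation modulo [p0]. *)
Lemma koszul_row_flat m : (m <= r)%N -> koszul m (f \o x) -> (forall i, (m <= i < r)%N -> p0 (x i)) ->
  (forall a, p0 a -> f a = 0) -> row_flat f p0 (\row_(i < r) x i).
Proof.
move=> mr hK hp kp c hc.
pose cc i := if insub i is Some o then c (o : 'I_r) 0 else 0.
have ccE (i : 'I_r) : cc i = c i 0 by rewrite /cc valK.
have [|s [s0 sN sE]] := hK cc.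
  have := congr1 (fun u : 'cV_1 => u 0 0) hc; rewrite !mxE => h.
  rewrite -[RHS]h -(big_mkord xpredT (fun i => f (x i) * cc i)).
  rewrite (eq_bigr (fun i : 'I_r => f (x i) * cc i)); last by move=> i _; rewrite !mxE ccE.
  rewrite -(big_mkord xpredT (fun i => f (x i) * cc i)); symmetry.
  rewrite [LHS](big_cat_nat (n := m)) //= (_ : \sum_(m <= i < r) _ = 0) ?addr0 //.
  rewrite big_nat_cond big1 // => i; rewrite andbT => hi.
  by rewrite kp ?mul0r //; apply: hp.
pose W (c : 'cV[T]_r) := exists l (M : 'M[A]_(r, l)) (e : 'cV[T]_l),
  (forall k, p0 ((\row_(i < r) x i *m M) 0 k)) /\ c = map_mx f M *m e.
have hW : submod W := row_flat_submod _.
pose d i : 'cV[T]_r := if insub i is Some o then delta_mx o 0 else 0.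
pose d' i : 'cV[A]_r := if insub i is Some o then delta_mx o 0 else 0.
have W1 (u : 'cV[A]_r) t : p0 ((\row_(i < r) x i *m u) 0 0) -> W (t *: map_mx f u).
  by move=> hu; exists 1%N, u, t%:M; split; [move=> k; rewrite ord1|rewrite mul_mx_scalar].
have dE i : d i = map_mx f (d' i).
  by rewrite /d /d'; case: insub => [o|]; rewrite ?map_mx0 // map_delta_mx.
have xd i : (i < r)%N -> (\row_(i < r) x i *m d' i) 0 0 = x i.
  by move=> ir; rewrite /d' (insubT (fun j => j < r)%N ir) -colE !mxE.
have -> : c = \sum_(i < m) \sum_(j < m) (s i j * f (x j)) *: d i + \sum_(m <= i < r) cc i *: d i.
  rewrite (eq_bigr (fun i : 'I_m => cc i *: d i)); last by move=> i _; rewrite -scaler_suml sE.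
  rewrite -(big_mkord xpredT (fun i => cc i *: d i)) -(big_cat_nat (n := m)) //= big_mkord.
  apply/colP => j; rewrite summxE (bigD1 j) //= big1 ?addr0; last first.
    by move=> l nl; rewrite /d valK !mxE eq_sym (negbTE nl) mulr0.
  by rewrite /d valK !mxE !eqxx mulr1 ccE.
apply: (submodD hW).
  apply: (double_sum_submod (F := fun i j => (s i j * f (x j)) *: d i) hW) => [i ir|i j ir jr].
    by rewrite s0 mul0r scale0r; apply: submod0.
  rewrite (sN i j) mulNr scaleNr !dE -!scalerA -scalerBr -!map_mxZ -map_mxB; apply: W1.
  rewrite mulmxBr -!scalemxAr mxE [X in X + _]mxE [X in _ + X]mxE [X in _ - X]mxE !xd ?(leq_trans _ mr) //.
  by rewrite mulrC subrr; apply: ideal0.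
rewrite big_nat_cond; apply: submod_sum => // i; rewrite andbT => /andP[mi ir]; rewrite dE; apply: W1.
by rewrite xd //; apply: hp; rewrite mi.
Qed.

Lemma flat_contract J a : colon_flat f p0 -> jac r (f \o x) ->
  (forall a, ~ span r x a -> exists b, b * a = 1) -> ideal J -> sub p0 J -> extend f J (f a) -> J a.
Proof.
move=> cf hj loc hJ p0J; rewrite -[f a]mulr1 => /(cf _ _ _ hJ p0J) h.
apply: contrapT => na; apply: (jac_proper hj).
apply: (extend_sub _ _ h) => [|z hz]; first exact: ideal_span.
apply: span_image; apply: contrapT => /loc [b hb]; apply: na.
by rewrite -[a]mulr1 -hb mulrCA; apply: idealM.
Qed.
End FlatCriteria.

(** * Taylor expansion modulo an ideal *)

(** Powers of the variables rather than powers of the ideal: the quotient has a box of monomials as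
    basis, and for [N = p^e] in characteristic [p] the generators are compatible with sums. *)
Definition vpow n N (K : comNzRingType) : PSn n K -> Prop := span n (fun i => psv n (fun=> 0 : K) i ^+ N).

Section VarPowers.
Variable K : comNzRingType.

Lemma ideal_vpow n N : ideal (@vpow n N K). Proof. exact: ideal_span. Qed.
Lemma vpow_mem n N i : (i < n)%N -> @vpow n N K (psv n (fun=> 0) i ^+ N).
Proof. exact: span_mem. Qed.

Lemma vpowS n N (f : ps (PSn n K)) : @vpow n.+1 N K f <-> forall j, (j < N)%N -> vpow N (pcoef f j).
Proof.
have e : (fun i => psv n.+1 (fun=> 0 : K) i.+1 ^+ N) = fun i => psC (psv n (fun=> 0) i ^+ N).
  by apply/funext => i; rewrite rmorphXn.
split.
  move=> /span_recl [a [b [hb ->]]] j jN; rewrite e in hb; move/span_psC: hb => hb.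
  rewrite pcoefD (_ : pcoef _ j = 0) ?add0r; first exact: hb.
  by rewrite mulrC; have := pcoefXn N a j; rewrite jN.
move=> h; apply/span_recl; exists (pshift N f), (f - psX _ ^+ N * pshift N f); split; last by rewrite /= mulrC addrC subrK.
rewrite e; apply/span_psC => j; rewrite pcoefB pcoefXn; case: ltnP => jN; first by rewrite subr0; apply: h.
rewrite pcoefE subnKC // subrr; exact: ideal0 (ideal_span _ _).
Qed.

Lemma vpow_le n N M : (M <= N)%N -> sub (@vpow n N K) (@vpow n M K).
Proof.
move=> MN; apply: span_sub; first exact: ideal_vpow.
by move=> i ir; rewrite -(subnK MN) exprD; apply: (idealM _ (ideal_vpow _ _)); apply: vpow_mem.
Qed.
Lemma ipow_vpow n N : exists L, sub (ipow n (psv n (fun=> 0)) L) (@vpow n N K).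
Proof.
apply: (@ipowm_pigeon _ (PSn n K)^o n _ full (@vpow n N K) (@submod_full _ _) (ideal_vpow n N)) => i ir.
exists N => z _; apply: (idealMr _ (ideal_vpow n N)); exact: vpow_mem.
Qed.
Lemma span_aug n y f : span n (psv n y) f -> psn_aug n K f = 0.
Proof.
move=> /spanP [c ->]; rewrite rmorph_sum big1 // => i _.
by rewrite rmorphM psn_augv // mulr0.
Qed.
End VarPowers.

Lemma vpow_map n N (K K' : comNzRingType) (h : {rmorphism K -> K'}) f : vpow N f -> vpow N (psn_map n h f).
Proof.
move=> /(span_image (psn_map n h)); apply: span_sub; first exact: ideal_vpow.
move=> i ir /=; rewrite rmorphXn psn_mapv (psv_eq _ (fun=> 0)) //; exact: vpow_mem.
Qed.

(* A flat [f : A -> D[[t]]] detects membership in an irreducible ideal [U] modulo high powers of the variables,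
   when its constant term is the projection onto [A/q]. *)
Lemma irreducible_detect (A D : comNzRingType) n (f : {rmorphism A -> PSn n D}) (U q : A -> Prop) a0 :
  noethR D -> colon_flat f (fun x => x = 0) -> ideal U -> (forall r, q r <-> U (r * a0)) ->
  (forall a, ~ U a -> exists y r, ~ q y /\ U (y * a0 - r * a)) ->
  (forall a, psn_aug n D (f a) = 0 <-> q a) ->
  exists N, forall a, vpow N (f a) -> U a.
Proof.
move=> nD cf hU qE irr augE.
have nT : noethR (PSn n D) by apply: psn_noeth.
(* If [f a] lies in [(t^N)] with [a] outside [U], then so does [f y * f a0] modulo [U T], for some
   [y] outside [q]. Krull's theorem and flatness put [f y - j] in [q T] with [j] in [(t)], and the
   constant term gives [y] in [q]. *)
have [N hN] := ring_krull n (psv n (fun=> 0 : D)) (f a0) nT (ideal_extend f U).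
exists N => a ha; apply: contrapT => nUa.
have [y [r [nq hy]]] := irr a nUa; have /spanP [c hc] := ha.
have [|j hj hj'] := hN (f y) (fun i => f r * c i).
  have -> : \sum_(i < n) psv n (fun=> 0) i ^+ N * (f r * c i) = f (r * a).
    rewrite rmorphM hc mulr_sumr; apply: eq_bigr => i _; rewrite mulrCA; congr (_ * _); exact: mulrC.
  by rewrite -rmorphM -rmorphB; apply: extend_mem.
apply: nq; apply/augE.
have : extend f (colon U a0) (f y - j).
  apply: cf => //; first by move=> z ->; apply: ideal0.
  by rewrite mulrC.
move=> h; have -> : psn_aug n D (f y) = psn_aug n D (f y - j) by rewrite rmorphB (span_aug hj) subr0.
have hI : ideal (fun F => psn_aug n D F = 0) by apply: (ideal_preim (J := fun z => z = 0) (psn_aug n D) (@submod_zero D D^o)).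
by apply: (extend_sub hI _ h) => z hz; apply/augE; apply/qE; rewrite mulrC.
Qed.

Section RegularModulo.
Variable K : comNzRingType.
Implicit Types (J : K -> Prop).

Definition reg_mod (T : comNzRingType) (J : T -> Prop) a := forall z, J (a * z) -> J z.

Definition coef_ideal J N : ps K -> Prop := fun f => forall j, (j < N)%N -> J (pcoef f j).

Lemma ideal_coef_ideal J N : ideal J -> ideal (coef_ideal J N).
Proof.
move=> hJ; apply/idealP; split.
- by move=> j _; apply: ideal0.
- by move=> f g hf hg j jN; apply: idealD => //; [apply: hf|apply: hg].
move=> g f hf j jN; rewrite pcoefM; apply: ideal_sum => // i _; apply: idealM => //; apply: hf.
by rewrite (leq_ltn_trans _ jN) // leq_subr.
Qed.
Lemma coef_ideal_reg1 J N F : ideal J -> reg_mod J (pcoef F 0) -> reg_mod (coef_ideal J N) F.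
Proof.
move=> hJ reg h hF j; have [m] := ubnP j; elim: m j => // m IH j jm jN.
apply: reg; have := hF j jN; rewrite pcoefM big_ord_recl subn0 => e.
have -> : pcoef F 0 * pcoef h j = pcoef F 0 * pcoef h j + \sum_(i < j) pcoef F (lift ord0 i) * pcoef h (j - lift ord0 i)
   - \sum_(i < j) pcoef F (lift ord0 i) * pcoef h (j - lift ord0 i) by rewrite addrK.
apply: (idealB hJ) => //; apply: ideal_sum => // i _; apply: idealM => //; apply: IH.
  rewrite lift0; apply: leq_trans (_ : j <= m)%N; last by rewrite -ltnS.
  by rewrite ltn_subrL /= (leq_ltn_trans _ (ltn_ord i)).
by rewrite (leq_ltn_trans _ jN) // leq_subr.
Qed.
Lemma coef_ideal_reg2 J N F G : ideal J -> reg_mod J (pcoef F 0) -> reg_mod (addg J (pcoef F 0)) (pcoef G 0) ->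
  reg_mod (addg (coef_ideal J N) F) G.
Proof.
move=> hJ reg1 reg2; elim: N => [|N IH] h; first by move=> _; exists 0.
have hI n := ideal_coef_ideal n hJ.
move=> [h' hh].
have := hh 0%N (ltn0Sn N); rewrite pcoefB !pcoefM0 => h0.
have /reg2 [z hz] : addg J (pcoef F 0) (pcoef G 0 * pcoef h 0) by exists (pcoef h' 0).
pose h1 := h - psC z * F; pose h1' := h' - psC z * G.
have e1 : coef_ideal J N.+1 (G * h1 - h1' * F).
  by have -> : G * h1 - h1' * F = G * h - h' * F by rewrite /h1 /h1'; ring.
have h10 : J (pcoef h1 0) by rewrite /h1 pcoefB pcoefC.
have h1'0 : J (pcoef h1' 0).
  apply: reg1; have := e1 0%N (ltn0Sn N); rewrite pcoefB !pcoefM0 => e2.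
  rewrite -(subKr (pcoef G 0 * pcoef h1 0) (pcoef F 0 * _)) [pcoef F 0 * _]mulrC.
  by apply: (idealB hJ) => //; apply: idealM.
have [z' hz'] : addg (coef_ideal J N) F (pshift 1 h1).
  apply: IH; exists (pshift 1 h1') => j jN.
  have := e1 j.+1 jN; rewrite {1}(ps_decomp1 h1) {1}(ps_decomp1 h1') => e2.
  have e3 : pcoef (G * (psC (pcoef h1 0) + psX K * pshift 1 h1) - (psC (pcoef h1' 0) + psX K * pshift 1 h1') * F) j.+1
     = pcoef (G * pshift 1 h1 - pshift 1 h1' * F) j + (pcoef G j.+1 * pcoef h1 0 - pcoef h1' 0 * pcoef F j.+1).
    have -> : G * (psC (pcoef h1 0) + psX K * pshift 1 h1) - (psC (pcoef h1' 0) + psX K * pshift 1 h1') * F =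
       psX K * (G * pshift 1 h1 - pshift 1 h1' * F) + (G * psC (pcoef h1 0) - psC (pcoef h1' 0) * F) by ring.
    by rewrite pcoefD pcoefX [pcoef (G * psC _ - _) _]pcoefB pcoefMC pcoefC.
  rewrite e3 in e2; rewrite -[pcoef _ j](addrK (pcoef G j.+1 * pcoef h1 0 - pcoef h1' 0 * pcoef F j.+1)).
  by apply: (idealB hJ) => //; apply: (idealB hJ); [apply: idealM|apply: idealMr].
exists (psC z + psX K * z').
have -> : h - (psC z + psX K * z') * F = psC (pcoef h1 0) + psX K * (pshift 1 h1 - z' * F).
  have := ps_decomp1 h1; rewrite {1}/h1 => e; rewrite mulrDl opprD addrA e; ring.
move=> [|j] jN; rewrite pcoefD pcoefX; first by rewrite addr0 pcoefE.
by rewrite [pcoef (psC _) _]pcoefE add0r; apply: hz'.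
Qed.
End RegularModulo.

(** One variable at a time, by lowest coefficients: regularity depends only on the constant terms of
    [F] and [G]. *)
Lemma vpow_reg n N (B : comNzRingType) (F G : PSn n B) :
  (forall z, psn_aug n B F * z = 0 -> z = 0) ->
  (forall z, addg (fun x => x = 0) (psn_aug n B F) (psn_aug n B G * z) -> addg (fun x => x = 0) (psn_aug n B F) z) ->
  reg_mod (@vpow n N B) F /\ reg_mod (addg (@vpow n N B) F) G.
Proof.
move=> h1 h2; elim: n F G h1 h2 => [|n IH] F G h1 h2.
  have e : @vpow 0 N B = fun x => x = 0.
    apply/funext => x; apply/propext; split; first by move=> /spanP [c ->]; rewrite big_ord0.
    by move=> ->; apply: ideal0; apply: ideal_span.
  by rewrite e; split.
have [g1 g2] := IH (ps_aug F) (ps_aug G) h1 h2.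
have e : @vpow n.+1 N B = coef_ideal (@vpow n N B) N.
  by apply/funext => f; apply/propext; apply: vpowS.
rewrite e; split; first exact: (@coef_ideal_reg1 (PSn n B) _ N F (ideal_vpow B n N) g1).
exact: (@coef_ideal_reg2 (PSn n B) _ N F G (ideal_vpow B n N) g1 g2).
Qed.

(* [T] as an [A]-module via [f] *)
Definition restr (A T : comNzRingType) (f : {rmorphism A -> T}) : Type := T.

Section Restriction.
Variables (A T : comNzRingType) (f : {rmorphism A -> T}).
Local Notation restr := (restr f).

HB.instance Definition _ := GRing.Zmodule.on restr.
Definition restr_scale (a : A) (t : restr) : restr := f a * (t : T).
Lemma restr_scaleA a b t : restr_scale a (restr_scale b t) = restr_scale (a * b) t.
Proof. by rewrite /restr_scale rmorphM mulrA. Qed.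
Lemma restr_scale1 : left_id 1 restr_scale.
Proof. by move=> t; rewrite /restr_scale rmorph1 mul1r. Qed.
Lemma restr_scaleDr : right_distributive restr_scale +%R.
Proof. by move=> a s t; rewrite /restr_scale mulrDr. Qed.
Lemma restr_scaleDl t : {morph restr_scale^~ t : a b / a + b}.
Proof. by move=> a b; rewrite /restr_scale rmorphD mulrDl. Qed.
HB.instance Definition _ := GRing.Zmodule_isLmodule.Build A restr
  restr_scaleA restr_scale1 restr_scaleDr restr_scaleDl.

Lemma restrE (a : A) (t : restr) : a *: t = f a * (t : T) :> T. Proof. by []. Qed.

Lemma submod_restr (W : T -> Prop) : W 0 -> (forall a b, W a -> W b -> W (a + b)) ->
  (forall a t, W t -> W (f a * t)) -> submod (V := restr) W.
Proof. by move=> h0 hD hM; split=> // a x y hx hy; apply: hD => //; apply: hM. Qed.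
Lemma ideal_restr (J : T -> Prop) : ideal J -> submod (V := restr) J.
Proof.
by move=> hJ; apply: submod_restr => *; [apply: ideal0|apply: idealD|apply: idealM].
Qed.

(** The generators are monomials in the [y i]; the first clause records this as an induction
    principle instead of naming exponents. *)
Lemma generators_mod_ipow r (y : nat -> T) : (forall t, exists a, span r y (t - f a)) ->
  forall L, exists m (v : nat -> T),
  (forall P : T -> Prop, P 1 -> (forall i z, (i < r)%N -> P z -> P (y i * z)) -> forall j, (j < m)%N -> P (v j)) /\
  forall t, exists2 w, lin (V := restr) m v w & ipow r y L (t - w).
Proof.
move=> h; elim=> [|L [m [v [mon IH]]]].
  by exists 0%N, (fun=> 0); split=> // t; exists 0 => //; exists (fun=> 0); rewrite big_ord0.
(* Index [0] carries [1], and index [i * m + j + 1] carries [y i * v j]. *)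
pose v' l := if l is l'.+1 then y (l' %/ m)%N * v (l' %% m)%N else 1.
exists (r * m).+1, v'; split=> [P P1 PM [//|j] jm|t].
  rewrite ltnS in jm; have m0 : (0 < m)%N by move: jm; case: (m) => //; rewrite muln0.
  by apply: (PM); [rewrite ltn_divLR|exact: (mon P P1 PM _ (ltn_pmod _ m0))].
have [a /spanP [c hc]] := h t.
have /choice [w hw] : forall i, exists w, lin (V := restr) m v w /\ ipow r y L (c i - w).
  by move=> i; have [w ? ?] := IH (c i); exists w.
have hl := @submod_lin_span A restr (r * m).+1 v'.
exists (f a * 1 + \sum_(i < r) y i * w i).
  apply: (submodD hl); first by apply: (submodZ hl a); exact: (lin_mem (V := restr) v' (i := 0)).
  apply: (submod_sum hl) => i _.
  have hy : submod (V := restr) (fun z => lin (V := restr) (r * m).+1 v' (y i * z)).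
    apply: submod_restr => [|s s' hs hs'|s s' hs].
    - by rewrite mulr0; apply: (submod0 hl).
    - by rewrite mulrDr; apply: (submodD hl).
    - by rewrite mulrCA; apply: (submodZ hl s).
  apply: (submod_lin hy _ (hw i).1) => j jm.
  have m0 : (0 < m)%N by apply: leq_ltn_trans jm.
  have -> : y i * v j = v' (i * m + j).+1.
    by rewrite /v' divnMDl // divn_small // addn0 modnMDl modn_small.
  apply: (lin_mem (V := restr)); rewrite ltnS.
  apply: (@leq_trans (i * m + m)); first by rewrite ltn_add2l.
  by rewrite -mulSnr leq_mul2r ltn_ord orbT.
rewrite mulr1 opprD addrA hc -sumrB; apply: ideal_sum => [|i _]; first exact: ideal_ipow.
by rewrite [c i * _]mulrC -mulrBr; apply: ipow_mulvar => //; apply: (hw i).2.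
Qed.

Lemma noeth_restr r (y : nat -> T) L (J : T -> Prop) : noethR A -> ideal J ->
  (forall t, exists a, span r y (t - f a)) -> sub (ipow r y L) J -> noeth (V := restr) full J.
Proof.
move=> nA hJ h LJ; have [m [v [_ hv]]] := generators_mod_ipow h L.
have hJ' := ideal_restr hJ.
have nJ : noeth (V := restr) (addm (V := restr) J (lin (V := restr) m v)) J by apply: noeth_lin.
apply: (@noeth_sub A restr _ J full J nJ hJ') => // t _.
have [w hw hl] := hv t; exists (t - w), w; rewrite subrK; split=> //; exact: LJ.
Qed.
End Restriction.

Lemma noeth_finite (A T : comNzRingType) (f : {rmorphism A -> T}) m (v : nat -> T) : noethR A ->
  (forall t, exists s : nat -> A, t = \sum_(j < m) f (s j) * v j) -> noeth (V := restr f) full (fun x => x = 0).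
Proof.
move=> nA h; have h0 := @submod_zero A (restr f).
have nJ : noeth (V := restr f) (addm (V := restr f) (fun x => x = 0) (lin (V := restr f) m v)) (fun x => x = 0) by apply: noeth_lin.
apply: (@noeth_sub A (restr f) _ (fun x => x = 0) full _ nJ h0) => // t _.
by have [s ->] := h t; apply: (addmr h0); exists s.
Qed.

(** For growing [M] these [F] form an increasing sequence of [A]-submodules of the noetherian module
    [T/J]; hence one exponent serves all [F]. *)
Lemma stationary_quotients (A T : comNzRingType) (f : {rmorphism A -> T}) (J : T -> Prop) r (x : nat -> A) :
  ideal J -> noeth (V := restr f) full J ->
  exists M0, forall L F, (forall w, ipow r x L w -> exists s, J (f w * F - f s)) ->
    forall w, ipow r x M0 w -> exists s, J (f w * F - f s).
Proof.
move=> hJ nJ.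
pose X M F := forall w, ipow r x M w -> exists s, J (f w * F - f s).
have hX M : submod (V := restr f) (X M).
  apply: submod_restr => [w _|F G hF hG w hw|a F hF w hw].
  - by exists 0; rewrite rmorph0 mulr0 subr0; apply: ideal0.
  - have [s hs] := hF w hw; have [s' hs'] := hG w hw; exists (s + s').
    by rewrite rmorphD mulrDr opprD addrACA; apply: idealD.
  have [s hs] := hF w hw; exists (a * s); rewrite rmorphM mulrCA -mulrBr; exact: idealM.
have Xle M M' : (M <= M')%N -> sub (X M) (X M').
  by move=> MM F hF w hw; apply: hF; apply: ipow_le hw.
pose XX F := exists M, X M F.
have hXX : submod (V := restr f) XX.
  split; first by exists 0%N; apply: (submod0 (hX _)).
  move=> a F G [M hM] [M' hM']; exists (maxn M M').
  by apply: (proj2 (hX _)); [apply: Xle hM; apply: leq_maxl|apply: Xle hM'; apply: leq_maxr].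
have JX M : sub J (X M).
  by move=> F hF w _; exists 0; rewrite rmorph0 subr0; apply: idealM.
have [|//|k [v [vX gen]]] := nJ XX hXX; first by move=> F hF; exists 0%N; apply: JX.
have [M0 hM0] : exists M0, forall i, (i < k)%N -> X M0 (v i).
  elim: k vX {gen} => [|k IH] h; first by exists 0%N.
  have [M hM] := IH (fun i ik => h i (ltnW ik)); have [M' hM'] := h k (ltnSn k).
  exists (maxn M M') => i; rewrite ltnS leq_eqVlt => /orP[/eqP->|ik].
    by apply: Xle hM'; apply: leq_maxr.
  by apply: Xle (hM i ik); apply: leq_maxl.
exists M0 => L F hF; have [c hc] := gen F (ex_intro _ L hF).
have := submodD (hX M0) (JX M0 _ hc) (submod_lin (hX M0) hM0 (ex_intro _ c erefl)).
by rewrite subrK.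
Qed.

Lemma noeth_field (k : fieldType) : noethR k.
Proof.
move=> U hU U0 _; have hU' : ideal U by [].
case: (EM (exists2 a, U a & a != 0)) => [[a Ua a0]|hn].
  exists 1%N, (fun=> a); split=> // x _; exists (fun=> x / a).
  by rewrite big_ord1 /GRing.scale /= divfK // subrr.
exists 0%N, (fun=> 0); split=> // x Ux; exists (fun=> 0); rewrite big_ord0 subr0.
by apply: contrapT => /eqP x0; apply: hn; exists x.
Qed.

(** * Power series over a field of characteristic p *)

Section PowerSeriesField.
Variables (k : fieldType) (p n : nat).
Hypothesis pk : p \in [pchar k].
Local Notation S := (PSn n k).
Local Notation X := (psv n (fun=> 0 : k)).
Local Notation T := (PSn n S).

Lemma noeth_S : noethR S. Proof. exact/psn_noeth/noeth_field. Qed.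
Lemma complete_S : complete n X.
Proof. by have := @psn_complete k n 0 (fun=> 0) (@complete0 _ _); rewrite addn0. Qed.
Lemma separated_S : separated n X.
Proof. by have := @psn_separated k n 0 (fun=> 0) (@separated0 _ _); rewrite addn0. Qed.
Lemma jac_S : jac n X.
Proof. exact: complete_jac complete_S separated_S. Qed.
Lemma span_S s : span n X s <-> psn_aug n k s = 0.
Proof.
split=> [|h]; first exact: span_aug.
by have := psn_aug_span (fun=> 0) s; rewrite h rmorph0 subr0.
Qed.
Lemma loc_S (s : S) : ~ span n X s -> exists b, b * s = 1.
Proof.
rewrite span_S => /eqP h; apply: (@psn_unit n k s (psn_aug n k s)^-1); exact: mulVf.
Qed.

Lemma S_eq_mod (T' : comNzRingType) (g h : {rmorphism S -> T'}) l (z : nat -> T') (J : T' -> Prop) : ideal J ->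
  (forall x, (forall L, exists2 j, J j & ipow l z L (x - j)) -> J x) ->
  (forall c, J (g (psnC n k c) - h (psnC n k c))) ->
  (forall i, (i < n)%N -> [/\ span l z (g (X i)), span l z (h (X i)) & J (g (X i) - h (X i))]) ->
  forall s, J (g s - h s).
Proof.
move=> hJ cl hC hX; apply: (rmorphism_eq_mod hJ cl hX) => a.
by exists (psnC n k (psn_aug n k a)); [apply: hC|apply: psn_aug_span].
Qed.
Lemma S_eq (T' : comNzRingType) (g h : {rmorphism S -> T'}) l (z : nat -> T') : separated l z ->
  (forall c, g (psnC n k c) = h (psnC n k c)) ->
  (forall i, (i < n)%N -> span l z (g (X i)) /\ g (X i) = h (X i)) ->
  forall s, g s = h s.
Proof.
move=> hs hC hX s; apply/eqP; rewrite -subr_eq0; apply/eqP.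
apply: (@S_eq_mod _ g h l z (fun x => x = 0)) => //.
- exact: (@submod_zero T' T'^o).
- by move=> x hx; apply: hs => L; have [j -> ] := hx L; rewrite subr0.
- by move=> c; rewrite hC subrr.
by move=> i ir; have [h1 h2] := hX i ir; rewrite -h2 subrr.
Qed.

Let p1 : (1 < p)%N. Proof. exact: prime_gt1 (pcharf_prime pk). Qed.
Let pe e : (0 < p ^ e)%N. Proof. by rewrite expn_gt0 (ltnW p1). Qed.

Lemma phi_exists e : exists g : {rmorphism S -> S}, (forall a, g (psnC n k a) = psnC n k a) /\
  forall i, (i < n)%N -> g (X i) = X i ^+ (p ^ e).
Proof.
apply: (@psn_eval k n S (psnC n k) n X (fun i => X i ^+ (p ^ e)) (fun=> 0) complete_S separated_S) => i ir.
by rewrite -(prednK (pe e)) exprS; apply: (idealMr _ (ideal_span _ _)); apply: span_mem.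
Qed.
(** Not the Frobenius map: constants are fixed, so that the image is the series in the [X_i^(p^e)]
    with all coefficients of [k], even for imperfect [k]. *)
Definition phi e := sval (cid (phi_exists e)).
Lemma phiC e a : phi e (psnC n k a) = psnC n k a.
Proof. by have [h _] := svalP (cid (phi_exists e)). Qed.
Lemma phiX e i : (i < n)%N -> phi e (X i) = X i ^+ (p ^ e).
Proof. by have [_ h] := svalP (cid (phi_exists e)); apply: h. Qed.

Lemma phi_le e e' s : (e <= e')%N -> exists s', phi e' s = phi e s'.
Proof.
move=> ee; exists (phi (e' - e) s).
apply: (@S_eq S (phi e') (phi e \o phi (e' - e)) n X separated_S) => [c|i ir] /=; first by rewrite !phiC.
rewrite !phiX // rmorphXn phiX // -exprM -expnD subnKC //; split=> //.
by rewrite -(prednK (pe e')) exprS; apply: (idealMr _ (ideal_span _ _)); apply: span_mem.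
Qed.

Lemma complete_T : complete (n + n) (psv n X).
Proof. exact/psn_complete/complete_S. Qed.
Lemma separated_T : separated (n + n) (psv n X).
Proof. exact/psn_separated/separated_S. Qed.

Lemma span_taylor (D : comNzRingType) (w : nat -> D) i : (i < n)%N ->
  span (n + n) (psv n w) (taylor_var n w i).
Proof.
move=> ir; apply: (idealD (ideal_span _ _)).
  by rewrite (psv_eq _ w) //; apply: span_mem; rewrite ltn_addr.
by rewrite -psv_base; apply: span_mem; rewrite ltn_add2l.
Qed.

Lemma tau_exists : exists g : {rmorphism S -> T}, (forall a, g (psnC n k a) = psnC n S (psnC n k a)) /\
  forall i, (i < n)%N -> g (X i) = taylor_var n X i.
Proof.
apply: (@psn_eval k n T (psnC n S \o psnC n k) (n + n) (psv n X) _ (fun=> 0) complete_T separated_T) => i ir.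
exact: span_taylor.
Qed.
Definition tau := sval (cid tau_exists).
Lemma tauC a : tau (psnC n k a) = psnC n S (psnC n k a).
Proof. by have [h _] := svalP (cid tau_exists). Qed.
Lemma tauX i : (i < n)%N -> tau (X i) = taylor_var n X i.
Proof. by have [_ h] := svalP (cid tau_exists); apply: h. Qed.

Lemma aug_taylor (D : comNzRingType) (w : nat -> D) i : (i < n)%N -> psn_aug n D (taylor_var n w i) = w i.
Proof. by move=> ir; rewrite rmorphD psn_augv // add0r psn_augC. Qed.

Lemma aug_tau s : psn_aug n S (tau s) = s.
Proof.
apply: (@S_eq S (psn_aug n S \o tau) idfun n X separated_S) => [c|i ir] /=.
  by rewrite tauC psn_augC.
by rewrite tauX // aug_taylor //; split=> //; apply: span_mem.
Qed.

Lemma pchar_comp (K K' : comNzRingType) (f : {rmorphism K -> K'}) : p \in [pchar K] -> p \in [pchar K'].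
Proof. exact: rmorph_pchar. Qed.

Lemma exprD_char (K : comNzRingType) e (a b : K) : p \in [pchar K] -> (a + b) ^+ (p ^ e) = a ^+ (p ^ e) + b ^+ (p ^ e).
Proof.
move=> pK; apply: exprDn_pchar; rewrite pnatX; apply/orP; left.
by rewrite pnatE ?(pcharf_prime pK).
Qed.

Lemma taylor_exp (D : comNzRingType) (w : nat -> D) e i : p \in [pchar D] -> (i < n)%N ->
  vpow (p ^ e) (taylor_var n w i ^+ (p ^ e) - psnC n D (w i ^+ (p ^ e))).
Proof.
move=> pD ir; rewrite exprD_char; last exact: (pchar_comp (psnC n D)).
by rewrite rmorphXn addrK; apply: vpow_mem.
Qed.

(** The subring [phi e] is constant under Taylor expansion modulo [(t_i^q)], with [q = p^e], since
    [(X_i + t_i)^q = X_i^q + t_i^q]. *)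
Lemma tau_phi e s : vpow (p ^ e) (tau (phi e s) - psnC n S (phi e s)).
Proof.
have jT : jac (n + n) (psv n X) by apply: complete_jac complete_T separated_T.
apply: (@S_eq_mod T (tau \o phi e) (psnC n S \o phi e) (n + n) (psv n X) (@vpow n (p ^ e) S)).
- exact: ideal_vpow.
- by move=> x; apply: (noeth_closed (@psn_noeth S n noeth_S) jT (ideal_vpow S n (p ^ e))).
- by move=> c; rewrite /= phiC tauC subrr; apply: ideal0; apply: ideal_vpow.
move=> i ir; rewrite /= phiX // [tau _]rmorphXn tauX //.
have pw (z : T) : span (n + n) (psv n X) z -> span (n + n) (psv n X) (z ^+ (p ^ e)).
  by move=> hz; rewrite -(prednK (pe e)) exprS; apply: (idealMr _ (ideal_span _ _)).
split; first by apply: pw; apply: span_taylor.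
  rewrite rmorphXn; apply: pw; rewrite -psv_base; apply: span_mem; by rewrite ltn_add2l.
by apply: taylor_exp => //; apply: (pchar_comp (psnC n k)).
Qed.

Section Theta.
Variables (D : comNzRingType) (can : {rmorphism S -> D}).
Hypothesis scan : forall d, exists s, can s = d.

Definition Theta : {rmorphism S -> PSn n D} := psn_map n can \o tau.

Lemma ThetaX i : (i < n)%N -> Theta (X i) = taylor_var n (can \o X) i.
Proof.
move=> ir; rewrite /Theta /= tauX // rmorphD psn_mapC psn_mapv; congr (_ + _).
exact: psv_eq.
Qed.
Lemma aug_Theta s : psn_aug n D (Theta s) = can s.
Proof. by rewrite /Theta /= psn_map_aug aug_tau. Qed.
Lemma Theta_phi e s : vpow (p ^ e) (Theta (phi e s) - psnC n D (can (phi e s))).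
Proof. by have := vpow_map can (tau_phi e s); rewrite rmorphB psn_mapC. Qed.

Lemma noeth_D : noethR D. Proof. exact: noeth_image scan noeth_S. Qed.
Lemma jac_D : jac n (can \o X). Proof. exact: jac_image jac_S. Qed.
Lemma complete_D : complete n (can \o X). Proof. exact: complete_image complete_S. Qed.
Lemma separated_D : separated n (can \o X). Proof. exact: noeth_separated noeth_D jac_D. Qed.
Lemma noeth_TD : noethR (PSn n D). Proof. exact/psn_noeth/noeth_D. Qed.
Lemma jac_TD : jac (n + n) (psv n (can \o X)).
Proof.
by apply: complete_jac; [apply/psn_complete/complete_D|apply/psn_separated/separated_D].
Qed.
Lemma jac_Theta : jac n (Theta \o X).
Proof. by apply: (jac_sub _ jac_TD) => i ir; rewrite [(_ \o _) i]ThetaX //; apply: span_taylor. Qed.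

(** In characteristic [p] every parameter is shifted, so the images of the [X i] have only trivial
    relations for an arbitrary quotient [D]. *)
Lemma Theta_row_flat : row_flat Theta (fun x => x = 0) (\row_(i < n) X i).
Proof.
suff hk : koszul n (Theta \o X).
  apply: (@koszul_row_flat _ _ Theta n X (fun x => x = 0) (@submod_zero S S^o) n (leqnn n) hk).
    by move=> i /andP[h1 h2]; have := leq_ltn_trans h1 h2; rewrite ltnn.
  by move=> a ->; apply: rmorph0.
have := @koszul_taylor n 0 D (can \o X) noeth_D; rewrite addn0 => h c e.
have [|||s [h1 h2 h3]] := h _ _ c.
- move=> i ir; apply: (jac_sub _ jac_D) => j _; exact: (span_mem (can \o X)).
- by move=> c' _; exists (fun _ _ => 0); split=> // *; rewrite oppr0.
- by rewrite -[RHS]e; apply: eq_bigr => i _; rewrite [in RHS](_ : (Theta \o X) i = taylor_var n (can \o X) i) //; exact: ThetaX.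
exists s; split=> // i ir; rewrite h3 //; apply: eq_bigr => j _; rewrite [in RHS](_ : (Theta \o X) j = taylor_var n (can \o X) j) //; exact: ThetaX.
Qed.
Lemma Theta_flat_rows J : ideal J -> forall g (b : 'rV[S]_g), (forall z, row_ideal b z <-> J z) ->
  row_flat Theta (fun x => x = 0) b.
Proof.
move=> hJ; have h0 : ideal (fun x : S => x = 0) by exact: (@submod_zero S S^o).
apply: (flat_rows noeth_S noeth_TD h0 _ jac_Theta loc_S Theta_row_flat _ hJ).
- by move=> a ->; apply: rmorph0.
- by move=> z ->; apply: ideal0; apply: ideal_span.
by move=> z ->; apply: ideal0.
Qed.
Lemma Theta_colon : colon_flat Theta (fun x => x = 0).
Proof.
have h0 : ideal (fun x : S => x = 0) by exact: (@submod_zero S S^o).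
apply: (flat_colon noeth_S noeth_TD h0 _ jac_Theta loc_S Theta_row_flat).
- by move=> a ->; apply: rmorph0.
by move=> z ->; apply: ideal0; apply: ideal_span.
Qed.
End Theta.

(* Uniform version of [irreducible_detect] for an arbitrary ideal. *)
Lemma Theta_detect (b : S -> Prop) : ideal b -> exists N, forall f,
  (forall (D : comNzRingType) (can : {rmorphism S -> D}), (forall d, exists s, can s = d) ->
     prime (fun s => can s = 0) -> (forall s, b s -> can s = 0) -> vpow N (Theta can f)) -> b f.
Proof.
move=> hb.
pose Q (U : S -> Prop) := sub b U -> exists N, forall f,
  (forall (D : comNzRingType) (can : {rmorphism S -> D}), (forall d, exists s, can s = d) ->
     prime (fun s => can s = 0) -> (forall s, b s -> can s = 0) -> vpow N (Theta can f)) -> U f.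
suff : Q b by apply.
apply: (@irreducible_ind S S^o full b Q noeth_S (noethR_ideal noeth_S hb)) => //.
- by exists 0%N.
- move=> U1 U2 h1 h2 bU; have [|N1 hN1] := h1; first by move=> x /bU [].
  have [|N2 hN2] := h2; first by move=> x /bU [].
  exists (maxn N1 N2) => f hf; split; [apply: hN1|apply: hN2] => D can s1 s2 s3.
    by apply: vpow_le (hf D can s1 s2 s3); apply: leq_maxl.
  by apply: vpow_le (hf D can s1 s2 s3); apply: leq_maxr.
move=> U a0 q hU bU _ _ nUa0 pq qE irr _ _.
have [hq q1 _] := pq; have [D [can [sc kc]]] := quotient_ring hq q1.
have [||N hN] := @irreducible_detect S D n (Theta can) U q a0 (noeth_D sc) (Theta_colon sc) hU qE.
- by move=> a na; apply: irr.
- by move=> a; rewrite aug_Theta.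
exists N => f hf; apply: hN; apply: hf => //.
  rewrite (_ : (fun s => can s = 0) = q) //; apply/funext => s; apply/propext; exact: kc.
by move=> s /bU hs; apply/kc/qE; apply: (idealMr _ hU).
Qed.
End PowerSeriesField.

Lemma psn_map_comp n (K K' K'' : comNzRingType) (f : {rmorphism K -> K'}) (g : {rmorphism K' -> K''})
    (h : {rmorphism K -> K''}) : (forall a, g (f a) = h a) -> forall F, psn_map n g (psn_map n f F) = psn_map n h F.
Proof.
move=> e; elim: n => [//|n IH] F /=; apply: psP => i; rewrite /ps_map !pcoefE; exact: IH.
Qed.
Lemma psn_map_ker n (K K' : comNzRingType) (f : {rmorphism K -> K'}) z : (forall a, f a = 0 -> exists b, a = z * b) ->
  forall F, psn_map n f F = 0 -> exists G, F = psnC n K z * G.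
Proof.
move=> h; elim: n => [//|n IH] F /= e.
have /choice [g hg] : forall i, exists G, pcoef F i = psnC n K z * G.
  by move=> i; apply: IH; have := congr1 (fun f => pcoef f i) e; rewrite /ps_map pcoefE pcoef0.
by exists (PS g); apply: psP => i; rewrite pcoefC pcoefE.
Qed.
Lemma psnC_regular n (K : comNzRingType) (z : K) : (forall b, z * b = 0 -> b = 0) ->
  forall F, psnC n K z * F = 0 -> F = 0.
Proof.
move=> h; elim: n => [//|n IH] F /= e; apply: psP => i; apply: IH.
by have := congr1 (fun f => pcoef f i) e; rewrite pcoefC.
Qed.

Section ExtendMore.
Variables (A T : comNzRingType) (f : {rmorphism A -> T}).

Lemma extend_row g (b : 'rV[A]_g) J t : (forall z, row_ideal b z <-> J z) ->
  extend f J t <-> exists s : 'cV[T]_g, t%:M = map_mx f b *m s.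
Proof.
move=> hb; split.
  pose I z := exists s : 'cV[T]_g, z%:M = map_mx f b *m s.
  have hI : ideal I.
    split; first by exists 0; rewrite mulmx0 raddf0.
    move=> c u v [s hs] [s' hs']; exists (c *: s + s'); rewrite mulmxDr -scalemxAr -hs -hs' raddfD /=.
    by rewrite scale_scalar_mx.
  apply: (extend_sub hI) => z /hb [s hs]; exists (map_mx f s).
  by rewrite -map_mxM -hs map_scalar_mx.
move=> [s hs]; have := congr1 (fun u : 'M_1 => u 0 0) hs; rewrite !mxE eqxx mulr1n => ->.
apply: ideal_sum => [|j _]; first exact: ideal_extend.
by rewrite mxE; apply: (idealMr _ (ideal_extend _ _)); apply: extend_mem; apply/hb/row_ideal_entry.
Qed.

Lemma extend_addg J a t : ideal J -> extend f (addg J a) t -> addg (extend f J) (f a) t.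
Proof.
move=> hJ; apply: extend_sub; first exact/ideal_addg/ideal_extend.
move=> z [r hr]; exists (f r); rewrite -rmorphM -rmorphB; exact: extend_mem.
Qed.
End ExtendMore.

(** * Frobenius descent *)

Section FrobeniusSaturation.
Variables (k : fieldType) (p n : nat).
Hypothesis pk : p \in [pchar k].
Local Notation S := (PSn n k).
Local Notation X := (psv n (fun=> 0 : k)).

Section Difference.
Variables (D : comNzRingType) (can : {rmorphism S -> D}).
Hypothesis scan : forall d, exists s, can s = d.
Hypothesis pD : prime (fun s => can s = 0).
Local Notation Th := (Theta can).
Local Notation c := (extend Th (fun s => can s = 0)).

Let hQ : ideal (fun s => can s = 0). Proof. by case: pD. Qed.

(** Modulo [c] the series behave like a completed tensor square of [D], and the element is
    [v = w (x) 1 - 1 (x) w]. If [v t] lies in [c], then modulo [Th w] the constant [can w] kills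
    [t], so [t = Th w * t1] modulo [c] with [v t1] again in [c]; iterating makes [t] divisible by
    all powers of [Th w]. *)
Lemma Theta_difference_regular w : span n X w -> can w <> 0 ->
  reg_mod c (Th w - psnC n D (can w)).
Proof.
move=> hw nw.
have hc : ideal c by apply: ideal_extend.
have reg1 t : c (Th w * t) -> c t.
  move=> h; have h0 z : z = 0 -> can z = 0 by move=> ->; apply: rmorph0.
  apply: extend_mono (Theta_colon scan hQ h0 h) => z; rewrite /colon.
  by case: pD => _ _ pr /pr [].
have hQw := ideal_addg w hQ.
have Qw1 : ~ addg (fun s => can s = 0) w 1.
  move=> [r hr]; have [u hu] := jac_unit (@jac_S k n) (idealM r (ideal_span n X) hw).
  by case: pD => _ + _; apply; rewrite -hu rmorphM hr mulr0.
have [D' [can' [sc' kc']]] := quotient_ring hQw Qw1.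
have [rho hrho] : exists rho : {rmorphism D -> D'}, forall s, rho (can s) = can' s.
  by apply: factor => // s hs; apply/kc'; apply: addgl.
have krho a : rho a = 0 -> exists b, a = can w * b.
  have [s <-] := scan a; rewrite hrho => /kc' [r hr]; exists (can r).
  by apply/eqP; rewrite -rmorphM -subr_eq0 -rmorphB mulrC hr.
have srho b : exists a, rho a = b by have [s <-] := sc' b; exists (can s).
have wreg b : can w * b = 0 -> b = 0.
  have [s <-] := scan b; rewrite -rmorphM; case: pD => _ _ pr /pr [] //.
pose c' := extend Th (addg (fun s => can s = 0) w).
(* Reduced modulo [can w], the equation becomes a relation over [D'[[t]]]. Flatness of [Theta can']
   lifts it, with an error divisible by [can w] that can be cancelled. *)
have reg2 t : c' (psnC n D (can w) * t) -> c' t.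
  have [g [b hb]] := row_of_ideal (@noeth_S k n) hQw.
  move=> /(extend_row _ _ hb) [s hs].
  have mapE F : psn_map n rho (Th F) = Theta can' F by apply: psn_map_comp.
  have [|l [M [e' [hM es]]]] := Theta_flat_rows sc' hQw hb (c := map_mx (psn_map n rho) s).
    have -> : map_mx (Theta can') b = map_mx (psn_map n rho) (map_mx Th b).
      by apply/matrixP => i j; rewrite !mxE mapE.
    rewrite -map_mxM -hs map_scalar_mx /= rmorphM psn_mapC hrho.
    by rewrite (_ : can' w = 0) ?rmorph0 ?mul0r ?raddf0 //; apply/kc'; apply: addgr.
  have sT (y : PSn n D') : exists x, psn_map n rho x = y.
    by have [a ha] := srho (psn_aug n D' y); have [x hx _] := psn_map_surj srho ha; exists x.
  have [lft hlft] := choice sT; pose e := map_mx lft e'.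
  have /choice [s'' hs''] : forall j, exists G, s j 0 - (map_mx Th M *m e) j 0 = psnC n D (can w) * G.
    move=> j; apply: (psn_map_ker krho); rewrite rmorphB.
    have := congr1 (fun u : 'cV_g => u j 0) es; rewrite [LHS]mxE => ->.
    apply/eqP; rewrite subr_eq0; apply/eqP; rewrite !mxE rmorph_sum; apply: eq_bigr => i _.
    by rewrite rmorphM !mxE hlft mapE.
  apply/(extend_row _ _ hb); exists (\col_j s'' j).
  have es2 : s = map_mx Th M *m e + psnC n D (can w) *: \col_j s'' j.
    apply/colP => j; rewrite [RHS]mxE [X in _ + X]mxE [X in _ + _ * X]mxE -hs'' addrC subrK //.
  have bM : map_mx Th b *m map_mx Th M = 0.
    rewrite -map_mxM; apply/rowP => j; rewrite mxE hM mxE; exact: rmorph0.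
  apply/matrixP => i j; rewrite !ord1 [LHS]mxE eqxx mulr1n; apply/eqP; rewrite -subr_eq0; apply/eqP.
  apply: (psnC_regular wreg); rewrite mulrBr.
  have := congr1 (fun u : 'M_1 => u 0 0) hs; rewrite [LHS]mxE eqxx mulr1n => ->.
  by rewrite es2 mulmxDr mulmxA bM mul0mx add0r -scalemxAr [X in X - _]mxE subrr.
set v := Th w - _.
have step t : c (v * t) -> exists t1, c (v * t1) /\ c (t - Th w * t1).
  move=> h; have /reg2 /(extend_addg hQ) [t1 ht1] : c' (psnC n D (can w) * t).
    have -> : psnC n D (can w) * t = Th w * t - v * t by rewrite /v; ring.
    apply: idealB; first exact: ideal_extend.
      apply: idealMr; first exact: ideal_extend.
      by apply: extend_mem; apply: addgr.
    by apply: extend_mono h => s hs; apply: addgl.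
  exists t1; rewrite mulrC in ht1; split=> //; apply: reg1.
  have -> : Th w * (v * t1) = v * t - v * (t - Th w * t1) by ring.
  by apply: (idealB hc) => //; apply: idealM.
move=> t ht.
have jw : jac 1 (fun=> Th w).
  by apply: (jac_sub _ (jac_Theta scan)) => i _; apply: span_image.
apply: (@noeth_closed _ 1 (fun=> Th w) c t (noeth_TD scan) jw hc) => L.
suff [t1 [h1 h2]] : exists t1, c (v * t1) /\ c (t - Th w ^+ L * t1).
  exists (t - Th w ^+ L * t1) => //; rewrite subKr; apply: idealMr; first exact: ideal_ipow.
  exact: (ipow_exp (fun=> Th w) L (i := 0)).
elim: L => [|L [t1 [h1 h2]]]; first by exists t; rewrite mul1r subrr; split=> //; apply: ideal0.
have [t2 [h3 h4]] := step t1 h1; exists t2; split=> //.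
have -> : t - Th w ^+ L.+1 * t2 = (t - Th w ^+ L * t1) + Th w ^+ L * (t1 - Th w * t2).
  by rewrite exprS; ring.
by apply: (idealD hc) => //; apply: idealM.
Qed.

(** With [y] a power of some [X i] outside the prime, [y] and the series congruent to [y w] are both
    constant modulo [(t_i^q)], so [Th y * v] lies in [c + (t_i^q)] for the difference [v]. Krull's
    theorem and regularity of [v] put [Th y] in [c + (t)], and the constant term gives
    [can y = 0]. *)
Lemma frobenius_saturation_prime (I2 : S -> Prop) w : (forall s, I2 s -> can s = 0) -> span n X w ->
  (forall e, exists M, forall i, (i < n)%N -> exists s, I2 (X i ^+ (p ^ e * M) * w - phi n pk e s)) -> can w = 0.
Proof.
move=> I2Q hw hZ; apply: contrapT => nw.
have [i [ir ny]] : exists i, (i < n)%N /\ can (X i) <> 0.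
  apply: contrapT => hn; apply: nw; apply: (span_sub hQ _ hw) => i ir.
  by apply: contrapT => h; apply: hn; exists i.
set v := Th w - psnC n D (can w).
have hc : ideal c by apply: ideal_extend.
have [N hN] := ring_krull n (psv n (fun=> 0 : D)) v (noeth_TD scan) hc.
have p1 : (1 < p)%N := prime_gt1 (pcharf_prime pk).
have Ne : (N <= p ^ N)%N by apply/ltnW/ltn_expl.
have [M /(_ i ir) [s hs]] := hZ N.
set y := X i ^+ _ in hs; set g := y * w - _ in hs.
have hy : y = phi n pk N (X i ^+ M) by rewrite rmorphXn phiX // -exprM.
have cg : can g = 0 by apply: I2Q.
pose a1 := Th (phi n pk N s) - psnC n D (can (phi n pk N s)).
pose a2 := Th y - psnC n D (can y).
have ha : vpow N (a1 - a2 * psnC n D (can w)).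
  apply: (vpow_le Ne); apply: (idealB (ideal_vpow _ _ _)); first exact: Theta_phi.
  by apply: (idealMr _ (ideal_vpow _ _ _)); rewrite /a2 hy; apply: Theta_phi.
have /spanP [u hu] := ha.
have e1 : Th y * v - (a1 - a2 * psnC n D (can w)) = Th g.
  have e2 : Th g = Th y * Th w - Th (phi n pk N s) by rewrite /g rmorphB rmorphM.
  have e3 : psnC n D (can (phi n pk N s)) = psnC n D (can y) * psnC n D (can w).
    rewrite -!rmorphM; congr (psnC _ _ _); apply/eqP; rewrite eq_sym -subr_eq0 -rmorphB.
    by apply/eqP.
  by rewrite e2 /a1 /a2 /v e3; ring.
have [|j hj hj'] := hN (Th y) u.
  have -> : \sum_(i < n) psv n (fun=> 0) i ^+ N * u i = a1 - a2 * psnC n D (can w).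
    by rewrite hu; apply: eq_bigr => l _; rewrite mulrC.
  by rewrite e1; apply: extend_mem.
have h : c (Th y - j) by apply: (Theta_difference_regular hw nw); rewrite mulrC.
have : can y = 0.
  have -> : can y = psn_aug n D (Th y - j) by rewrite rmorphB (span_aug hj) subr0 aug_Theta.
  apply: (extend_sub (J := fun F => psn_aug n D F = 0) _ _ h).
    exact: (ideal_preim (J := fun z => z = 0) (psn_aug n D) (@submod_zero D D^o)).
  by move=> z hz; rewrite aug_Theta.
by move=> /(primeX pD).
Qed.
End Difference.
End FrobeniusSaturation.

Lemma ipowm_restr (A T : comNzRingType) (f : {rmorphism A -> T}) r (y : nat -> A) L t :
  ipow r (f \o y) L t -> ipowm (V := restr f) r y L full t.
Proof.
elim: L t => [//|L IH] t /ipowS_E [u [hu ->]]; exists u; split=> // i ir; apply: IH; exact: hu.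
Qed.

Section FrobeniusSaturation.
Variables (k : fieldType) (p n : nat).
Hypothesis pk : p \in [pchar k].
Local Notation S := (PSn n k).
Local Notation X := (psv n (fun=> 0 : k)).
Local Notation phi := (phi n pk).

Let p1 : (1 < p)%N. Proof. exact: prime_gt1 (pcharf_prime pk). Qed.
Let pe e : (0 < p ^ e)%N. Proof. by rewrite expn_gt0 (ltnW p1). Qed.

Lemma vpow_phi e s : vpow (p ^ e) s -> span n (phi e \o X) s.
Proof.
apply: span_sub; first exact: ideal_span.
by move=> i ir; rewrite -(phiX pk e ir); apply: (span_mem (phi e \o X)).
Qed.

Lemma const_generators L : exists m (v : nat -> S),
  (forall P : S -> Prop, P 1 -> (forall i z, (i < n)%N -> P z -> P (X i * z)) -> forall j, (j < m)%N -> P (v j)) /\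
  forall t, exists2 w,
  lin (V := restr (psnC n k)) m v w & ipow n X L (t - w).
Proof. by apply: generators_mod_ipow => t; exists (psn_aug n k t); apply: psn_aug_span. Qed.

Lemma ipow_phi e L : exists L', sub (ipow n X L') (ipow n (phi e \o X) L).
Proof.
have [K hK] := ipow_vpow k n (p ^ e); exists (L * K)%N.
elim: L => [//|L IH]; rewrite mulSn -[L.+1]add1n; apply: ipowD; first exact: ideal_ipow.
by move=> a b /hK /vpow_phi ha /IH hb; apply: ipowM => //; apply/ipow1.
Qed.

Lemma jac_phi e : jac n (phi e \o X).
Proof.
apply: (jac_sub _ (@jac_S k n)) => i ir; rewrite [(_ \o _) i]phiX // -(prednK (pe e)) exprS.
by apply: (idealMr _ (ideal_span _ _)); apply: span_mem.
Qed.

Lemma phi_generators e : exists m (v : nat -> S),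
  (forall P : S -> Prop, P 1 -> (forall i z, (i < n)%N -> P z -> P (X i * z)) -> forall j, (j < m)%N -> P (v j)) /\
  forall t, exists s : nat -> S, t = \sum_(j < m) phi e (s j) * v j.
Proof.
have [L hL] := ipow_vpow k n (p ^ e); have [m [v [mon hv]]] := const_generators L.
exists m, v; split=> //; apply: (complete_generation (@complete_S k n) (noeth_separated (@noeth_S k n) (@jac_phi e))) => t.
have [w [c ->] hw] := hv t; exists (fun j => psnC n k (c j)); apply: vpow_phi.
rewrite (eq_bigr (fun j : 'I_m => psnC n k (c j) * v j)); first exact: hL hw.
by move=> j _; rewrite phiC.
Qed.

Lemma noeth_phi e : noeth (V := restr (phi e)) full (fun x => x = 0).
Proof. by have [m [v [_ hv]]] := phi_generators e; apply: (noeth_finite (@noeth_S k n) hv). Qed.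

(** The ring [S] is finite over the image of [phi e], and the powers of the [X_i^(p^e)] define the
    same topology. *)
Lemma phi_closed e (W : S -> Prop) h : submod (V := restr (phi e)) W ->
  (forall L, exists2 y, W y & ipow n X L (h - y)) -> W h.
Proof.
move=> hW cl.
have nW : noeth (V := restr (phi e)) full W.
  by apply: (noeth_sub (@noeth_phi e) hW) => // x ->; apply: (submod0 hW).
apply: (@krull_closed S (restr (phi e)) full W n X h (@jac_S k n) nW (@submod_full _ _) hW) => //.
move=> L; have [L' hL'] := ipow_phi e L; have [y hy hyh] := cl L'.
exists y, (h - y); split=> //; last by rewrite addrC subrK.
by apply: ipowm_restr; apply: hL'.
Qed.

Variable I2 : S -> Prop.
Hypothesis hI2 : ideal I2.
Hypothesis sat2 : forall h M, (forall i, (i < n)%N -> I2 (X i ^+ M * h)) -> I2 h.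

(** The saturation of [phi e S + I2]. Exponents are multiples of [p^e] so that the multipliers lie
    in the image of [phi e] as well. *)
Definition frob_sat e h := exists M, forall i, (i < n)%N -> exists s, I2 (X i ^+ (p ^ e * M) * h - phi e s).

Lemma frob_sat_le e e' h : (e <= e')%N -> frob_sat e' h -> frob_sat e h.
Proof.
move=> ee [M hM]; exists (p ^ (e' - e) * M)%N => i ir; have [s hs] := hM i ir.
have [s' hs'] := phi_le pk s ee; exists s'; rewrite -hs' mulnA -expnD subnKC //.
Qed.

Lemma frob_sat_I2 e h : I2 h -> frob_sat e h.
Proof. by exists 0%N => i _; exists 0; rewrite rmorph0 subr0; apply: idealM. Qed.

Lemma submod_frob_sat e : submod (V := restr (phi e)) (frob_sat e).
Proof.
apply: submod_restr => [|a b [M hM] [M' hM']|a t [M hM]].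
- by apply: frob_sat_I2; apply: ideal0.
- exists (M + M')%N => i ir; have [s hs] := hM i ir; have [s' hs'] := hM' i ir.
  exists (X i ^+ M' * s + X i ^+ M * s'); rewrite rmorphD !rmorphM !rmorphXn !phiX // -!exprM.
  have -> : X i ^+ (p ^ e * (M + M')) * (a + b) - (X i ^+ (p ^ e * M') * phi e s + X i ^+ (p ^ e * M) * phi e s')
    = X i ^+ (p ^ e * M') * (X i ^+ (p ^ e * M) * a - phi e s) + X i ^+ (p ^ e * M) * (X i ^+ (p ^ e * M') * b - phi e s').
    by rewrite mulnDr exprD; ring.
  by apply: idealD => //; apply: idealM.
exists M => i ir; have [s hs] := hM i ir; exists (a * s).
by rewrite rmorphM mulrCA -mulrBr; apply: idealM.
Qed.

Definition frob_sat0 e h := frob_sat e h /\ span n X h.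

(** By [frobenius_saturation_prime], [w] lies in every prime over [I2]. Then the [phi N s] congruent
    to a multiple of [w] vanishes at these primes, and being constant under Taylor expansion it lies
    in [I2] by [Theta_detect]; saturatedness of [I2] returns to [w]. *)
Lemma frob_sat0_inter w : (forall e, frob_sat0 e w) -> I2 w.
Proof.
move=> hw.
have zero (D : comNzRingType) (can : {rmorphism S -> D}) : (forall d, exists s, can s = d) ->
    prime (fun s => can s = 0) -> (forall s, I2 s -> can s = 0) -> can w = 0.
  move=> sc pc kc; apply: (frobenius_saturation_prime (pk := pk) sc pc kc (proj2 (hw 0%N))) => e.
  by have [] := hw e.
have [N hN] := Theta_detect hI2.
have [[M hM] _] := hw N.
apply: (sat2 (M := p ^ N * M)) => i ir; have [s hs] := hM i ir.
suff hf : I2 (phi N s) by rewrite -(subrK (phi N s) (_ * w)); apply: idealD.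
apply: hN => D can sc pc kc; apply: (vpow_le (ltnW (ltn_expl N p1))).
have := Theta_phi pk can N s; have -> : can (phi N s) = 0.
  apply/eqP; rewrite -oppr_eq0 -[X in X == _]add0r -[X in X + _](_ : can (X i ^+ (p ^ N * M) * w) = 0).
    by rewrite -rmorphB kc.
  by rewrite rmorphM zero // mulr0.
by rewrite rmorph0 subr0.
Qed.

Lemma frob_sat0_le e e' h : (e <= e')%N -> frob_sat0 e' h -> frob_sat0 e h.
Proof. by move=> ee [h1 h2]; split=> //; apply: frob_sat_le h1. Qed.

Lemma submod_frob_sat0 e : submod (V := restr (phi e)) (frob_sat0 e).
Proof.
apply: (submod_capm (submod_frob_sat e)); apply: ideal_restr; exact: ideal_span.
Qed.
Lemma frob_sat0_const e (c : k) h : frob_sat0 e h -> frob_sat0 e (psnC n k c * h).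
Proof. by move=> hh; rewrite -(phiC n pk e c); apply: (submodZ (submod_frob_sat0 e)). Qed.

(** Chevalley's argument: the images in the finite-dimensional quotients of [S] stabilise as [e]
    grows, so a counterexample for every [e] converges to one in the intersection, which
    [frob_sat0_inter] places in [I2]. *)
Lemma frob_sat_compact L : exists e, forall h, frob_sat0 e h -> exists2 g, I2 g & ipow n X L (h - g).
Proof.
pose E L l h := exists2 y, frob_sat0 l y & ipow n X L (h - y).
have hE l J : submod (V := restr (psnC n k)) (E J l).
  have hs := submod_frob_sat0 l; have hi := ideal_ipow n X J.
  apply: submod_restr => [|a b [y hy hy'] [z hz hz']|c t [y hy hy']].
  - by exists 0; [apply: (submod0 hs)|rewrite subrr; apply: ideal0].
  - by exists (y + z); [apply: (submodD hs)|rewrite opprD addrACA; apply: idealD].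
  by exists (psnC n k c * y); [apply: frob_sat0_const|rewrite -mulrBr; apply: idealM].
have Edec J l l' h : (l <= l')%N -> E J l' h -> E J l h.
  by move=> ll [y hy hy']; exists y => //; apply: frob_sat0_le hy.
have Est J : exists l0, forall l h, (l0 <= l)%N -> E J l0 h -> E J l h.
  have [m [v [_ hv]]] := const_generators J.
  have hi := ideal_ipow n X J.
  have pk0 : prime (fun c : k => c = 0).
    split; [exact: (@submod_zero k k^o)|by apply/eqP; apply: oner_neq0|].
    by move=> a b /eqP; rewrite mulf_eq0 => /orP[]/eqP; [left|right].
  have [|||||l0 hl0] := @saturated_dcc k (restr (psnC n k)) _ (E J) (ipow n X J) v m pk0 (fun l => hE l J).
  - by move=> l h; apply: Edec.
  - move=> l w x /eqP nw hx; have := submodZ (hE l J) w^-1 hx.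
    by rewrite scalerA mulVf // scale1r.
  - exact: ideal_restr.
  - by move=> i a _ ->; rewrite scale0r; apply: ideal0.
  - exists 0%N => l x _ hx _; exists 0; last by rewrite subr0.
    exact: (submod0 (submod_frob_sat0 l)).
  exists l0 => l h ll; apply: hl0 => //; have [w hw hw'] := hv h.
  by exists (h - w), w; split=> //; rewrite subrK.
apply: contrapT => hn.
pose Einf J h := forall l, E J l h.
have inf J l h : (forall l' h', (l <= l')%N -> E J l h' -> E J l' h') -> frob_sat0 l h -> Einf J h.
  move=> hst hh l'; have h0 : E J l h by exists h => //; rewrite subrr; apply: ideal0; apply: ideal_ipow.
  by case: (leqP l l') => [ll|/ltnW ll]; [apply: hst|apply: Edec h0].
have [y0 [hy0 ny0]] : exists y0, Einf L y0 /\ ~ exists2 g, I2 g & ipow n X L (y0 - g).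
  have [l0 hl0] := Est L; apply: contrapT => hn'; apply: hn; exists l0 => h hh.
  by apply: contrapT => hg; apply: hn'; exists h; split=> //; apply: inf hh.
have lift J y : Einf J y -> exists y', Einf J.+1 y' /\ ipow n X J (y' - y).
  move=> hy; have [l0 hl0] := Est J.+1; have [y' hy' hyy] := hy l0.
  exists y'; split; first by apply: inf hy'.
  by rewrite -opprB; apply: (idealN (ideal_ipow _ _ _)).
have /choice [st hst] : forall q : nat * S, exists y', Einf q.1 q.2 -> Einf q.1.+1 y' /\ ipow n X q.1 (y' - q.2).
  move=> [J y] /=; case: (EM (Einf J y)) => [/lift [y' hy']|]; last by exists y.
  by exists y'.
pose ys := fix ys j := if j is j.+1 then st ((L + j)%N, ys j) else y0.
have hys j : Einf (L + j)%N (ys j).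
  elim: j => [|j IH]; first by rewrite addn0.
  by rewrite addnS; apply: (hst (_, _) IH).1.
have hd j : ipow n X (L + j) (ys j.+1 - ys j) := (hst (_, _) (hys j)).2.
have [|s hs] := (@complete_S k n) (fun j => ys j.+1 - ys j).
  by move=> j; apply: ipow_le (hd j); apply: leq_addl.
have tel J : \sum_(j < J) (ys j.+1 - ys j) = ys J - y0.
  by rewrite -(big_mkord xpredT (fun j => ys j.+1 - ys j)) telescope_sumr.
have lim J : ipow n X J (y0 + s - ys J).
  by have := hs J; rewrite tel opprB addrA [s + y0]addrC.
have dL J : ipow n X L (ys J - y0).
  rewrite -tel; apply: ideal_sum => [|j _]; first exact: ideal_ipow.
  by apply: ipow_le (hd j); apply: leq_addr.
have hy e : frob_sat0 e (y0 + s).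
  apply: (phi_closed (submod_frob_sat0 e)) => J; have [y hy hyy] := hys J e; exists y => //.
  rewrite -(subrK (ys J) (y0 + s)) -addrA; apply: (idealD (ideal_ipow _ _ _)) => //.
  by apply: ipow_le hyy; apply: leq_addl.
apply: ny0; exists (y0 + s); first exact: frob_sat0_inter.
rewrite -opprB; apply: (idealN (ideal_ipow _ _ _)).
rewrite -(subrK (ys L) (y0 + s)) -addrA; apply: (idealD (ideal_ipow _ _ _)); [exact: lim|exact: dL].
Qed.

(** On an irreducible component of [W] over [phi e S], either all [X i] are nilpotent, and a power
    of the maximal ideal is absorbed, or some [X i] is regular, and saturation adds nothing. *)
Lemma frob_sat_open e : exists L, forall h, frob_sat e h ->
  (exists g s, I2 g /\ ipow n X L (h - g - phi e s)) -> exists s, I2 (h - phi e s).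
Proof.
pose W h := exists s, I2 (h - phi e s).
have hW : submod (V := restr (phi e)) W.
  apply: submod_restr => [|a b [s hs] [s' hs']|a t [s hs]].
  - by exists 0; rewrite rmorph0 subr0; apply: ideal0.
  - by exists (s + s'); rewrite rmorphD opprD addrACA; apply: idealD.
  - by exists (a * s); rewrite rmorphM -mulrBr; apply: idealM.
have nW : noeth (V := restr (phi e)) full W.
  by apply: (noeth_sub (@noeth_phi e) hW) => // x ->; apply: (submod0 hW).
pose Q (U : S -> Prop) := sub W U -> exists L, forall h, frob_sat e h -> (exists2 u, U u & ipow n X L (h - u)) -> U h.
suff : Q W.
  move=> [//|L hL]; exists L => h hh [g [s [hg hl]]]; apply: hL => //; exists (g + phi e s).
    by exists s; rewrite addrK.
  by rewrite opprD addrA.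
apply: (@irreducible_ind S (restr (phi e)) full W Q (@noeth_S k n) nW (@submod_full _ _) hW) => //.
- by exists 0%N.
- move=> U1 U2 h1 h2 WU; have [|L1 hL1] := h1; first by move=> x /WU [].
  have [|L2 hL2] := h2; first by move=> x /WU [].
  exists (maxn L1 L2) => h hh [u [u1 u2] hu]; split; [apply: hL1 => //|apply: hL2 => //]; exists u => //.
    by apply: ipow_le hu; apply: leq_maxl.
  by apply: ipow_le hu; apply: leq_maxr.
move=> U a0 q hU WU _ _ nUa0 pq qE irr nil _.
have [hq q1 qM] := pq.
case: (EM (forall i, (i < n)%N -> q (X i))) => [hX|/existsNP [i /not_implyP [ir nX]]].
  have [|L hL] := @ipowm_pigeon S (restr (phi e)) n X full U (@submod_full _ _) hU.
    by move=> i ir; have [N hN] := nil _ (hX i ir); exists N => z hz; apply: hN.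
  have [L' hL'] := ipow_phi e L; exists L' => h _ [u hu hl].
  rewrite -(subrK u h); apply: (submodD hU) => //; apply: hL; apply: ipowm_restr; exact: hL'.
exists 0%N => h [M hM] _; apply: contrapT => nUh.
have [y [r [ny hy]]] := irr h Logic.I nUh.
have [s hs] := hM i ir.
have hXh : U (phi e (X i ^+ M) * h).
  by apply: WU; exists s; rewrite rmorphXn phiX // -exprM.
have : q (X i ^+ M * y).
  apply/qE; have := submodD hU (submodZ hU (X i ^+ M) hy) (submodZ hU r hXh).
  by rewrite !restrE /restr_scale /= rmorphM => h1; congr U: h1; ring.
by case/qM => // /(primeX pq).
Qed.

(** Constants always belong to the image of [phi], so the constant term of [h] is removed. By
    compactness the rest is close to [I2], and by openness close is enough. *)
Lemma frobenius_saturation e1 : exists e, (e1 <= e)%N /\ forall h, frob_sat e h -> exists s, I2 (h - phi e1 s).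
Proof.
have [L hL] := frob_sat_open e1; have [e he] := frob_sat_compact L.
exists (maxn e1 e); split; first exact: leq_maxl.
move=> h hh; apply: hL; first by apply: frob_sat_le hh; apply: leq_maxl.
set e' := maxn e1 e in hh *; set c := psnC n k (psn_aug n k h).
have hc : frob_sat0 e' (h - c).
  split; last exact: psn_aug_span.
  apply: (submodB (submod_frob_sat e')) => //; exists 0%N => i _; exists c.
  by rewrite muln0 mul1r phiC subrr; apply: ideal0.
have [g hg hl] := he _ (frob_sat0_le (leq_maxr e1 e) hc).
by exists g, c; split=> //; rewrite phiC -addrA [- g - _]addrC addrA.
Qed.
End FrobeniusSaturation.

(** * Coordinates of truncated series in powers of the Taylor variables *)

Section ShiftedCoordinates.
Variables (K : comNzRingType) (a : K).
Local Notation u := (psX K + psC a).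

Lemma shifted_exp_coef i j : (i <= j)%N -> pcoef (u ^+ i) j = (i == j)%:R.
Proof.
elim: i j => [|i IH] j ij; first by rewrite expr0 pcoef1 eq_sym.
rewrite exprS mulrDl pcoefD pcoefX pcoefC; case: j ij => // j ij.
by rewrite !IH // ?eqSS ?(ltnW ij) // (ltn_eqF ij) // mulr0 addr0.
Qed.

Definition shifted_sum q (c : nat -> K) : ps K := \sum_(i < q) psC (c i) * u ^+ i.

Lemma shifted_sum_coef q c : pcoef (shifted_sum q c) q = 0.
Proof.
rewrite pcoef_sum big1 // => i _; rewrite pcoefC shifted_exp_coef ?(ltnW (ltn_ord i)) //.
by rewrite ltn_eqF // mulr0.
Qed.

Lemma shifted_coordinates q (f : ps K) (J : K -> Prop) : ideal J -> (forall j, (j < q)%N -> J (pcoef f j)) ->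
  exists c : nat -> K, (forall i, (i < q)%N -> J (c i)) /\ forall j, (j < q)%N -> pcoef (f - shifted_sum q c) j = 0.
Proof.
move=> hJ; elim: q f => [|q IH] f hf; first by exists (fun=> 0).
have [|c [hc hcf]] := IH (f - psC (pcoef f q) * u ^+ q).
  move=> j jq; rewrite pcoefB pcoefC; apply: (idealB hJ); first by apply/hf/ltnW.
  by apply: idealMr => //; apply: hf.
exists (fun i => if i == q then pcoef f q else c i); split.
  by move=> i; rewrite ltnS leq_eqVlt; case: eqP => [_ _|_ /= /hc //]; apply: hf.
have e : f - shifted_sum q.+1 (fun i => if i == q then pcoef f q else c i) =
   f - psC (pcoef f q) * u ^+ q - shifted_sum q c.
  rewrite /shifted_sum big_ord_recr /= eqxx opprD addrA addrAC; congr (_ - _ - _).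
  by apply: eq_bigr => i _; rewrite (ltn_eqF (ltn_ord i)).
move=> j; rewrite e ltnS leq_eqVlt => /orP[/eqP ->|]; last exact: hcf.
by rewrite pcoefB shifted_sum_coef pcoefB pcoefC shifted_exp_coef // eqxx mulr1 subrr subr0.
Qed.

Lemma shifted_coordinates_uniq q (c : nat -> K) :
  (forall j, (j < q)%N -> pcoef (shifted_sum q c) j = 0) -> forall i, (i < q)%N -> c i = 0.
Proof.
elim: q => [//|q IH] h.
have cq : c q = 0.
  have := h q (ltnSn q); rewrite /shifted_sum big_ord_recr /= pcoefD -/(shifted_sum q c) shifted_sum_coef.
  by rewrite pcoefC shifted_exp_coef // eqxx mulr1 add0r.
move=> i; rewrite ltnS leq_eqVlt => /orP[/eqP -> //|iq]; apply: IH iq => j jq.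
by have := h j (ltnW jq); rewrite /shifted_sum big_ord_recr /= cq rmorph0 mul0r addr0.
Qed.

Lemma shifted_sumB q c c' : shifted_sum q (fun i => c i - c' i) = shifted_sum q c - shifted_sum q c'.
Proof. by rewrite -sumrB; apply: eq_bigr => i _; rewrite rmorphB mulrBl. Qed.
Lemma shifted_sumD q c c' : shifted_sum q (fun i => c i + c' i) = shifted_sum q c + shifted_sum q c'.
Proof. by rewrite -big_split; apply: eq_bigr => i _; rewrite rmorphD mulrDl. Qed.
Lemma shifted_sumM q z c : shifted_sum q (fun i => z * c i) = psC z * shifted_sum q c.
Proof. by rewrite mulr_sumr; apply: eq_bigr => i _; rewrite rmorphM mulrA. Qed.
End ShiftedCoordinates.

(* Series all of whose coordinates in the basis [u^i], [u_i = t_i + a_i], [i_j < q], of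
   [D[[t]]/(t_j^q)] lie in [Z]. *)
Fixpoint lattice (D : comNzRingType) (q : nat) (Z : D -> Prop) (n : nat) (a : nat -> D) : PSn n D -> Prop :=
  match n with
  | 0 => Z
  | m.+1 => fun f => exists c : nat -> PSn m D, (forall i, (i < q)%N -> @lattice D q Z m (fun i => a i.+1) (c i)) /\
      forall j, (j < q)%N -> pcoef (f - shifted_sum (psnC m D (a 0%N)) q c) j = 0
  end.

Section Lattices.
Variables (D : comNzRingType) (q : nat).
Implicit Types (Z : D -> Prop) (a : nat -> D).

Lemma lattice_vpow Z n a f : Z 0 -> vpow q f -> @lattice D q Z n a f.
Proof.
move=> Z0; elim: n a f => [|n IH] a f; first by move=> /spanP [c ->]; rewrite big_ord0.
move=> /vpowS hf; have [c [hc hcf]] := shifted_coordinates (psnC n D (a 0%N)) (ideal_vpow D n q) hf.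
by exists c; split=> // i iq; apply: IH; apply: hc.
Qed.

Lemma latticeD Z n a f g : (forall x y, Z x -> Z y -> Z (x + y)) ->
  @lattice D q Z n a f -> lattice q Z a g -> lattice q Z a (f + g).
Proof.
move=> ZD; elim: n a f g => [|n IH] a f g; first exact: ZD.
move=> [c [hc hcf]] [d [hd hdg]]; exists (fun i => c i + d i); split; first by move=> i iq; exact: (IH _ _ _ (hc i iq) (hd i iq)).
move=> j jq; rewrite shifted_sumD opprD addrACA pcoefD hcf // hdg // addr0 //.
Qed.

Lemma lattice_const Z Z' n a z f : (forall h, Z h -> Z' (z * h)) ->
  @lattice D q Z n a f -> lattice q Z' a (psnC n D z * f).
Proof.
move=> ZZ; elim: n a f => [|n IH] a f; first exact: ZZ.
move=> [c [hc hcf]]; exists (fun i => psnC n D z * c i); split; first by move=> i iq; exact: (IH _ _ (hc i iq)).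
by move=> j jq; rewrite shifted_sumM -mulrBr pcoefC hcf // mulr0.
Qed.

Lemma lattice_mono Z Z' n a f : sub Z Z' -> @lattice D q Z n a f -> lattice q Z' a f.
Proof.
move=> ZZ /(@lattice_const Z Z' n a 1); rewrite rmorph1 mul1r; apply.
by move=> h /ZZ; rewrite mul1r.
Qed.

Lemma lattice_psnC Z n a h : (0 < q)%N -> Z 0 -> Z h -> @lattice D q Z n a (psnC n D h).
Proof.
move=> q0 Z0 hh; elim: n a => [//|n IH] a.
exists (fun i => if i == 0%N then psnC n D h else 0); split.
  move=> [|i] _ /=; first exact: IH.
  by apply: lattice_vpow => //; apply: ideal0; apply: ideal_vpow.
move=> j jq; rewrite /shifted_sum; case: q q0 => [//|q'] _.
by rewrite big_ord_recl /= mulr1 big1 ?addr0 ?subrr // => i _; rewrite rmorph0 mul0r.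
Qed.

(** Constants act coordinatewise and coordinates are unique, so a divisibility condition on [f] is
    one on each coordinate. *)
Lemma lattice_div (I : Type) (w : I -> D) Z n a f :
  (forall i, @lattice D q Z n a (psnC n D (w i) * f)) -> lattice q (fun h => forall i, Z (w i * h)) a f.
Proof.
elim: n a f => [|n IH] a f h; first exact: h.
have [c [_ hc]] := shifted_coordinates (q := q) (f := f) (psnC n D (a 0%N)) (@ideal_full (PSn n D)) (fun _ _ => Logic.I).
exists c; split=> // l lq; apply: IH => i.
have [d [hd hdf]] := h i.
suff -> : psnC n D (w i) * c l = d l by apply: hd.
apply/eqP; rewrite -subr_eq0; apply/eqP.
apply: (@shifted_coordinates_uniq _ (psnC n D (a 0%N)) q (fun l => psnC n D (w i) * c l - d l)) lq => j jq.
rewrite shifted_sumB shifted_sumM.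
have -> : psC (psnC n D (w i)) * shifted_sum (psnC n D (a 0%N)) q c - shifted_sum (psnC n D (a 0%N)) q d =
   (psnC n.+1 D (w i) * f - shifted_sum (psnC n D (a 0%N)) q d) - psC (psnC n D (w i)) * (f - shifted_sum (psnC n D (a 0%N)) q c).
  by rewrite /=; ring.
by rewrite pcoefB hdf // pcoefC hc // mulr0 subrr.
Qed.

Lemma lattice_closure Z n a f (Cl : PSn n D -> Prop) :
  (forall h, Z h -> Cl (psnC n D h)) -> (forall F G, Cl F -> Cl G -> Cl (F + G)) ->
  (forall i F, (i < n)%N -> Cl F -> Cl (taylor_var n a i * F)) -> (forall F, vpow q F -> Cl F) ->
  lattice q Z a f -> Cl f.
Proof.
elim: n a f Cl => [|n IH] a f Cl hZ hD hM hv; first exact: hZ.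
move=> [c [hc hcf]]; rewrite -(subrK (shifted_sum (psnC n D (a 0%N)) q c) f).
apply: (hD); first by apply: hv; apply/vpowS => j jq; rewrite hcf //; apply: ideal0; apply: ideal_vpow.
have Cl0 : Cl 0 by apply: hv; apply: ideal0; apply: ideal_vpow.
rewrite /shifted_sum; elim/big_rec: _ => // i F _ hF; apply: (hD) => //.
have := hc i (ltn_ord i); move: (c i) => d hd; rewrite mulrC.
elim: (nat_of_ord i) => [|l IHl]; last first.
  by rewrite exprS -mulrA; exact: (hM 0%N _ (ltn0Sn n) IHl).
rewrite expr0 mul1r.
apply: (IH (fun i => a i.+1) d (fun G => Cl (psC G))); last exact: hd.
- by move=> h hh; apply: hZ.
- by move=> G G' hG hG'; rewrite rmorphD; apply: hD.
- by move=> l G ln hG; rewrite rmorphM; have := hM l.+1 _ ln hG; rewrite /taylor_var /= rmorphD.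
move=> G hG; apply: hv; apply/vpowS => -[|j] jq; rewrite pcoefE //=.
by apply: ideal0; apply: ideal_vpow.
Qed.
End Lattices.

(** Multiplication by [u_i = t_i + a_i] shifts coordinates cyclically: modulo [t_i^q] the overflow
    [u_i^q] is the constant [a_i^q], which preserves [Z]. *)
Lemma lattice_taylor (D : comNzRingType) p e (Z : D -> Prop) n a f i : p \in [pchar D] ->
  Z 0 -> (forall x y, Z x -> Z y -> Z (x + y)) -> (forall i h, (i < n)%N -> Z h -> Z (a i ^+ (p ^ e) * h)) ->
  (i < n)%N -> @lattice D (p ^ e) Z n a f -> lattice (p ^ e) Z a (taylor_var n a i * f).
Proof.
move=> pD Z0 ZD; have q0 : (0 < p ^ e)%N by rewrite expn_gt0 (ltnW (prime_gt1 (pcharf_prime pD))).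
elim: n a f i => [//|n IH] a f [|i] Za ir [c [hc hcf]]; last first.
  exists (fun l => taylor_var n (fun i => a i.+1) i * c l); split.
    by move=> l lq; apply: IH => //; [move=> l' h l'n; apply: (Za l'.+1)|apply: hc].
  move=> j jq; rewrite shifted_sumM.
  have -> : taylor_var n.+1 a i.+1 = psC (taylor_var n (fun i => a i.+1) i) by rewrite /taylor_var /= rmorphD.
  by rewrite -mulrBr pcoefC hcf // mulr0.
pose u : PSn n.+1 D := psX (PSn n D) + psC (psnC n D (a 0%N)).
exists (fun l => if l is l'.+1 then c l' else psnC n D (a 0%N ^+ (p ^ e)) * c (p ^ e).-1); split.
  move=> [|l] lq; last by apply: hc; apply: ltnW.
  by apply: lattice_const; [move=> h; apply: (Za 0%N)|apply: hc; rewrite prednK].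
have e1 : u ^+ (p ^ e) = psX (PSn n D) ^+ (p ^ e) + psC (psnC n D (a 0%N ^+ (p ^ e))).
  rewrite !rmorphXn /u; apply: exprD_char; apply: (pchar_comp (psnC n.+1 D)); exact: pD.
have e2 : taylor_var n.+1 a 0 = u by [].
have e3 : shifted_sum (psnC n D (a 0%N)) (p ^ e)
    (fun l => if l is l'.+1 then c l' else psnC n D (a 0%N ^+ (p ^ e)) * c (p ^ e).-1) =
    u * shifted_sum (psnC n D (a 0%N)) (p ^ e) c - psX (PSn n D) ^+ (p ^ e) * psC (c (p ^ e).-1).
  have -> : psX (PSn n D) ^+ (p ^ e) * psC (c (p ^ e).-1) = u ^+ (p ^ e) * psC (c (p ^ e).-1) -
     psC (psnC n D (a 0%N ^+ (p ^ e))) * psC (c (p ^ e).-1) by rewrite e1; ring.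
  rewrite /shifted_sum; move: (psnC n D (a 0%N ^+ (p ^ e))) => b.
  case: (p ^ e)%N q0 => [//|q] _; rewrite big_ord_recl [in RHS]big_ord_recr /= expr0 mulr1 mulrDr mulr_sumr.
  rewrite -/u (exprS u q) rmorphM addrC.
  have -> : \sum_(i < q) psC (c i) * u ^+ (bump 0 i) = \sum_(i < q) u * (psC (c i) * u ^+ i).
    by apply: eq_bigr => i _; rewrite /bump /= add1n exprS mulrCA.
  ring.
move=> j jq; rewrite e2 e3.
have -> : u * f - (u * shifted_sum (psnC n D (a 0%N)) (p ^ e) c - psX (PSn n D) ^+ (p ^ e) * psC (c (p ^ e).-1))
  = u * (f - shifted_sum (psnC n D (a 0%N)) (p ^ e) c) + psX (PSn n D) ^+ (p ^ e) * psC (c (p ^ e).-1) by ring.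
rewrite pcoefD pcoefXn jq addr0 pcoefM big1 // => l _; rewrite hcf ?mulr0 //.
by rewrite (leq_ltn_trans _ jq) // leq_subr.
Qed.

(** The ring [S] is generated over [phi e S] by monomials in the [X i]; these go to monomials in the
    Taylor variables, while [phi e S] goes to constants. *)
Lemma Theta_lattice (k : fieldType) p n (pk : p \in [pchar k]) (D : comNzRingType) (can : {rmorphism PSn n k -> D}) e s :
  lattice (p ^ e) (fun d => exists s, d = can (phi n pk e s)) (can \o psv n (fun=> 0 : k)) (Theta can s).
Proof.
set Z := fun d => _; set a := _ \o _.
have Z0 : Z 0 by exists 0; rewrite !rmorph0.
have ZD x y : Z x -> Z y -> Z (x + y) by move=> [u ->] [v ->]; exists (u + v); rewrite !rmorphD.
have q0 : (0 < p ^ e)%N by rewrite expn_gt0 (ltnW (prime_gt1 (pcharf_prime pk))).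
have pD : p \in [pchar D] by apply: (pchar_comp (can \o psnC n k)).
have [m [v [mon hv]]] := @phi_generators k p n pk e.
have hP j : (j < m)%N -> forall c, lattice (p ^ e) Z a (Theta can (phi n pk e c * v j)).
  apply: (mon (fun z => forall c, lattice (p ^ e) Z a (Theta can (phi n pk e c * z)))) => [c|i z ir hz c].
    rewrite mulr1 -(subrK (psnC n D (can (phi n pk e c))) (Theta _ _)).
    by apply: latticeD => //; [apply: lattice_vpow => //; apply: Theta_phi|apply: lattice_psnC => //; exists c].
  rewrite mulrCA rmorphM ThetaX //; apply: lattice_taylor => // l h ln [u ->].
  exists (psv n (fun=> 0 : k) l * u); have -> : phi n pk e (psv n (fun=> 0 : k) l * u) = psv n (fun=> 0 : k) l ^+ (p ^ e) * phi n pk e u.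
    by rewrite rmorphM phiX.
  by rewrite rmorphM rmorphXn.
have [c ->] := hv s; rewrite rmorph_sum.
elim/big_ind: _ => [|F G|j _]; [|exact: latticeD|exact: hP].
by apply: lattice_vpow => //; apply: ideal0; apply: ideal_vpow.
Qed.

(** * Duality data on a complete unramified regular ring *)

Section RegularPowers.
Variables (T : comNzRingType) (J : T -> Prop) (a b : T).
Hypotheses (hJ : ideal J) (ra : reg_mod J a) (rb : reg_mod (addg J a) b).

Lemma reg_mod_exp (K : T -> Prop) c k : reg_mod K c -> reg_mod K (c ^+ k).
Proof.
move=> h; elim: k => [|k IH] z; first by rewrite mul1r.
by rewrite exprS -mulrA => /h /IH.
Qed.

Lemma reg_mod_pow k l : reg_mod (addg J (a ^+ k)) (b ^+ l).
Proof.
apply: reg_mod_exp; elim: k => [|k IH] z.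
  by move=> _; exists z; rewrite mulr1 subrr; apply: ideal0.
move=> [w hw]; have [|z' hz'] := rb (z := z).
  by exists (w * a ^+ k); rewrite -mulrA -exprSr.
have [|v hv] := IH z'.
  exists w; apply: ra.
  have -> : a * (b * z' - w * a ^+ k) = (b * z - w * a ^+ k.+1) - b * (z - z' * a) by rewrite exprS; ring.
  by apply: (idealB hJ) => //; apply: idealM.
exists v; have -> : z - v * a ^+ k.+1 = (z - z' * a) + a * (z' - v * a ^+ k) by rewrite exprS; ring.
by apply: (idealD hJ) => //; apply: idealM.
Qed.

(** A regular sequence of length two is not contained in the radical of [J + (z)]: otherwise [z] is
    regular, [b^l c] lies in [J + (a^l)], hence [c = v a^l] and [1 - v z] lies in [J]. *)
Lemma reg_mod_principal z l : ~ J 1 -> (forall c, exists u, u * (1 - c * z) = 1) ->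
  addg J z (a ^+ l) -> addg J z (b ^+ l) -> False.
Proof.
move=> J1 hz [c hc] [d hd].
have rz : reg_mod J z.
  move=> w hw; apply: (reg_mod_exp (k := l) ra).
  have -> : a ^+ l * w = (a ^+ l - c * z) * w + c * (z * w) by ring.
  by apply: (idealD hJ); [apply: idealMr|apply: idealM].
have [v hv] : addg J (a ^+ l) c.
  apply: (@reg_mod_pow l l); exists d; apply: rz.
  have -> : z * (b ^+ l * c - d * a ^+ l) = (b ^+ l - d * z) * (a ^+ l) - (a ^+ l - c * z) * b ^+ l by ring.
  by apply: (idealB hJ); apply: idealMr.
have h : J (1 - v * z).
  apply: (reg_mod_exp (k := l) ra).
  have -> : a ^+ l * (1 - v * z) = (a ^+ l - c * z) + (c - v * a ^+ l) * z by ring.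
  by apply: (idealD hJ) => //; apply: idealMr.
by have [u hu] := hz v; apply: J1; rewrite -hu; apply: idealM.
Qed.
End RegularPowers.

(* What is needed to kill [c] times a class modulo [bb] by passing to [J0]; see [duality]. *)
Definition dual_data (A : comNzRingType) r (x : nat -> A) (a b : A) (J0 bb : A -> Prop) (c : A) : Prop :=
  exists (T : comNzRingType) (Th : {rmorphism A -> T}) (JJ : T -> Prop) (rel : T -> A -> Prop),
  [/\ ideal JJ, reg_mod JJ (Th a), reg_mod (addg JJ (Th a)) (Th b), forall z, J0 z -> JJ (Th z) &
   [/\ rel 1 c, forall u F f G g, rel F f -> rel G g -> rel (Th u * F + G) (u * f + g),
      forall F f, rel F f -> JJ F -> bb f &
      forall L F, (forall w, ipow r x L w -> exists s, JJ (Th w * F - Th s)) -> exists f, rel F f]].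

(** * Taylor maps on a complete unramified ring and on its reduction modulo p *)

Section Cover.
Variables (A : comNzRingType) (p n : nat) (x : nat -> A).
Hypotheses (pp : prime.prime p) (xn : x n = p%:R) (nA : noethR A).
Hypotheses (cA : complete n.+1 x) (sA : separated n.+1 x).
Hypotheses (loc : forall a, ~ span n.+1 x a -> exists b, b * a = 1) (M1 : ~ span n.+1 x 1).
Hypothesis KR : koszul n.+1 x.
Variables (k : fieldType) (res : {rmorphism A -> k}).
Hypotheses (sres : forall c, exists a, res a = c) (kres : forall a, res a = 0 <-> span n.+1 x a).
Local Notation S := (PSn n k).
Local Notation X := (psv n (fun=> 0 : k)).

Let jA : jac n.+1 x := complete_jac cA sA.

Lemma pchar_res : p \in [pchar k].
Proof.
apply/andP; split=> //; rewrite -(rmorph_nat res); apply/eqP/kres; rewrite -xn; exact: span_mem.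
Qed.
Let pk := pchar_res.

Lemma psv0 (D : comNzRingType) : psv n (fun=> 0 : D) n = 0.
Proof. by have := psv_base n (fun=> 0 : D) 0; rewrite addn0 rmorph0. Qed.

(** Cohen's structure theorem for [A/pA], obtained by lifting the residue map to [k[[X]]]. Index [n]
    of [X] is [0], in accordance with [x n = p]. *)
Lemma cover_exists : exists i : {rmorphism A -> S}, (forall a, psn_aug n k (i a) = res a) /\
  forall j, (j < n.+1)%N -> i (x j) = X j.
Proof.
pose J (s : S) := psn_aug n k s = 0.
have hJ : ideal J := ideal_preim (J := fun z => z = 0) (psn_aug n k) (@submod_zero k k^o).
have hX j : (j < n.+1)%N -> span n X (X j).
  rewrite ltnS leq_eqVlt => /orP[/eqP ->|]; last exact: span_mem.
  by rewrite psv0; apply: ideal0; apply: ideal_span.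
have p0 : p%:R = 0 :> S by rewrite -(rmorph_nat (psnC n k)) (pcharf0 pk) rmorph0.
have [|||||||i [h1 h2]] := @lifting_limit A S p n x X pp xn _ loc M1 KR n X J (psnC n k \o res) (@complete_S k n) (@separated_S k n) hJ.
- by rewrite psv0 p0.
- by rewrite /J rmorph1; apply/eqP/oner_neq0.
- by move=> s hs; apply/span_S.
- move=> s /(_ 1%N) [j hj /ipow1 /span_S].
  by rewrite rmorphB hj subr0.
- exact: hX.
- by split=> [|a b|a b] /=; rewrite ?rmorph1 ?rmorphD ?rmorphM subrr; apply: ideal0.
- move=> j jn; rewrite /J rmorphB /= psn_augC (kres (x j)).2; last exact: span_mem.
  by rewrite (span_S _).1 ?subrr //; apply: hX.
exists i; split=> // a; have := h1 a; rewrite /J rmorphB /= psn_augC => /eqP.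
by rewrite subr_eq0 => /eqP.
Qed.

Variable i : {rmorphism A -> S}.
Hypotheses (iaug : forall a, psn_aug n k (i a) = res a) (ix : forall j, (j < n.+1)%N -> i (x j) = X j).

Lemma span_cover s : span n.+1 (i \o x) s <-> span n X s.
Proof.
split; apply: span_sub; try exact: ideal_span.
  move=> j; rewrite /= ltnS leq_eqVlt => /orP[/eqP ->|jn]; last by rewrite ix ?(leqW jn) //; apply: span_mem.
  by rewrite ix // psv0; apply: ideal0; apply: ideal_span.
by move=> j jn; rewrite -ix ?(leqW jn) //; apply: (span_mem (i \o x)); apply: leqW.
Qed.
Lemma cover_p : i p%:R = 0. Proof. by rewrite -xn ix // psv0. Qed.
Lemma jac_cover : jac n.+1 (i \o x).
Proof.
by apply: (jac_sub _ (@jac_S k n)) => j jn; apply/span_cover; apply: (span_mem (i \o x)).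
Qed.
Lemma cover_surjective s : exists a, i a = s.
Proof.
apply: (complete_surjective cA (noeth_separated (@noeth_S k n) jac_cover)) => t.
have [a ha] := sres (psn_aug n k t); exists a; apply/span_cover/span_S.
by rewrite rmorphB iaug ha subrr.
Qed.

Let pA := span 1 (fun=> p%:R : A).

(** Flatness over [A/pA]: the last parameter is [p], and the others go to the variables, which have
    only trivial relations. *)
Lemma cover_colon : colon_flat i pA.
Proof.
have hpA : ideal pA := ideal_span _ _.
have kpA a : pA a -> i a = 0.
  by move=> /spanP [c ->]; rewrite big_ord1 rmorphM cover_p mulr0.
apply: (flat_colon nA (@noeth_S k n) hpA kpA jac_cover loc); last first.
  by apply: span_sub; [exact: ideal_span|move=> j _; rewrite -xn; apply: span_mem].
apply: (@koszul_row_flat A S i n.+1 x pA hpA n (leqnSn n)) => //; last first.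
  move=> j /andP[h1 h2]; have -> : j = n by apply/eqP; rewrite eqn_leq h1 andbT -ltnS.
  by rewrite xn; apply: (span_mem (fun=> p%:R : A) (i := 0)).
have := @koszul_taylor n 0 k (fun=> 0) (@noeth_field k); rewrite addn0 => h c e.
have [|||s [h1 h2 h3]] := h _ _ c.
- by move=> m _ d; exists 1; rewrite big_ord1 mulr0 subr0 mulr1.
- by move=> c' _; exists (fun _ _ => 0); split=> // *; rewrite oppr0.
- rewrite -[RHS]e; apply: eq_bigr => j _.
  by rewrite /taylor_var rmorph0 addr0 [(i \o x) j]ix // leqW.
exists s; split=> // j jn; rewrite h3 //; apply: eq_bigr => l _.
by rewrite /taylor_var rmorph0 addr0 [(i \o x) l]ix // leqW.
Qed.

Lemma cover_contract J a : ideal J -> J p%:R -> extend i J (i a) -> J a.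
Proof.
move=> hJ Jp; apply: (flat_contract cover_colon jac_cover loc hJ).
by apply: span_sub.
Qed.

Variables (I : A -> Prop) (a b : A).
Hypotheses (hI : ideal I) (I1 : ~ I 1) (Ma : span n.+1 x a) (Mb : span n.+1 x b).
Hypotheses (ra : reg_mod I a) (rb : reg_mod (addg I a) b).

(** The saturation of the image of [I] in [k[[X]]], since the Frobenius argument needs a saturated
    ideal. *)
Definition cover_sat h := exists M, forall j, (j < n)%N -> extend i I (X j ^+ M * h).

Lemma cover_sat_ext h : extend i I h -> cover_sat h.
Proof. by move=> hh; exists 0%N => j _; apply: idealM => //; apply: ideal_extend. Qed.

Lemma ideal_cover_sat : ideal cover_sat.
Proof.
have hE := ideal_extend i I; apply/idealP; split.
- by apply: cover_sat_ext; apply: ideal0.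
- move=> u v [M hM] [M' hM']; exists (M + M')%N => j jn.
  have -> : X j ^+ (M + M') * (u + v) = X j ^+ M' * (X j ^+ M * u) + X j ^+ M * (X j ^+ M' * v).
    by rewrite exprD; ring.
  by apply: (idealD hE); apply: (idealM _ hE); auto.
by move=> c u [M hM]; exists M => j jn; rewrite mulrCA; apply: (idealM _ hE); apply: hM.
Qed.

Lemma cover_sat_sat h M : (forall j, (j < n)%N -> cover_sat (X j ^+ M * h)) -> cover_sat h.
Proof.
move=> hM; have hE := ideal_extend i I.
have [M' hM'] : exists M', forall j l, (j < n)%N -> (l < n)%N -> extend i I (X l ^+ M' * (X j ^+ M * h)).
  suff /(_ n (leqnn n)) : forall m, (m <= n)%N ->
      exists M', forall j l, (j < m)%N -> (l < n)%N -> extend i I (X l ^+ M' * (X j ^+ M * h)) by [].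
  elim=> [|m IH] mn; first by exists 0%N.
  have [M1' h1] := IH (ltnW mn); have [M2 h2] := hM m mn.
  exists (M1' + M2)%N => j l + ln; rewrite exprD -mulrA ltnS leq_eqVlt => /orP[/eqP ->|jm].
    by apply: (idealM _ hE); apply: h2.
  by rewrite mulrCA; apply: (idealM _ hE); apply: h1.
exists (M' + M)%N => j jn; rewrite exprD -mulrA; exact: hM'.
Qed.

(** Otherwise [I + (p)] would contain a power of the maximal ideal, hence powers of [a] and [b],
    against [reg_mod_principal]. *)
Lemma cover_sat_proper : ~ cover_sat 1.
Proof.
move=> [M hM]; pose J := addg I (p%:R : A).
have hJ : ideal J by apply: ideal_addg.
have hx j : (j < n.+1)%N -> J (x j ^+ M.+1).
  rewrite ltnS leq_eqVlt => /orP[/eqP ->|jn].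
    by rewrite xn exprS; apply: (idealMr _ hJ); apply: addgr.
  rewrite exprS; apply: (idealM _ hJ); apply: cover_contract => //; first exact: addgr.
  rewrite rmorphXn ix ?(leqW jn) // -[X in extend _ _ X]mulr1.
  by apply: extend_mono (hM j jn) => z; apply: addgl.
have [L hL] : exists L, sub (ipow n.+1 x L) J := @ipowm_pigeon A A^o n.+1 x full J (@submod_full _ _) hJ (fun j jn => ex_intro _ M.+1 (fun z _ => idealMr z hJ (hx j jn))).
have pow c : span n.+1 x c -> J (c ^+ L).
  by move=> hc; apply: (hL); elim: L {hL} => [//|L IH]; rewrite exprS -[L.+1]add1n; apply: ipowM IH; apply/ipow1.
apply: (reg_mod_principal hI ra rb I1 _ (pow a Ma) (pow b Mb)) => c.
have := jac_unit jA; apply; apply: (idealM _ (ideal_span _ _)); rewrite -xn; exact: span_mem.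
Qed.

Variables (B B2 : comNzRingType) (can : {rmorphism A -> B}) (can2 : {rmorphism S -> B2}) (rho : {rmorphism B -> B2}).
Hypotheses (scan : forall c, exists a, can a = c) (kcan : forall a, can a = 0 <-> I a).
Hypotheses (scan2 : forall c, exists a, can2 a = c) (kcan2 : forall a, can2 a = 0 <-> cover_sat a).
Hypothesis rhoE : forall a, rho (can a) = can2 (i a).
Local Notation C := (PSn n B).

Lemma complete_C : complete (n + n.+1) (psv n (can \o x)).
Proof. exact/psn_complete/complete_image. Qed.
Lemma noeth_B : noethR B. Proof. exact: noeth_image scan nA. Qed.
Lemma jac_B : jac n.+1 (can \o x). Proof. exact: jac_image. Qed.
Lemma separated_C : separated (n + n.+1) (psv n (can \o x)).
Proof. exact/psn_separated/(noeth_separated noeth_B jac_B). Qed.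
Lemma noeth_C : noethR C. Proof. exact/psn_noeth/noeth_B. Qed.
Lemma jac_C : jac (n + n.+1) (psv n (can \o x)).
Proof. exact: complete_jac complete_C separated_C. Qed.

Lemma span_taylorS (D : comNzRingType) (w : nat -> D) j : (j < n.+1)%N ->
  span (n + n.+1) (psv n w) (taylor_var n w j).
Proof.
move=> jn; apply: (idealD (ideal_span _ _)); last by rewrite -psv_base; apply: span_mem; rewrite ltn_add2l.
move: jn; rewrite ltnS leq_eqVlt => /orP[/eqP ->|jn]; first by rewrite psv0; apply: ideal0; apply: ideal_span.
by rewrite (psv_eq _ w) //; apply: span_mem; rewrite ltn_addr.
Qed.
Lemma taylor_last (D : comNzRingType) (w : nat -> D) : taylor_var n w n = psnC n D (w n).
Proof. by rewrite /taylor_var psv0 add0r. Qed.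

(** The constant term and the compatibility with [Theta] are imposed together: a set-theoretic
    choice satisfying both is a ring map modulo [J], the series that vanish under both projections,
    and [lifting_limit] corrects it. *)
Lemma lift_exists : exists Th : {rmorphism A -> C}, [/\ forall c, psn_aug n B (Th c) = can c,
  forall c, psn_map n rho (Th c) = Theta can2 (i c) & forall j, (j < n.+1)%N -> Th (x j) = taylor_var n (can \o x) j].
Proof.
have srho c : exists d, rho d = c.
  by have [s <-] := scan2 c; have [u <-] := cover_surjective s; exists (can u).
have /choice [th hth] : forall c, exists F, psn_map n rho F = Theta can2 (i c) /\ psn_aug n B F = can c.
  by move=> c; have [|F h1 h2] := psn_map_surj srho (F := Theta can2 (i c)) (a := can c);
    [rewrite rhoE aug_Theta|exists F].
pose J F := psn_aug n B F = 0 /\ psn_map n rho F = 0.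
have hJ : ideal J.
  apply: (submod_capm (V := C^o)).
    exact: (ideal_preim (J := fun z => z = 0) (psn_aug n B) (@submod_zero B B^o)).
  exact: (ideal_preim (J := fun z => z = 0) (psn_map n rho) (@submod_zero (PSn n B2) (PSn n B2)^o)).
have JE F G : psn_aug n B F = psn_aug n B G -> psn_map n rho F = psn_map n rho G -> J (F - G).
  by move=> h1 h2; split; rewrite rmorphB ?h1 ?h2 subrr.
have thX j : (j < n.+1)%N -> J (th (x j) - taylor_var n (can \o x) j).
  move=> jn; have [h1 h2] := hth (x j); apply: JE; rewrite ?h1 ?h2.
    rewrite rmorphD psn_augC /=; move: jn; rewrite ltnS leq_eqVlt => /orP[/eqP ->|jn].
      by rewrite psv0 rmorph0 add0r.
    by rewrite psn_augv // add0r.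
  rewrite /taylor_var rmorphD psn_mapC /= rhoE ix //.
  move: jn; rewrite ltnS leq_eqVlt => /orP[/eqP ->|jn].
    by rewrite !psv0 !rmorph0 add0r.
  rewrite -[LHS]/(Theta can2 (X j)) ThetaX //; congr (_ + _).
  by rewrite psn_mapv; apply: psv_eq.
have [|||||||Th [h1 h2]] := @lifting_limit A C p n x (taylor_var n (can \o x)) pp xn _ loc M1 KR (n + n.+1) (psv n (can \o x)) J th complete_C separated_C hJ.
- by rewrite taylor_last /= xn !rmorph_nat.
- by move=> [/eqP]; rewrite rmorph1 oner_eq0.
- move=> F [hF _]; have := psn_aug_span (can \o x) F; rewrite hF rmorph0 subr0.
  by apply: span_sub; [exact: ideal_span|move=> j jn; apply: span_mem; rewrite ltn_addr].
- by move=> F; apply: (noeth_closed noeth_C jac_C hJ).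
- exact: span_taylorS.
- split=> [|c d|c d]; apply: JE.
  + by have [_ ->] := hth 1; rewrite !rmorph1.
  + by have [-> _] := hth 1; rewrite !rmorph1.
  + by have [_ ->] := hth (c + d); rewrite !rmorphD (hth c).2 (hth d).2.
  + by have [-> _] := hth (c + d); rewrite !rmorphD (hth c).1 (hth d).1.
  + by have [_ ->] := hth (c * d); rewrite !rmorphM (hth c).2 (hth d).2.
  + by have [-> _] := hth (c * d); rewrite !rmorphM (hth c).1 (hth d).1.
- exact: thX.
exists Th; split=> // c; have [u v] := h1 c; have [u' v'] := hth c.
  by rewrite -v'; apply/eqP; rewrite -subr_eq0 -rmorphB u.
by rewrite -u'; apply/eqP; rewrite -subr_eq0 -rmorphB v.
Qed.

Variable Th : {rmorphism A -> C}.
Hypotheses (Thaug : forall c, psn_aug n B (Th c) = can c)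
  (Thmap : forall c, psn_map n rho (Th c) = Theta can2 (i c))
  (Thx : forall j, (j < n.+1)%N -> Th (x j) = taylor_var n (can \o x) j).
Variables (g : nat) (v : nat -> A).
Hypothesis hv : forall z, I z <-> span g v z.

Lemma Th_ipow N : exists s, forall z, ipow g v s z -> vpow N (Th z).
Proof.
have [L hL] := ipow_vpow B n N; exists L => z hz; apply: hL.
apply: ipow_mono (ipow_image Th hz) => j jg /=.
have := psn_aug_span (fun=> 0) (Th (v j)); rewrite Thaug (kcan (v j)).2 ?rmorph0 ?subr0 //.
by apply/hv; apply: span_mem.
Qed.

Lemma Th_regular N : reg_mod (@vpow n N B) (Th a) /\ reg_mod (addg (@vpow n N B) (Th a)) (Th b).
Proof.
apply: vpow_reg; rewrite !Thaug => z; have [z' <-] := scan z.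
  by rewrite -rmorphM => /kcan /ra /kcan.
move=> [r]; have [r' <-] := scan r; rewrite -!rmorphM -rmorphB => /kcan h.
have [|w hw] := rb (z := z'); first by exists r'.
by exists (can w); rewrite -rmorphM -rmorphB; apply/kcan.
Qed.

Lemma map_taylor (D D' : comNzRingType) (h : {rmorphism D -> D'}) w j : (j < n.+1)%N ->
  psn_map n h (taylor_var n w j) = taylor_var n (h \o w) j.
Proof.
rewrite ltnS leq_eqVlt => /orP[/eqP ->|jn]; first by rewrite !taylor_last psn_mapC.
rewrite /taylor_var rmorphD psn_mapC psn_mapv; congr (_ + _); exact: psv_eq.
Qed.

(** On a component whose prime contains [p], a power of [p] suffices. On the others the expansion
    over [A/q] is flat and [irreducible_detect] applies. *)
Lemma Th_detect (W : A -> Prop) : ideal W -> (forall z, I z -> exists l, W (z ^+ l)) ->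
  exists N c, forall f, vpow N (Th f) -> W (p%:R ^+ c * f).
Proof.
move=> hW rad.
pose Q (U : A -> Prop) := sub W U -> exists N c, forall c' f, (c <= c')%N -> vpow N (Th f) -> U (p%:R ^+ c' * f).
suff : Q W by move=> [//|N [c hN]]; exists N, c => f; apply: hN.
apply: (@irreducible_ind A A^o full W Q nA (noethR_ideal nA hW)) => //.
- by exists 0%N, 0%N.
- move=> U1 U2 h1 h2 WU; have [|N1 [c1 hN1]] := h1; first by move=> z /WU [].
  have [|N2 [c2 hN2]] := h2; first by move=> z /WU [].
  exists (maxn N1 N2), (maxn c1 c2)%N => c f; rewrite geq_max => /andP[hc1 hc2] hf; split.
    by apply: hN1 => //; apply: vpow_le hf; apply: leq_maxl.
  by apply: hN2 => //; apply: vpow_le hf; apply: leq_maxr.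
move=> U a0 q hU WU _ _ nUa0 pq qE irr nil _.
have hU' : ideal U by [].
have Iq z : I z -> q z.
  by move=> /rad [l hl]; apply: (primeX (k := l) pq); apply/qE; apply: (idealMr _ hU'); apply: WU.
case: (EM (q p%:R)) => [qp|nqp].
  by have [c hc] := nil _ qp; exists 0%N, c => c' f cc _; rewrite -(subnKC cc) exprD -mulrA; apply: hc.
have [hq q1 qM] := pq; have [D [cq [sq kq]]] := quotient_ring hq q1.
have [rq hrq] : exists rq : {rmorphism B -> D}, forall z, rq (can z) = cq z.
  by apply: factor => // z /kcan /Iq /kq.
pose F : {rmorphism A -> PSn n D} := psn_map n rq \o Th.
have Faug z : psn_aug n D (F z) = cq z by rewrite /F /= psn_map_aug Thaug hrq.
have Fx j : (j < n.+1)%N -> F (x j) = taylor_var n (cq \o x) j.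
  move=> jn; rewrite /F /= Thx // map_taylor //; congr (taylor_var n _ j).
  by apply/funext => l /=; rewrite hrq.
have nD : noethR D := noeth_image sq nA.
have jD : jac n.+1 (cq \o x) := jac_image sq jA.
have nT : noethR (PSn n D) by apply: psn_noeth.
have jT : jac (n + n.+1) (psv n (cq \o x)).
  apply: complete_jac; first exact/psn_complete/complete_image.
  exact/psn_separated/(noeth_separated nD jD).
have jF : jac n.+1 (F \o x).
  by apply: (jac_sub _ jT) => j jn; rewrite [(F \o x) j]Fx //; apply: span_taylorS.
have h0 : ideal (fun z : A => z = 0) by exact: (@submod_zero A A^o).
have k0 z : z = 0 -> F z = 0 by move=> ->; apply: rmorph0.
(* The images are [n] shifted variables and the constant [p], which is nonzero in the domain
   [A/q]. *)
have kF : koszul n.+1 (F \o x).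
  have hk : koszul (n + 1) (taylor_var n (cq \o x)).
    apply: koszul_taylor => // [m mn|c].
      apply: (jac_sub _ jD) => _ _; apply: (span_mem (cq \o x)); exact: leqW.
    rewrite big_ord1 /= addn0 => hc; exists (fun _ _ => 0); split=> // [*|[|//] _]; rewrite ?oppr0 //.
    rewrite big_ord1 mul0r; have [z hz] := sq (c 0%N); move: hc; rewrite -hz -rmorphM => /kq.
    by case/qM => [|/kq //]; rewrite xn => /nqp.
  rewrite addn1 in hk => c hc; have [|s [h1 h2 h3]] := hk c.
    by rewrite -[RHS]hc; apply: eq_bigr => j _; rewrite [(F \o x) j]Fx.
  exists s; split=> // j jn; rewrite h3 //; apply: eq_bigr => l _; by rewrite [(F \o x) l]Fx.
have cF : colon_flat F (fun z => z = 0).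
  apply: (flat_colon nA nT h0 k0 jF loc); last by move=> z ->; apply: ideal0; apply: ideal_span.
  apply: (@koszul_row_flat A _ F n.+1 x _ h0 n.+1 (leqnn _) kF _ k0).
  by move=> j /andP[h1 h2]; have := leq_ltn_trans h1 h2; rewrite ltnn.
have [||N hN] := @irreducible_detect A D n F U q a0 nD cF hU' qE.
- by move=> z nz; apply: irr.
- by move=> z; rewrite Faug.
exists N, 0%N => c f _ hf; apply: (idealM _ hU'); apply: hN.
by apply: (vpow_map rq).
Qed.

Lemma rad_ipow s z : I z -> exists l, ipow g v s (z ^+ l).
Proof.
move=> /hv hz; exists s; elim: s => [//|s IH]; rewrite exprS -[s.+1]add1n.
by apply: ipowM IH; apply/ipow1.
Qed.

(** The exponent has two sources: [M0], as [p^M0] lies in the uniform power of the maximal ideal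
    that carries [F] into the image of [Th]; and [c], the loss in [Th_detect]. *)
Lemma torsion_data s : exists c s', dual_data n.+1 x a b (ipow g v s') (ipow g v s) (p%:R ^+ c).
Proof.
have hW := ideal_ipow g v s.
have [N [c hN]] := Th_detect hW (@rad_ipow s).
have [s' hs'] := Th_ipow N.
have hV := ideal_vpow B n N.
have [L hL] := ipow_vpow B n N.
have nV : noeth (V := restr Th) full (@vpow n N B).
  apply: (noeth_restr nA hV _ hL) => F; have [f hf] := scan (psn_aug n B F); exists f.
  have := psn_aug_span (fun=> 0) (F - Th f).
  by rewrite rmorphB Thaug hf subrr rmorph0 subr0.
have [M0 hM0] := stationary_quotients n.+1 x hV nV.
have [r1 r2] := Th_regular N.
exists (c + M0)%N, s', C, Th, (@vpow n N B).
(* Formally [f] is [p^(c + M0) F]: the element [s0] represents [p^M0 F] only modulo the kernel, and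
   the further factor [p^c] removes this ambiguity. *)
exists (fun F f => exists s0, vpow N (p%:R ^+ M0 * F - Th s0) /\ ipow g v s (f - p%:R ^+ c * s0)).
split=> //; split.
- exists (p%:R ^+ M0); rewrite mulr1 rmorphXn rmorph_nat subrr -exprD subrr.
  by split; apply: ideal0.
- move=> u F f G f' [s0 [h1 h2]] [s1 [h3 h4]]; exists (u * s0 + s1); split.
    have -> : p%:R ^+ M0 * (Th u * F + G) - Th (u * s0 + s1) =
      Th u * (p%:R ^+ M0 * F - Th s0) + (p%:R ^+ M0 * G - Th s1) by rewrite rmorphD rmorphM; ring.
    by apply: (idealD hV) => //; apply: (idealM _ hV).
  have -> : u * f + f' - p%:R ^+ c * (u * s0 + s1) = u * (f - p%:R ^+ c * s0) + (f' - p%:R ^+ c * s1) by ring.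
  by apply: (idealD hW) => //; apply: (idealM _ hW).
- move=> F f [s0 [h1 h2]] hF; rewrite -(subrK (p%:R ^+ c * s0) f); apply: (idealD hW) => //.
  apply: hN; rewrite -(subKr (p%:R ^+ M0 * F) (Th s0)); apply: (idealB hV) => //; exact: (idealM _ hV).
move=> L' F hF; have [|s0 hs0] := hM0 L' F hF (p%:R ^+ M0).
  by rewrite -xn; apply: ipow_exp.
by exists (p%:R ^+ c * s0), s0; rewrite rmorphXn rmorph_nat in hs0; rewrite subrr; split=> //; apply: ideal0.
Qed.

(** Two levels [N <= e] are used: [F] is given modulo [(t_i^(p^e))], and only its image modulo
    [(t_i^(p^N))] is shown to come from [S]; [N] is large enough for [Theta_detect], and [e] is what
    [frobenius_saturation] requires for [N]. *)
Lemma mod_p_data s : exists s', dual_data n.+1 x a b (ipow g v s') (addg (ipow g v s) p%:R) 1.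
Proof.
set W := ipow g v s; have hW : ideal W := ideal_ipow g v s.
have hWS := ideal_extend i W.
have [N hN] := Theta_detect hWS.
have I21 := cover_sat_proper; have hI2 := ideal_cover_sat.
have [e [Ne he]] := frobenius_saturation pk hI2 cover_sat_sat N.
have p1 : (1 < p)%N by apply: prime_gt1.
have q0 : (0 < p ^ e)%N by rewrite expn_gt0 (ltnW p1).
have qq : (p ^ N <= p ^ e)%N by rewrite leq_exp2l.
have [s' hs'] := Th_ipow (p ^ e).
have [r1 r2] := Th_regular (p ^ e).
have hV N' (D : comNzRingType) := ideal_vpow D n N'.
exists s', C, Th, (@vpow n (p ^ e) B), (fun F f => vpow (p ^ N) (psn_map n rho F - Theta can2 (i f))).
split=> //; split.
- by rewrite !rmorph1 subrr; apply: ideal0.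
- move=> u F f G f' h1 h2.
  have -> : psn_map n rho (Th u * F + G) - Theta can2 (i (u * f + f')) =
     Theta can2 (i u) * (psn_map n rho F - Theta can2 (i f)) + (psn_map n rho G - Theta can2 (i f')).
    by rewrite !rmorphD !rmorphM Thmap; ring.
  by apply: (idealD (hV _ _)) => //; apply: (idealM _ (hV _ _)).
- move=> F f h1 h2.
  have h3 : vpow N (Theta can2 (i f)).
    apply: (vpow_le (ltnW (ltn_expl N p1))); rewrite -(subKr (psn_map n rho F) (Theta _ _)).
    by apply: (idealB (hV _ _)) => //; apply: (vpow_le qq); apply: vpow_map.
  apply: cover_contract; [exact: ideal_addg|exact: addgr|].
  apply: (@extend_mono _ _ i W) => [z|]; first exact: addgl.
  apply: hN => D can' sc' pD' WD.
  have [hQ Q1 QM] := pD'.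
  have IQ z : extend i I z -> can' z = 0.
    apply: (extend_sub hQ) => y /(@rad_ipow s) [l hl]; apply: (primeX (k := l) pD').
    by rewrite -rmorphXn; apply: WD; apply: extend_mem.
  (* A prime over [I S] contains the saturation: either some [X j] is outside it, or it is the
     maximal ideal and the saturation is proper. *)
  have satQ z : can2 z = 0 -> can' z = 0.
    move=> /kcan2 hz; have [M hM] := hz.
    case: (EM (forall j, (j < n)%N -> can' (X j) = 0)) => [hX|/existsNP [j /not_implyP [jn nX]]].
      apply: (span_sub (v := X) hQ hX); apply: contrapT => /loc_S [u hu].
      by apply: I21; rewrite -hu; apply: idealM.
    by case: (QM _ _ (IQ _ (hM j jn))) => // /(primeX pD').
  have [h hh] := factor scan2 satQ.
  have -> : Theta can' (i f) = psn_map n h (Theta can2 (i f)) by symmetry; apply: psn_map_comp.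
  exact: vpow_map.
move=> L F hF.
pose Z d := exists t, d = can2 (phi n pk e t).
have Z0 : Z 0 by exists 0; rewrite !rmorph0.
have ZD d d' : Z d -> Z d' -> Z (d + d') by move=> [u ->] [u' ->]; exists (u + u'); rewrite !rmorphD.
(* Multiplied by the constant [X_j^(p^e L)], the series [F] falls into the lattice over [phi e S];
   dividing coordinatewise puts the coordinates of [F] in the saturation. *)
have lat : lattice (p ^ e) (fun h => forall j : 'I_n, Z (can2 (X j ^+ (p ^ e * L)) * h)) (can2 \o X) (psn_map n rho F).
  apply: lattice_div => j.
  have [|t ht] := hF (x j ^+ (p ^ e * L)).
    apply: ipow_le (ipow_exp _ _ _); last exact: leqW.
    by rewrite leq_pmull.
  have {}ht : vpow (p ^ e) (Theta can2 (X j ^+ (p ^ e * L)) * psn_map n rho F - Theta can2 (i t)).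
    have := vpow_map rho ht; rewrite rmorphB rmorphM !Thmap.
    by rewrite [i (x j ^+ _)]rmorphXn ix // leqW.
  have e1 : X j ^+ (p ^ e * L) = phi n pk e (X j ^+ L) by rewrite rmorphXn phiX // -exprM.
  have hX := Theta_phi pk can2 e (X j ^+ L); rewrite -e1 in hX.
  set w := X j ^+ _ in ht hX *.
  have -> : psnC n B2 (can2 w) * psn_map n rho F = Theta can2 (i t) +
     ((Theta can2 w * psn_map n rho F - Theta can2 (i t)) - (Theta can2 w - psnC n B2 (can2 w)) * psn_map n rho F).
    by ring.
  apply: latticeD => //; first exact: Theta_lattice.
  apply: lattice_vpow => //; apply: (idealB (hV _ _)) => //; exact: (idealMr _ (hV _ _)).
(* By [frobenius_saturation] the coordinates come from [phi N S], at the coarser level. *)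
have {}lat : lattice (p ^ e) (fun d => exists t, d = can2 (phi n pk N t)) (can2 \o X) (psn_map n rho F).
  apply: lattice_mono lat => h; have [h' <-] := scan2 h => hh.
  have [|t ht] := he h'.
    exists L => j jn; have [t ht] := hh (Ordinal jn); exists t; apply/kcan2.
    by rewrite rmorphB rmorphM ht subrr.
  by exists t; apply/eqP; rewrite -subr_eq0 -rmorphB; apply/eqP/kcan2.
(* Modulo [(t_i^(p^N))] constants from [phi N S] and the Taylor variables are values of [Theta], so
   the whole lattice is. *)
pose Cl G := exists f, vpow (p ^ N) (G - Theta can2 (i f)).
apply: (lattice_closure (Cl := Cl) _ _ _ _ lat).
- move=> _ [t ->]; have [f hf] := cover_surjective (phi n pk N t); exists f; rewrite hf.
  by rewrite -opprB; apply: (idealN (hV _ _)); apply: Theta_phi.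
- move=> G G' [f hf] [f' hf']; exists (f + f'); rewrite !rmorphD opprD addrACA.
  exact: (idealD (hV _ _)).
- move=> j G jn [f hf]; exists (x j * f); rewrite !rmorphM ix ?(leqW jn) // ThetaX //.
  by rewrite -mulrBr; apply: (idealM _ (hV _ _)).
move=> G hG; exists 0; rewrite !rmorph0 subr0; exact: vpow_le hG.
Qed.
End Cover.

Lemma dual_data_exists (A : comNzRingType) (p n : nat) (x : nat -> A) (I : A -> Prop) (a b : A) g (v : nat -> A) s :
  prime.prime p -> x n = p%:R -> noethR A -> complete n.+1 x -> separated n.+1 x ->
  (forall a, ~ span n.+1 x a -> exists b, b * a = 1) -> ~ span n.+1 x 1 -> koszul n.+1 x ->
  ideal I -> ~ I 1 -> span n.+1 x a -> span n.+1 x b -> reg_mod I a -> reg_mod (addg I a) b ->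
  (forall z, I z <-> span g v z) ->
  (exists c s', dual_data n.+1 x a b (ipow g v s') (ipow g v s) (p%:R ^+ c)) /\
  exists s', dual_data n.+1 x a b (ipow g v s') (addg (ipow g v s) p%:R) 1.
Proof.
move=> pp xn nA cA sA loc M1 KR hI I1 Ma Mb ra rb hv.
have hM : ideal (span n.+1 x) := ideal_span _ _.
have [|k [res [sres kres]]] := residue_field hM M1.
  by move=> z /loc [u hu]; exists u; rewrite hu subrr; apply: ideal0.
have [i [iaug ix]] := cover_exists pp xn loc M1 KR kres.
have [B [can [scan kcan]]] := quotient_ring hI I1.
have hs1 : ~ cover_sat i I 1.
  by eapply cover_sat_proper; try exact: rb; eassumption.
have [B2 [can2 [scan2 kcan2]]] := quotient_ring (ideal_cover_sat i I) hs1.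
have [rho hrho] : exists rho : {rmorphism B -> B2}, forall z, rho (can z) = (can2 \o i) z.
  by apply: factor => // z /kcan hz; apply/kcan2; apply: cover_sat_ext; apply: extend_mem.
have [Th [Thaug Thmap Thx]] : exists Th : {rmorphism A -> PSn n B}, [/\ forall c, psn_aug n B (Th c) = can c,
  forall c, psn_map n rho (Th c) = Theta can2 (i c) & forall j, (j < n.+1)%N -> Th (x j) = taylor_var n (can \o x) j].
  by eapply lift_exists; eassumption.
split; first by eapply torsion_data; eassumption.
by eapply mod_p_data; try exact: hv; eassumption.
Qed.

(** * Cohomology of cyclic modules through an injective resolution *)

Section InjectiveModules.
Variables (R : comNzRingType) (E : lmodType R).
Hypothesis injE : injective_module E.

Lemma injective_extend (W : lmodType R) (U : W -> Prop) (g : W -> E) : submod U ->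
  (forall a x y, U x -> U y -> g (a *: x + y) = a *: g x + g y) ->
  exists h : {linear W -> E}, forall x, U x -> h x = g x.
Proof.
move=> hU hg.
pose P : {pred W} := fun x => `[< U x >].
have PE x : x \in P <-> U x by rewrite /P unfold_in; split=> [/asboolP|h] //; apply/asboolP.
have cl : submod_closed P.
  by split; [apply/PE; apply: submod0|move=> a x y /PE hx /PE hy; apply/PE; exact: (proj2 hU)].
pose S : submodClosed W := HB.pack_for (submodClosed W) P (GRing.isSubmodClosed.Build R W P (GRing.submod_closed_semi cl)).
pose f (u : submodule S) : W := val u.
have flin : linear f by move=> a u v; rewrite /f linearP.
pose mf := GRing.isLinear.Build R (submodule S) W _ f flin.
pose f' : {linear submodule S -> W} := HB.pack_for {linear submodule S -> W} f mf.
pose g0 (u : submodule S) : E := g (val u).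
have glin : linear g0.
  by move=> a u v; rewrite /g0 linearP hg //; apply/PE; apply: valP.
pose mg := GRing.isLinear.Build R (submodule S) E _ g0 glin.
pose g' : {linear submodule S -> E} := HB.pack_for {linear submodule S -> E} g0 mg.
have finj : injective f' by exact: val_inj.
have [h hh] := @injE (submodule S) W f' g' finj.
exists h => x hx; have hxP : x \in S by apply/PE.
exact: (hh (Sub x hxP)).
Qed.

Lemma injective_rel (W : lmodType R) (U : W -> Prop) (rel : W -> E -> Prop) : submod U ->
  (forall x, U x -> exists e, rel x e) ->
  (forall a x y e e', rel x e -> rel y e' -> rel (a *: x + y) (a *: e + e')) ->
  (forall e, rel 0 e -> e = 0) ->
  exists h : {linear W -> E}, forall x e, U x -> rel x e -> h x = e.
Proof.
move=> hU tot lin0 fun0.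
have func x e e' : rel x e -> rel x e' -> e = e'.
  move=> h1 h2; apply/eqP; rewrite -subr_eq0 addrC -scaleN1r; apply/eqP/fun0.
  by rewrite -(addNr x) -scaleN1r; apply: lin0.
have /choice [g hg] : forall x, exists e, U x -> rel x e.
  by move=> x; case: (EM (U x)) => [/tot [e he]|]; [exists e|exists 0].
have [|h hh] := injective_extend (U := U) (g := g) hU.
  move=> a x y hx hy; apply: func (hg _ _) (lin0 _ _ _ _ _ (hg _ hx) (hg _ hy)).
  exact: (proj2 hU).
by exists h => x e hx he; rewrite hh //; apply: func he; apply: hg.
Qed.

(* Extension of a homomorphism from an ideal, given as a functional relation. *)
Lemma injective_ideal (U : R -> Prop) (rel : R -> E -> Prop) : ideal U ->
  (forall x, U x -> exists e, rel x e) ->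
  (forall a x y e e', rel x e -> rel y e' -> rel (a * x + y) (a *: e + e')) ->
  (forall e, rel 0 e -> e = 0) ->
  exists e0, forall x e, U x -> rel x e -> x *: e0 = e.
Proof.
move=> hU tot lin0 fun0; have [h hh] := @injective_rel R^o U rel hU tot lin0 fun0.
exists (h 1) => x e hx he; rewrite -(hh x e hx he) -linearZ; congr (h _); exact: mulr1.
Qed.

Definition ann (b : R -> Prop) : E -> Prop := fun e => forall r, b r -> r *: e = 0.

Lemma submod_ann b : submod (ann b).
Proof.
split; first by move=> r _; rewrite scaler0.
by move=> a x y hx hy r hr; rewrite scalerDr scalerA mulrC -scalerA hx // hy // scaler0 addr0.
Qed.

Lemma ann_addg b y e : ann b e -> y *: e = 0 -> ann (addg b y) e.
Proof.
move=> h hy r [s hs]; rewrite -(subrK (s * y) r) scalerDl (h _ hs) add0r -scalerA hy scaler0 //.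
Qed.

(** Multiplication by [y] embeds [R/(b : y)] in [R/b]; maps to the injective module extend along
    it. *)
Lemma injective_divide b y e : ideal b -> ann (colon b y) e -> exists e', ann b e' /\ y *: e' = e.
Proof.
move=> hb he.
pose rel x u := exists r, b (x - r * y) /\ u = r *: e.
have [||||e' he'] := @injective_ideal (addg b y) rel.
- exact: ideal_addg.
- by move=> x [r hr]; exists (r *: e), r.
- move=> a x z _ _ [r [h1 ->]] [r' [h2 ->]]; exists (a * r + r'); split; last by rewrite scalerDl scalerA.
  have -> : a * x + z - (a * r + r') * y = a * (x - r * y) + (z - r' * y) by ring.
  by apply: (idealD hb) => //; apply: idealM.
- move=> _ [r [h ->]]; apply: he; rewrite /colon mulrC -[r * y]opprK; apply: (idealN hb); by rewrite sub0r in h.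
exists e'; split.
  by move=> r hr; apply: he'; [apply: addgl|exists 0; rewrite mul0r subr0 scale0r].
by apply: he'; [apply: addgr|exists 1; rewrite mul1r subrr scale1r; split=> //; apply: ideal0].
Qed.

(** Dual to the embedding of [R/(b1 cap b2)] in the sum of [R/b1] and [R/b2]. *)
Lemma injective_split b1 b2 e : ideal b1 -> ideal b2 -> ann (fun r => b1 r /\ b2 r) e ->
  exists e1, ann b1 e1 /\ ann b2 (e - e1).
Proof.
move=> h1 h2 he.
pose rel x u := exists s, b1 (x - s) /\ b2 s /\ u = s *: e.
have [||||e1 he1] := @injective_ideal (addm (V := R^o) b1 b2) rel.
- exact: submod_addm.
- by move=> _ [s [t [hs ht ->]]]; exists (t *: e), t; rewrite addrK.
- move=> a x z _ _ [s [hs [hs' ->]]] [t [ht [ht' ->]]]; exists (a * s + t).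
  split; last by split; [apply: (idealD h2) => //; apply: idealM|rewrite scalerDl scalerA].
  have -> : a * x + z - (a * s + t) = a * (x - s) + (z - t) by ring.
  by apply: (idealD h1) => //; apply: idealM.
- move=> _ [s [hs [hs' ->]]]; apply: he; split=> //.
  by rewrite -[s]opprK; apply: (idealN h1); rewrite sub0r in hs.
exists e1; split=> r hr.
  apply: he1; first exact: (addml (V := R^o) h2).
  by exists 0; rewrite subr0 scale0r; split=> //; split=> //; apply: ideal0.
rewrite scalerBr (he1 r (r *: e)) ?subrr //; first exact: (addmr (V := R^o) h1).
by exists r; rewrite subrr; split=> //; apply: ideal0.
Qed.
End InjectiveModules.

Section Resolution.
Variables (R : comNzRingType) (E : injective_resolution (R^o : lmodType R)).
Hypothesis nR : noethR R.
Local Notation d := (cdiff E _).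
Implicit Types (b : R -> Prop) (j : nat).

Lemma dK j (e : E j) : cdiff E j.+1 (cdiff E j e) = 0. Proof. exact: cdiffK. Qed.

Definition cocyc b j (e : E j) := ann b e /\ cdiff E j e = 0.
Definition cobd b j : E j -> Prop :=
  match j with 0 => fun e => e = 0 | l.+1 => fun e => exists2 y : E l, ann b y & cdiff E l y = e end.
Definition ext0 j b := forall e : E j, cocyc b e -> cobd b e.

Lemma submod_cocyc b j : submod (@cocyc b j).
Proof.
apply: (submod_capm (submod_ann _ b)).
by split; rewrite ?raddf0 // => a x y hx hy; rewrite linearP hx hy scaler0 addr0.
Qed.
Lemma submod_cobd b j : submod (@cobd b j).
Proof.
case: j => [|j]; first exact: submod_zero.
have ha := submod_ann (E j) b; split; first by exists 0; [apply: submod0|rewrite raddf0].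
move=> a _ _ [x hx <-] [y hy <-]; exists (a *: x + y); [exact: (proj2 ha)|by rewrite linearP].
Qed.
Lemma cobd_cocyc b j (e : E j) : cobd b e -> cocyc b e.
Proof.
case: j e => [|j] e /=; first by move=> ->; apply: (submod0 (submod_cocyc b 0)).
by move=> [y hy <-]; split; [move=> r hr; rewrite -linearZ hy // raddf0|exact: dK].
Qed.
Lemma ann_mono b b' (V : lmodType R) (e : V) : sub b b' -> ann b' e -> ann b e.
Proof. by move=> h he r /h; apply: he. Qed.
Lemma cobd_mono b b' j (e : E j) : sub b b' -> cobd b' e -> cobd b e.
Proof.
by case: j e => [|j] e h //= [y hy <-]; exists y => //; apply: ann_mono hy.
Qed.

Lemma ext0_ideal1 j b : b 1 -> ext0 j b.
Proof.
move=> b1 e [he _]; have -> : e = 0 by rewrite -[e]scale1r he.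
exact: (submod0 (submod_cobd b j)).
Qed.

(** The middle term of the long exact sequence of [R/(b : x) -> R/b -> R/(b + (x))]. *)
Lemma ext0_colon j b x : ideal b -> ext0 j (colon b x) -> ext0 j (addg b x) -> ext0 j b.
Proof.
move=> hb h1 h2 e [he de].
have xe : cocyc (colon b x) (x *: e).
  by split; [move=> r hr; rewrite scalerA mulrC; apply: he|rewrite linearZ /= de scaler0].
case: j e he de xe h1 h2 => [|j] e he de xe h1 h2.
  by apply: h2; split=> //; apply: ann_addg => //; apply: h1.
have [y hy ey] := h1 _ xe.
have [y' [hy' ey']] := injective_divide (@res_injective _ _ E j) hb hy.
have [|z hz ez] := h2 (e - cdiff E j y').
  split; last by rewrite raddfB /= de dK subrr.
  apply: ann_addg; last by rewrite scalerBr -linearZ ey' ey subrr.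
  apply: (submodB (submod_ann _ _)) => //; by move=> r hr; rewrite -linearZ hy' // raddf0.
exists (y' + z); last by rewrite raddfD /= ez addrC subrK.
by apply: (submodD (submod_ann _ _)) => //; apply: ann_mono hz; apply: addgl.
Qed.

(** The obstruction to dividing a class by the regular element [y] lies in
    [Ext^(j+1)(R/(b + (y)), R)]. *)
Lemma cocyc_divide j b y (e : E j) : ideal b -> (forall r, b (y * r) -> b r) -> ext0 j.+1 (addg b y) ->
  cocyc b e -> exists2 e', cocyc b e' & y *: e' = e.
Proof.
move=> hb reg h [he de].
have [|e1 [he1 ye1]] := injective_divide (@res_injective _ _ E j) (y := y) (e := e) hb.
  by move=> r /reg; apply: he.
have [|z hz ez] := h (cdiff E j e1).
  split; last exact: dK.
  apply: ann_addg; last by rewrite -linearZ ye1 de.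
  by move=> r hr; rewrite -linearZ he1 // raddf0.
exists (e1 - z); last by rewrite scalerBr ye1 hz ?subr0 //; apply: addgr.
split; last by rewrite raddfB /= ez subrr.
by apply: (submodB (submod_ann _ _)) => //; apply: ann_mono hz; apply: addgl.
Qed.

Section Finiteness.
(* For [K] a submodule of [R^g], the cohomology of [Hom(R^g/K, E)] is finite: dimension shifting along
   [0 -> K -> R^g -> R^g/K -> 0]. *)
Definition tup j g := {ffun 'I_g -> E j}.
Definition pair j g (k : 'cV[R]_g) (Y : tup j g) : E j := \sum_i k i 0 *: Y i.
Definition tann j g (K : 'cV[R]_g -> Prop) (Y : tup j g) := forall k, K k -> pair k Y = 0.
Definition tdiff j g (Y : tup j g) : tup j.+1 g := [ffun i => cdiff E j (Y i)].
Definition tcocyc j g K (Y : tup j g) := tann K Y /\ forall i, cdiff E j (Y i) = 0.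
Definition tcobd j g K : tup j g -> Prop :=
  match j with 0 => fun Y => Y = 0 | l.+1 => fun Y => exists2 Z : tup l g, tann K Z & tdiff Z = Y end.

Lemma pairD j g k (Y Z : tup j g) a : pair k (a *: Y + Z) = a *: pair k Y + pair k Z.
Proof.
rewrite scaler_sumr -big_split; apply: eq_bigr => i _.
by rewrite !ffunE scalerDr !scalerA mulrC.
Qed.
Lemma pair_lin j g a k k' (Y : tup j g) : pair (a *: k + k') Y = a *: pair k Y + pair k' Y.
Proof.
rewrite scaler_sumr -big_split; apply: eq_bigr => i _.
by rewrite !mxE scalerDl scalerA.
Qed.
Lemma pair_diff j g k (Y : tup j g) : pair k (tdiff Y) = cdiff E j (pair k Y).
Proof. by rewrite linear_sum; apply: eq_bigr => i _; rewrite ffunE linearZ. Qed.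
Lemma submod_tann j g K : submod (@tann j g K).
Proof.
split; first by move=> k _; rewrite /pair big1 // => i _; rewrite ffunE scaler0.
by move=> a Y Z hY hZ k hk; rewrite pairD hY // hZ // scaler0 addr0.
Qed.
Lemma submod_tcocyc j g K : submod (@tcocyc j g K).
Proof.
apply: (submod_capm (@submod_tann j g K)); split=> [i|a Y Z hY hZ i]; first by rewrite ffunE raddf0.
by rewrite !ffunE linearP hY hZ scaler0 addr0.
Qed.
Lemma tdiff_lin j g a (Y Z : tup j g) : tdiff (a *: Y + Z) = a *: tdiff Y + tdiff Z.
Proof. by apply/ffunP => i; rewrite !ffunE linearP. Qed.

Lemma tdiffB j g (Y Z : tup j g) : tdiff (Y - Z) = tdiff Y - tdiff Z.
Proof. by apply/ffunP => i; rewrite !ffunE raddfB. Qed.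
Lemma tdiff_sum j g r (c : nat -> R) (y : nat -> tup j g) : tdiff (\sum_(i < r) c i *: y i) = \sum_(i < r) c i *: tdiff (y i).
Proof.
elim: r => [|r IH]; first by rewrite !big_ord0; apply/ffunP => i; rewrite !ffunE raddf0.
by rewrite !big_ord_recr /= addrC tdiff_lin IH addrC.
Qed.
Lemma pair0l j g (Y : tup j g) : pair 0 Y = 0.
Proof. by rewrite /pair big1 // => i _; rewrite mxE scale0r. Qed.
Lemma pair0r j g k : pair k (0 : tup j g) = 0.
Proof. by rewrite /pair big1 // => i _; rewrite ffunE scaler0. Qed.
Lemma pairB j g k (Y Z : tup j g) : pair k (Y - Z) = pair k Y - pair k Z.
Proof. by have := pairD k Z Y (-1); rewrite !scaleN1r addrC => ->; rewrite addrC. Qed.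
Lemma pair_sum j g k r (c : nat -> R) (y : nat -> tup j g) : pair k (\sum_(i < r) c i *: y i) = \sum_(i < r) c i *: pair k (y i).
Proof.
elim: r => [|r IH]; first by rewrite !big_ord0 pair0r.
by rewrite !big_ord_recr /= addrC pairD IH addrC.
Qed.

Lemma tdiff0 j g : tdiff (0 : tup j g) = 0.
Proof. by apply/ffunP => i; rewrite !ffunE raddf0. Qed.
Lemma tdiffK j g (Y : tup j g) : tdiff (tdiff Y) = 0.
Proof. by apply/ffunP => i; rewrite !ffunE dK. Qed.
Lemma tcobd_tcocyc j g K (Y : tup j g) : tcobd K Y -> tcocyc K Y.
Proof.
case: j Y => [|j] Y; first by move=> ->; apply: (submod0 (@submod_tcocyc 0 g K)).
move=> [Z hZ <-]; split; first by move=> k hk; rewrite pair_diff hZ // raddf0.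
by move=> i; rewrite ffunE dK.
Qed.

Lemma injective_tuple j g h (M : 'M[R]_(g, h)) (F : tup j h) :
  (forall r : 'cV[R]_h, M *m r = 0 -> pair r F = 0) -> exists Y : tup j g, forall r, pair (M *m r) Y = pair r F.
Proof.
move=> hF.
pose U (k : 'cV[R]_g) := exists r, k = M *m r.
pose rel (k : 'cV[R]_g) e := exists2 r, k = M *m r & e = pair r F.
have [||||H hH] := injective_rel (@res_injective _ _ E j) (U := U) (rel := rel).
- split; first by exists 0; rewrite mulmx0.
  by move=> a _ _ [r ->] [s ->]; exists (a *: r + s); rewrite mulmxDr scalemxAr.
- by move=> _ [r ->]; exists (pair r F), r.
- by move=> a _ _ _ _ [r -> ->] [s -> ->]; exists (a *: r + s); [rewrite mulmxDr scalemxAr|rewrite pair_lin].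
- by move=> _ [r e0 ->]; apply: hF.
exists [ffun i => H (delta_mx i 0)] => r.
rewrite -(hH (M *m r) (pair r F)); [|by exists r|by exists r].
rewrite {2}[M *m r]matrix_sum_delta linear_sum; apply: eq_bigr => i _.
by rewrite big_ord1 ffunE linearZ.
Qed.

Lemma tcobd_full j g (Y : tup j.+1 g) : (forall i, cdiff E j.+1 (Y i) = 0) -> exists Z, tdiff Z = Y.
Proof.
move=> h; have /choice [Z hZ] : forall i, exists z, cdiff E j z = Y i.
  by move=> i; exact: (proj1 (@res_exactS R R^o E j (Y i)) (h i)).
by exists [ffun i => Z i]; apply/ffunP => i; rewrite !ffunE.
Qed.

Lemma noeth_tcocyc j g K : submod K -> noeth (@tcocyc j g K) (@tcobd j g K).
Proof.
elim: j g K => [|j IH] g K hK.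
  move=> U hU _ UZ.
  pose f (r : 'cV[R]_g) : tup 0 g := [ffun i => res_aug E (r i 0)].
  have flin a r s : f (a *: r + s) = a *: f r + f s.
    by apply/ffunP => i; rewrite !ffunE !mxE; exact: (linearP (res_aug E)).
  pose U' r := U (f r).
  have f0 : f 0 = 0 by apply/ffunP => i; rewrite !ffunE !mxE raddf0.
  have hU' : submod U'.
    by split; rewrite /U' ?f0; [apply: submod0|move=> a r s hr hs; rewrite flin; exact: (proj2 hU)].
  have [|//|r [v [vU gen]]] := @noeth_col R g nR U' hU'; first by move=> _ ->; apply: (submod0 hU').
  exists r, (fun i => f (v i)); split=> // Y hY.
  have [_ hd] := UZ Y hY.
  have /choice [u hu] : forall i, exists u : R^o, res_aug E u = Y i.
    by move=> i; exact: (proj1 (@res_exact0 R R^o E (Y i)) (hd i)).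
  have eY : Y = f (\col_i u i) by apply/ffunP => i; rewrite ffunE mxE hu.
  have [|c hc] := gen (\col_i u i); first by rewrite /U' -eY.
  exists c; rewrite /= eY.
  move/eqP: hc; rewrite subr_eq0 => /eqP ->.
  suff -> : f (\sum_(i < r) c i *: v i) = \sum_(i < r) c i *: f (v i) by rewrite subrr.
  elim: r {vU gen} => [|r IHr]; first by rewrite !big_ord0.
  by rewrite !big_ord_recr /= addrC flin IHr addrC.
have h0 := @submod_zero R 'cV[R]_g.
have [h [s hs]] := noeth_fg (@noeth_col R g nR) h0 hK (fun x hx => eq_ind_r K (submod0 hK) hx) (fun _ _ => Logic.I).
pose M : 'M[R]_(g, h) := \matrix_(i, l) s l i 0.
have MK k : K k <-> exists r, k = M *m r.
  have ME (r : 'cV[R]_h) : M *m r = \sum_(l < h) r l 0 *: s l.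
    by apply/colP => i; rewrite mxE summxE; apply: eq_bigr => l _; rewrite !mxE mulrC.
  rewrite hs; split.
    move=> [_ [_ [-> [c ->] ->]]]; exists (\col_l c l); rewrite add0r ME.
    by apply: eq_bigr => l _; rewrite mxE.
  move=> [r ->]; exists 0, (M *m r); rewrite add0r; split=> //.
  exists (fun l => if insub l is Some o then r (o : 'I_h) 0 else 0); rewrite ME.
  by apply: eq_bigr => l _; rewrite valK.
(* The matrix [M] presents [K] as [R^h/K'], to which the induction hypothesis in degree [j]
   applies. *)
pose K' (r : 'cV[R]_h) := M *m r = 0.
have hK' : submod K'.
  by split; rewrite /K' ?mulmx0 // => a u w hu hw; rewrite mulmxDr -scalemxAr hu hw scaler0 addr0.
move=> U hU BU UZ.
(* The preimage of [U] under the connecting map: a cocycle [F] on [K] is extended to [Y] on [R^g],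
   and its image is [dY]. *)
pose U' (F : tup j h) := tcocyc K' F /\ exists Y : tup j g, (forall r, pair (M *m r) Y = pair r F) /\ U (tdiff Y).
have hU' : submod U'.
  have hC := @submod_tcocyc j h K'; split.
    split; first exact: submod0.
    exists 0; have t0 : tdiff 0 = 0 :> tup j.+1 g by apply/ffunP => i; rewrite !ffunE raddf0.
    split; last by rewrite t0; apply: submod0.
    by move=> r; rewrite (submod0 (@submod_tann j g (fun=> True))) // (submod0 (@submod_tann j h (fun=> True))).
  move=> a F G [hF [Y [hY hY']]] [hG [Z [hZ hZ']]]; split; first exact: (proj2 hC).
  exists (a *: Y + Z); split; first by move=> r; rewrite !pairD hY hZ.
  by rewrite tdiff_lin; exact: (proj2 hU).
have [||r [v [vU gen]]] := IH h K' hK' U' hU'.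
- move=> F hF; split; first exact: tcobd_tcocyc.
  case: j U F hU hF {IH BU UZ U' hU'} => [|j] U F hU.
    by move=> ->; exists 0; rewrite tdiff0; split; [move=> q; rewrite !pair0r|apply: submod0].
  move=> [G hG <-]; have [|W hW] := injective_tuple (M := M) (F := G); first by move=> q hq; apply: hG.
  exists (tdiff W); split; first by move=> q; rewrite pair_diff hW pair_diff.
  by rewrite tdiffK; apply: submod0.
- by move=> F [].
(* The connecting map sends coboundaries to coboundaries, whichever extension [Y] is chosen. *)
have lastep (Y : tup j g) (D : tup j h) :
    tcobd K' D -> (forall q, pair (M *m q) Y = pair q D) -> @tcobd j.+1 g K (tdiff Y).
  move: Y D; clear - MK; case: j => [|j] Y D.
    by move=> -> hY; exists Y => // k /MK [q ->]; rewrite hY pair0r.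
  move=> [G hG <-] hY; have [|W hW] := injective_tuple (M := M) (F := G); first by move=> q hq; apply: hG.
  exists (Y - tdiff W); last by rewrite tdiffB tdiffK subr0.
  by move=> k /MK [q ->]; rewrite pairB hY !pair_diff hW subrr.
have /choice [y hy] : forall i, exists Y : tup j g, (i < r)%N -> (forall r, pair (M *m r) Y = pair r (v i)) /\ U (tdiff Y).
  move=> i; case: (ltnP i r) => [ir|_]; last by exists 0.
  by have [_ [Y hY]] := vU i ir; exists Y.
exists r, (fun i => tdiff (y i)); split; first by move=> i ir; apply: (hy i ir).2.
move=> X hX; have [hXa hXd] := UZ X hX.
have [Y eY] := tcobd_full hXd.
pose F : tup j h := [ffun l => pair (M *m delta_mx l 0) Y].
have FE q : pair q F = pair (M *m q) Y.
  rewrite {2}[q]matrix_sum_delta mulmx_sumr.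
  have psum (I : finType) (f : I -> 'cV[R]_g) : pair (\sum_i f i) Y = \sum_i pair (f i) Y.
    apply: (big_morph (fun k => pair k Y)) => [k k'|]; first by have := pair_lin 1 k k' Y; rewrite !scale1r.
    exact: pair0l.
  rewrite psum; apply: eq_bigr => l _; rewrite big_ord1 ffunE -scalemxAr.
  by have := pair_lin (q l 0) (M *m delta_mx l 0) 0 Y; rewrite addr0 pair0l addr0 => ->.
have FY : U' F.
  split; first split.
  - by move=> q hq; rewrite FE hq pair0l.
  - move=> l; rewrite ffunE -pair_diff eY; apply: hXa; apply/MK; by exists (delta_mx l 0).
  by exists Y; split; [move=> q; rewrite FE|rewrite eY].
have [c hc] := gen _ FY; exists c.
pose Y' := Y - \sum_(i < r) c i *: y i.
have -> : X - \sum_(i < r) c i *: tdiff (y i) = tdiff Y'.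
  by rewrite /Y' tdiffB eY tdiff_sum.
have FE' q : pair (M *m q) Y' = pair q (F - \sum_(i < r) c i *: v i).
  rewrite /Y' !pairB FE; congr (_ - _); rewrite !pair_sum; apply: eq_bigr => i _.
  by rewrite (hy i (ltn_ord i)).1.
move: hc FE'; apply: lastep.
Qed.
End Finiteness.

Lemma noeth_cocyc j b : ideal b -> noeth (@cocyc b j) (@cobd b j).
Proof.
move=> hb.
pose K (k : 'cV[R]_1) := b (k 0 0).
have hK : submod K.
  split=> [|a k l hk hl]; rewrite /K !mxE; first exact: ideal0.
  by apply: (idealD hb) => //; apply: idealM.
have tannE l (Y : tup l 1) : tann K Y <-> ann b (Y 0).
  split=> h; first by move=> r hr; have := h r%:M; rewrite /K /pair big_ord1 !mxE eqxx mulr1n; apply.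
  by move=> k hk; rewrite /pair big_ord1; apply: h.
have cE l (e : E l) : [ffun=> e] 0 = e :> E l by rewrite ffunE.
have YE l (Y : tup l 1) : Y = [ffun=> Y 0] by apply/ffunP => i; rewrite ffunE ord1.
move=> U hU BU UZ.
have [|||r [v [vU gen]]] := @noeth_tcocyc j 1 K hK (fun Y => U (Y 0)).
- by split=> [|a Y Z hY hZ]; rewrite !ffunE; [apply: submod0|exact: (proj2 hU)].
- move=> Y hY; apply: BU; case: (j) Y hY => [|l] Y /=; first by move=> ->; rewrite ffunE.
  by move=> [Z /tannE hZ <-]; exists (Z 0); rewrite ?ffunE.
- by move=> Y /UZ [h1 h2]; split; [apply/tannE|move=> i; rewrite ord1].
exists r, (fun i => v i 0); split=> // e he.
have [|c hc] := gen [ffun=> e]; first by rewrite ffunE.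
exists c; move: hc.
have -> : [ffun=> e] - \sum_(i < r) c i *: v i = [ffun=> e - \sum_(i < r) c i *: v i 0] :> tup j 1.
  apply/ffunP => l; rewrite !ffunE; congr (_ - _).
  by elim/big_ind2 : _ => [|_ f _ g <- <-|i _]; rewrite ?ffunE // ord1.
case: (j) (e - _) => [|l] z /=; first by move=> /ffunP /(_ 0); rewrite !ffunE.
by move=> [Z /tannE hZ /ffunP /(_ 0)]; rewrite !ffunE => hz; exists (Z 0).
Qed.
End Resolution.

Lemma pred_eq T (P Q : T -> Prop) : (forall x, P x <-> Q x) -> P = Q.
Proof. by move=> h; apply/funext => x; apply/propext. Qed.

Lemma span_addg (R : comNzRingType) i (x : nat -> R) : span i.+1 x = addg (span i x) (x i).
Proof.
apply: pred_eq => z; split.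
  by move=> /spanP [c ->]; exists (c i); rewrite big_ord_recr /= addrK; apply/spanP; exists c.
move=> [r hr]; rewrite -(subrK (r * x i) z); apply: (idealD (ideal_span _ _)).
  by apply: (span_sub (ideal_span _ _) _ hr) => j ji; apply: span_mem; apply: ltnW.
by apply: (idealM _ (ideal_span _ _)); apply: span_mem.
Qed.

(** * Ext over a regular local ring *)

Section LocalExt.
Variables (R : comNzRingType) (E : injective_resolution (R^o : lmodType R)).
Hypothesis nR : noethR R.
Local Notation ext0 := (ext0 E).
Implicit Types (b : R -> Prop) (j : nat).

(** If [y u = dz], divide [z] by [y] and subtract the differential of the quotient from [u]: this
    leaves [du] unchanged and makes [y] kill the cochain. *)
Lemma cobd_addg j b y (u : E j) : ideal b -> (forall r, b (y * r) -> b r) -> ann b u -> cobd b (y *: u) ->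
  cobd (addg b y) (cdiff E j u).
Proof.
move=> hb reg; case: j u => [|j] u hu /=.
  by move=> hyu; exists u => //; apply: ann_addg.
move=> [z hz ez].
have [|z' [hz' yz]] := injective_divide (@res_injective _ _ E j) (y := y) (e := z) hb.
  by move=> r /reg; apply: hz.
exists (u - cdiff E j z'); last by rewrite raddfB /= dK subr0.
apply: ann_addg; last by rewrite scalerBr -ez -yz linearZ /= subrr.
apply: (submodB (submod_ann _ _)) => //; by move=> r hr; rewrite -linearZ hz' // raddf0.
Qed.

(** Injectivity of the map from [Ext^j(R/(b + (y)), R)] to [Ext^j(R/b, R)], whose kernel comes from
    [Ext^(j-1)(R/b, R)]. *)
Lemma cobd_addg_ext j b y (e : E j) : ideal b -> (forall r, b (y * r) -> b r) -> (forall l, j = l.+1 -> ext0 l b) ->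
  cocyc (addg b y) e -> cobd b e -> cobd (addg b y) e.
Proof.
move=> hb reg; case: j e => [|j] e // hl [he de] [u hu eu].
rewrite -eu; apply: cobd_addg => //; apply: hl => //; split.
  exact: (submodZ (submod_ann _ _)).
by rewrite linearZ /= eu he //; apply: addgr.
Qed.

(** The modules [Ext^j(R/b, R)] are concentrated in degree [i], where the class of [u] generates a
    copy of [R/b]. *)
Definition ext_cyclic i b := (forall j, j != i -> ext0 j b) /\ exists u : E i, [/\ cocyc b u,
  forall e, cocyc b e -> exists r, cobd b (e - r *: u) & forall r, cobd b (r *: u) -> b r].

(** The connecting map raises the degree by one: with [y u' = u], the new generator is [du']. *)
Lemma ext_cyclic_addg i b y : ideal b -> (forall r, b (y * r) -> b r) -> ext_cyclic i b ->
  ext_cyclic i.+1 (addg b y).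
Proof.
move=> hb reg [hj [u [[bu du] gen tors]]].
have hb' : ideal (addg b y) := ideal_addg _ hb.
have mono j (e : E j) : cocyc (addg b y) e -> cocyc b e.
  by move=> [h1 h2]; split=> //; apply: ann_mono h1; apply: addgl.
have [|u' [bu' yu']] := injective_divide (@res_injective _ _ E i) (y := y) (e := u) hb.
  by move=> r /reg; apply: bu.
split=> [j ji e he|].
  case: (eqVneq j i) ji e he => [->|ji] ji' e he.
    apply: cobd_addg_ext => //; first by move=> l il; apply: hj; rewrite il neq_ltn ltnSn.
    have [r hr] := gen e (mono _ _ he).
    suff br : b r by move: hr; rewrite bu // subr0.
    apply/reg/tors; rewrite -scalerA.
    have -> : y *: (r *: u) = - (y *: (e - r *: u)).
      by rewrite scalerBr he.1 ?sub0r ?opprK //; apply: addgr.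
    by apply: (submodN (submod_cobd _ _ _)); apply: (submodZ (submod_cobd _ _ _)).
  apply: cobd_addg_ext => //; last by apply: hj => //; apply: mono.
  by move=> l jl; apply: hj; apply: contra ji'; rewrite jl eqSS.
exists (cdiff E i u'); split.
- split; last exact: dK.
  by apply: ann_addg; [move=> r hr; rewrite -linearZ bu' // raddf0|rewrite -linearZ yu' du].
- move=> e he; have [|z hz ez] := hj i.+1 _ e (mono _ _ he); first by rewrite neq_ltn ltnSn orbT.
  have [|r hr] := gen (y *: z).
    split; first by apply: (submodZ (submod_ann _ _)).
    by rewrite linearZ /= ez he.1 //; apply: addgr.
  exists r; rewrite -ez -linearZ -raddfB; apply: cobd_addg => //.
    by apply: (submodB (submod_ann _ _)) => //; apply: (submodZ (submod_ann _ _)).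
  by rewrite scalerBr (scalerA y r) mulrC -(scalerA r y) yu'.
- move=> r [t ht et].
  have [|s hs] := gen (r *: u' - t).
    split; last by rewrite linearB linearZ /= et subrr.
    apply: (submodB (submod_ann _ _)); first by apply: (submodZ (submod_ann _ _)).
    by apply: ann_mono ht; apply: addgl.
  exists s; apply: tors.
  have -> : (r - s * y) *: u = y *: (r *: u' - t - s *: u).
    rewrite !scalerBr (ht y (addgr _ hb)) subr0 !scalerA (mulrC y r) -(scalerA r y) yu'.
    by rewrite scalerBl (mulrC y s).
  by apply: (submodZ (submod_cobd _ _ _)).
Qed.

Lemma ext_cyclic0 : ext_cyclic 0 (fun x : R => x = 0).
Proof.
split=> [[|j] // _ e [_ de]|].
  have [y hy] := proj1 (@res_exactS R R^o E j e) de.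
  by exists y => // r ->; rewrite scale0r.
have aug1 r : res_aug E r = r *: res_aug E (1 : R^o).
  by rewrite -linearZ; congr (res_aug E _); rewrite -[LHS]mulr1.
exists (res_aug E (1 : R^o)); split.
- split; first by move=> r ->; rewrite scale0r.
  by apply/(proj2 (@res_exact0 R R^o E _)); exists 1.
- move=> e [_ de]; have [r hr] := proj1 (@res_exact0 R R^o E e) de.
  by exists r; rewrite /= -aug1 hr subrr.
- move=> r /=; rewrite -aug1 => h; apply: (@res_aug_inj R R^o E); by rewrite h raddf0.
Qed.

Lemma ext_cyclic_regseq r (x : nat -> R) i : regseq r x -> (i <= r)%N -> ext_cyclic i (span i x).
Proof.
move=> reg; elim: i => [|i IH] ir.
  have -> : span 0 x = (fun z : R => z = 0); last exact: ext_cyclic0.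
  apply: pred_eq => z; split=> [[c ->]|->]; first by rewrite big_ord0.
  by apply: ideal0; apply: ideal_span.
rewrite span_addg; apply: ext_cyclic_addg; [exact: ideal_span| |exact/IH/ltnW].
by move=> a; apply: reg.
Qed.

Variables (D : nat) (x : nat -> R).
Hypothesis reg : regseq D x.
Hypothesis loc : forall a, ~ span D x a -> exists c, c * a = 1.
Hypothesis M1 : ~ span D x 1.

Lemma local_jac : jac D x.
Proof.
move=> c; apply: loc => h; apply: M1.
rewrite -(subrK (\sum_(i < D) c i * x i) 1); apply: (idealD (ideal_span _ _)) => //.
by apply/spanP; exists c.
Qed.

Lemma local_max b : ideal b -> ~ b 1 -> (forall i, (i < D)%N -> b (x i)) -> b = span D x.
Proof.
move=> hb b1 h; apply: pred_eq => z; split=> [bz|]; last exact: span_sub.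
by apply: contrapT => /loc [c hc]; apply: b1; rewrite -hc; apply: idealM.
Qed.

(** Multiplication by [y] is surjective on the finite module [Ext^j(R/b, R)], so Nakayama
    applies. *)
Lemma ext0_regular j b y : ideal b -> span D x y -> (forall r, b (y * r) -> b r) -> ext0 j.+1 (addg b y) -> ext0 j b.
Proof.
move=> hb My hy h.
have hZ := submod_cocyc E b j; have hW := submod_cobd E b j.
apply: (nakayama local_jac (noeth_cocyc nR (j := j) hb) hZ hW (@cobd_cocyc _ E b j)) => e he.
have [e' he' <-] := cocyc_divide hb hy h he.
apply: addmr => //.
have /spanP [c ->] := My.
rewrite scaler_suml; apply: (submod_sum (submod_ipowm _ _ _ hZ)) => i _.
rewrite mulrC -scalerA; apply: ipowm_mul => //; exact: (submodZ hZ).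
Qed.

(** A proper ideal that is not prime splits into a colon ideal and a sum, both larger. A prime is
    the maximal ideal or misses some parameter, which is then regular modulo it. *)
Lemma ext0_dichotomy (Q : (R -> Prop) -> Prop) b : ideal b ->
  (forall J, ideal J -> J 1 -> Q J) ->
  (forall J y, ideal J -> Q (colon J y) -> Q (addg J y) -> Q J) ->
  Q (span D x) ->
  (forall J y, prime J -> span D x y -> ~ J y -> Q (addg J y) -> Q J) -> Q b.
Proof.
move=> hb h1 h2 h3 h4; apply: (noethR_ind nR hb) => J hJ _ IH.
have [J1|J1] := EM (J 1); first exact: h1.
have [[a [c [hac na nc]]]|np] := EM (exists a c, [/\ J (a * c), ~ J a & ~ J c]).
  apply: (h2 J a hJ); apply: IH.
  - exact: ideal_colon. - exact: colonl. - by move=> h; apply: nc; apply: h.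
  - exact: ideal_addg. - exact: addgl. - by move=> h; apply: na; apply: h; apply: addgr.
have pJ : prime J.
  split=> // a c hac; apply: contrapT => /not_orP [na nc]; apply: np; by exists a, c.
have [[i [iD ni]]|hx] := EM (exists i, (i < D)%N /\ ~ J (x i)).
  apply: (h4 J (x i)) => //; first exact: span_mem.
  by apply: IH; [exact: ideal_addg|exact: addgl|move=> h; apply: ni; apply: h; apply: addgr].
rewrite (local_max hJ J1) // => i iD; apply: contrapT => ni; apply: hx; by exists i.
Qed.

Lemma primeE (J : R -> Prop) (y r : R) : prime J -> ~ J y -> J (y * r) -> J r.
Proof. by move=> [_ _ h] ny /h []. Qed.

(* Global dimension [D]. *)
Lemma ext0_above b j : ideal b -> (D < j)%N -> ext0 j b.
Proof.
move=> hb; move: j; apply: (ext0_dichotomy hb (Q := fun b => forall j, (D < j)%N -> ext0 j b)).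
- by move=> J _ J1 j _; apply: ext0_ideal1.
- by move=> J y hJ h1 h2 j Dj; apply: (ext0_colon (x := y)) => //; [apply: h1|apply: h2].
- by move=> j Dj; apply: (ext_cyclic_regseq reg (leqnn D)).1; rewrite neq_ltn Dj orbT.
- move=> J y pJ My ny h j Dj; apply: (ext0_regular (y := y)) => //; first by case: pJ.
    by move=> r; apply: primeE.
  by apply: h; apply: ltnW.
Qed.

Lemma prime_span : prime (span D x).
Proof.
split=> //; first exact: ideal_span.
move=> a c hac; apply: contrapT => /not_orP [/loc [u hu] nc]; apply: nc.
by rewrite -[c]mul1r -hu -mulrA; apply: (idealM _ (ideal_span _ _)).
Qed.

Lemma chain_cons n (P : nat -> R -> Prop) (J : R -> Prop) : chain n P -> prime J -> sub J (P 0%N) -> ~ sub (P 0%N) J ->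
  chain n.+1 (fun i => if i is k.+1 then P k else J).
Proof. by move=> [h1 h2] pJ s ns; split=> -[|i] // h; [apply: h1|apply: h2]. Qed.

(* A regular local ring is Cohen-Macaulay. *)
Lemma ext0_below b e j : ideal b -> (forall k P, chain k P -> sub b (P 0%N) -> (k <= e)%N) ->
  (j + e < D)%N -> ext0 j b.
Proof.
move=> hb; move: e j.
apply: (ext0_dichotomy hb (Q := fun b => forall e j, (forall k P, chain k P -> sub b (P 0%N) -> (k <= e)%N) ->
  (j + e < D)%N -> ext0 j b)).
- by move=> J _ J1 e j _ _; apply: ext0_ideal1.
- move=> J y hJ h1 h2 e j hc je; apply: (ext0_colon (x := y)) => //.
    by apply: (h1 e) => // k P cP hP; apply: (hc k P cP) => z hz; apply: hP; apply: colonl.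
  by apply: (h2 e) => // k P cP hP; apply: (hc k P cP) => z hz; apply: hP; apply: addgl.
- move=> e j _ je; apply: (ext_cyclic_regseq reg (leqnn D)).1.
  by rewrite neq_ltn (leq_ltn_trans (leq_addr e j) je).
- move=> J y pJ My ny h e j hc je; have hJ : ideal J by case: pJ.
  have up k P : chain k P -> sub (addg J y) (P 0%N) -> (k.+1 <= e)%N.
    move=> cP hP; have sJ : sub J (P 0%N) by move=> z hz; apply: hP; apply: addgl.
    apply: (hc _ _ (chain_cons cP pJ sJ _)) => // s; apply: ny; apply: s; apply: hP; exact: addgr.
  case: e hc je up => [|e] hc je up.
    have c0 : chain 0 (fun=> span D x) by split=> // i _; exact: prime_span.
    suff s0 : sub (addg J y) (span D x) by have := up 0%N _ c0 s0.
    move=> z [s hs]; rewrite -(subrK (s * y) z); apply: (idealD (ideal_span _ _)); last first.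
      by apply: (idealM _ (ideal_span _ _)).
    apply: contrapT => /loc [u hu]; case: pJ => _ J1 _; apply: J1; rewrite -hu; exact: idealM.
  apply: (ext0_regular (y := y)) => //; first by move=> r; apply: primeE.
  by apply: (h e); [move=> k P cP hP; apply: (up _ _ cP hP)|rewrite addSnnS].
Qed.

(** Mayer-Vietoris for [R/(b1 cap b2)], [R/b1], [R/b2] and [R/(b1 + b2)]. *)
Lemma ext0_cap j b1 b2 : ideal b1 -> ideal b2 -> ext0 j b1 -> ext0 j b2 -> ext0 j.+1 (addm (V := R^o) b1 b2) ->
  ext0 j (fun r => b1 r /\ b2 r).
Proof.
move=> h1 h2 e1 e2 e3 e [he de].
have [u [hu1 hu2]] := injective_split (@res_injective _ _ E j) h1 h2 he.
have [|z hz ez] := e3 (cdiff E j u).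
  split; last exact: dK.
  move=> _ [s [t [hs ht ->]]]; rewrite scalerDl -linearZ hu1 // raddf0 add0r.
  rewrite -[u](subKr e) raddfB /= de sub0r scalerN -linearZ hu2 // raddf0 oppr0 //.
have hz1 : ann b1 z by apply: ann_mono hz; apply: (addml (V := R^o) h2).
have hz2 : ann b2 z by apply: ann_mono hz; apply: (addmr (V := R^o) h1).
rewrite -(subrK (u - z) e); apply: (submodD (submod_cobd _ _ _)).
  apply: (@cobd_mono _ _ _ b2) => [r []//|]; apply: e2; split.
    rewrite opprB addrCA; apply: (submodD (submod_ann _ _)) => //.
  by rewrite !raddfB /= de ez subrr addr0.
apply: (@cobd_mono _ _ _ b1) => [r []//|]; apply: e1; split.
  exact: (submodB (submod_ann _ _)).
by rewrite raddfB /= ez subrr.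
Qed.

(** By irreducible decomposition [b] lies in an ideal [H] with vanishing top [Ext] that a power of
    the maximal ideal carries back into [b]; saturation gives [b = H]. Components at the maximal
    ideal are replaced by the unit ideal; on the others a parameter is regular and [Ext^(D+1)]
    vanishes. *)
Lemma ext0_saturated b : ideal b -> (forall L r, (forall w, ipow D x L w -> b (w * r)) -> b r) -> ext0 D b.
Proof.
move=> hb sat.
pose Q U := exists H L, [/\ ideal H, ext0 D H, sub U H & forall h w, H h -> ipow D x L w -> U (w * h)].
suff [H [L [hH eH bH Hb]]] : Q b.
  have -> : b = H; last exact: eH.
  by apply: pred_eq => z; split=> [/bH//|hz]; apply: (sat L) => w hw; apply: Hb.
apply: (@irreducible_ind R R^o full b Q nR (noethR_ideal nR hb) (@submod_full _ _) hb) => //.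
- exists full, 0%N; split=> //; exact: ext0_ideal1.
- move=> U1 U2 [H1 [L1 [i1 e1 s1 k1]]] [H2 [L2 [i2 e2 s2 k2]]].
  exists (fun r => H1 r /\ H2 r), (maxn L1 L2); split.
  + exact: submod_capm i1 i2.
  + apply: ext0_cap => //; apply: ext0_above => //; exact: submod_addm.
  + by move=> z [z1 z2]; split; [apply: s1|apply: s2].
  + move=> h w [h1 h2] hw; split; [apply: k1|apply: k2] => //; apply: ipow_le hw; [exact: leq_maxl|exact: leq_maxr].
- move=> U a0 q hU bU _ _ na0 pq qE irr nil.
  have [[i [iD ni]]|hx] := EM (exists i, (i < D)%N /\ ~ q (x i)).
    exists U, 0%N; split=> //; last by move=> h w hh _; apply: idealM.
    apply: (ext0_regular (y := x i)) => //; first exact: span_mem.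
      move=> a ha; apply: contrapT => na; have [y [r [ny hy]]] := irr a Logic.I na.
      apply: ny; apply: (primeE pq ni); apply/qE.
      have -> : (x i * y) *: a0 = x i *: (y *: a0 - r *: (a : R^o)) + r *: (x i * a : R^o).
        by rewrite /GRing.scale /=; ring.
      by apply: (submodD hU); apply: (submodZ hU).
    by apply: ext0_above => //; apply: ideal_addg.
  have [i iD|L hL] := @ipowm_pigeon R R^o D x full U (@submod_full _ _) hU.
    apply: nil; apply: contrapT => ni; apply: hx; by exists i.
  exists full, L; split=> //; first exact: ext0_ideal1.
  by move=> h w _ hw; rewrite mulrC; apply: (idealM _ hU); apply: hL.
Qed.
End LocalExt.

(** The ideals [(J : m^L)], with [m] generated by [x], increase with [L], and the stationary one is
    saturated. *)
Lemma saturation_exists (R : comNzRingType) r (x : nat -> R) J : noethR R -> ideal J ->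
  exists L, forall L' z, (forall w, ipow r x L' w -> forall u, ipow r x L u -> J (u * (w * z))) ->
    forall u, ipow r x L u -> J (u * z).
Proof.
move=> nR hJ.
pose U L : R -> Prop := fun z => forall u, ipow r x L u -> J (u * z).
have hU L : ideal (U L).
  apply/idealP; split=> [u _|y z hy hz u hu|c y hy u hu].
  - by rewrite mulr0; apply: ideal0.
  - by rewrite mulrDr; apply: idealD => //; [apply: hy|apply: hz].
  - by rewrite mulrCA; apply: idealM => //; apply: hy.
have [|||L hL] := @noeth_stable R R^o full J U (noethR_ideal nR hJ) hU => //.
- by move=> L z hz u _; apply: idealM.
- move=> L z hz u hu; apply: hz; exact: ipow_le hu.
have stab k : sub (U (k + L)%N) (U L).
  elim: k => [//|k IH] z hz; apply: hL => w [c [hc ->]].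
  rewrite mulr_suml; apply: ideal_sum => // i _.
  have -> : x i *: (c i : R^o) * z = c i * (x i * z) by rewrite /GRing.scale /=; ring.
  suff hx : U L (x i * z) by apply: hx; apply: hc.
  apply: IH => u hu; have -> : u * (x i * z) = x i * u * z by ring.
  by apply: hz; rewrite addSn; apply: ipow_mulvar.
exists L => L' z h u hu; apply: (stab L') => // w hw.
rewrite mulrC; apply: (ipowD (ideal_colon z hJ) _ hw) => a b ha hb.
by rewrite /colon (_ : z * (a * b) = b * (a * z)); [apply: h|ring].
Qed.

Lemma ipow_image_sub (R A : comNzRingType) (i : {rmorphism R -> A}) r (x : nat -> R) L (H : A -> Prop) :
  ideal H -> (forall w, ipow r x L w -> H (i w)) -> sub (ipow r (i \o x) L) H.
Proof.
elim: L H => [|L IH] H hH h.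
  by move=> z _; apply: ideal1 => //; rewrite -(rmorph1 i); apply: h.
apply: ipow_sub => // j z jr hz.
apply: (IH (colon H (i (x j)))) hz; first exact: ideal_colon.
by move=> w hw; rewrite /colon -rmorphM; apply: h; apply: ipow_mulvar.
Qed.

Lemma extend_ipow (R A : comNzRingType) (i : {rmorphism R -> A}) r (x : nat -> R) L :
  extend i (ipow r x L) = ipow r (i \o x) L.
Proof.
apply: pred_eq => z; split.
  apply: extend_sub; first exact: ideal_ipow.
  elim: L => [//|L IH] w [c [hc ->]]; rewrite rmorph_sum; apply: ideal_sum; first exact: ideal_ipow.
  by move=> j _; rewrite -[_ *: _]/(x j * c j) rmorphM; apply: (ipow_mulvar (y := i \o x)) => //; apply/IH/hc.
by apply: ipow_image_sub; [exact: ideal_extend|move=> w; exact: extend_mem].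
Qed.

Lemma extend_addgE (R A : comNzRingType) (i : {rmorphism R -> A}) J c : ideal J ->
  extend i (addg J c) = addg (extend i J) (i c).
Proof.
move=> hJ; apply: pred_eq => z; split; first exact: extend_addg.
move=> [s hs]; rewrite -(subrK (s * i c) z); apply: (idealD (ideal_extend _ _)).
  by apply: (extend_mono (addgl c hJ)) hs.
by apply: (idealM _ (ideal_extend _ _)); apply: extend_mem; apply: addgr.
Qed.

(* Artin-Rees for multiplication by a nonzerodivisor. *)
Lemma colon_ipow (R : comNzRingType) g (v : nat -> R) (p : R) s : noethR R -> (forall z, p * z = 0 -> z = 0) ->
  exists N, sub (colon (ipow g v N) p) (ipow g v s).
Proof.
move=> nR reg; have hW := ideal_ipow g v s.
pose Q (U : R -> Prop) := exists N, sub (colon (ipow g v N) p) U.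
apply: (@irreducible_ind R R^o full (ipow g v s) Q nR (noethR_ideal nR hW) (@submod_full _ _) hW) => //.
- by exists 0%N.
- move=> U1 U2 [N1 h1] [N2 h2]; exists (maxn N1 N2) => z hz; split; [apply: h1|apply: h2]; apply: ipow_le hz.
    exact: leq_maxl.
  exact: leq_maxr.
- move=> U a0 q hU WU _ _ na0 pq qE irr _.
  have hpq : ideal q by case: pq.
  have vq : sub (span g v) q.
    apply: (span_sub hpq) => i ig; apply: (primeX (k := s) pq); apply/qE.
    by rewrite -[_ *: _]/(v i ^+ s * a0) mulrC; apply: (idealM _ hU); apply: WU; apply: ipow_exp.
  pose pU z := exists2 u, U u & z = p * u.
  have hpU : ideal pU.
    apply/idealP; split=> [|_ _ [u hu ->] [w hw ->]|c _ [u hu ->]].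
    - by exists 0; rewrite ?mulr0 //; apply: ideal0.
    - by exists (u + w); rewrite ?mulrDr //; apply: idealD.
    - by exists (c * u); [apply: idealM|rewrite mulrCA].
  (* If [p z] lies in a high power of [(v)] with [z] outside [U], then so does [y p a0] modulo [pU],
     for some [y] outside [q]. Krull's theorem gives [(y - j) p a0] in [pU], and cancelling [p] puts
     [y] in [q]. *)
  have [N hN] := ring_krull g v (p * a0) nR hpU.
  pose G z := exists u : nat -> R, z = \sum_(i < g) v i ^+ N * u i.
  have hG : ideal G.
    apply/idealP; split=> [|_ _ [u ->] [w ->]|c _ [u ->]].
    - by exists (fun=> 0); rewrite big1 // => i _; rewrite mulr0.
    - by exists (fun i => u i + w i); rewrite -big_split; apply: eq_bigr => i _; rewrite /= mulrDr.
    - by exists (fun i => c * u i); rewrite mulr_sumr; apply: eq_bigr => i _; rewrite mulrCA.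
  have [i ig|L hL] := @ipowm_pigeon R R^o g v full G (@submod_full _ _) hG.
    exists N => z _; exists (fun j => if j == i then z else 0).
    rewrite (bigD1 (Ordinal ig)) //= eqxx big1 ?addr0 // => j.
    by rewrite -val_eqE /= => /negbTE ->; rewrite mulr0.
  exists L => z hz; apply: contrapT => nz.
  have [y [r [ny hy]]] := irr z Logic.I nz.
  have [u hu] := hL _ (idealM r (ideal_ipow g v L) hz).
  have [|j jv [w hw e]] := hN y u.
    exists (y * a0 - r * z) => //; rewrite -hu; ring.
  apply: ny; rewrite -(subrK j y); apply: (idealD hpq); last exact: vq.
  apply/qE; rewrite -[_ *: _]/((y - j) * a0).
  suff -> : (y - j) * a0 = w by [].
  by apply/eqP; rewrite -subr_eq0; apply/eqP/reg; rewrite mulrBr -e; ring.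
Qed.

(** * Vanishing and nonvanishing *)

Section Duality.
Variables (R : comNzRingType) (E : injective_resolution (R^o : lmodType R)).
Variables (n : nat) (x : nat -> R).
Hypothesis nR : noethR R.
Hypothesis rx : regseq n.+1 x.
Hypothesis loc : forall a, ~ span n.+1 x a -> exists c, c * a = 1.
Hypothesis M1 : ~ span n.+1 x 1.
Variables (A : comNzRingType) (i : {rmorphism R -> A}).
Hypothesis nA : noethR A.
Hypothesis jA : jac n.+1 (i \o x).
Hypothesis dense : forall a, exists c, span n.+1 (i \o x) (a - i c).
Hypothesis sub_ipow : forall L c, ipow n.+1 (i \o x) L (i c) -> ipow n.+1 x L c.

Let jR := local_jac loc M1.

(** A cocycle [g] with [a^k g = pi e] is built for each [k]; by closedness in the finite module
    [Ext^n(R/K, R)] this makes [pi e] a coboundary. *)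
Lemma duality (a b pi : R) J0 bb : dual_data n.+1 (i \o x) (i a) (i b) J0 (extend i bb) (i pi) ->
  span n.+1 x a -> span n.+1 x b -> ideal bb ->
  forall e : E n, cocyc bb e -> cobd (fun r => J0 (i r)) (pi *: e).
Proof.
move=> [T [Th [JJ [rel [hJJ ra rb J0J [rel1 rlin rJ rex]]]]]] Ma Mb hbb e [be de].
pose K r := JJ (Th (i r)).
suff : cobd K (pi *: e) by apply: cobd_mono => r; apply: J0J.
have hK : ideal K.
  apply/idealP; split; rewrite /K; first by rewrite !rmorph0; apply: ideal0.
  - by move=> y z hy hz; rewrite !rmorphD; apply: idealD.
  - by move=> c z hz; rewrite !rmorphM; apply: idealM.
have rel0 : rel 0 0.
  by have := rlin (-1) 1 (i pi) 1 (i pi) rel1 rel1; rewrite rmorphN rmorph1 !mulN1r !addNr.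
have rscale u F f : rel F f -> rel (Th u * F) (u * f).
  by move=> h; have := rlin u F f 0 0 h rel0; rewrite !addr0.
(* Divisibility of the class by all [a^k] suffices, because [a] lies in the maximal ideal. *)
suff key k : exists2 g : E n, cocyc K g & a ^+ k *: g = pi *: e.
  have hZ := submod_cocyc E K n; have hW := submod_cobd E K n.
  have ja : jac 1 (fun=> a) by apply: (jac_sub _ jR).
  have hip L g : cocyc K g -> ipowm 1 (fun=> a) L (@cocyc R E K n) (a ^+ L *: g).
    move=> hg; elim: L => [|L IH]; first by rewrite scale1r.
    by rewrite exprS -scalerA; apply: (@ipowm_mul _ _ 1 (fun=> a) L (@cocyc R E K n) 0%N).
  apply: (krull_closed ja (noeth_cocyc nR (j := n) hK) hZ hW) => //.
  - exact: cobd_cocyc.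
  - by have [g hg] := key 0%N; rewrite scale1r => <-.
  - by move=> L; have [g hg <-] := key L; apply: (addmr hW); apply: hip.
have haK : ideal (addg K (a ^+ k)) by exact: ideal_addg.
have [L sat] := saturation_exists n.+1 x nR haK.
(* The saturation of [K + (a^k)]. Since [b^L] multiplies it into [K + (a^k)], regularity of [b]
   makes [Th v] divisible by [a^k] modulo [JJ]. *)
pose V v := forall w, ipow n.+1 x L w -> addg K (a ^+ k) (w * v).
have hV : ideal V.
  apply/idealP; split=> [u _|y z hy hz u hu|c y hy u hu].
  - by rewrite mulr0; apply: ideal0.
  - by rewrite mulrDr; apply: idealD => //; [apply: hy|apply: hz].
  - by rewrite mulrCA; apply: idealM => //; apply: hy.
have KV : sub K V by move=> r hr w _; apply: addgl => //; apply: idealM.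
have Va : V (a ^+ k) by move=> w _; apply: idealM => //; apply: addgr.
(* The map [v |-> rho e], where [rho] in [R] represents [F = Th v / a^k]. It is a relation because
   [F], [f] and [rho] are chosen; [rE0] shows that the value is unique. *)
pose rE v (u : E n) := exists rho F f,
  [/\ JJ (Th (i v) - Th (i a) ^+ k * F), rel F f, extend i bb (f - i rho) & u = rho *: e].
have hE := ideal_extend i bb.
have totV v : V v -> exists u, rE v u.
  move=> hv.
  have [F hF] : addg JJ (Th (i a) ^+ k) (Th (i v)).
    apply: (reg_mod_pow hJJ ra rb (k := k) (l := L)).
    have [|r hr] := hv (b ^+ L).
      elim: (L) => [//|l IH]; rewrite exprS; apply: (@ipowM _ _ _ 1) IH; exact/ipow1.
    exists (Th (i r)).
    by move: hr; rewrite /K !(rmorphB, rmorphM, rmorphXn).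
  have FV w : ipow n.+1 x L w -> exists r, JJ (Th (i w) * F - Th (i r)).
    move=> /hv [r hr]; exists r; apply: (reg_mod_exp (k := k) ra).
    have -> : Th (i a) ^+ k * (Th (i w) * F - Th (i r)) =
       (Th (i w) * Th (i v) - Th (i r) * Th (i a) ^+ k) - Th (i w) * (Th (i v) - F * Th (i a) ^+ k) by ring.
    apply: idealB => //; last exact: idealM.
    by move: hr; rewrite /K !(rmorphB, rmorphM, rmorphXn).
  have [|f hf] := rex L F.
    apply: ipow_image_sub => [|w /FV [r hr]]; last by exists (i r).
    apply/idealP; split=> [|y z [s hs] [t ht]|c y [s hs]].
    - by exists 0; rewrite !rmorph0 mul0r subr0; apply: ideal0.
    - exists (s + t); rewrite !rmorphD mulrDl opprD addrACA; exact: idealD.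
    - by exists (c * s); rewrite !rmorphM -mulrA -mulrBr; apply: idealM.
  (* The element [f] lives in the completion. A power of the maximal ideal carries it into [R]
     modulo [bb A], and such elements already come from [R]. *)
  have [|rho hrho] := completion_saturated nR nA jR jA loc dense sub_ipow (J := bb) (L := L) (t := f) hbb.
    move=> w /FV [r hr]; exists (r * pi).
    apply: (rJ _ _ _ hr); rewrite rmorphM.
    have := rlin (- i r) 1 (i pi) _ _ rel1 (rscale (i w) _ _ hf).
    by rewrite rmorphN mulr1 mulNr addrC (addrC (- (i r * i pi))).
  by exists (rho *: e), rho, F, f; split=> //; rewrite mulrC.
have rE0 u : rE 0 u -> u = 0.
  move=> [rho [F [f [h1 h2 h3 ->]]]]; apply: be.
  apply: (completion_contract nR jR dense sub_ipow) => //.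
  rewrite -[i rho](subKr f); apply: idealB h3 => //; apply: rJ h2 _.
  apply: (reg_mod_exp (k := k) ra); rewrite -[_ * F]opprK; apply: idealN => //.
  by move: h1; rewrite !rmorph0 sub0r.
have rElin c y z u u' : rE y u -> rE z u' -> rE (c * y + z) (c *: u + u').
  move=> [r [F [f [h1 h2 h3 ->]]]] [r' [F' [f' [h1' h2' h3' ->]]]].
  exists (c * r + r'), (Th (i c) * F + F'), (i c * f + f'); split.
  - rewrite !(rmorphD, rmorphM).
    have -> : Th (i c) * Th (i y) + Th (i z) - Th (i a) ^+ k * (Th (i c) * F + F') =
      Th (i c) * (Th (i y) - Th (i a) ^+ k * F) + (Th (i z) - Th (i a) ^+ k * F') by ring.
    by apply: idealD => //; apply: idealM.
  - exact: rlin.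
  - rewrite !(rmorphD, rmorphM).
    have -> : i c * f + f' - (i c * i r + i r') = i c * (f - i r) + (f' - i r') by ring.
    by apply: idealD => //; apply: idealM.
  - by rewrite scalerDl scalerA.
have [g hg] := injective_ideal (@res_injective _ _ E n) hV totV rElin rE0.
have ga : a ^+ k *: g = pi *: e.
  apply: hg => //; exists pi, 1, (i pi); split=> //.
    by rewrite !rmorphXn mulr1 subrr; apply: ideal0.
  by rewrite subrr; apply: ideal0.
have gK : ann K g.
  move=> r hr; apply: hg; first exact: KV.
  exists 0, 0, 0; split=> //; last by rewrite scale0r.
    by rewrite mulr0 subr0.
  by rewrite rmorph0 subrr; apply: ideal0.
(* Values of the map are multiples of the cocycle [e], so [V] kills [dg]. As [V] is saturated,
   [dg = dy] with [y] killed by [V], in particular by [a^k]; so [g - y] is the cocycle sought. *)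
have [|y hy ey] := ext0_saturated (E := E) nR rx loc M1 hV sat (e := cdiff E n g).
  split; last exact: dK.
  move=> v hv; have [u hu] := totV v hv.
  have du : cdiff E n u = 0.
    by case: hu => [rho [_ [_ [_ _ _ ->]]]]; rewrite linearZ /= de scaler0.
  by rewrite -linearZ (hg v u hv hu).
exists (g - y); last by rewrite scalerBr ga hy // subr0.
split; last by rewrite raddfB /= ey subrr.
by apply: (submodB (submod_ann _ _)) => //; apply: ann_mono hy.
Qed.
End Duality.

Lemma ext_vanishing (R : comNzRingType) (E : injective_resolution (R^o : lmodType R)) (p n : nat)
  (x : nat -> R) (I : R -> Prop) (a b : R) g (v : nat -> R) :
  prime.prime p -> x n = p%:R -> noethR R -> regseq n.+1 x ->
  (forall c, ~ span n.+1 x c -> exists u, u * c = 1) -> ~ span n.+1 x 1 -> (forall z : R, p%:R * z = 0 -> z = 0) ->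
  ideal I -> ~ I 1 -> span n.+1 x a -> span n.+1 x b -> reg_mod I a -> reg_mod (addg I a) b ->
  (forall z, I z <-> span g v z) ->
  forall s (e : E n), cocyc (ipow g v s) e -> exists s', cobd (ipow g v s') e.
Proof.
move=> pp xn nR rx loc M1 p0 hI I1 Ma Mb ra rb Iv.
have jR := local_jac loc M1.
have [A [i [nA cA sA dense subp]]] := completion nR M1.
have jA := complete_jac cA sA.
have MA z : span n.+1 x z -> span n.+1 (i \o x) (i z) by apply: span_image.
have locA c : ~ span n.+1 (i \o x) c -> exists u, u * c = 1.
  have [c' hc'] := dense c => nc.
  have [|u hu] := loc c'.
    by move=> /MA h; apply: nc; rewrite -(subrK (i c') c); apply: (idealD (ideal_span _ _)).
  have [|w hw] := jac_unit (z := - (i u * (c - i c'))) jA.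
    by apply: (idealN (ideal_span _ _)); apply: (idealM _ (ideal_span _ _)).
  by exists (w * i u); rewrite -[RHS]hw -(rmorph1 i) -hu rmorphM; ring.
have kA := completion_koszul nR nA jR jA loc dense subp (regseq_koszul rx).
have IE : I = span g v by apply: pred_eq.
have eI z : extend i I z <-> span g (i \o v) z by rewrite IE; exact: extend_span.
have I1A : ~ extend i I 1.
  by rewrite -(rmorph1 i) => /(completion_contract nR jR dense subp hI).
have reg_ext J c : ideal J -> reg_mod J c -> reg_mod (extend i J) (i c).
  move=> hJ h z /(completion_colon nR nA jR jA loc dense subp hJ); apply: extend_mono; exact: h.
have raA := reg_ext _ _ hI ra.
have rbA : reg_mod (addg (extend i I) (i a)) (i b).
  by rewrite -extend_addgE //; apply: reg_ext => //; apply: ideal_addg.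
have pA : (i \o x) n = p%:R by rewrite /= xn rmorph_nat.
have data s := dual_data_exists s pp pA nA cA sA locA (jac_proper jA) kA (ideal_extend i I) I1A (MA _ Ma) (MA _ Mb) raA rbA eI.
have sub_back s : sub (ipow g v s) (fun r => ipow g (i \o v) s (i r)).
  by move=> r hr; rewrite -extend_ipow; apply: extend_mem.
have dual0 s : exists c s', forall e : E n, cocyc (ipow g v s) e -> cobd (ipow g v s') (p%:R ^+ c *: e).
  have [[c [s' h]] _] := data s; exists c, s' => e he.
  apply: (cobd_mono (@sub_back s')); apply: (duality nR rx loc M1 nA jA dense subp _ Ma Mb _ he).
    by move: h; rewrite -(extend_ipow i g v s) rmorphXn rmorph_nat; exact.
  exact: ideal_ipow.
have dualp s : exists s', forall e : E n, cocyc (addg (ipow g v s) p%:R) e -> cobd (ipow g v s') e.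
  have [_ [s' h]] := data s; exists s' => e he.
  apply: (cobd_mono (@sub_back s')); rewrite -[e]scale1r.
  apply: (duality nR rx loc M1 nA jA dense subp _ Ma Mb _ he).
    rewrite extend_addgE; last exact: ideal_ipow.
    by rewrite extend_ipow rmorph1 rmorph_nat.
  by apply: ideal_addg; apply: ideal_ipow.
have mono k l (e : E n) : (k <= l)%N -> cobd (ipow g v k) e -> cobd (ipow g v l) e.
  by move=> kl; apply: cobd_mono; exact: ipow_le.
(* Induction on [c] removes the factor [p^c] given by [dual0]. *)
suff step c s (e : E n) : cocyc (ipow g v s) e ->
    (exists s', cobd (ipow g v s') (p%:R ^+ c *: e)) -> exists s', cobd (ipow g v s') e.
  move=> s e he; have [c [s' hs']] := dual0 s; apply: (step c s) => //; by exists s'; apply: hs'.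
elim: c => [|c IH] he; first by rewrite scale1r.
move=> [s']; rewrite exprS -scalerA => hpe; apply: IH => //.
set e1 := p%:R ^+ c *: e in hpe *.
have [be1 de1] : cocyc (ipow g v s) e1 by apply: (submodZ (submod_cocyc _ _ _)).
(* Up to a coboundary, [e1] is replaced by a cocycle killed by [p], to which [dualp] applies: with
   [p e1 = dy], write [y = p y'] and subtract [dy']. Since [p] is regular, [colon_ipow] provides a
   power of the ideal that kills [y']. *)
suff [N [e' [he' hpe' [N' hN']]]] : exists N (e' : E n), [/\ cocyc (ipow g v N) e', p%:R *: e' = 0 &
    exists N', cobd (ipow g v N') (e1 - e')].
  have [s2 hs2] := dualp N; exists (maxn N' s2); rewrite -(subrK e' e1).
  apply: (submodD (submod_cobd _ _ _)); first by apply: mono hN'; exact: leq_maxl.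
  apply: mono (hs2 _ _); first exact: leq_maxr.
  by case: he' => h1 h2; split=> //; apply: ann_addg.
have [N hN] := @colon_ipow R g v p%:R s' nR p0.
case: (n) e {he} e1 be1 de1 hpe => [|l] e e1 be1 de1 /= hpe.
  exists s, e1; split=> //; exists 0%N; rewrite subrr; exact: (submod0 (submod_cobd E _ 0)).
case: hpe => y hy ey.
have [|y' [hy' ey']] := injective_divide (@res_injective _ _ E l) (b := ipow g v N) (y := p%:R) (e := y) (ideal_ipow _ _ _).
  by apply: ann_mono hy.
have bdy : ann (ipow g v N) (cdiff E l y') by move=> r hr; rewrite -linearZ hy' // raddf0.
exists (maxn N s), (e1 - cdiff E l y'); split.
- split; last by rewrite raddfB /= de1 dK subrr.
  apply: (submodB (submod_ann _ _)); [apply: ann_mono be1|apply: ann_mono bdy]; apply: ipow_le; [exact: leq_maxr|exact: leq_maxl].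
- by rewrite scalerBr -linearZ ey' ey subrr.
- exists N; rewrite subKr; by exists y'.
Qed.

Definition dim_le (R : comNzRingType) (b : R -> Prop) e := forall k P, chain k P -> sub b (P 0%N) -> (k <= e)%N.

(* A prime containing [J + y R] strictly contains a prime over [J], as [y] is regular on [R/J]. *)
Lemma dim_le_addg (R : comNzRingType) (J : R -> Prop) y e k P : noethR R -> ideal J -> reg_mod J y -> dim_le J e ->
  chain k P -> sub (addg J y) (P 0%N) -> (k < e)%N.
Proof.
move=> nR hJ hy he cP sP.
have pP : prime (P 0%N) by case: cP => h _; apply: h.
have [hP P1 PM] := pP.
have [|||Q [pQ JQ dQ]] := @prime_avoid R (fun z => exists w l, ~ P 0%N w /\ z = w * y ^+ l) J nR hJ.
- by exists 1, 0%N; rewrite mulr1.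
- move=> _ _ [w [l [nw ->]]] [w' [l' [nw' ->]]]; exists (w * w'), (l + l')%N; split; first by move=> /PM [].
  by rewrite exprD; ring.
- move=> _ [w [l [nw ->]]] h; apply: nw; apply: sP; apply: addgl => //.
  by apply: (reg_mod_exp (k := l) hy); rewrite mulrC.
have QP : sub Q (P 0%N).
  by move=> z Qz; apply: contrapT => nz; apply: (dQ z) => //; exists z, 0%N; rewrite mulr1.
apply: (he _ _ (chain_cons cP pQ QP _)) => // h.
by apply: (dQ y); [exists 1, 1%N; rewrite mul1r|apply: h; apply: sP; apply: addgr].
Qed.

Section Nonvanishing.
Variables (R : comNzRingType) (E : injective_resolution (R^o : lmodType R)).
Hypothesis nR : noethR R.
Variables (D : nat) (x : nat -> R).
Hypothesis reg : regseq D x.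
Hypothesis loc : forall a, ~ span D x a -> exists c, c * a = 1.
Hypothesis M1 : ~ span D x 1.
Local Notation ext0 := (ext0 E).

(** The term of the long exact sequence of multiplication by [y] that lies between [Ext^j(R/b, R)]
    and [Ext^(j+1)(R/b, R)]. *)
Lemma ext0_up j b y : ideal b -> reg_mod b y -> ext0 j b -> ext0 j.+1 b -> ext0 j.+1 (addg b y).
Proof.
move=> hb hy h0 h1 e [be de].
have [|z hz ez] := h1 e; first by split=> //; apply: ann_mono be; apply: addgl.
have yz : cobd b (y *: z).
  apply: h0; split; first exact: (submodZ (submod_ann _ _)).
  by rewrite linearZ /= ez be //; apply: addgr.
by have := cobd_addg hb hy hz yz; rewrite ez.
Qed.

Lemma colon_prime (b : R -> Prop) : ideal b -> ~ b 1 -> exists z, prime (colon b z).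
Proof.
move=> hb b1.
have hc z := ideal_colon z hb.
have [|P [hP _ [z [nz eP]] mx]] := noethR_max (Q := fun P => exists z, ~ b z /\ P = colon b z) nR (hc 1).
  by exists 1.
exists z; rewrite -eP; split=> // [|u w]; first by rewrite eP /colon mulr1.
move=> uw; apply: contrapT => /not_orP [nu nw]; apply: nw.
have Pu : sub (colon b (z * u)) P.
  apply: mx; [exact: hc| |].
    by rewrite eP /colon => t ht; rewrite mulrAC; apply: idealMr.
  by exists (z * u); split=> //; move: nu; rewrite eP.
by apply: Pu; rewrite /colon -mulrA; move: uw; rewrite eP.
Qed.

Lemma sub_max (b : R -> Prop) : ideal b -> ~ b 1 -> sub b (span D x).
Proof.
by move=> hb b1 z bz; apply: contrapT => /loc [c hc]; apply: b1; rewrite -hc; apply: idealM.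
Qed.

(* The residue field embeds into [R/b], and [Ext^(D+1)] vanishes. *)
Lemma ext0_top b : ideal b -> ~ b 1 -> dim_le b 0 -> ~ ext0 D b.
Proof.
move=> hb b1 db h.
have [z pz] := colon_prime hb b1.
have hz : ideal (colon b z) by case: pz.
have ez : colon b z = span D x.
  apply: local_max => // [|i iD]; first by case: pz.
  have sz : sub (colon b z) (span D x) by apply: sub_max => //; case: pz.
  have pM := prime_span loc M1.
  have c0 : chain 0 (fun=> span D x) by split.
  apply: contrapT => ni; have := db _ _ (chain_cons c0 pz sz _).
  move=> /(_ _ _) f; suff : (1 <= 0)%N by [].
  by apply: f; [move=> s; apply: ni; apply: s; exact: span_mem|exact: colonl].
have [_ [u [hu _ tors]]] := ext_cyclic_regseq E reg (leqnn D).
apply: M1; apply: tors; rewrite scale1r -ez.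
rewrite -ez in hu.
have [u' [bu' zu']] := injective_divide (@res_injective _ _ E D) hb hu.1.
have [|w hw ew] := ext0_above (E := E) nR reg loc M1 (ideal_addg z hb) (ltnSn D) (e := cdiff E D u').
  split; last exact: dK.
  apply: ann_addg; last by rewrite -linearZ zu' hu.2.
  by move=> r hr; rewrite -linearZ bu' // raddf0.
have : cobd b (u' - w).
  apply: h; split; last by rewrite raddfB /= ew subrr.
  by apply: (submodB (submod_ann _ _)) => //; apply: ann_mono hw; apply: addgl.
have -> : u = z *: (u' - w) by rewrite scalerBr zu' hw ?subr0 //; apply: addgr.
case: (D) (u' - w) => [|l] t /=; first by move=> ->; rewrite scaler0.
move=> [y hy <-]; exists (z *: y); last by rewrite linearZ.
by move=> r hr; rewrite scalerA mulrC; apply: hy.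
Qed.

Lemma ext0_other b y j : ideal b -> span D x y -> reg_mod b y -> (forall l, l != j.+1 -> ext0 l (addg b y)) ->
  forall l, l != j -> ext0 l b.
Proof.
by move=> hb My hy h l lj; apply: (ext0_regular nR loc M1 hb My hy); apply: h; rewrite eqSS.
Qed.

(** Vanishing in degree [n] would propagate to degree [n + 2 = D] on adding [y1] and [y2], against
    [ext0_top]. The neighbouring degrees vanish by transfer from the quotient of finite length. *)
Lemma ext_nonzero b y1 y2 n : D = n.+2 -> ideal b -> ~ b 1 -> span D x y1 -> span D x y2 ->
  reg_mod b y1 -> reg_mod (addg b y1) y2 -> dim_le b 2 -> ~ ext0 n b.
Proof.
move=> eD hb b1 My1 My2 r1 r2 db h.
have hb1 := ideal_addg y1 hb; have hb2 := ideal_addg y2 hb1.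
have d1 : dim_le (addg b y1) 1 by move=> k P cP sP; rewrite -ltnS; apply: dim_le_addg cP sP.
have d2 : dim_le (addg (addg b y1) y2) 0 by move=> k P cP sP; rewrite -ltnS; apply: dim_le_addg cP sP.
have b21 : ~ addg (addg b y1) y2 1.
  move=> h21; apply: M1.
  have sb : sub b (span D x) by exact: sub_max.
  have add_sub J y : ideal J -> sub J (span D x) -> span D x y -> sub (addg J y) (span D x).
    move=> hJ s My z [r hr]; rewrite -(subrK (r * y) z); apply: (idealD (ideal_span _ _)); first exact: s.
    by apply: (idealM _ (ideal_span _ _)).
  by apply: (add_sub (addg b y1) y2) h21 => //; apply: add_sub.
apply: (ext0_top hb2 b21 d2).
have e2 l : l != D -> ext0 l (addg (addg b y1) y2).
  rewrite neq_ltn => /orP[lD|lD]; last by apply: (ext0_above nR reg loc M1).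
  by apply: (ext0_below nR reg loc M1 hb2 d2); rewrite addn0.
have e1 := ext0_other hb1 My2 r2 (j := n.+1); have e0 := ext0_other hb My1 r1 (j := n).
rewrite eD in e2 *.
have nn k : k.+1 != k by rewrite neq_ltn ltnSn orbT.
apply: ext0_up => //; last by apply: e1.
apply: ext0_up => //; apply: e0 => // l ll; exact: e1.
Qed.

(** The generators [v k] are added one at a time to the ideal that kills the primitive [y]: the
    class of [v_k y] vanishes because its degree is below the codimension, and dividing its
    primitive by [v_k] gives the correction of [y]. *)
Lemma cobd_descend g v s n (e : E n) : (n.+1 < D)%N -> dim_le (span g v) 2 -> ann (span g v) e ->
  cobd (ipow g v s) e -> cobd (span g v) e.
Proof.
case: n e => [//|l] e lD dI he /= [y0 hy0 ey0].
have ds b : ideal b -> sub (ipow g v s) b -> ext0 l b.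
  move=> hb sb; apply: (ext0_below nR reg loc M1 (e := 2) hb); last by rewrite addn2.
  move=> k P cP bP; apply: (dI k P cP).
  have pP : prime (P 0%N) by case: cP => h _; apply: h.
  apply: span_sub => [|i ig]; first by case: pP.
  by apply: (primeX (k := s) pP); apply: bP; apply: sb; apply: ipow_exp.
suff [b [y [hb sb vb by0 ey]]] : exists b (y : E l),
    [/\ ideal b, sub (ipow g v s) b, forall i, (i < g)%N -> b (v i), ann b y & cdiff E l y = e].
  by exists y => //; apply: ann_mono by0; apply: span_sub.
suff : forall k, (k <= g)%N -> exists b (y : E l),
    [/\ ideal b, sub (ipow g v s) b, forall i, (i < k)%N -> b (v i), ann b y & cdiff E l y = e] by apply.
elim=> [_|k IH kg]; first by exists (ipow g v s), y0; split=> //; exact: ideal_ipow.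
have [b [y [hb sb vb by0 ey]]] := IH (ltnW kg).
set z := v k.
suff [y' [h1 h2]] : exists y', ann (addg b z) y' /\ cdiff E l y' = e.
  exists (addg b z), y'; split=> //; first exact: ideal_addg.
    by move=> r /sb; apply: addgl.
  move=> i; rewrite ltnS leq_eqVlt => /orP[/eqP ->|/vb]; [exact: addgr|exact: addgl].
have : cobd (colon b z) (z *: y).
  apply: ds; [exact: ideal_colon|by move=> r /sb; apply: colonl|].
  split; first by move=> r hr; rewrite scalerA mulrC; apply: by0.
  by rewrite linearZ /= ey he //; apply: span_mem.
case: (l) y {y0 hy0 ey0 IH ds lD} e he by0 ey => [|k'] y e he by0 ey /=.
  by move=> zy; exists y; split=> //; apply: ann_addg.
move=> [w hw ew]; have [w' [hw' ew']] := injective_divide (@res_injective _ _ E k') hb hw.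
exists (y - cdiff E k' w'); split; last by rewrite raddfB /= dK subr0.
apply: ann_addg; last by rewrite scalerBr -linearZ ew' ew subrr.
apply: (submodB (submod_ann _ _)) => //; by move=> r hr; rewrite -linearZ hw' // raddf0.
Qed.
End Nonvanishing.

Lemma ipow_prod (R : comNzRingType) g (v : nat -> R) (I H : R -> Prop) t : ideal H -> (forall i, (i < g)%N -> I (v i)) ->
  (forall u : 'I_t -> R, (forall j, I (u j)) -> H (\prod_j u j)) -> sub (ipow g v t) H.
Proof.
move=> hH hv; elim: t H hH => [|t IH] H hH h.
  move=> z _; apply: ideal1 => //; have := h (fun=> 0); rewrite big_ord0; apply; by case.
apply: ipow_sub => // i z ig; apply: (IH (colon H (v i)) (ideal_colon _ hH)) => u hu; rewrite /colon.
have := h (fun j => if unlift ord0 j is Some j' then u j' else v i).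
rewrite big_ord_recl unlift_none (eq_bigr u) => [|j _]; last by rewrite liftK.
by apply=> j; case: unliftP => [j' _|_]; [apply: hu|apply: hv].
Qed.

(** * Local cohomology classes as torsion cocycles *)

Section LocalCohomology.
Variables (R : comNzRingType) (I : idealr R) (E : injective_resolution (R^o : lmodType R)) (g : nat) (v : nat -> R).
Hypothesis Iv : forall z, z \in I <-> span g v z.

Lemma ideal_pow_ipow t z : ideal_pow I t z -> ipow g v t z.
Proof.
move=> [n [c [u [hu ->]]]]; apply: ideal_sum => [|i _]; first exact: ideal_ipow.
apply: (idealM _ (ideal_ipow _ _ _)).
have : forall j, span g v (u i j) by move=> j; apply/Iv; apply: hu.
move: (u i); elim: t {u hu} => [//|t IH] u hu; rewrite big_ord_recl.
by apply: (@ipowM _ _ _ 1 t); [apply/ipow1|apply: IH].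
Qed.

Lemma torsion_ipow n (e : E n) : e \in @torsion R I (E n) <-> exists s, ann (ipow g v s) e.
Proof.
split=> [/asboolP [t ht]|[s hs]]; last by apply/asboolP; exists s => a /ideal_pow_ipow /hs.
exists t; apply: (@ipow_prod R g v (fun z => z \in I) (fun r => r *: e = 0)) => [|i ig|u hu].
- split; first by rewrite scale0r.
  by move=> a x y hx hy; rewrite scalerDl -[_ *: x]/(a * x) -scalerA hx hy scaler0 addr0.
- by apply/Iv; apply: span_mem.
- apply: ht; exists 1%N, (fun=> 1), (fun=> u); split=> //.
  by rewrite big_ord1 mul1r.
Qed.

Lemma local_cohomology_coboundary n (x : Gamma I (E n)) :
  coboundary_in (C := Gamma_complex I E) x <-> exists s, cobd (ipow g v s) (val x).
Proof.
case: n x => [|n] x /=.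
  by split=> [->|[_ e]]; [exists 0%N|apply: val_inj].
split=> [[y <-]|[s [y hy ey]]].
  have /torsion_ipow [s hs] := valP y; by exists s, (val y).
have ty : y \in @torsion R I (E n) by apply/torsion_ipow; exists s.
by exists (exist _ y ty); apply: val_inj.
Qed.

Lemma local_cohomology_eq0 n : (forall s (e : E n), cocyc (ipow g v s) e -> exists s', cobd (ipow g v s') e) ->
  forall x : local_cohomology I E n, x = 0.
Proof.
move=> h x; have [y ->] := quot_projP x.
have -> : 0 = quot_proj (coboundary (C := Gamma_complex I E) (n := n)) 0 by symmetry; exact: raddf0.
apply/eq_quot_proj; rewrite subr0; apply/asboolP/local_cohomology_coboundary.
have /torsion_ipow [s hs] := valP (val y).
apply: (h s); split=> //.
have /eqP := valP y; move=> /(congr1 val); exact.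
Qed.

Lemma local_cohomology_neq0 n (e : E n) : cocyc (span g v) e -> (forall s, ~ cobd (ipow g v s) e) ->
  exists x : local_cohomology I E n, x <> 0.
Proof.
move=> [be de] ne.
have te : e \in @torsion R I (E n) by apply/torsion_ipow; exists 1%N => r /ipow1; apply: be.
pose x : Gamma_complex I E n := exist _ e te.
have cx : x \in cocycle (C := Gamma_complex I E) (n := n) by apply/eqP; apply: val_inj.
exists (quot_proj (coboundary (C := Gamma_complex I E) (n := n)) (exist _ x cx)).
have -> : 0 = quot_proj (coboundary (C := Gamma_complex I E) (n := n)) 0 by symmetry; exact: raddf0.
move/eq_quot_proj; rewrite subr0 => /asboolP/local_cohomology_coboundary [s hs].
exact: (ne s).
Qed.
End LocalCohomology.

(** * Regular parameters, chains of primes and depth in terms of predicates *)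

Lemma idealr_ideal (R : comNzRingType) (J : idealr R) : ideal (fun z => z \in J) /\ 1 \notin J.
Proof.
split; last by rewrite idealr1.
apply/idealP; split=> [|y z hy hz|c z hz]; [exact: idealr0|by rewrite rpredD|exact: ring_quotient.idealMr].
Qed.

Lemma in_span_nth (R : comNzRingType) (s : seq R) z : in_span s z <-> span (size s) (nth 0 s) z.
Proof.
split=> [[c ->]|/spanP [c ->]]; last by exists (fun i => c i).
apply: ideal_sum => [|i _]; first exact: ideal_span.
by apply: (idealM _ (ideal_span _ _)); apply: span_mem.
Qed.

Lemma noetherian_noethR (R : comNzRingType) : noetherian R -> noethR R.
Proof.
move=> nR U hU _ _.
pose P : {pred R} := fun x => `[< U x >].
have PE x : x \in P <-> U x by rewrite /P unfold_in; split=> [/asboolP|h] //; apply/asboolP.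
have [|s hs] := nR P.
  by split; [apply/PE; apply: submod0|move=> a x y /PE hx /PE hy; apply/PE; exact: (proj2 hU)].
exists (size s), (nth 0 s); split=> [i ir|x /PE /hs /in_span_nth /spanP [c ->]].
  by apply/PE/hs/in_span_nth; apply: span_mem.
by exists c; rewrite subrr.
Qed.

Lemma local_unit (R : comNzRingType) (m : idealr R) a : noethR R -> local_ring m -> a \notin m -> exists u, u * a = 1.
Proof.
move=> nR [_ mx] am; apply: contrapT => na.
have h0 : ideal (addg (fun z => z = 0) a) by apply: ideal_addg; exact: (@submod_zero R R^o).
have [|J [hJ aJ J1 Jmax]] := noethR_max (Q := fun J => ~ J 1) nR h0.
  by move=> [r /eqP]; rewrite subr_eq0 => /eqP h; apply: na; exists r.
have [n hn] := quotient_idealr hJ J1.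
have hmax : maximal_ideal n.
  move=> K nK z zK; apply/hn; have [hK K1] := idealr_ideal K.
  by apply: (Jmax _ hK _ _ z zK) => [y /hn /nK //|]; apply/negP.
by move/negP: am; apply; rewrite -(mx n hmax); apply/hn/aJ; exists 1; rewrite mul1r subrr.
Qed.

Lemma chain_snoc (R : comNzRingType) k (P : nat -> R -> Prop) (J : R -> Prop) : chain k P -> prime J -> sub (P k) J -> ~ sub J (P k) ->
  chain k.+1 (fun i => if (i <= k)%N then P i else J).
Proof.
move=> [h1 h2] pJ s ns; split=> i ik; first by case: ifP => // /h1.
have ik' : (i <= k)%N by [].
rewrite ik'; case: (ltnP i k) => [ilt|kle]; first exact: h2.
by have -> : i = k by apply/eqP; rewrite eqn_leq ik'.
Qed.

Section Dimension.
Variables (R : comNzRingType) (D : nat) (x : nat -> R).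
Hypothesis nR : noethR R.
Hypothesis loc : forall a, ~ span D x a -> exists c, c * a = 1.
Hypothesis M1 : ~ span D x 1.

(** A chain that does not end in the maximal ideal is prolonged by it, so [dimension_bound] applies;
    at full length it shows that the ring is a domain with regular parameters. *)
Lemma chain_dimension k (P : nat -> R -> Prop) : chain k P ->
  (k <= D)%N /\ (k = D -> (forall z, P 0%N z -> z = 0) /\ regseq D x).
Proof.
move=> cP.
have h0 := @submod_zero R R^o.
have addm0 (N : R -> Prop) z : addm (V := R^o) (fun z => z = 0) N z <-> N z.
  by split=> [[_ [u [-> hu ->]]]|h]; [rewrite add0r|exists 0, z; rewrite add0r].
have bound l (Q : nat -> R -> Prop) : chain l Q -> Q l = span D x ->
    (l <= D)%N /\ (l = D -> sub (Q 0%N) (fun z => z = 0) /\ regmod (fun z => z = 0) D x).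
  move=> cQ eQ; apply: (dimension_bound nR h0 cQ).
  - by move=> _ ->; case: cQ => h _; have [hQ _ _] := h 0%N (leq0n _); apply: ideal0.
  - move=> z; rewrite eQ => hz; apply: loc => h1; apply: M1.
    by rewrite -(subrK z 1); apply: (idealD (ideal_span _ _)).
  - by move=> z; rewrite eQ addm0.
have [hP P1 _] : prime (P k) by case: cP => h _; apply: h.
have [sM|nM] := EM (sub (span D x) (P k)).
  have [|h1 h2] := bound k P cP; first by apply: pred_eq => z; split=> [|/sM//]; exact: (sub_max loc).
  split=> // /h2 [h3 h4]; split=> // i a iD hi.
  by apply/addm0/h4 => //; apply/addm0.
have [|h _] := bound _ _ (chain_snoc cP (prime_span loc M1) (sub_max loc hP P1) nM).
  by rewrite ltnn.
by split; [exact: ltnW|move=> kD; rewrite kD ltnn in h].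
Qed.
End Dimension.

Lemma prime_chain_chain (R : comNzRingType) n : prime_chain R n -> exists P, chain (R := R) n P.
Proof.
move=> [P hP]; exists (fun i z => z \in P i); split=> [i _|i /hP //].
have [h1 h2] := idealr_ideal (P i); split=> //; first exact/negP.
by move=> y z; rewrite prime_idealrM => /orP.
Qed.

Lemma chain_prime_chain (R : comNzRingType) n (P : nat -> R -> Prop) : chain n P -> prime_chain R n.
Proof.
move=> [pP hP].
have /choice [Q hQ] : forall i, exists J : prime_idealr R, forall z, z \in J <-> P (minn i n) z.
  move=> i; have [hJ J1 JM] := pP (minn i n) (geq_minr _ _).
  pose S : {pred R} := fun z => `[< P (minn i n) z >].
  have SE z : z \in S <-> P (minn i n) z by rewrite /S unfold_in; split=> [/asboolP|h] //; apply/asboolP.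
  have cl : idealr_closed S.
    split; first by apply/SE; apply: ideal0.
      by apply/negP => /SE.
    move=> a y z /SE hy /SE hz; apply/SE; exact: (proj2 hJ).
  have pc : prime_idealr_closed S.
    by move=> y z /SE /JM [/SE h|/SE h]; rewrite h ?orbT.
  exists (HB.pack_for (prime_idealr R) S (isIdealr.Build R S cl) (isPrimeIdealrClosed.Build R S pc)) => z.
  exact: SE.
exists Q => i ilt; have [h1 h2] := hP i ilt.
have e1 : minn i n = i by apply/minn_idPl; exact: ltnW.
have e2 : minn i.+1 n = i.+1 by apply/minn_idPl.
split=> [z /hQ|h]; first by rewrite e1 => /h1 hz; apply/hQ; rewrite e2.
by apply: h2 => z hz; rewrite -e1; apply/hQ/h/hQ; rewrite e2.
Qed.

Lemma chain_quotient (R B : comNzRingType) (f : {rmorphism R -> B}) n (P : nat -> R -> Prop) :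
  (forall b, exists a, f a = b) -> (forall a, f a = 0 -> P 0%N a) -> chain n P ->
  chain n (fun i b => exists2 a, f a = b & P i a).
Proof.
move=> sf kf cP; have [pP hP] := cP.
have back i a : (i <= n)%N -> (exists2 a', f a' = f a & P i a') -> P i a.
  move=> ilt [a' ha' Pa']; have [hJ _ _] := pP i ilt.
  rewrite -(subKr a' a); apply: idealB => //; apply: (chain_le cP (i := 0)); first by rewrite ilt.
  by apply: kf; rewrite rmorphB ha' subrr.
split=> i ilt.
  have [hJ J1 JM] := pP i ilt; split.
  - apply/idealP; split=> [|_ _ [a <- ha] [c <- hc]|b _ [a <- ha]].
    + by exists 0; [rewrite rmorph0|apply: ideal0].
    + by exists (a + c); [rewrite rmorphD|apply: idealD].
    + by have [c <-] := sf b; exists (c * a); [rewrite rmorphM|apply: idealM].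
  - by rewrite -(rmorph1 f) => /(back i _ ilt).
  - move=> b c; have [a <-] := sf b; have [a' <-] := sf c; rewrite -rmorphM => /(back i _ ilt) /JM [h|h].
      by left; exists a.
    by right; exists a'.
have [h1 h2] := hP i ilt; split=> [_ [a <- /h1 ha]|h]; first by exists a.
by apply: h2 => a ha; apply: (back i _ (ltnW ilt)); apply: h; exists a.
Qed.

(** As [p] is outside the square of the maximal ideal, it can be exchanged for one of the minimal
    generators. *)
Lemma regular_parameters (R : comNzRingType) (m : idealr R) d p :
  regular_local_ring m d -> mixed_characteristic m p -> unramified m p ->
  exists n (x : nat -> R), [/\ d = n.+1, x n = p%:R, noethR R, prime.prime p &
   [/\ forall z, z \in m <-> span n.+1 x z, forall c, ~ span n.+1 x c -> exists u, u * c = 1,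
       ~ span n.+1 x 1, regseq n.+1 x & forall z : R, p%:R * z = 0 -> z = 0]].
Proof.
move=> [nR lR [dim _] [[s [ss gs]] _]] [char0 /andP[pp /eqP pm]] unr.
have nR' := noetherian_noethR nR.
have p0 : p%:R != 0 :> R by have := char0 p.-1; rewrite prednK // prime.prime_gt0.
have pin : p%:R \in m.
  rewrite -[p%:R]subr0 Quotient.idealrBE; apply/eqP.
  apply: etrans (etrans pm _); last by symmetry; exact: (rmorph0 (\pi_{ideal_quot m})%qT).
  exact: (rmorph_nat (\pi_{ideal_quot m})%qT).
have [hm m1] := idealr_ideal m.
pose s0 := nth 0 s.
have ms z : z \in m <-> span d s0 z by rewrite gs in_span_nth ss.
have /spanP [c hc] := proj1 (ms _) pin.
case: d dim ss ms hc => [|n] dim ss ms hc.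
  by move: p0; rewrite hc big_ord0 eqxx.
have [i [iN ni]] : exists i, (i < n.+1)%N /\ c i \notin m.
  (* If all coefficients of [p] were in the maximal ideal, each [c_i s_i] would be a product of two
     of its elements. *)
  apply: contrapT => nc; apply: unr; exists n.+1, (fun=> 1), (fun i j => if j == ord0 then c i else s0 i).
  split=> [i j|]; last by rewrite hc; apply: eq_bigr => i _; rewrite mul1r !big_ord_recl big_ord0 mulr1.
  case: ifP => _; last by apply/ms; apply: span_mem.
  by apply: contrapT => ni; apply: nc; exists i; split=> //; apply/negP.
have [u hu] := local_unit nR' lR ni.
(* The generator [s0 i] is dropped, [s0 n] moves to its place, and [p] becomes the last
   parameter. *)
pose x j := if j == n then p%:R else if j == i then s0 n else s0 j.
have hx := ideal_span n.+1 x.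
have sx j : (j < n.+1)%N -> j != i -> span n.+1 x (s0 j).
  move=> jn ji; case: (eqVneq j n) ji => [->|jn'] ji.
    have <- : x i = s0 n by rewrite /x eq_sym (negbTE ji) eqxx.
    exact: span_mem.
  have <- : x j = s0 j by rewrite /x (negbTE jn') (negbTE ji).
  exact: span_mem.
have mx z : z \in m <-> span n.+1 x z.
  rewrite ms; split; [apply: (span_sub hx)|apply: (span_sub (ideal_span _ _))] => j jn; last first.
    rewrite /x; case: ifP => _; first by apply/ms.
    by case: ifP => _; apply: span_mem.
  case: (eqVneq j i) => [->|]; last exact: sx.
  rewrite -[s0 i]mul1r -hu -mulrA; apply: idealM => //.
  have -> : c i * s0 i = p%:R - \sum_(k < n.+1 | k != Ordinal iN) c k * s0 k.
    by rewrite hc (bigD1 (Ordinal iN)) //= addrK.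
  apply: idealB => //; last by apply: ideal_sum => // k ki; apply: idealM => //; apply: sx.
  by have <- : x n = p%:R; [rewrite /x eqxx|apply: span_mem].
have loc a : ~ span n.+1 x a -> exists u, u * a = 1.
  by move=> na; apply: (local_unit nR' lR); apply/negP => /mx.
have M1 : ~ span n.+1 x 1 by move/mx; apply/negP.
have [P cP] := prime_chain_chain dim.
have [_ /(_ erefl) [P0 reg]] := chain_dimension nR' loc M1 cP.
exists n, x; split=> //; first by rewrite /x eqxx.
split=> // z pz; have [hP _ PM] : prime (P 0%N) by case: cP => h _; apply: h.
have /PM [/P0 e|/P0 //] : P 0%N (p%:R * z) by rewrite pz; apply: ideal0.
by move: p0; rewrite e eqxx.
Qed.

Lemma depth_regular (R : comNzRingType) (m I : idealr R) : depth_quot_ge m I 2 ->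
  exists a b, [/\ a \in m, b \in m, reg_mod (fun z => z \in I) a & reg_mod (addg (fun z => z \in I) a) b].
Proof.
pose f : {rmorphism R -> {ideal_quot I}} := (\pi_{ideal_quot I})%qT.
have fE z : f z = 0 <-> z \in I.
  rewrite -[z in z \in I]subr0 Quotient.idealrBE; split=> [e|/eqP e].
    by apply/eqP; apply: (etrans e); symmetry; exact: (rmorph0 f).
  by apply: (etrans e); exact: (rmorph0 f).
move=> [s [s2 sm [reg _]]]; case: s s2 sm reg => [|a [|b s]] // _ sm reg; exists a, b; split.
- by apply: sm; rewrite mem_head.
- by apply: sm; rewrite in_cons mem_head orbT.
- move=> z az; apply/fE.
  have [||c ->] := reg 0%N _ (f z); [by []| |by rewrite big_ord0].
  exists (fun=> 0); rewrite big_ord0; apply: etrans (proj2 (fE _) az); symmetry; exact: (rmorphM f).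
- move=> z [r hr].
  have [||c hc] := reg 1%N _ (f z); [by []| |].
    exists (fun=> f r); rewrite big_ord1; apply/eqP; rewrite -subr_eq0; apply/eqP.
    apply: etrans (proj2 (fE _) hr); rewrite rmorphB !rmorphM; by [].
  exists (repr (c ord0)); apply/fE; rewrite rmorphB rmorphM.
  have -> : f (repr (c ord0)) = c ord0 by exact: reprK.
  by rewrite hc big_ord1 subrr.
Qed.

Theorem proposition4p10 (R : comNzRingType) (m : idealr R) (d p : nat)
    (I : idealr R)
    (Rreg : regular_local_ring m d)
    (Rmixed : mixed_characteristic m p)
    (Runram : unramified m p)
    (Idepth : depth_quot_ge m I 2)
    (E : injective_resolution (R^o : lmodType R)) :
  (forall x : local_cohomology I E (d - 1), x = 0) /\
  (krull_dim {ideal_quot I} 2 ->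
     exists x : local_cohomology I E (d - 2), x <> 0).
Proof.
have [n [x [-> xn nR pp [mx loc M1 reg p0]]]] := regular_parameters Rreg Rmixed Runram.
have [a [b [/mx Ma /mx Mb ra rb]]] := depth_regular Idepth.
have [hI /negP I1] := idealr_ideal I.
have [g [v Iv]] := noethR_fg nR hI.
split.
  rewrite subn1; apply: (local_cohomology_eq0 (g := g) (v := v)) => // s e he.
  exact: (ext_vanishing pp xn nR reg loc M1 p0 hI I1 Ma Mb ra rb Iv he).
move=> [_ nchain].
have IE : (fun z : R => is_true (z \in I)) = span g v by apply: pred_eq.
have dI : dim_le (fun z => z \in I) 2.
  move=> k P cP sP; rewrite leqNgt; apply/negP => k2; apply: nchain.
  pose f : {rmorphism R -> {ideal_quot I}} := (\pi_{ideal_quot I})%qT.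
  apply: (@chain_prime_chain _ 3 (fun i b => exists2 a, f a = b & P i a)).
  apply: chain_quotient => [y|z e|]; first by exists (repr y); exact: reprK.
    apply: sP; rewrite -[z]subr0 Quotient.idealrBE; apply/eqP; apply: (etrans e).
    by symmetry; exact: (rmorph0 f).
  case: cP => h1 h2; split=> i ik; [apply: h1|apply: h2]; exact: leq_trans ik k2.
have dimR (J : R -> Prop) : dim_le J n.+1 by move=> k P cP _; have [] := chain_dimension nR loc M1 cP.
have cM : chain 0 (fun=> span n.+1 x) by split=> // i _; exact: prime_span.
have subM J y : ideal J -> sub J (span n.+1 x) -> span n.+1 x y -> sub (addg J y) (span n.+1 x).
  move=> hJ s My z [r hr]; rewrite -(subrK (r * y) z); apply: (idealD (ideal_span _ _)); first exact: s.
  by apply: (idealM _ (ideal_span _ _)).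
(* The regular sequence [a, b] lowers the dimension twice, so [d] is at least [2] and [d - 2] is not
   truncated. *)
have n1 : (0 < n)%N.
  have hIa := ideal_addg a hI.
  have d1 : dim_le (addg (fun z => z \in I) a) n.
    by move=> k P cP sP; rewrite -ltnS; apply: (dim_le_addg nR hI ra (dimR _) cP sP).
  apply: (dim_le_addg nR hIa rb d1 cM).
  by apply: (subM _ _ hIa) => //; apply: subM => //; apply: (sub_max loc).
case: n n1 reg loc M1 Ma Mb dimR cM subM xn mx => // n _ reg loc M1 Ma Mb dimR cM subM xn mx.
rewrite !subSS subn0.
have := ext_nonzero (E := E) nR reg loc M1 erefl hI I1 Ma Mb ra rb dI; rewrite IE => hn.
have [e [he ne]] : exists e : E n, cocyc (span g v) e /\ ~ cobd (span g v) e.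
  apply: contrapT => h; apply: hn => e he; apply: contrapT => ne; apply: h; by exists e.
apply: (local_cohomology_neq0 Iv he) => s hs; apply: ne.
by apply: (cobd_descend nR reg loc M1 _ _ he.1 hs) => //; rewrite -IE.
Qed.
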